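(* Let $p>2$. Let $(Y_i)_{i\in\mathbb Z}$ be a strictly stationary sequence of real-valued random variables with marginal density $f$ with respect to Lebesgue measure $\lambda$ on $\mathbb R$. Assume that $\sum_{k=0}^n(k+1)^{p-2}\beta_{2,Y}(k)=O(n^{\delta(p-1)})$ for some $\delta\in[0,1)$. Let $r\ge0$ be an integer and assume that either $f\mathbf 1_{[0,1]}\in\mathrm{Lip}^*(s,\mathbb L^p([0,1],\lambda))$ with $0<s<r+1$, or $f\mathbf 1_{[0,1]}\in W^s(\mathbb L^p([0,1],\lambda))$ with $s=r+1$. Then, taking $m_n=[Cn^{(1-\delta)/(2s+1)}]$ with a constant $C>0$ (where $[\cdot]$ is the integer part), the piecewise polynomial estimator $f_n$ of order $r$ on the regular partition of $]0,1]$ into $m_n$ intervals (see context) satisfies $$\mathbb E\Big(\int_0^1|f_n(x)-f(x)|^p\,dx\Big)=O\Big(n^{\frac{-ps(1-\delta)}{2s+1}}\Big).$$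
   Context: Estimator: let $(Q_i)_{1\le i\le r+1}$ be an orthonormal basis (in $\mathbb L^2([0,1],\lambda)$) of the space of polynomials of order $r$ (degree at most $r$) on $[0,1]$; set $R_i(x)=Q_i(x)$ if $x\in]0,1]$ and $R_i(x)=0$ otherwise. For $1\le i\le r+1$, $1\le j\le m_n$, let $\varphi_{i,j}(x)=\sqrt{m_n}\,R_i(m_nx-(j-1))$, $X_{i,j,n}=\frac1n\sum_{k=1}^n\varphi_{i,j}(Y_k)$ and $f_n=\sum_{i=1}^{r+1}\sum_{j=1}^{m_n}X_{i,j,n}\varphi_{i,j}$ (defined for $n$ large enough that $m_n\ge1$). Function spaces ($f\mathbf 1_{[0,1]}$ is regarded as a function on $[0,1]$): for a positive integer $s$, $W^s(\mathbb L^p([0,1],\lambda))$ is the Sobolev space of functions such that $g^{(s-1)}$ is absolutely continuous with almost everywhere derivative $g^{(s)}\in\mathbb L^p([0,1],\lambda)$. For $s>0$, $\mathrm{Lip}^*(s,\mathbb L^p([0,1],\lambda))$ is the generalized Lipschitz space of DeVore and Lorentz (a Besov space $B_{s,p,\infty}$): functions $g\in\mathbb L^p([0,1],\lambda)$ with $\sup_{t>0}t^{-s}\omega_m(g,t)_p<\infty$, where $m=[s]+1$ and $\omega_m(g,t)_p=\sup_{0<u\le t}\|\Delta_u^mg\|_{\mathbb L^p([0,1-mu])}$ is the $m$-th modulus of smoothness, $\Delta_u^m$ being the $m$-th order forward difference with step $u$. Dependence coefficients: let $P$ be the law of $Y_0$, $P_{(Y_i,Y_j)}$ the law of $(Y_i,Y_j)$,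 $\mathcal F_\ell=\sigma(Y_i, i\le \ell)$, and let $P_{Y_k|\mathcal F_\ell}$ and $P_{(Y_i,Y_j)|\mathcal F_\ell}$ be the conditional distributions of $Y_k$ and of $(Y_i,Y_j)$ given $\mathcal F_\ell$. For a measure $Q$ and a function $g$, $Q(g)=\int g\,dQ$. Put $f_t=\mathbf 1_{]-\infty,t]}$ (for $t\in\mathbb R$) and $f_t^{(0)}=f_t-P(f_t)$, and define $$b_\ell(k)=\sup_{t\in\mathbb R}|P_{Y_k|\mathcal F_\ell}(f_t)-P(f_t)|,\qquad b_\ell(i,j)=\sup_{(s,t)\in\mathbb R^2}\big|P_{(Y_i,Y_j)|\mathcal F_\ell}(f_t^{(0)}\otimes f_s^{(0)})-P_{(Y_i,Y_j)}(f_t^{(0)}\otimes f_s^{(0)})\big|.$$ Then $\beta_{1,Y}(k)=\mathbb E(b_0(k))$ and $\beta_{2,Y}(k)=\max\{\beta_{1,Y}(k),\ \sup_{i>j\ge k}\mathbb E(b_0(i,j))\}$. *)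

(* Defs.v *)
From HB Require Import structures.
From mathcomp Require Import all_boot all_order all_algebra.
From mathcomp Require Import all_classical all_reals all_analysis.
Set Implicit Arguments.
Unset Strict Implicit.
Unset Printing Implicit Defensive.
Import Order.TTheory GRing.Theory Num.Theory.
Import numFieldNormedType.Exports.
Local Open Scope classical_set_scope.
Local Open Scope ring_scope.

Section asymptotics.
Context {R : realType}.

(* u = O(v) for an extended-real sequence u. Stating it in \bar R, rather than
   with the library's =O after applying fine, keeps +oo from being read as 0. *)
Definition ebigO (u : nat -> \bar R) (v : nat -> R) : Prop :=
  exists K : R, \forall n \near \oo, (`|u n| <= (K * `|v n|)%:E)%E.

End asymptotics.

Section processes.
Context {d : measure_display} {T : measurableType d} {R : realType}.
Context {P : probability T R}.

(* Equality of the laws, on n.-tuple R with its product sigma-algebra, of each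
   finite-dimensional marginal and of its shifts. *)
Definition strictly_stationary (Y : int -> {RV P >-> R}) : Prop :=
  forall (n : nat) (t : n.-tuple int) (h : int) (B : set (n.-tuple R)),
    measurable B ->
    P [set w | B [tuple Y (tnth t i + h) w | i < n]] =
    P [set w | B [tuple Y (tnth t i) w | i < n]].

Definition is_density (X : {RV P >-> R}) (f : R -> R) : Prop :=
  [/\ forall x, 0 <= f x,
      measurable_fun setT f &
      forall B : set R, measurable B ->
        distribution P X B = (\int[lebesgue_measure]_(x in B) (f x)%:E)%E].

(* Generators of F_l = sigma(Y_i, i <= l). *)
Definition past (Y : int -> {RV P >-> R}) (l : int) : set (set T) :=
  [set A | exists i : int, i <= l /\
           exists2 B : set R, measurable B & A = Y i @^-1` B].

Definition pairRV (X1 X2 : {RV P >-> R}) : T -> R * R :=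
  fun w => (X1 w, X2 w).

Lemma measurable_pairRV (X1 X2 : {RV P >-> R}) :
  measurable_fun setT (pairRV X1 X2).
Proof. by apply: measurable_fun_pair; exact: measurable_funPT. Qed.

HB.instance Definition _ (X1 X2 : {RV P >-> R}) :=
  isMeasurableFun.Build _ _ _ _ (pairRV X1 X2) (measurable_pairRV X1 X2).

End processes.

(* kappa is a version of the regular conditional distribution of X given the
   sigma-algebra generated by G. *)
Definition is_cond_dist {d : measure_display} {T : measurableType d}
    {R : realType} (P : probability T R) (G : set (set T))
    {d' : measure_display} {U : measurableType d'} (X : {RV P >-> U})
    (kappa : R.-pker (g_sigma_algebraType G) ~> U) : Prop :=
  forall (A : set T) (B : set U), G.-sigma.-measurable A -> measurable B ->
    P (A `&` X @^-1` B) = (\int[P]_(w in A) kappa w B)%E.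
Arguments is_cond_dist {d T R} P {G d' U} X kappa.

Section dependence.
Context {d : measure_display} {T : measurableType d} {R : realType}.
Context {P : probability T R}.
Variable Y : int -> {RV P >-> R}.

Definition half_line (t : R) : R -> R := \1_`]-oo, t].

(* f_t^(0) = f_t - P(f_t), with P the law of Y_0 *)
Definition half_line0 (t x : R) : R :=
  half_line t x - \int[distribution P (Y 0)]_y half_line t y.

Definition half_line0_tensor (t s : R) (z : R * R) : R :=
  half_line0 t z.1 * half_line0 s z.2.

(* b_l(k) at a sample point, Q being the value there of P_{Y_k|F_l} *)
Definition b1 (Q : {measure set R -> \bar R}) : \bar R :=
  ereal_sup [set `|\int[Q]_y half_line t y
                  - \int[distribution P (Y 0)]_y half_line t y|%:E
            | t in [set: R]].

(* b_l(i,j) at a sample point, Q being the value there of P_{(Y_i,Y_j)|F_l} *)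
Definition b2 (i j : int) (Q : {measure set (R * R) -> \bar R}) : \bar R :=
  ereal_sup [set `|\int[Q]_z half_line0_tensor ts.1 ts.2 z
                  - \int[distribution P (pairRV (Y i) (Y j))]_z
                      half_line0_tensor ts.1 ts.2 z|%:E
            | ts in [set: R * R]].

Local Notation F0 := (g_sigma_algebraType (past Y 0)).

(* k1 k and k2 i j stand for P_{Y_k|F_0} and P_{(Y_i,Y_j)|F_0} *)
Definition beta1 (k1 : nat -> R.-pker F0 ~> R) (k : nat) : \bar R :=
  (\int[P]_w b1 (k1 k w))%E.

Definition beta2 (k1 : nat -> R.-pker F0 ~> R)
    (k2 : nat -> nat -> R.-pker F0 ~> (R * R)%type) (k : nat) : \bar R :=
  maxe (beta1 k1 k)
    (ereal_sup [set (\int[P]_w b2 ij.1%:Z ij.2%:Z (k2 ij.1 ij.2 w))%E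
               | ij in [set ij : nat * nat | (k <= ij.2 < ij.1)%N]]).

End dependence.
Arguments beta1 {d T R P} Y k1 k.
Arguments beta2 {d T R P} Y k1 k2 k.

(* In this section, functions g : R -> R are considered on [0,1] only. *)
Section function_spaces.
Context {R : realType}.
Local Notation mu := (@lebesgue_measure R).

Definition fdiff (m : nat) (u : R) (g : R -> R) (x : R) : R :=
  \sum_(i < m.+1) (-1) ^+ (m - i) * 'C(m, i)%:R * g (x + i%:R * u).

Definition Lp_norm (p : R) (D : set R) (g : R -> R) : \bar R :=
  'N[mu]_p%:E [EFin \o (g \_ D)].

(* For m * u > 1 the interval is empty and the norm is 0. *)
Definition modulus_smooth (p : R) (m : nat) (g : R -> R) (t : R) : \bar R :=
  ereal_sup [set Lp_norm p `[0, 1 - m%:R * u] (fdiff m u g)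
            | u in [set u : R | 0 < u <= t]].

Definition Lip_star (s p : R) (g : R -> R) : Prop :=
  g \_ `[0, 1] \in Lfun mu p%:E /\
  (ereal_sup [set (t `^ (- s))%:E
                  * modulus_smooth p (Num.truncn s).+1 g t
             | t in [set t : R | (0 < t)%R]] < +oo)%E.

Definition abs_continuous (a b : R) (g : R -> R) : Prop :=
  forall e : R, 0 < e -> exists2 del : R, 0 < del &
    forall (n : nat) (I : 'I_n -> R * R),
      (forall k, a <= (I k).1 /\ (I k).1 <= (I k).2 /\ (I k).2 <= b) ->
      (forall k l, k != l -> (I k).2 <= (I l).1 \/ (I l).2 <= (I k).1) ->
      \sum_(k < n) ((I k).2 - (I k).1) < del ->
      \sum_(k < n) `|g (I k).2 - g (I k).1| < e.

(* W^s(L^p([0,1])), s >= 1. As usual for Sobolev spaces, g is identified with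
   its Lebesgue-a.e. class: D 0 is the smooth version of g on [0,1] and D i its
   derivative of order i, D s being the a.e. derivative of D s.-1. Derivatives
   are two-sided, hence taken in ]0,1[; since D i and D i.+1 are continuous on
   [0,1], the one-sided derivatives at 0 and 1 agree. *)
Definition sobolev (s : nat) (p : R) (g : R -> R) : Prop :=
  exists D : nat -> R -> R,
  [/\ {ae mu, forall x : R, 0 <= x <= 1 -> D 0 x = g x},
      forall i, (i < s.-1)%N ->
        {within `[0, 1], continuous (D i)} /\
        (forall x : R, 0 < x < 1 -> is_derive x 1 (D i) (D i.+1 x)),
      abs_continuous 0 1 (D s.-1),
      {ae mu, forall x : R, 0 < x < 1 -> is_derive x 1 (D s.-1) (D s x)} &
      D s \_ `[0, 1] \in Lfun mu p%:E].

End function_spaces.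

Section estimator.
Context {R : realType}.

Definition is_orthonormal_poly_basis (r : nat) (Q : 'I_r.+1 -> {poly R}) :
    Prop :=
  [/\ forall i, (size (Q i) <= r.+1)%N,
      forall i j,
        \int[lebesgue_measure]_(x in `[0, 1]) ((Q i).[x] * (Q j).[x])
        = (i == j)%:R &
      forall q : {poly R}, (size q <= r.+1)%N ->
        exists c : 'I_r.+1 -> R, q = \sum_i c i *: Q i].

Definition poly01 (q : {poly R}) (x : R) : R :=
  if x \in `]0, 1] then q.[x] else 0.

(* j ranges over 0, ..., m - 1, so that m * x - j replaces m * x - (j - 1) *)
Definition phi (r : nat) (Q : 'I_r.+1 -> {poly R}) (m : nat)
    (i : 'I_r.+1) (j : 'I_m) (x : R) : R :=
  Num.sqrt m%:R * poly01 (Q i) (m%:R * x - j%:R).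

Definition estimator {d : measure_display} {T : measurableType d}
    {P : probability T R} (Y : int -> {RV P >-> R})
    (r : nat) (Q : 'I_r.+1 -> {poly R}) (m n : nat) (w : T) (x : R) : R :=
  \sum_(i < r.+1) \sum_(j < m)
    (n%:R^-1 * \sum_(1 <= k < n.+1) phi Q i j (Y k%:Z w)) * phi Q i j x.

End estimator.

(* Main.v *)
From HB Require Import structures.
From mathcomp Require Import all_boot all_order all_algebra.
From mathcomp Require Import all_classical all_reals all_analysis.
From mathcomp Require Import measurable_realfun zify ring lra.
Require Import Defs.
Import Order.TTheory GRing.Theory Num.Theory.
Import numFieldNormedType.Exports.
Set Implicit Arguments.
Unset Strict Implicit.
Unset Printing Implicit Defensive.
Local Open Scope classical_set_scope.
Local Open Scope ring_scope.

(** The error is split into the bias and the stochastic error. Write h_ij for the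
    i-th basis polynomial carried by the j-th bin, without normalization (pieces),
    so that the estimator is a combination of the h_ij with coefficients m / n times
    the sums over k of h_ij(Y_k).

    The bias is the distance from f to its orthogonal projection on piecewise
    polynomials (mean_estimatorE). On each bin the projection is bounded in L^p and
    reproduces polynomials of degree at most r, so it is enough to approximate f by
    polynomials, bin by bin (projection_error_on). If f has s = r + 1 derivatives,
    this is Taylor's formula (chain_poly, bias_sobolev). In the generalized Lipschitz
    case f is first replaced by a combination of iterated averages of step of order
    1 / m: its distance to f is an average of k-th differences of f, and its k-th
    derivative is a k-th difference divided by the k-th power of the step
    (approximant_error, approximant_top_bound, bias_lip). Both cases give
    O(m^(-ps)) for the p-th power of the L^p norm.

    For the stochastic error let S_n^a be the sum over n times of the centred
    variables X^a_k of h_a(Y_k), where a ranges over all pairs (i, j). At each point at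
    most r + 1 pieces are nonzero, and they live on intervals of length 1 / m, so that
    the integral of the p-th power of the error is at most a multiple of
    m^(p-1) n^(-p) sum_a |S_n^a|^p (pieces_combination_Lp). The point is to bound
    A_n = sum_a E |S_n^a|^p as a whole, by a multiple of
    n^((1+delta)p/2) m^(1-p/2) (energy_bound); then the error is
    O((m / n^(1-delta))^(p/2)), which for the given m is of the order of m^(-ps).

    A_n is bounded by a recursion from n to 2n (Afwd_double, doubling_recursion). In
    |x + y|^p <= (1+e)(|x|^p + |y|^p) + C |x|^(p-2) y^2, with x a sum over the past and
    y one over the future, everything rests on the terms
    sum_a E |x_a|^(p-2) X^a_u X^a_v with 0 < u <= v, where the conditional law of
    (Y_u, Y_v) given the past enters. The weight |x_a|^(p-2) is cut at a fraction of its
    bound (sum_a |x_a|^p)^((p-2)/p), the fraction depending on u and v - u. Below the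
    cut, time is shifted so that u becomes 0 and one pays the one-point coefficient of
    lag v - u, while the sum over a bears on |X^a_u| only (low_bound). Above the cut,
    the weights themselves are summable and one pays the two-point coefficient of lag u
    (high_bound). Young's inequality converts the result into a small multiple of A_n
    plus n sum_k (k+1)^(p-2) beta_2(k), which the hypothesis controls (cross_final,
    moment_bound). Centring y^2 leaves products of expectations, which involve only
    the variances of the S_n^a (variance_sum).

    The dependence coefficients apply because each h_a and each h_a^2 is a uniform limit of
    steps of bounded total jump, uniformly in m (step_approx_piece,
    controlled_step_family). *)

(** * Inequalities for real powers *)

Section real_inequalities.
Context {R : realType}.
Implicit Types (p q x y a b c e nu : R).

Lemma one_powR p : 1 `^ p = 1 :> R.
Proof. by rewrite powR1. Qed.

Lemma le_powR_base p a b : 0 <= p -> 0 <= a -> a <= b -> a `^ p <= b `^ p.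
Proof.
move=> p0 a0 ab; apply: ge0_ler_powR => //; rewrite nnegrE //.
exact: le_trans ab.
Qed.

Lemma powR_le1 p a : 0 <= a -> a <= 1 -> 0 <= p -> a `^ p <= 1.
Proof. by move=> a0 a1 p0; rewrite -[leRHS](one_powR p) le_powR_base. Qed.

Lemma powR_root p a : p != 0 -> 0 <= a -> (a `^ p^-1) `^ p = a.
Proof. by move=> p0 a0; rewrite -powRrM mulVf// powRr1. Qed.

Lemma powR_split2 p a : 2 < p -> 0 <= a -> a `^ p = a `^ (p - 2) * a ^+ 2.
Proof.
move=> p2 a0; rewrite -powR_mulrn// -powRD; last first.
  by apply/implyP => /eqP h; exfalso; lra.
by congr (_ `^ _); lra.
Qed.

(** If one of x, y is much smaller than the other, then |x + y|^p exceeds the p-th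
    power of the larger by a factor close to 1; otherwise x and y are comparable
    and the last term dominates. Unlike a Taylor expansion at order 2, this has no
    term of first order in y, and it holds for every p > 2. *)
Lemma normr_powRD_le p e : 2 < p -> 0 < e -> exists2 C, 0 <= C &
  forall x y, `|x + y| `^ p <=
    (1 + e) * (`|x| `^ p + `|y| `^ p) + C * (`|x| `^ (p - 2) * y ^+ 2).
Proof.
move=> p2 e0.
have p0 : 0 <= p by lra.
have pn0 : p != 0 by apply/eqP => h; lra.
(* d is the threshold ratio for which (1 + d)^p = 1 + e *)
pose d := (1 + e) `^ p^-1 - 1.
have d0 : 0 < d.
  rewrite subr_gt0 -[ltLHS](one_powR p^-1) gt0_ltr_powR ?invr_gt0 ?nnegrE//; lra.
have dE : (1 + d) `^ p = 1 + e.
  by rewrite /d addrC subrK powR_root//; lra.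
exists ((1 + d^-1) `^ p * d^-1 ^+ 2).
  by rewrite mulr_ge0 ?powR_ge0 ?exprn_ge0 ?invr_ge0 ?ltW.
move=> x y.
have D (z t : R) : `|z| <= d * `|t| -> `|z + t| `^ p <= (1 + e) * `|t| `^ p.
  move=> zt; rewrite -dE -powRM//; last by lra.
  apply: le_powR_base => //; apply: le_trans (ler_normD _ _) _.
  by rewrite mulrDl mul1r addrC lerD2l.
have C0 : 0 <= (1 + d^-1) `^ p * d^-1 ^+ 2 * (`|x| `^ (p - 2) * y ^+ 2).
  by apply: mulr_ge0; apply: mulr_ge0; rewrite ?powR_ge0 ?sqr_ge0.
have X0 := powR_ge0 `|x| p; have Y0 := powR_ge0 `|y| p.
case: (leP `|y| (d * `|x|)) => [yx|yx].
  have := D _ _ yx; rewrite addrC; nra.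
case: (leP `|x| (d * `|y|)) => [xy|xy].
  have := D _ _ xy; nra.
have H : `|x + y| `^ p <=
    (1 + d^-1) `^ p * d^-1 ^+ 2 * (`|x| `^ (p - 2) * y ^+ 2).
  apply: (@le_trans _ _ (((1 + d^-1) * `|x|) `^ p)).
    apply: le_powR_base => //; apply: le_trans (ler_normD _ _) _.
    rewrite mulrDl mul1r lerD2l mulrC ler_pdivlMr// mulrC; exact: ltW.
  have d1 : 0 <= 1 + d^-1 by rewrite addr_ge0// invr_ge0 ltW.
  rewrite powRM// -mulrA ler_wpM2l ?powR_ge0//.
  rewrite powR_split2// [leRHS]mulrCA ler_wpM2l ?powR_ge0//.
  rewrite -exprMn -(ger0_norm (sqr_ge0 (d^-1 * y))) normrX lerXn2r ?nnegrE//.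
  rewrite normrM gtr0_norm ?invr_gt0// mulrC ler_pdivlMr// mulrC.
  exact: ltW.
apply: le_trans H _; rewrite lerDr mulr_ge0 ?addr_ge0//; lra.
Qed.

(** Young's inequality in the form in which a weight nu is charged to the power
    a^p, to be absorbed later. *)
Lemma powR_youngM p a b nu : 2 < p -> 0 <= a -> 0 <= b -> 0 < nu ->
  a `^ (p - 2) * b <= nu * a `^ p + nu `^ (- ((p - 2) / 2)) * b `^ (p / 2).
Proof.
move=> p2 a0 b0 nu0.
case: (leP b (nu * a ^+ 2)) => [h|h].
  rewrite (powR_split2 p2 a0) mulrCA.
  apply: (@le_trans _ _ (a `^ (p - 2) * (nu * a ^+ 2))).
    by rewrite ler_wpM2l ?powR_ge0.
  by rewrite lerDl mulr_ge0 ?powR_ge0.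
have h' : a ^+ 2 <= b / nu by rewrite ler_pdivlMr// mulrC ltW.
have -> : a `^ (p - 2) = (a ^+ 2) `^ ((p - 2) / 2).
  rewrite -powR_mulrn// -powRrM; congr (_ `^ _); by field.
apply: (@le_trans _ _ ((b / nu) `^ ((p - 2) / 2) * b)).
  by rewrite ler_wpM2r// le_powR_base ?sqr_ge0//; lra.
have nu1 := ltW nu0.
rewrite powRM ?invr_ge0// -(powR_inv1 nu1) -powRrM mulN1r.
have -> : b `^ (p / 2) = b `^ ((p - 2) / 2) * b.
  rewrite -{3}(powRr1 b0) -powRD; first by congr (_ `^ _); by field.
  by apply/implyP => /eqP hh; exfalso; lra.
rewrite mulrAC mulrC lerDr mulr_ge0 ?powR_ge0//.
Qed.

Lemma normr_powRD_le2 p e : 2 < p -> 0 < e -> exists2 C, 0 <= C &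
  forall x y, `|x + y| `^ p <= (1 + e) * `|x| `^ p + C * `|y| `^ p.
Proof.
move=> p2 e0; have e20 : 0 < e / 2 by rewrite divr_gt0.
have [C0 C00 H] := normr_powRD_le p2 e20.
pose eta := e / 2 / (C0 + 1).
have eta0 : 0 < eta by rewrite divr_gt0// ltr_wpDl.
exists (1 + e / 2 + C0 * eta `^ (- ((p - 2) / 2))).
  by rewrite addr_ge0 ?mulr_ge0 ?powR_ge0// addr_ge0// ltW.
move=> x y; apply: le_trans (H x y) _.
have := powR_youngM p2 (normr_ge0 x) (sqr_ge0 y) eta0.
have -> : (y ^+ 2) `^ (p / 2) = `|y| `^ p.
  rewrite -real_normK ?num_real// -powR_mulrn// -powRrM mulrC divfK//.
move=> h; have h2 := ler_wpM2l C00 h.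
have h3 : C0 * eta <= e / 2.
  rewrite /eta mulrA ler_pdivrMr ?ltr_wpDl// mulrC ler_wpM2l ?(ltW e20)//.
  by rewrite lerDl.
have x0 := powR_ge0 `|x| p.
have h4 := ler_wpM2r x0 h3.
rewrite mulrDr in h2.
apply: le_trans (lerD (lexx _) h2) _.
rewrite mulrDr [X in _ + (X + _)]mulrA.
have -> : (1 + e) * `|x| `^ p = (1 + e / 2) * `|x| `^ p + e / 2 * `|x| `^ p by field.
rewrite [X in _ <= _ + X](_ : _ = (1 + e / 2) * `|y| `^ p +
  C0 * (eta `^ (- ((p - 2) / 2)) * `|y| `^ p)); last by ring.
lra.
Qed.

Lemma powR_tangent p x a : 1 < p -> 0 <= x -> 0 <= a ->
  p * (x * a `^ (p - 1)) <= x `^ p + (p - 1) * a `^ p.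
Proof.
move=> p1 x0 a0.
have p0 : 0 < p by lra.
have q0 : 0 < p / (p - 1) by rewrite divr_gt0//; lra.
have := @conjugate_powR R x (a `^ (p - 1)) p (p / (p - 1)) x0
  (powR_ge0 _ _) p0 q0.
rewrite -powRrM [(p - 1) * _]mulrC divfK; last by apply/eqP; lra.
have p0' : p != 0 by rewrite gt_eqF.
have p1' : p - 1 != 0 by rewrite subr_eq0 gt_eqF.
have -> : p^-1 + (p / (p - 1))^-1 = 1 by field; rewrite p0' p1'.
move=> /(_ erefl) h.
have -> : x `^ p + (p - 1) * a `^ p = p * (x `^ p / p + a `^ p / (p / (p - 1))).
  by field; rewrite p0' p1'.
by rewrite ler_pM2l.
Qed.

Lemma powR_sum_le (I : finType) p (w x : I -> R) : 1 < p ->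
  (forall i, 0 <= w i) -> (forall i, 0 <= x i) ->
  (\sum_i w i * x i) `^ p <=
  (\sum_i w i) `^ (p - 1) * \sum_i w i * x i `^ p.
Proof.
move=> p1 w0 x0.
pose W := \sum_i w i; pose X := \sum_i w i * x i.
have W0 : 0 <= W by apply: sumr_ge0.
have X0 : 0 <= X by apply: sumr_ge0 => i _; rewrite mulr_ge0.
rewrite -/W -/X.
have [W00|W00] := eqVneq W 0.
  have wi i : w i = 0.
    by move/eqP: W00; rewrite psumr_eq0// => /allP/(_ i (mem_index_enum _))/eqP.
  rewrite /X big1 ?powR0; first by rewrite mulr_ge0 ?powR_ge0// sumr_ge0// => i _;
    rewrite mulr_ge0 ?powR_ge0.
  - by apply/eqP; lra.
  - by move=> i _; rewrite wi mul0r.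
have Wp : 0 < W by rewrite lt_def W00.
pose a := X / W.
have a0 : 0 <= a by rewrite divr_ge0.
have H : \sum_i w i * (p * (x i * a `^ (p - 1))) <=
         \sum_i w i * (x i `^ p + (p - 1) * a `^ p).
  by apply: ler_sum => i _; rewrite ler_wpM2l// powR_tangent.
have E1 : \sum_i w i * (p * (x i * a `^ (p - 1))) = p * (X * a `^ (p - 1)).
  rewrite mulr_suml mulr_sumr; apply: eq_bigr => i _; ring.
have E2 : \sum_i w i * (x i `^ p + (p - 1) * a `^ p) =
    (\sum_i w i * x i `^ p) + W * ((p - 1) * a `^ p).
  by rewrite mulr_suml -big_split/=; apply: eq_bigr => i _; rewrite mulrDr.
have XE : X = W * a by rewrite /a mulrC divfK.
have aE : a * a `^ (p - 1) = a `^ p by rewrite mulr_powRB1//; lra.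
move: H; rewrite E1 E2 XE -mulrA aE => H.
rewrite powRM//.
have -> : W `^ p = W `^ (p - 1) * W by rewrite mulrC mulr_powRB1//; lra.
rewrite -mulrA ler_wpM2l ?powR_ge0//; lra.
Qed.

(** For c >= 0 each term is at most n^c; for c < 0 the increments of n^(c+1) are bounded
    below by the weighted arithmetic-geometric inequality. *)
Lemma powR_sum_range c : -1 < c -> exists2 C, 0 < C &
  forall n : nat, \sum_(i < n) i.+1%:R `^ c <= C * n%:R `^ (c + 1).
Proof.
move=> c1; have [c0|c0] := leP 0 c.
  exists 1 => // n; rewrite mul1r.
  apply: (@le_trans _ _ (\sum_(i < n) n%:R `^ c)).
    by apply: ler_sum => i _; rewrite le_powR_base// ler_nat.
  rewrite sumr_const card_ord -[leLHS]mulr_natr.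
  by rewrite powRD ?powRr1//; apply/implyP => h; exfalso; move: h; rewrite gt_eqF//; lra.
pose a := c + 1.
have a0 : 0 < a by rewrite /a; lra.
have a1 : a < 1 by rewrite /a; lra.
exists a^-1; first by rewrite invr_gt0.
elim=> [|n IH].
  by rewrite big_ord0 powR0 ?mulr0// gt_eqF.
rewrite big_ord_recr/=.
apply: le_trans (lerD IH (lexx _)) _.
rewrite -lerBrDl -mulrBr ler_pdivlMl//.
pose t : R := n%:R / n.+1%:R.
have t0 : 0 <= t by rewrite divr_ge0.
have ap : 0 < a^-1 by rewrite invr_gt0.
have bp : 0 < (1 - a)^-1 by rewrite invr_gt0; lra.
have := @conjugate_powR R (t `^ a) 1 a^-1 (1 - a)^-1 (powR_ge0 _ _) ler01 ap bp.
rewrite !invrK -powRrM mulfV ?gt_eqF// powRr1// powR1 mulr1.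
have -> : a + (1 - a) = 1 by ring.
move=> /(_ erefl); rewrite mul1r => ht.
have nE : n%:R = n.+1%:R * t :> R.
  by rewrite /t mulrC divfK// pnatr_eq0.
have -> : n%:R `^ (c + 1) = n.+1%:R `^ a * t `^ a :> R.
  by rewrite {1}nE powRM.
rewrite -/a -[X in X - _]mulr1 -mulrBr.
have nE' : n.+1%:R `^ c = n.+1%:R `^ a * n.+1%:R^-1 :> R.
  rewrite -[X in _ * X]powR_inv1// -powRD; first by congr (_ `^ _); rewrite /a; ring.
  by rewrite pnatr_eq0 implybT.
rewrite nE' mulrCA ler_wpM2l ?powR_ge0//.
have -> : n.+1%:R^-1 = 1 - t.
  by rewrite /t -natr1; field; rewrite natr1 pnatr_eq0.
have := ht; nra.
Qed.

(** A discrete form of (int u)^q <= q int u(t) t^(q-1) dt for 0 <= u <= 1: the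
    increment of s^q at s_n = u_0 + ... + u_n is at most a multiple of
    u_n s_n^(q-1), and s_n <= n + 1. *)
Lemma powR_sum_weighted q : 1 <= q -> exists2 C, 0 < C &
  forall (n : nat) (u : nat -> R), (forall i, 0 <= u i <= 1) ->
  (\sum_(i < n) u i) `^ q <= C * \sum_(i < n) u i * i.+1%:R `^ (q - 1).
Proof.
move=> q1; pose N := (Num.truncn q).+1; exists N%:R; first by rewrite ltr0n.
have bern (t : R) (k : nat) : 0 <= t <= 1 -> 1 - k%:R * t <= (1 - t) ^+ k.
  move=> t01; elim: k => [|k IH]; first by rewrite mul0r subr0 expr0.
  rewrite exprS -natr1.
  have k0 : 0 <= k%:R :> R by rewrite ler0n.
  have : (1 - t) * (1 - k%:R * t) <= (1 - t) * (1 - t) ^+ k.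
    by rewrite ler_wpM2l//; lra.
  move: k0; move: (k%:R) => K k0; nra.
move=> n u u01; elim: n => [|n IH].
  by rewrite !big_ord0 powR0 ?mulr0//; apply/eqP; lra.
rewrite !big_ord_recr/= mulrDr.
set s := \sum_(i < n) u i in IH *.
have s0 : 0 <= s by apply: sumr_ge0 => i _; case/andP: (u01 i).
have sn : s <= n%:R.
  rewrite -[n in leRHS]card_ord -sum1_card natr_sum ler_sum// => i _.
  by case/andP: (u01 i).
have /andP[un0 un1] := u01 n.
have [su0|su0] := eqVneq (s + u n) 0.
  rewrite su0 powR0; last by apply/eqP; lra.
  rewrite addr_ge0// !mulr_ge0 ?powR_ge0// sumr_ge0// => i _.
  by rewrite mulr_ge0 ?powR_ge0//; case/andP: (u01 i).
have sup : 0 < s + u n by rewrite lt_def su0 addr_ge0.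
apply: le_trans (lerD IH (lexx _)).
rewrite -lerBlDl.
pose t := u n / (s + u n).
have t01 : 0 <= t <= 1.
  rewrite divr_ge0 ?addr_ge0//= ler_pdivrMr// mul1r lerDr//.
have sE : s = (s + u n) * (1 - t) by rewrite /t; field.
have t1 : 0 <= 1 - t by lra.
have H1 : (1 - t) ^+ N <= (1 - t) `^ q.
  rewrite -powR_mulrn//.
  have [->|tn1] := eqVneq (1 - t) 0; first by rewrite !powR0 ?pnatr_eq0// gt_eqF//; lra.
  have -> : N%:R = q + (N%:R - q) by rewrite addrC subrK.
  rewrite powRD ?tn1 ?implybT// ler_piMr ?powR_ge0//.
  apply: powR_le1 => //; first by lra.
  by rewrite subr_ge0 ltW// /N truncnS_gt.
have H2 := le_trans (bern t N t01) H1.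
have -> : s `^ q = (s + u n) `^ q * (1 - t) `^ q.
  by rewrite {1}sE powRM// addr_ge0.
rewrite -[X in X - _]mulr1 -mulrBr.
apply: (@le_trans _ _ ((s + u n) `^ q * (N%:R * t))).
  by rewrite ler_wpM2l ?powR_ge0//; lra.
have -> : (s + u n) `^ q = (s + u n) * (s + u n) `^ (q - 1).
  by rewrite mulr_powRB1 ?addr_ge0//; lra.
have -> : (s + u n) * (s + u n) `^ (q - 1) * (N%:R * t) =
  N%:R * (u n * (s + u n) `^ (q - 1)) by rewrite /t; field.
rewrite ler_wpM2l// ler_wpM2l// le_powR_base ?subr_ge0 ?addr_ge0//.
by rewrite -natr1 lerD.
Qed.
End real_inequalities.

(** * Expectations of bounded measurable functions *)

Section bounded_measurable.
Context {R : realType}.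

(** Bounded measurable functions: the class in which every expectation below
    exists and the algebra of expectations holds without side conditions. *)
Definition bmf {d} {T : measurableType d} (g : T -> R) :=
  measurable_fun setT g /\ exists M : R, forall w, `|g w| <= M.

Context {d} {T : measurableType d}.
Implicit Types g h : T -> R.

Lemma bmf_cst (c : R) : bmf (fun _ : T => c).
Proof. by split; [exact: measurable_cst|exists `|c|]. Qed.

Lemma bmfD g h : bmf g -> bmf h -> bmf (fun w => g w + h w).
Proof.
move=> [mg [M gM]] [mh [N hN]]; split; first exact: (measurable_funD mg mh).
by exists (M + N) => w; apply: le_trans (ler_normD _ _) (lerD _ _).
Qed.

Lemma bmfM g h : bmf g -> bmf h -> bmf (fun w => g w * h w).
Proof.
move=> [mg [M gM]] [mh [N hN]]; split; first exact: measurable_funM.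
by exists (M * N) => w; rewrite normrM ler_pM.
Qed.

Lemma bmfN g : bmf g -> bmf (fun w => - g w).
Proof.
move=> [mg [M gM]]; split; last by exists M => w; rewrite normrN.
exact: measurableT_comp.
Qed.

Lemma bmfB g h : bmf g -> bmf h -> bmf (fun w => g w - h w).
Proof. by move=> bg bh; exact: (bmfD bg (bmfN bh)). Qed.

Lemma bmf_sum (I : Type) (s : seq I) (Q : pred I) (g : I -> T -> R) :
  (forall i, bmf (g i)) -> bmf (fun w => \sum_(i <- s | Q i) g i w).
Proof.
move=> bg; elim: s => [|i s IH].
  by under [X in bmf X]funext do rewrite big_nil; exact: bmf_cst.
under [X in bmf X]funext do rewrite big_cons.
by case: (Q i) => //; exact: bmfD.
Qed.

Lemma bmf_norm g : bmf g -> bmf (fun w => `|g w|).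
Proof.
move=> [mg [M gM]]; split; last by exists M => w; rewrite normr_id.
exact: measurableT_comp.
Qed.

Lemma bmfX g n : bmf g -> bmf (fun w => g w ^+ n).
Proof.
move=> bg; elim: n => [|n IH]; first exact: bmf_cst.
by under [X in bmf X]funext do rewrite exprS; exact: bmfM.
Qed.

Lemma bmf_powR g (e : R) : 0 <= e -> (forall w, 0 <= g w) -> bmf g ->
  bmf (fun w => g w `^ e).
Proof.
move=> e0 g0 [mg [M gM]]; split; first exact: measurableT_comp (measurable_powR e) mg.
exists (M `^ e) => w; rewrite ger0_norm ?powR_ge0// le_powR_base//.
by rewrite -(ger0_norm (g0 w)).
Qed.

Lemma bmf_comp {d'} {T' : measurableType d'} (g : T' -> R) (f : T -> T') :
  bmf g -> measurable_fun setT f -> bmf (fun w => g (f w)).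
Proof.
move=> [mg [M gM]] mf; split; last by exists M.
exact: measurableT_comp.
Qed.

Lemma bmf_indic (A : set T) : measurable A -> bmf (\1_A : T -> R).
Proof.
move=> mA; split; first exact: measurable_indic.
by exists 1 => w; rewrite indicE; case: (_ \in _); rewrite ?normr0 ?normr1.
Qed.

Variable P : probability T R.

Lemma bmf_integrable g : bmf g -> P.-integrable setT (EFin \o g).
Proof.
move=> [mg [M gM]]; apply: (@le_integrable _ _ _ P setT measurableT _ (cst M%:E)).
- exact/measurable_EFinP.
- by move=> w _; rewrite /= lee_fin (le_trans (gM w))// ler_norm.
- exact: finite_measure_integrable_cst.
Qed.

Lemma ExD g h : bmf g -> bmf h ->
  \int[P]_w (g w + h w) = \int[P]_w g w + \int[P]_w h w.
Proof. by move=> bg bh; rewrite RintegralD//; exact: bmf_integrable. Qed.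

Lemma ExB g h : bmf g -> bmf h ->
  \int[P]_w (g w - h w) = \int[P]_w g w - \int[P]_w h w.
Proof. by move=> bg bh; rewrite RintegralB//; exact: bmf_integrable. Qed.

Lemma ExZ (c : R) g : bmf g -> \int[P]_w (c * g w) = c * \int[P]_w g w.
Proof. by move=> bg; rewrite RintegralZl//; exact: bmf_integrable. Qed.

Lemma Ex_cst (c : R) : \int[P]_w c = c.
Proof. transitivity (c * fine (P setT)); first exact: Rintegral_cst.
by rewrite probability_setT mulr1. Qed.

Lemma Ex_le g h : bmf g -> bmf h -> (forall w, g w <= h w) ->
  \int[P]_w g w <= \int[P]_w h w.
Proof. by move=> bg bh gh; apply: le_Rintegral => //; exact: bmf_integrable. Qed.

Lemma Ex_ge0 g : (forall w, 0 <= g w) -> 0 <= \int[P]_w g w.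
Proof. by move=> g0; apply: Rintegral_ge0. Qed.

Lemma Ex_norm g : bmf g -> `|\int[P]_w g w| <= \int[P]_w `|g w|.
Proof. by move=> bg; apply: le_normr_Rintegral => //; exact: bmf_integrable. Qed.

Lemma Ex_sum (I : Type) (s : seq I) (Q : pred I) (g : I -> T -> R) :
  (forall i, bmf (g i)) ->
  \int[P]_w (\sum_(i <- s | Q i) g i w) = \sum_(i <- s | Q i) \int[P]_w g i w.
Proof.
move=> bg; elim: s => [|i s IH].
  by under eq_Rintegral do rewrite big_nil; rewrite big_nil Ex_cst.
under eq_Rintegral do rewrite big_cons; rewrite big_cons.
by case: (Q i) => //; rewrite ExD ?IH//; exact: bmf_sum.
Qed.

Lemma Ex_indic (A : set T) : measurable A -> \int[P]_w \1_A w = fine (P A).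
Proof. by move=> mA; rewrite /Rintegral integral_indic// setIT. Qed.

Lemma EFin_Ex g : bmf g -> (\int[P]_w (g w)%:E)%E = (\int[P]_w g w)%:E.
Proof.
move=> bg; rewrite /Rintegral fineK//.
by apply: integrable_fin_num => //; exact: bmf_integrable.
Qed.

End bounded_measurable.

Ltac bmf_tac := repeat first
  [ assumption
  | match goal with H : forall _, bmf _ |- _ => solve [exact: H] end
  | apply: bmf_cst | apply: bmfD | apply: bmfB | apply: bmfM
  | apply: bmfN | apply: bmf_norm | apply: bmfX
  | apply: bmf_sum => ? ].

(** * Conditional distributions tested against past variables *)

Section conditioning.
Context {d : measure_display} {T : measurableType d} {R : realType}.
Variable P : probability T R.

Lemma sum_ltn_indic (L k : nat) :
  \sum_(i < L) ((i < k)%N)%:R = (minn L k)%:R :> R.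
Proof.
elim: L => [|L IH]; first by rewrite big_ord0 min0n.
rewrite big_ord_recr/= IH -natrD; congr (_%:R).
by case: (ltnP L k) => h; lia.
Qed.

Variable G : set (set T).
Hypothesis GT : forall A, G A -> d.-measurable A.
Local Notation F0 := (g_sigma_algebraType G).

Lemma sub_measurable (A : set T) : measurable (A : set F0) -> d.-measurable A.
Proof. by apply: smallest_sub => //; exact: sigma_algebra_measurable. Qed.

Lemma sub_bmf (g : T -> R) : bmf (g : F0 -> R) -> bmf g.
Proof.
move=> [mg bg]; split => //.
by move=> _ B mB; apply: sub_measurable; exact: mg.
Qed.

(** A function whose integral over each event of the sub-sigma-algebra vanishes is
    orthogonal to every bounded variable z of that sigma-algebra: a nonnegative z is
    a uniform limit of multiples of sums of indicators of its upper level sets. *)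
Lemma cond_test (g : T -> R) : bmf g ->
  (forall A : set F0, measurable A -> \int[P]_w (\1_A w * g w) = 0) ->
  forall z : F0 -> R, bmf z -> \int[P]_w (z w * g w) = 0.
Proof.
move=> bg test.
have [_ [K gK]] := bg.
have K0 : 0 <= K := le_trans (normr_ge0 _) (gK point).
have pos (z : F0 -> R) : bmf z -> (forall w, 0 <= z w) ->
    \int[P]_w (z w * g w) = 0.
  move=> bz z0; have bzT := sub_bmf bz.
  have [mz [M0 zM0]] := bz.
  pose M := (Num.truncn M0).+1.
  have zM w : z w <= M%:R.
    by rewrite (le_trans (ler_norm _))// (le_trans (zM0 w))// ltW// truncnS_gt.
  apply/eqP; rewrite -normr_eq0 eq_le normr_ge0 andbT; apply/ler_addgt0Pl => /= e e0.
  rewrite addr0.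
  pose N := (Num.truncn (K / e)).+1.
  have NK : K / e < N%:R by exact: truncnS_gt.
  have N0 : 0 < N%:R :> R by rewrite ltr0n.
  (* the number of i with i + 1 <= N z is the integer part of N z *)
  pose A (i : nat) : set F0 := [set w | i.+1%:R <= N%:R * z w].
  have mA i : measurable (A i).
    have := @measurable_fun_ler _ F0 R setT (cst i.+1%:R) (fun w => N%:R * z w).
    move=> /(_ (measurable_cst _) (measurable_funM (measurable_cst _) mz)).
    move=> /(_ measurableT [set true]); rewrite setTI.
    by move=> h; exact: h.
  pose zN (w : T) : R := \sum_(i < N * M) N%:R^-1 * \1_(A i) w.
  have zNE w : zN w = N%:R^-1 * (Num.truncn (N%:R * z w))%:R.
    rewrite /zN -mulr_sumr; congr (_ * _).
    transitivity (\sum_(i < N * M) ((i < Num.truncn (N%:R * z w))%N)%:R : R).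
      apply: eq_bigr => i _; rewrite indicE; congr ((nat_of_bool _)%:R).
      have nz0 : 0 <= N%:R * z w by rewrite mulr_ge0.
      apply/idP/idP; first by rewrite inE /A/= => ?; rewrite truncn_ge_nat.
      by rewrite inE /A/= truncn_ge_nat.
    rewrite sum_ltn_indic (minn_idPr _)//.
    rewrite -(ler_nat R) (@le_trans _ _ (N%:R * z w)) ?truncn_le//; first by rewrite mulr_ge0.
    by rewrite natrM ler_pM2l.
  have zzN w : `|z w - zN w| <= N%:R^-1.
    have nz0 : 0 <= N%:R * z w by rewrite mulr_ge0.
    have /andP[h1 h2] := truncn_itv nz0.
    have -> : z w - zN w = N%:R^-1 * (N%:R * z w - (Num.truncn (N%:R * z w))%:R).
      by rewrite zNE mulrBr mulKf// gt_eqF.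
    rewrite ger0_norm; last by rewrite mulr_ge0 ?invr_ge0// subr_ge0.
    by rewrite ler_piMr ?invr_ge0// lerBlDr addrC natr1 ltW.
  have bA i : bmf (\1_(A i) : T -> R) by apply: bmf_indic; exact: sub_measurable.
  have bzN : bmf zN by apply: bmf_sum => i; apply: bmfM => //; exact: bmf_cst.
  have zNg : \int[P]_w (zN w * g w) = 0.
    under eq_Rintegral do rewrite /zN mulr_suml.
    rewrite Ex_sum; last by move=> i; bmf_tac.
    rewrite big1// => i _.
    under eq_Rintegral do rewrite -mulrA.
    by rewrite ExZ ?test ?mulr0//; bmf_tac.
  have -> : \int[P]_w (z w * g w) = \int[P]_w ((z w - zN w) * g w).
    rewrite -[LHS]subr0 -zNg -ExB; [|exact: bmfM|exact: bmfM].
    by apply: eq_Rintegral => w _; rewrite mulrBl.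
  have bd : bmf (fun w : T => (z w - zN w) * g w) by bmf_tac.
  apply: le_trans (Ex_norm P bd) _.
  apply: (@le_trans _ _ (\int[P]_w (N%:R^-1 * K))); last first.
    rewrite Ex_cst mulrC ler_pdivrMr// mulrC -ler_pdivrMr//; exact: ltW.
  apply: Ex_le; [exact: bmf_norm|exact: bmf_cst|].
  by move=> w; rewrite normrM ler_pM.
move=> z bz; have [_ [M zM]] := bz.
have bzT := sub_bmf bz.
have h1 := pos (fun w => z w + M) (bmfD bz (bmf_cst M)).
have {}h1 : \int[P]_w ((z w + M) * g w) = 0.
  apply: h1 => w; have := zM w; have := ler_norm (- z w); rewrite normrN; lra.
have h2 := test setT measurableT.
have h3 : \int[P]_w (M * g w) = 0.
  rewrite ExZ//; transitivity (M * (\int[P]_w (\1_setT w * g w))).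
    by congr (_ * _); apply: eq_Rintegral => w _; rewrite indicT mul1r.
  by rewrite h2 mulr0.
rewrite -[LHS]addr0 -[in LHS]h3 -ExD; [|exact: bmfM|by bmf_tac].
by rewrite -[RHS]h1; apply: eq_Rintegral => w _; rewrite mulrDl.
Qed.

Context {d' : measure_display} {U : measurableType d'}.
Variables (X : {RV P >-> U}) (kappa : R.-pker F0 ~> U).
Hypothesis kappaX : is_cond_dist P X kappa.

Lemma kernel_le1 w (B : set U) : measurable B ->
  kappa w B \is a fin_num /\ (kappa w B <= 1)%E.
Proof.
move=> mB; have h : (kappa w B <= 1)%E.
  by rewrite -(@prob_kernel _ _ _ _ _ kappa w) le_measure ?inE.
by split => //; rewrite ge0_fin_numE// (le_lt_trans h)// ltry.
Qed.

Lemma bmf_kernel (B : set U) : measurable B ->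
  bmf ((fun w => fine (kappa w B)) : F0 -> R).
Proof.
move=> mB; split.
  apply: (measurableT_comp (f := fine)) => //.
  exact: (@measurable_kernel _ _ F0 U R kappa B mB).
exists 1 => w; rewrite ger0_norm ?fine_ge0//.
by have [h1 h2] := kernel_le1 w mB; rewrite -lee_fin fineK.
Qed.

Lemma cond_dist_Ex (B : set U) (z : F0 -> R) : measurable B -> bmf z ->
  \int[P]_w (z w * \1_B (X w)) = \int[P]_w (z w * fine (kappa w B)).
Proof.
move=> mB bz; have bzT := sub_bmf bz.
have bk := sub_bmf (bmf_kernel mB).
have bX : bmf (fun w : T => \1_B (X w) : R).
  exact: bmf_comp (bmf_indic mB) _.
apply/eqP; rewrite -subr_eq0 -ExB; [|exact: bmfM..].
apply/eqP; under eq_Rintegral do rewrite -mulrBr.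
apply: cond_test => //; first exact: bmfB.
move=> A mA; have mAT := sub_measurable mA.
have bA : bmf (\1_A : T -> R) by exact: bmf_indic.
under eq_Rintegral do rewrite mulrBr.
rewrite ExB; [|exact: bmfM..].
apply/eqP; rewrite subr_eq0; apply/eqP.
have h := kappaX mA mB.
have -> : \int[P]_w (\1_A w * \1_B (X w)) = fine (P (A `&` X @^-1` B)).
  rewrite -Ex_indic; last by apply: measurableI => //; rewrite -[X @^-1` B]setTI; exact: measurable_funPT.
  by apply: eq_Rintegral => w _; rewrite (@indicI _ R A (X @^-1` B)).
rewrite h /Rintegral; congr fine.
rewrite [LHS](@integral_mkcond _ T R P); apply: eq_integral => w _.
rewrite patchE indicE; case: (w \in A); rewrite ?mul0r// mul1r fineK//.
by case: (kernel_le1 w mB).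
Qed.

End conditioning.

(** * Shift invariance of expectations *)

Section stationarity.
Context {d : measure_display} {T : measurableType d} {R : realType}.
Context {P : probability T R}.
Variable Y : int -> {RV P >-> R}.
Hypothesis hY : strictly_stationary Y.

Lemma measurable_window n (t : 'I_n -> int) :
  measurable_fun setT (fun w => [tuple Y (t i) w | i < n]).
Proof.
apply/measurable_fun_tnthP => i.
apply: (eq_measurable_fun (Y (t i))); last exact: measurable_funPT.
by move=> w _ /=; rewrite tnth_mktuple.
Qed.

Lemma stationary_window n (t : n.-tuple int) (h : int) (G : n.-tuple R -> R) :
  bmf G ->
  \int[P]_w G [tuple Y (tnth t i + h) w | i < n] =
  \int[P]_w G [tuple Y (tnth t i) w | i < n].
Proof.
move=> bG; have [mG [M GM]] := bG; rewrite /Rintegral; congr fine.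
pose f1 w := [tuple Y (tnth t i + h) w | i < n].
pose f2 w := [tuple Y (tnth t i) w | i < n].
have m1 : measurable_fun setT f1 by exact: measurable_window.
have m2 : measurable_fun setT f2 by exact: measurable_window.
have mE : measurable_fun setT (EFin \o G) by exact/measurable_EFinP.
have I1 : P.-integrable setT ((EFin \o G) \o f1).
  exact: (bmf_integrable P (bmf_comp bG m1)).
have I2 : P.-integrable setT ((EFin \o G) \o f2).
  exact: (bmf_integrable P (bmf_comp bG m2)).
have E1 := integral_pushforward m1 mE I1 measurableT.
have E2 := integral_pushforward m2 mE I2 measurableT.
rewrite !preimage_setT in E1 E2.
transitivity (\int[pushforward P f1]_(y in setT) (EFin \o G) y)%E; first by rewrite E1.
transitivity (\int[pushforward P f2]_(y in setT) (EFin \o G) y)%E; last by rewrite E2.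
by apply: eq_measure_integral => B mB _; exact: hY.
Qed.

(** The form in which stationarity is used: a functional of finitely many
    coordinates of a path, whatever the times at which the path is read. *)
Lemma stationary_path n (t : nat -> int) (h : int) (F : (nat -> R) -> R) :
  bmf (fun v : n.-tuple R => F (nth 0 v)) ->
  (forall y y' : nat -> R, (forall i, (i < n)%N -> y i = y' i) -> F y = F y') ->
  \int[P]_w F (fun i => Y (t i + h) w) = \int[P]_w F (fun i => Y (t i) w).
Proof.
move=> bF locF.
pose tt := [tuple t i | i < n].
have := stationary_window tt h bF.
set a := \int[P]_w _; set b := \int[P]_w _ => ab.
transitivity a; last (rewrite ab; symmetry); rewrite /a /b;
  apply: eq_Rintegral => w _; apply: locF => i ilt;
  by rewrite (nth_mktuple _ _ (Ordinal ilt)) tnth_mktuple.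
Qed.

Lemma stationary1 (t h : int) (g : R -> R) : bmf g ->
  \int[P]_w g (Y (t + h) w) = \int[P]_w g (Y t w).
Proof.
move=> bg.
apply: (@stationary_path 1 (fun _ => t) h (fun y => g (y 0%N))).
  apply: bmf_comp => //.
  rewrite [X in measurable_fun _ X](_ : _ = (@tnth 1 R)^~ ord0); first exact: measurable_tnth.
  by apply/funext => v; rewrite (tnth_nth 0).
by move=> y y' ->.
Qed.

Local Notation F0 := (g_sigma_algebraType (past Y 0)).

Lemma past_measurable (l : int) (A : set T) : past Y l A -> d.-measurable A.
Proof.
move=> [i [_ [B mB ->]]]; rewrite -[X in measurable X]setTI; exact: measurable_funPT.
Qed.

Lemma measurable_past (i : int) : i <= 0 ->
  measurable_fun [set: F0] (Y i : F0 -> R).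
Proof.
move=> i0 _ B mB; rewrite setTI; apply: sub_gen_smallest.
by exists i; split => //; exists B.
Qed.

End stationarity.

(** * Truncation levels and weights *)

Section weights.
Context {R : realType}.
Variables (p x : R).
Hypotheses (p2 : 2 < p) (xlo : (p - 2) / p < x) (x1 : x < 1)
  (xhi : x < (p - 2) / 2).

(** The weight |S|^(p-2) of the past is cut at the fraction cutoff u q of its
    maximal value when the two future variables are at times u + 1 and u + 1 + q. The
    exponent x is chosen so that both Young weights below are summable. *)
Definition cutoff (u q : nat) : R := Num.min 1 ((q.+1%:R / u.+1%:R) `^ x).

(** nu1 and nu2 are the weights given to the p-th powers in Young's inequality for
    the truncated part and for the rest. Their powers of n make the total weight a
    multiple of eta, and their powers of q or u turn the other terms into the sums
    of (k + 1)^(p - 2) beta k. *)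
Definition nu1 (eta : R) (n q : nat) : R :=
  eta * (n%:R `^ (- (2 * x / (p - 2))) * q.+1%:R `^ (2 * x / (p - 2) - 2)).

Definition nu2 (eta : R) (n u : nat) : R :=
  eta * (n%:R `^ (- (2 / (p - 2))) * u.+1%:R `^ (2 / (p - 2) - 2)).

(** The two summations of Young's inequality that close the recursion on the sums
    of p-th powers. *)
Definition low_weights_bound (C : R) : Prop :=
  forall (eta A : R) (n : nat) (b : nat -> R),
  0 < eta -> 0 <= A -> (forall q, 0 <= b q) ->
  \sum_(u < n) \sum_(q < n) cutoff u q *
     (nu1 eta n q * A + nu1 eta n q `^ (- ((p - 2) / 2)) * b q) <=
  C * (eta * A + eta `^ (- ((p - 2) / 2)) *
    (n%:R * \sum_(q < n) q.+1%:R `^ (p - 2) * b q)).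

Definition high_weights_bound (C : R) : Prop :=
  forall (eta A : R) (n : nat) (c : nat -> R),
  0 < eta -> 0 <= A -> (forall u, 0 <= c u) ->
  \sum_(u < n) \sum_(q < n | (q < u)%N) cutoff u q `^ (- (2 / (p - 2))) *
     (nu2 eta n u * A + nu2 eta n u `^ (- ((p - 2) / 2)) * c u) <=
  C * (eta * A + eta `^ (- ((p - 2) / 2)) *
    (n%:R * \sum_(u < n) u.+1%:R `^ (p - 2) * c u)).

Let pos (n : nat) : 0 < n.+1%:R :> R. Proof. by rewrite ltr0n. Qed.
Let neq0 (n : nat) : n.+1%:R != 0 :> R. Proof. by rewrite pnatr_eq0. Qed.
Let p20 : 0 < p - 2. Proof. by rewrite subr_gt0. Qed.
Let p2n : p - 2 != 0. Proof. by rewrite gt_eqF. Qed.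
Let p00 : 0 < p. Proof. exact: lt_trans p2. Qed.
Let x0 : 0 < x. Proof. by apply: le_lt_trans xlo; rewrite divr_ge0 ?ltW. Qed.

Lemma cutoff_gt0 u q : 0 < cutoff u q.
Proof. by rewrite lt_min ltr01 powR_gt0// divr_gt0. Qed.

Lemma cutoff_le u q : cutoff u q <= q.+1%:R `^ x * u.+1%:R `^ (- x).
Proof.
rewrite ge_min; apply/orP; right.
rewrite powRM// ?invr_ge0// -(powR_inv1 (ltW (pos u))) -powRrM mulN1r//.
Qed.

Lemma cutoff_eq1 u q : (u <= q)%N -> cutoff u q = 1.
Proof.
move=> uq; apply/min_idPl.
have : 1 <= q.+1%:R / u.+1%:R :> R by rewrite ler_pdivlMr// mul1r ler_nat.
by move=> h; rewrite -[leLHS](one_powR x) le_powR_base// ltW.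
Qed.

Lemma nu1_gt0 eta n q : 0 < eta -> 0 < nu1 eta n.+1 q.
Proof. by move=> e0; rewrite mulr_gt0// mulr_gt0// powR_gt0. Qed.

Lemma nu2_gt0 eta n q : 0 < eta -> 0 < nu2 eta n.+1 q.
Proof. by move=> e0; rewrite mulr_gt0// mulr_gt0// powR_gt0. Qed.

Lemma nu1_pow eta n q : 0 < eta -> nu1 eta n.+1 q `^ (- ((p - 2) / 2)) =
  eta `^ (- ((p - 2) / 2)) * (n.+1%:R `^ x * q.+1%:R `^ (p - 2 - x)).
Proof.
move=> e0; rewrite /nu1 powRM ?mulr_ge0 ?powR_ge0 ?(ltW e0)//.
congr (_ * _); rewrite powRM ?powR_ge0// -!powRrM.
by congr (_ `^ _ * _ `^ _); field; rewrite p2n.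
Qed.

Lemma nu2_pow eta n q : 0 < eta -> nu2 eta n.+1 q `^ (- ((p - 2) / 2)) =
  eta `^ (- ((p - 2) / 2)) * (n.+1%:R * q.+1%:R `^ (p - 3)).
Proof.
move=> e0; rewrite /nu2 powRM ?mulr_ge0 ?powR_ge0 ?(ltW e0)//.
congr (_ * _); rewrite powRM ?powR_ge0// -!powRrM.
rewrite -[in RHS](powRr1 (ltW (pos n))).
by congr (_ `^ _ * _ `^ _); field; rewrite ?p2n.
Qed.

(** The sums over u and q separate. They behave as powers of n because -x > -1 and
    because x > (p - 2) / p makes the exponent of q larger than -1. *)
Lemma low_weights_sum : exists2 C, 0 < C & low_weights_bound C.
Proof.
have mx : -1 < - x by rewrite ltrN2.
have [C1 C10 H1] := powR_sum_range mx.
have xx : -1 < x + (2 * x / (p - 2) - 2).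
  have : (p - 2) < x * p by rewrite -ltr_pdivrMr.
  move=> h; have -> : x + (2 * x / (p - 2) - 2) = x * p / (p - 2) - 2.
    by field; rewrite p2n.
  have : 1 < x * p / (p - 2) by rewrite ltr_pdivlMr// mul1r.
  by move=> h1; rewrite ltrBrDr (_ : -1 + 2 = 1 :> R)//; ring.
have [C2 C20 H2] := powR_sum_range xx.
exists (C1 * C2 + C1); first by rewrite addr_gt0// mulr_gt0.
move=> eta A [|n] b e0 A0 b0.
  rewrite !big_ord0 mul0r mulr0 addr0 mulr_ge0 ?addr_ge0 ?mulr_ge0// ltW//.
set m := n.+1.
set E := eta `^ (- ((p - 2) / 2)).
have E0 : 0 <= E by exact: powR_ge0.
apply: (@le_trans _ _ (\sum_(u < m) \sum_(q < m)
    u.+1%:R `^ (- x) * (q.+1%:R `^ x *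
     (nu1 eta m q * A + nu1 eta m q `^ (- ((p - 2) / 2)) * b q)))).
  apply: ler_sum => u _; apply: ler_sum => q _.
  rewrite mulrA ler_wpM2r ?[_ * q.+1%:R `^ x]mulrC ?cutoff_le//.
  by rewrite addr_ge0// mulr_ge0 ?powR_ge0// ltW// nu1_gt0.
under eq_bigr do rewrite -mulr_sumr.
rewrite -mulr_suml.
set Q := (X in _ * X <= _).
have QE : Q <= eta * A * (C2 * m%:R `^ (x - 1)) +
   E * (m%:R `^ x * \sum_(q < m) q.+1%:R `^ (p - 2) * b q).
  have -> : Q = eta * A * m%:R `^ (- (2 * x / (p - 2))) *
       (\sum_(q < m) q.+1%:R `^ (x + (2 * x / (p - 2) - 2))) +
       E * (m%:R `^ x * \sum_(q < m) q.+1%:R `^ (p - 2) * b q).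
    rewrite !mulr_sumr -big_split/=; apply: eq_bigr => q _.
    rewrite (@nu1_pow _ n)// -/E -/m /nu1 mulrDr; congr (_ + _).
      rewrite powRD ?neq0 ?implybT//; ring.
    have -> : q.+1%:R `^ (p - 2) = q.+1%:R `^ x * q.+1%:R `^ (p - 2 - x) :> R.
      by rewrite -powRD ?neq0 ?implybT//; congr (_ `^ _); ring.
    ring.
  rewrite lerD2r -mulrA ler_wpM2l ?mulr_ge0 ?(ltW e0)//.
  apply: le_trans (ler_wpM2l (powR_ge0 _ _) (H2 m)) _.
  rewrite mulrCA ler_wpM2l ?(ltW C20)// -powRD ?neq0 ?implybT//.
  by rewrite le_eqVlt; apply/orP; left; apply/eqP; congr (_ `^ _); ring.
have Q0 : 0 <= Q.
  apply: sumr_ge0 => q _; rewrite mulr_ge0 ?powR_ge0// addr_ge0// mulr_ge0 ?powR_ge0//.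
  by rewrite ltW// nu1_gt0.
apply: le_trans (ler_pM _ Q0 (H1 m) QE) _.
  by apply: sumr_ge0 => i _; exact: powR_ge0.
set B := \sum_(q < m) _ * b _.
have B0 : 0 <= B by apply: sumr_ge0 => q _; rewrite mulr_ge0 ?powR_ge0.
have P1 : m%:R `^ (- x + 1) * m%:R `^ (x - 1) = 1 :> R.
  by rewrite -powRD ?neq0 ?implybT// (_ : _ + _ = 0) ?powRr0//; ring.
have P2 : m%:R `^ (- x + 1) * m%:R `^ x = m%:R :> R.
  rewrite -powRD ?neq0 ?implybT// (_ : _ + _ = 1); last by ring.
  by rewrite powRr1.
have -> : C1 * m%:R `^ (- x + 1) *
   (eta * A * (C2 * m%:R `^ (x - 1)) + E * (m%:R `^ x * B)) =
   C1 * C2 * (eta * A) * (m%:R `^ (- x + 1) * m%:R `^ (x - 1)) +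
   C1 * (E * ((m%:R `^ (- x + 1) * m%:R `^ x) * B)) by ring.
rewrite P1 P2 mulr1.
have h1 : 0 <= eta * A by rewrite mulr_ge0 ?(ltW e0).
have h2 : 0 <= E * (m%:R * B) by rewrite !mulr_ge0.
have h3 : 0 <= C1 * C2 by rewrite mulr_ge0 ?(ltW C10) ?(ltW C20).
rewrite mulrDr lerD// ler_wpM2r// ?lerDl ?lerDr ?(ltW C10)//.
Qed.

(** For fixed u the sum over q < u is of order u, since x < (p - 2) / 2. *)
Lemma high_weights_sum : exists2 C, 0 < C & high_weights_bound C.
Proof.
pose y := 2 * x / (p - 2).
have y1 : -1 < - y.
  by rewrite ltrN2 /y ltr_pdivrMr// mul1r mulrC -ltr_pdivlMr.
have [C3 C30 H3] := powR_sum_range y1.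
have z1 : -1 < 2 / (p - 2) - 1 by rewrite ltrBrDl addrN divr_gt0.
have [C4 C40 H4] := powR_sum_range z1.
exists (C3 * C4 + C3); first by rewrite addr_gt0// mulr_gt0.
move=> eta A [|n] c e0 A0 c0.
  rewrite !big_ord0 mul0r mulr0 addr0 mulr_ge0 ?addr_ge0 ?mulr_ge0// ltW//.
set m := n.+1.
set E := eta `^ (- ((p - 2) / 2)).
have E0 : 0 <= E by exact: powR_ge0.
have inner (u : 'I_m) :
    \sum_(q < m | (q < u)%N) cutoff u q `^ (- (2 / (p - 2))) <= C3 * u.+1%:R.
  apply: (@le_trans _ _ (\sum_(q < m | (q < u)%N)
      u.+1%:R `^ y * q.+1%:R `^ (- y))).
    apply: ler_sum => q qu.
    have -> : cutoff u q = (q.+1%:R / u.+1%:R) `^ x.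
      apply/min_idPr; apply: powR_le1; rewrite ?divr_ge0 ?(ltW x0)//.
      by rewrite ler_pdivrMr// mul1r ler_nat ltnS ltnW.
    rewrite -powRrM powRM ?invr_ge0//.
    rewrite -(powR_inv1 (ltW (pos u))) -powRrM mulrC.
    by rewrite le_eqVlt; apply/orP; left; apply/eqP;
      congr (_ `^ _ * _ `^ _); rewrite /y; field; rewrite p2n.
  rewrite -mulr_sumr.
  apply: (@le_trans _ _ (u.+1%:R `^ y * \sum_(q < u.+1) q.+1%:R `^ (- y))).
    rewrite ler_wpM2l ?powR_ge0//.
    rewrite (big_ord_widen m (fun q => q.+1%:R `^ (- y)))// [leRHS]big_mkcond.
    rewrite [leLHS]big_mkcond; apply: ler_sum => q _.
    have [qu|qu] := ltnP q u; first by rewrite ltnS ltnW.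
    by case: ifP => //; rewrite powR_ge0.
  apply: le_trans (ler_wpM2l (powR_ge0 _ _) (H3 _)) _.
  rewrite mulrCA ler_wpM2l ?(ltW C30)// -powRD ?neq0 ?implybT//.
  by rewrite addrA addrN add0r powRr1.
apply: (@le_trans _ _ (\sum_(u < m) C3 * u.+1%:R *
     (nu2 eta m u * A + nu2 eta m u `^ (- ((p - 2) / 2)) * c u))).
  apply: ler_sum => u _; rewrite -mulr_suml ler_wpM2r//.
  by rewrite addr_ge0// mulr_ge0 ?powR_ge0// ltW// nu2_gt0.
set B := \sum_(q < m) _ * c _.
have B0 : 0 <= B by apply: sumr_ge0 => q _; rewrite mulr_ge0 ?powR_ge0.
have -> : \sum_(u < m) C3 * u.+1%:R *
     (nu2 eta m u * A + nu2 eta m u `^ (- ((p - 2) / 2)) * c u) =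
   C3 * (eta * A) * (m%:R `^ (- (2 / (p - 2))) *
     \sum_(u < m) u.+1%:R `^ (2 / (p - 2) - 1)) + C3 * (E * (m%:R * B)).
  rewrite /B !mulr_sumr -big_split/=; apply: eq_bigr => u _.
  rewrite (@nu2_pow _ n)// -/E -/m /nu2.
  have -> : u.+1%:R `^ (2 / (p - 2) - 1) = u.+1%:R * u.+1%:R `^ (2 / (p - 2) - 2) :> R.
    rewrite -{2}(powRr1 (ltW (pos u))) -powRD ?neq0 ?implybT//.
    by congr (_ `^ _); ring.
  have -> : u.+1%:R `^ (p - 2) = u.+1%:R * u.+1%:R `^ (p - 3) :> R.
    rewrite -{2}(powRr1 (ltW (pos u))) -powRD ?neq0 ?implybT//.
    by congr (_ `^ _); ring.
  ring.
have h1 : 0 <= eta * A by rewrite mulr_ge0 ?(ltW e0).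
have h2 : 0 <= E * (m%:R * B) by rewrite !mulr_ge0.
have h3 : 0 <= C3 * C4 by rewrite mulr_ge0 ?(ltW C30) ?(ltW C40).
rewrite mulrDr lerD//; last by rewrite ler_wpM2r// lerDr.
apply: (@le_trans _ _ (C3 * (eta * A) * C4)).
  rewrite ler_wpM2l ?mulr_ge0 ?(ltW C30) ?(ltW e0)//.
  apply: le_trans (ler_wpM2l (powR_ge0 _ _) (H4 _)) _.
  rewrite mulrCA -powRD ?neq0 ?implybT// subrK addNr powRr0 mulr1//.
by rewrite mulrAC ler_wpM2r// lerDl ltW.
Qed.

End weights.

Lemma weights_exponent {R : realType} (p : R) : 2 < p ->
  exists x : R, [/\ (p - 2) / p < x, x < 1 & x < (p - 2) / 2].
Proof.
move=> p2; have p0 : 0 < p - 2 by rewrite subr_gt0.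
exists (p * (p - 2) / (p ^+ 2 - p + 2)).
have d0 : 0 < p ^+ 2 - p + 2 by nra.
have d1 : p ^+ 2 - p + 2 < p * p by rewrite -expr2; lra.
have d2 : p * (p - 2) < p ^+ 2 - p + 2 by nra.
have d3 : p * 2 < p ^+ 2 - p + 2 by nra.
move: (p ^+ 2 - p + 2) d0 d1 d2 d3 => D d0 d1 d2 d3.
have pp : 0 < p by exact: lt_trans p2.
have -> : p * (p - 2) / D = (p - 2) * (p / D) by rewrite mulrAC mulrC.
split.
- by rewrite ltr_pM2l// ltr_pdivlMr// mulrC ltr_pdivrMr.
- by rewrite mulrA ltr_pdivrMr// mul1r mulrC.
- by rewrite ltr_pM2l// ltr_pdivrMr// mulrC ltr_pdivlMr.
Qed.

Lemma sum_lag_le {R : realType} (e : nat -> R) (l i : nat) : (forall q, 0 <= e q) ->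
  \sum_(i' < l) (if (i <= i')%N then e (i' - i)%N else 0) <= \sum_(q < l) e q.
Proof.
move=> e0; rewrite -(big_mkord xpredT (fun i' => if (i <= i')%N then e (i' - i)%N else 0)).
rewrite -(big_mkord xpredT e).
have [li|il] := leqP l i.
  rewrite big_nat big1 ?sumr_ge0// => j /andP[_ jl].
  by rewrite leqNgt (leq_trans jl).
rewrite (big_cat_nat (n := i)) ?(ltnW il)//=.
rewrite big_nat big1 ?add0r; last by move=> j /andP[_ ji]; rewrite leqNgt ji.
rewrite -{1}(add0n i) big_addn.
rewrite [leRHS](big_cat_nat (n := l - i)) ?leq_subr//=.
rewrite (@eq_bigr _ _ _ _ _ _ _ e); last by move=> j _; rewrite leq_addl addnK.
by rewrite lerDl sumr_ge0.
Qed.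

(** * Functionals of partial sums along a path *)

Section path_functionals.
Context {R : realType} {J : finType}.
Variables (p : R) (x : J -> R -> R) (k : nat).
Implicit Types (y : nat -> R) (kp : R).

Definition psum j y := \sum_(i < k) x j (y i).
Definition pweight j y := `|psum j y| `^ (p - 2).
Definition ptotal y := \sum_j `|psum j y| `^ p.
(** A common bound for all the weights, at the fraction kp of which each one is cut. *)
Definition pmax y := ptotal y `^ ((p - 2) / p).
Definition plow kp j y := pweight j y * (pweight j y <= kp * pmax y)%R%:R.
Definition phigh kp j y := pweight j y * (~~ (pweight j y <= kp * pmax y)%R)%:R.

Hypothesis p2 : 2 < p.
Let p0 : 0 < p. Proof. exact: lt_trans p2. Qed.
Let p20 : 0 < p - 2. Proof. by rewrite subr_gt0. Qed.

Lemma pweight_ge0 j y : 0 <= pweight j y. Proof. exact: powR_ge0. Qed.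

Lemma ptotal_ge0 y : 0 <= ptotal y.
Proof. by apply: sumr_ge0 => j _; exact: powR_ge0. Qed.

Lemma pmax_ge0 y : 0 <= pmax y. Proof. exact: powR_ge0. Qed.

Lemma plow_ge0 kp j y : 0 <= plow kp j y.
Proof. by rewrite mulr_ge0 ?pweight_ge0. Qed.

Lemma phigh_ge0 kp j y : 0 <= phigh kp j y.
Proof. by rewrite mulr_ge0 ?pweight_ge0. Qed.

Lemma pweightE kp j y : pweight j y = phigh kp j y + plow kp j y.
Proof. by rewrite /phigh /plow; case: (_ <= _); rewrite !(mulr0, mulr1, add0r, addr0). Qed.

Lemma plow_le kp j y : 0 <= kp -> plow kp j y <= kp * pmax y.
Proof.
move=> kp0; rewrite /plow; case: (leP (pweight j y)) => h; rewrite ?mulr1 ?mulr0//.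
by rewrite mulr_ge0 ?pmax_ge0.
Qed.

Lemma pweight_powE j y : pweight j y `^ (p / (p - 2)) = `|psum j y| `^ p.
Proof. by rewrite -powRrM mulrC divfK// gt_eqF. Qed.

Lemma pmax_powE y : pmax y `^ (p / (p - 2)) = ptotal y.
Proof.
rewrite -powRrM (_ : _ * _ = 1) ?powRr1 ?ptotal_ge0//.
by rewrite mulrA divfK ?gt_eqF// mulfV// gt_eqF.
Qed.

Lemma pweight_le_pmax j y : pweight j y <= pmax y.
Proof.
have -> : pweight j y = (`|psum j y| `^ p) `^ ((p - 2) / p).
  by rewrite -powRrM mulrC divfK// gt_eqF.
rewrite le_powR_base ?divr_ge0 ?powR_ge0 ?(ltW p20) ?(ltW p0)//.
by rewrite /ptotal (bigD1 j)//= lerDl sumr_ge0// => i _; exact: powR_ge0.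
Qed.

Lemma phigh1 j y : phigh 1 j y = 0.
Proof. by rewrite /phigh mul1r pweight_le_pmax mulr0. Qed.

(** Markov's inequality: a weight above the level kp * pmax is at most a multiple of
    |S^j|^p, and these powers sum to a power of pmax. *)
Lemma sum_phigh kp y : 0 < kp ->
  \sum_j phigh kp j y <= kp `^ (- (2 / (p - 2))) * pmax y.
Proof.
move=> kp0.
have [m0|m0] := eqVneq (pmax y) 0.
  rewrite m0 mulr0 big1// => j _.
  have := pweight_le_pmax j y; rewrite m0 => h.
  by rewrite /phigh (le_anti (introT andP (conj h (pweight_ge0 j y)))) mul0r.
have mp : 0 < pmax y by rewrite lt_def m0 pmax_ge0.
have H j : phigh kp j y <= `|psum j y| `^ p * (kp * pmax y) `^ (- (2 / (p - 2))).
  rewrite /phigh; case: (leP (pweight j y)) => [_|h].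
    by rewrite mulr0 mulr_ge0 ?powR_ge0.
  rewrite mulr1 -pweight_powE.
  have wp : 0 < pweight j y by apply: lt_trans h; rewrite mulr_gt0.
  have -> : p / (p - 2) = 1 + 2 / (p - 2) by field; rewrite gt_eqF.
  rewrite powRD ?(gt_eqF wp) ?implybT// powRr1 ?(ltW wp)// -mulrA.
  rewrite ler_peMr ?(ltW wp)// powRN -ler_pdivrMr ?invr_gt0 ?powR_gt0 ?mulr_gt0//.
  rewrite mul1r invrK le_powR_base ?divr_ge0 ?(ltW p20)//.
    by rewrite mulr_ge0 ?(ltW kp0) ?pmax_ge0.
  exact: ltW.
apply: le_trans (ler_sum _ (fun j _ => H j)) _.
rewrite -mulr_suml -/(ptotal y) -pmax_powE powRM ?(ltW kp0) ?(ltW mp)//.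
rewrite mulrCA ler_wpM2l ?powR_ge0// -powRD ?m0 ?implybT//.
rewrite (_ : _ + _ = 1) ?powRr1 ?(ltW mp)//; field; rewrite gt_eqF//.
Qed.

Lemma psum_loc j y y' : (forall i, (i < k)%N -> y i = y' i) -> psum j y = psum j y'.
Proof. by move=> yy; apply: eq_bigr => i _; rewrite yy. Qed.

Lemma pweight_loc j y y' : (forall i, (i < k)%N -> y i = y' i) ->
  pweight j y = pweight j y'.
Proof. by move=> yy; rewrite /pweight (psum_loc j yy). Qed.

Lemma ptotal_loc y y' : (forall i, (i < k)%N -> y i = y' i) ->
  ptotal y = ptotal y'.
Proof. by move=> yy; apply: eq_bigr => j _; rewrite (psum_loc j yy). Qed.

Lemma plow_loc kp j y y' : (forall i, (i < k)%N -> y i = y' i) ->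
  plow kp j y = plow kp j y'.
Proof. by move=> yy; rewrite /plow /pmax (pweight_loc j yy) (ptotal_loc yy). Qed.

Hypothesis bx : forall j, bmf (x j).
Context {d} {T : measurableType d} (y : T -> nat -> R).
Hypothesis my : forall i, measurable_fun setT (fun w => y w i).

Lemma bmf_psum j : bmf (fun w => psum j (y w)).
Proof. by apply: bmf_sum => i; exact: bmf_comp. Qed.

Lemma bmf_pweight j : bmf (fun w => pweight j (y w)).
Proof. by apply: bmf_powR; rewrite ?(ltW p20)//; apply: bmf_norm; exact: bmf_psum. Qed.

Lemma bmf_ptotal : bmf (fun w => ptotal (y w)).
Proof.
apply: bmf_sum => j; apply: bmf_powR; rewrite ?(ltW p0)//.
by apply: bmf_norm; exact: bmf_psum.
Qed.

Lemma bmf_pmax : bmf (fun w => pmax (y w)).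
Proof.
apply: bmf_powR; [by rewrite divr_ge0 ?ltW|exact: (fun w => ptotal_ge0 (y w))|].
exact: bmf_ptotal.
Qed.

Lemma bmf_bool (b : T -> bool) : measurable_fun setT b ->
  bmf (fun w => (b w)%:R : R).
Proof.
move=> mb; have := mb measurableT [set true] I; rewrite setTI => mbT.
have := @bmf_indic R _ T _ mbT; congr bmf; apply/funext => w; rewrite indicE.
by congr ((nat_of_bool _)%:R); apply/idP/idP; rewrite inE.
Qed.

Lemma measurable_le_pmax kp j :
  measurable_fun setT (fun w => pweight j (y w) <= kp * pmax (y w)).
Proof.
apply: measurable_fun_ler; first by have [] := bmf_pweight j.
by apply: measurable_funM => //; have [] := bmf_pmax.
Qed.

Lemma bmf_plow kp j : bmf (fun w => plow kp j (y w)).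
Proof.
by apply: bmfM; [exact: bmf_pweight|apply: bmf_bool; exact: measurable_le_pmax].
Qed.

Lemma bmf_phigh kp j : bmf (fun w => phigh kp j (y w)).
Proof.
apply: bmfM; [exact: bmf_pweight|apply: bmf_bool].
by apply: measurable_neg; exact: measurable_le_pmax.
Qed.

End path_functionals.
Arguments bmf_pweight {R J p x k} p2 bx {d T y} my j.
Arguments bmf_ptotal {R J p x k} p2 bx {d T y} my.
Arguments bmf_pmax {R J p x k} p2 bx {d T y} my.
Arguments bmf_plow {R J p x k} p2 bx {d T y} my kp j.
Arguments bmf_phigh {R J p x k} p2 bx {d T y} my kp j.
Arguments bmf_psum {R J x k} bx {d T y} my j.

(** * Doubling the length of the partial sums *)

Section core.
Context {d : measure_display} {T : measurableType d} {R : realType}.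
Context {P : probability T R} (Y : int -> {RV P >-> R}).
Hypothesis hY : strictly_stationary Y.
Local Notation F0 := (g_sigma_algebraType (past Y 0)).
Variables (J : finType) (h : J -> R -> R) (M V p : R).
Variables (D : nat -> F0 -> R) (D2 : nat -> nat -> F0 -> R) (beta : nat -> R).
Hypothesis p2 : 2 < p.
Hypothesis bh : forall j, bmf (h j).
Hypothesis hM : forall y, \sum_j `|h j y| <= M.
Hypothesis V0 : 0 <= V.
Hypothesis bD : forall q, bmf (D q).
Hypothesis D01 : forall q w, 0 <= D q w <= 1.
Hypothesis bD2 : forall a b, bmf (D2 a b).
Hypothesis D201 : forall a b w, 0 <= D2 a b w <= 1.
Hypothesis betaD : forall q, \int[P]_w D q w <= beta q.
Hypothesis betaD2 : forall a b, (b < a)%N -> \int[P]_w D2 a b w <= beta b.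

Definition mean_of (j : J) : R := \int[P]_w h j (Y 0 w).
Definition cen (j : J) (v : R) : R := h j v - mean_of j.
Definition cX (j : J) (i : int) (w : T) : R := cen j (Y i w).

Hypothesis H1 : forall j q (z : F0 -> R), bmf z -> (forall w, 0 <= z w) ->
  `|\int[P]_w (z w * cX j q%:Z w)| <= V * \int[P]_w (z w * D q w).
Hypothesis H2 : forall j a b (z : F0 -> R), (b < a)%N ->
  bmf z -> (forall w, 0 <= z w) ->
  `|\int[P]_w (z w * (cX j a%:Z w * cX j b%:Z w -
       \int[P]_w' (cX j a%:Z w' * cX j b%:Z w')))| <=
  V * \int[P]_w (z w * D2 a b w).
Hypothesis H3 : forall j a (z : F0 -> R), bmf z -> (forall w, 0 <= z w) ->
  `|\int[P]_w (z w * (cX j a%:Z w * cX j a%:Z w -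
       \int[P]_w' (cX j a%:Z w' * cX j a%:Z w')))| <=
  V * \int[P]_w (z w * D a w).

Let pastT := @past_measurable _ _ _ P Y 0.
Let toT (g : F0 -> R) : bmf g -> bmf (g : T -> R) := @sub_bmf _ T R _ pastT g.
Let bDT q : bmf (D q : T -> R). Proof. exact: toT. Qed.
Let bD2T a b : bmf (D2 a b : T -> R). Proof. exact: toT. Qed.
Let p0 : 0 < p. Proof. exact: lt_trans p2. Qed.
Let p20 : 0 < p - 2. Proof. by rewrite subr_gt0. Qed.
Let M0 : 0 <= M.
Proof. by apply: le_trans (hM 0); apply: sumr_ge0. Qed.

Lemma bmf_cen j : bmf (cen j).
Proof. by apply: bmfB => //; exact: bmf_cst. Qed.

Lemma bmf_cX j i : bmf (cX j i).
Proof. by apply: bmf_comp (bmf_cen j) _; exact: measurable_funPT. Qed.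

Lemma bmf_cX_past j i : i <= 0 -> bmf (cX j i : F0 -> R).
Proof. by move=> i0; apply: bmf_comp (bmf_cen j) _; exact: measurable_past. Qed.

Lemma bmf_hY j i : bmf (fun w => h j (Y i w)).
Proof. by apply: bmf_comp (bh j) _; exact: measurable_funPT. Qed.

Lemma sum_mean : \sum_j `|mean_of j| <= M.
Proof.
apply: (@le_trans _ _ (\sum_j \int[P]_w `|h j (Y 0 w)|)).
  by apply: ler_sum => j _; apply: Ex_norm; exact: bmf_hY.
rewrite -Ex_sum; last by move=> j; apply: bmf_norm; exact: bmf_hY.
rewrite -[leRHS](Ex_cst P M); apply: Ex_le; last by move=> w; exact: hM.
  by apply: bmf_sum => j; apply: bmf_norm; exact: bmf_hY.
exact: bmf_cst.
Qed.

Lemma sum_cen v : \sum_j `|cen j v| <= 2 * M.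
Proof.
apply: (@le_trans _ _ (\sum_j (`|h j v| + `|mean_of j|))).
  by apply: ler_sum => j _; exact: ler_normB.
by rewrite big_split/= mulrDl mul1r lerD// sum_mean.
Qed.

Lemma cen_le j v : `|cen j v| <= 2 * M.
Proof.
by apply: le_trans (sum_cen v); rewrite (bigD1 j)//= lerDl sumr_ge0.
Qed.

Lemma Ex_cX j i : \int[P]_w cX j i w = 0.
Proof.
have -> : \int[P]_w cX j i w = \int[P]_w cX j 0 w.
  by have := stationary1 hY 0 i (bmf_cen j); rewrite add0r.
by rewrite /cX /cen ExB ?Ex_cst ?subrr//; [exact: bmf_hY|exact: bmf_cst].
Qed.

(** The positive and negative parts of z are treated separately. *)
Lemma one_dep_signed j q (z : F0 -> R) : bmf z ->
  `|\int[P]_w (z w * cX j q%:Z w)| <= V * \int[P]_w (`|z w| * D q w).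
Proof.
move=> bz; have bzT := toT bz; have bX := bmf_cX j q.
pose zp w := (`|z w| + z w) / 2; pose zn w := (`|z w| - z w) / 2.
have bzp : bmf (zp : F0 -> R) by rewrite /zp; bmf_tac.
have bzn : bmf (zn : F0 -> R) by rewrite /zn; bmf_tac.
have bzpT := toT bzp; have bznT := toT bzn.
have zp0 w : 0 <= zp w by rewrite divr_ge0//; have := ler_norm (- z w); rewrite normrN; lra.
have zn0 w : 0 <= zn w by rewrite divr_ge0//; have := ler_norm (z w); lra.
have -> : \int[P]_w (z w * cX j q w) =
   \int[P]_w (zp w * cX j q w) - \int[P]_w (zn w * cX j q w).
  rewrite -ExB; [|exact: bmfM..].
  by apply: eq_Rintegral => w _; rewrite -mulrBl /zp /zn; congr (_ * _); field.
apply: le_trans (ler_normB _ _) _.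
apply: le_trans (lerD (H1 j q bzp zp0) (H1 j q bzn zn0)) _.
rewrite -mulrDr ler_wpM2l// -ExD; [|exact: bmfM..].
rewrite le_eqVlt; apply/orP; left; apply/eqP.
by apply: eq_Rintegral => w _; rewrite -mulrDl /zp /zn; congr (_ * _); field.
Qed.

(** The future starts at time 1, while the past is read backwards from time 0
    (past_path) or from time - u (shifted_path). *)
Definition fwd (l : nat) (j : J) (w : T) : R := \sum_(i < l) cX j i.+1%:Z w.
Definition past_path (w : T) (i : nat) : R := Y (- i%:Z) w.
Definition shifted_path (u : nat) (w : T) (i : nat) : R := Y (- i%:Z - u%:Z) w.

Section fixed_k.
Variable k : nat.
Local Notation sm := (psum cen k).
Local Notation wt := (pweight p cen k).
Local Notation tot := (ptotal p cen k).
Local Notation mx := (pmax p cen k).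
Local Notation low := (plow p cen k).
Local Notation high := (phigh p cen k).
Definition Apast : R := \int[P]_w tot (past_path w).

Let mpp i : measurable_fun [set: F0] (fun w => past_path w i).
Proof. by apply: measurable_past; rewrite oppr_le0. Qed.
Let mps u i : measurable_fun [set: F0] (fun w => shifted_path u w i).
Proof. by apply: measurable_past; rewrite -opprD oppr_le0. Qed.
Let mppT i : measurable_fun [set: T] (fun w => past_path w i).
Proof. exact: measurable_funPT. Qed.
Let mpsT u i : measurable_fun [set: T] (fun w => shifted_path u w i).
Proof. exact: measurable_funPT. Qed.

Lemma Apast_ge0 : 0 <= Apast.
Proof. by apply: Ex_ge0 => w; exact: ptotal_ge0. Qed.

Lemma measurable_nth n i : measurable_fun setT (fun v : n.-tuple R => nth 0 v i).
Proof.
have [il|il] := ltnP i n.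
  apply: (eq_measurable_fun ((@tnth n R)^~ (Ordinal il))).
    by move=> v _; rewrite (tnth_nth 0).
  exact: measurable_tnth.
have -> : (fun v : n.-tuple R => nth 0 v i) = cst 0.
  by apply/funext => v; rewrite nth_default// size_tuple.
exact: measurable_cst.
Qed.

Lemma Ex_tot_shift u : \int[P]_w tot (shifted_path u w) = Apast.
Proof.
apply: (stationary_path hY (n := k) (fun i => - i%:Z) (- u%:Z)).
  exact: (bmf_ptotal (y := fun v : k.-tuple R => nth 0 v) p2 bmf_cen (@measurable_nth k)).
exact: ptotal_loc.
Qed.

(** The product of pmax with a variable in [0, 1]; such a variable is at least its
    own power p / 2. *)
Lemma young_max (z : T -> nat -> R) (nu : R) (b : T -> R) : 0 < nu ->
  (forall i, measurable_fun [set: T] (fun w => z w i)) ->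
  bmf b -> (forall w, 0 <= b w <= 1) ->
  \int[P]_w (mx (z w) * b w) <= nu * \int[P]_w tot (z w) +
     nu `^ (- ((p - 2) / 2)) * \int[P]_w b w.
Proof.
move=> nu0 mz bb b01.
have btot : bmf (fun w => tot (z w)) := bmf_ptotal p2 bmf_cen mz.
have bmx : bmf (fun w => mx (z w)) := bmf_pmax p2 bmf_cen mz.
rewrite -(ExZ P nu btot) -(ExZ P _ bb) -ExD; [|by bmf_tac|by bmf_tac].
apply: Ex_le; [by bmf_tac|by bmf_tac|] => w.
have /andP[b0 b1] := b01 w.
have t0 := ptotal_ge0 p cen k (z w).
have -> : mx (z w) = (tot (z w) `^ p^-1) `^ (p - 2).
  by rewrite -powRrM mulrC.
apply: le_trans (powR_youngM p2 (powR_ge0 _ _) b0 nu0) _.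
rewrite powR_root ?gt_eqF// lerD2l ler_wpM2l ?powR_ge0//.
have [->|bn0] := eqVneq (b w) 0; first by rewrite powR0// gt_eqF// divr_gt0.
rewrite ge1r_powR//; first by rewrite lt_def bn0 b0.
by rewrite ler_pdivlMr// mul1r ltW.
Qed.

Lemma low_shift j kp (u q : nat) :
  \int[P]_w (low kp j (past_path w) * (cX j (u + q)%:Z w * cX j u%:Z w)) =
  \int[P]_w ((low kp j (shifted_path u w) * cX j 0 w) * cX j q%:Z w).
Proof.
pose t (i : nat) : int := match i with 0 => u%:Z | 1 => (u + q)%:Z | i.+2 => - i%:Z end.
pose F (y : nat -> R) := (low kp j (fun i => y i.+2) * cen j (y 0%N)) * cen j (y 1%N).
have := @stationary_path _ _ _ P Y hY k.+2 t (- u%:Z) F.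
set a := \int[P]_w _; set b := \int[P]_w _ => ab.
transitivity b; last (rewrite -ab).
- by apply: eq_Rintegral => w _; rewrite /F /= -mulrA [cX j u w * _]mulrC.
- rewrite /a; apply: eq_Rintegral => w _; rewrite /F /cX /= subrr.
  by rewrite PoszD addrAC subrr add0r.
- apply: bmfM; [apply: bmfM|].
  + apply: (bmf_plow (y := fun (v : k.+2.-tuple R) i => nth 0 v i.+2) p2 bmf_cen).
    by move=> i; exact: measurable_nth.
  + by apply: bmf_comp (bmf_cen j) _; exact: measurable_nth.
  + by apply: bmf_comp (bmf_cen j) _; exact: measurable_nth.
- move=> y y' yy.
  have e0 : y 0%N = y' 0%N by exact: yy.
  have e1 : y 1%N = y' 1%N by exact: yy.
  have e2 : low kp j (fun i : nat => y i.+2) = low kp j (fun i : nat => y' i.+2).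
    by apply: plow_loc => i ik; apply: yy.
  by rewrite /F e0 e1 e2.
Qed.

(** After a shift by - u the variable of index u is a bounded function of Y_0, hence
    of the past; it joins the truncated weight, and only the coefficient of lag q is
    paid. Truncation lets the sum over j be taken inside: it bears on |X^j| alone. *)
Lemma low_bound kp nu (u q : nat) : 0 <= kp -> 0 < nu ->
  \sum_j `|\int[P]_w (low kp j (past_path w) * (cX j (u + q)%:Z w * cX j u%:Z w))| <=
  V * (2 * M) * kp * (nu * Apast + nu `^ (- ((p - 2) / 2)) * beta q).
Proof.
move=> kp0 nu0.
have bl j : bmf (fun w : F0 => low kp j (shifted_path u w)).
  exact: (bmf_plow p2 bmf_cen (mps u)).
have bmx : bmf (fun w : T => mx (shifted_path u w)) by exact: (bmf_pmax p2 bmf_cen (mpsT u)).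
have bz j : bmf (fun w : F0 => low kp j (shifted_path u w) * cX j 0 w).
  by apply: bmfM => //; exact: bmf_cX_past.
have bzD j : bmf (fun w : T => `|low kp j (shifted_path u w) * cX j 0 w| * D q w).
  by apply: bmfM => //; apply: bmf_norm; exact: toT.
apply: (@le_trans _ _ (\sum_j V * \int[P]_w (`|low kp j (shifted_path u w) * cX j 0 w| * D q w))).
  by apply: ler_sum => j _; rewrite low_shift one_dep_signed.
rewrite -mulr_sumr -!mulrA ler_wpM2l// -Ex_sum//.
apply: (@le_trans _ _ (\int[P]_w (2 * M * kp * (mx (shifted_path u w) * D q w)))).
  apply: Ex_le; [exact: bmf_sum|by bmf_tac|] => w.
  rewrite -mulr_suml mulrA; have /andP[D0 _] := D01 q w; rewrite ler_wpM2r//.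
  apply: (@le_trans _ _ (\sum_j kp * mx (shifted_path u w) * `|cX j 0 w|)).
    apply: ler_sum => j _; rewrite normrM ger0_norm ?plow_ge0//.
    by rewrite ler_wpM2r// plow_le.
  rewrite -mulr_sumr mulrC -mulrA ler_wpM2r ?mulr_ge0 ?pmax_ge0//.
  exact: sum_cen.
rewrite ExZ; last by bmf_tac.
rewrite -!mulrA ler_wpM2l// ler_wpM2l// ler_wpM2l//.
apply: le_trans (young_max nu0 (mpsT u) (bDT q) (D01 q)) _.
by rewrite Ex_tot_shift lerD2l ler_wpM2l ?powR_ge0.
Qed.

Lemma cov_stat j (u q : nat) :
  \int[P]_w (cX j (u + q)%:Z w * cX j u%:Z w) = \int[P]_w (cX j 0 w * cX j q%:Z w).
Proof.
pose t (i : nat) : int := match i with O => u%:Z | _ => (u + q)%:Z end.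
pose F (y : nat -> R) := cen j (y 0%N) * cen j (y 1%N).
have := @stationary_path _ _ _ P Y hY 2 t (- u%:Z) F.
set a := \int[P]_w _; set b := \int[P]_w _ => ab.
transitivity b; last (rewrite -ab).
- by apply: eq_Rintegral => w _; rewrite /F /= mulrC.
- rewrite /a; apply: eq_Rintegral => w _; rewrite /F /cX /= subrr.
  by rewrite PoszD addrAC subrr add0r.
- by apply: bmfM; apply: bmf_comp (bmf_cen j) _; exact: measurable_nth.
- move=> y y' yy.
  have e0 : y 0%N = y' 0%N by exact: yy.
  have e1 : y 1%N = y' 1%N by exact: yy.
  by rewrite /F e0 e1.
Qed.

Lemma cov_le j (u q : nat) :
  `|\int[P]_w (cX j (u + q)%:Z w * cX j u%:Z w)| <=
  V * \int[P]_w (`|cX j 0 w| * D q w).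
Proof. by rewrite cov_stat; apply: one_dep_signed; exact: bmf_cX_past. Qed.

Lemma low_mean_bound kp nu (u q : nat) : 0 <= kp -> 0 < nu ->
  \sum_j `|\int[P]_w (low kp j (past_path w) *
      \int[P]_w' (cX j (u + q)%:Z w' * cX j u%:Z w'))| <=
  V * (2 * M) * kp * (nu * Apast + nu `^ (- ((p - 2) / 2)) * beta q).
Proof.
move=> kp0 nu0.
have bl j : bmf (fun w : T => low kp j (past_path w)).
  exact: (bmf_plow p2 bmf_cen mppT).
have bmx : bmf (fun w : T => mx (past_path w)) by exact: (bmf_pmax p2 bmf_cen mppT).
set dd := \int[P]_w D q w.
have dd0 : 0 <= dd by apply: Ex_ge0 => w; case/andP: (D01 q w).
have dd1 : dd <= 1.
  rewrite -[leRHS](Ex_cst P); apply: Ex_le => //; first exact: bmf_cst.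
  by move=> w; case/andP: (D01 q w).
pose c j := \int[P]_w (cX j (u + q)%:Z w * cX j u%:Z w).
have bXD j : bmf (fun w : T => `|cX j 0 w| * D q w).
  by apply: bmfM => //; apply: bmf_norm; exact: bmf_cX.
have sumc : \sum_j `|c j| <= V * (2 * M * dd).
  apply: (@le_trans _ _ (\sum_j V * \int[P]_w (`|cX j 0 w| * D q w))).
    by apply: ler_sum => j _; exact: cov_le.
  rewrite -mulr_sumr ler_wpM2l// -Ex_sum// -ExZ//.
  apply: Ex_le; [exact: bmf_sum|by bmf_tac|] => w.
  rewrite -mulr_suml ler_wpM2r ?sum_cen//; by case/andP: (D01 q w).
apply: (@le_trans _ _ (\sum_j kp * (\int[P]_w mx (past_path w)) * `|c j|)).
  apply: ler_sum => j _.
  have -> : \int[P]_w (low kp j (past_path w) * c j) = c j * \int[P]_w low kp j (past_path w).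
    by rewrite -ExZ//; apply: eq_Rintegral => w _; rewrite mulrC.
  rewrite normrM mulrC ler_wpM2r// ger0_norm; last first.
    by apply: Ex_ge0 => w; exact: plow_ge0.
  rewrite -ExZ//; apply: Ex_le => //; first by bmf_tac.
  by move=> w; exact: plow_le.
have e0 : 0 <= \int[P]_w mx (past_path w) by apply: Ex_ge0 => w; exact: pmax_ge0.
rewrite -mulr_sumr; apply: le_trans (ler_wpM2l (mulr_ge0 kp0 e0) sumc) _.
have -> : kp * (\int[P]_w mx (past_path w)) * (V * (2 * M * dd)) =
   V * (2 * M) * kp * \int[P]_w (mx (past_path w) * dd).
  have -> : \int[P]_w (mx (past_path w) * dd) = dd * \int[P]_w mx (past_path w).
    by rewrite -ExZ//; apply: eq_Rintegral => w _; rewrite mulrC.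
  ring.
rewrite ler_wpM2l ?mulr_ge0//.
have := @young_max past_path nu (fun _ => dd) nu0 mppT (bmf_cst dd).
rewrite Ex_cst => H; apply: le_trans (H _) _; first by move=> w; rewrite dd0 dd1.
by rewrite lerD2l ler_wpM2l ?powR_ge0// betaD.
Qed.

Lemma low_square_bound kp nu (u : nat) : 0 <= kp -> 0 < nu ->
  \sum_j `|\int[P]_w (low kp j (past_path w) * (cX j u%:Z w * cX j u%:Z w -
      \int[P]_w' (cX j u%:Z w' * cX j u%:Z w')))| <=
  8 * M ^+ 2 * kp * (nu * Apast + nu `^ (- ((p - 2) / 2)) * 1).
Proof.
move=> kp0 nu0.
have bl j : bmf (fun w : T => low kp j (past_path w)).
  exact: (bmf_plow p2 bmf_cen mppT).
have bmx : bmf (fun w : T => mx (past_path w)) by exact: (bmf_pmax p2 bmf_cen mppT).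
have bX j := bmf_cX j u.
pose c j := \int[P]_w (cX j u%:Z w * cX j u%:Z w).
have sumsq w : \sum_j (cX j u w * cX j u w) <= 4 * M ^+ 2.
  apply: (@le_trans _ _ (\sum_j 2 * M * `|cX j u w|)).
    apply: ler_sum => j _; apply: le_trans (ler_norm _) _.
    by rewrite normrM ler_wpM2r// cen_le.
  rewrite -mulr_sumr; apply: le_trans (ler_wpM2l _ (sum_cen _)) _; rewrite ?mulr_ge0//.
  by rewrite le_eqVlt; apply/orP; left; apply/eqP; ring.
have c0 j : 0 <= c j by apply: Ex_ge0 => w; rewrite -expr2 sqr_ge0.
have bXX j : bmf (fun w : T => cX j u w * cX j u w) by apply: bmfM.
have sumc : \sum_j c j <= 4 * M ^+ 2.
  rewrite /c -Ex_sum//.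
  rewrite -[leRHS](Ex_cst P); apply: Ex_le => //; [exact: bmf_sum|exact: bmf_cst].
apply: (@le_trans _ _ (\sum_j \int[P]_w (kp * mx (past_path w) *
    (cX j u w * cX j u w + c j)))).
  apply: ler_sum => j _; rewrite -/(c j).
  have b1 : bmf (fun w : T => low kp j (past_path w) * (cX j u w * cX j u w - c j)).
    by bmf_tac.
  apply: le_trans (Ex_norm P b1) _; apply: Ex_le; [exact: bmf_norm|by bmf_tac|].
  move=> w; rewrite normrM ger0_norm ?plow_ge0// ler_pM ?plow_ge0 ?plow_le//.
  apply: le_trans (ler_normB _ _) _.
  by rewrite ger0_norm -?expr2 ?sqr_ge0// ger0_norm.
rewrite -Ex_sum; last by move=> j; bmf_tac.
apply: (@le_trans _ _ (\int[P]_w (8 * M ^+ 2 * kp * (mx (past_path w) * 1)))).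
  apply: Ex_le; [by apply: bmf_sum => j; bmf_tac|by bmf_tac|] => w.
  rewrite -mulr_sumr big_split/=.
  have -> : 8 * M ^+ 2 * kp * (mx (past_path w) * 1) =
    kp * mx (past_path w) * (4 * M ^+ 2 + 4 * M ^+ 2) by ring.
  by rewrite ler_wpM2l ?mulr_ge0 ?pmax_ge0// lerD.
rewrite ExZ; last by bmf_tac.
rewrite ler_wpM2l ?mulr_ge0 ?sqr_ge0//.
have := @young_max past_path nu (fun _ => 1) nu0 mppT (bmf_cst 1).
by rewrite Ex_cst; apply => w; rewrite ler01 lexx.
Qed.

(** Above the truncation level the weights are summable over j, and conditioning the
    product of the two variables on the past costs the coefficient of lag u. *)
Lemma high_bound kp nu (u q : nat) : 0 < kp -> 0 < nu ->
  \sum_j `|\int[P]_w (high kp j (past_path w) *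
     (cX j (u + q)%:Z w * cX j u%:Z w -
      \int[P]_w' (cX j (u + q)%:Z w' * cX j u%:Z w')))| <=
  V * kp `^ (- (2 / (p - 2))) *
    (nu * Apast + nu `^ (- ((p - 2) / 2)) * beta u).
Proof.
move=> kp0 nu0.
have bl j : bmf (fun w : F0 => high kp j (past_path w)).
  exact: (bmf_phigh p2 bmf_cen mpp).
have blT j := toT (bl j).
have bmx : bmf (fun w : T => mx (past_path w)) by exact: (bmf_pmax p2 bmf_cen mppT).
(* for q = 0 the product is a square, controlled by the one-point coefficient *)
pose E (w : T) := if q == 0 then D u w else D2 (u + q) u w.
have bE : bmf E by rewrite /E; case: (q == 0).
have E01 w : 0 <= E w <= 1 by rewrite /E; case: (q == 0).
have Eb : \int[P]_w E w <= beta u.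
  by rewrite /E; have [q0|q0] := eqVneq q 0; rewrite ?betaD// betaD2// -ltn_subLR// subnn lt0n.
apply: (@le_trans _ _ (\sum_j V * \int[P]_w (high kp j (past_path w) * E w))).
  apply: ler_sum => j _; rewrite /E; have [->|q0] := eqVneq q 0.
    by rewrite addn0; apply: H3 => // w; exact: phigh_ge0.
  apply: H2 => //; last by move=> w; exact: phigh_ge0.
  by rewrite -ltn_subLR// subnn lt0n.
rewrite -mulr_sumr -!mulrA ler_wpM2l// -Ex_sum; last by move=> j; bmf_tac.
apply: (@le_trans _ _ (\int[P]_w (kp `^ (- (2 / (p - 2))) * (mx (past_path w) * E w)))).
  apply: Ex_le; [by apply: bmf_sum => j; bmf_tac|by bmf_tac|] => w.
  rewrite -mulr_suml mulrA; have /andP[e0 _] := E01 w; rewrite ler_wpM2r//.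
  exact: sum_phigh.
rewrite ExZ; last by bmf_tac.
rewrite ler_wpM2l ?powR_ge0//.
apply: le_trans (young_max nu0 mppT bE E01) _.
by rewrite lerD2l ler_wpM2l ?powR_ge0.
Qed.

(** At lag 0 no decay is available and the coefficient is replaced by 1. *)
Definition beta_or1 (q : nat) : R := if q == 0%N then 1 else beta q.
Definition low_cst : R := 8 * M ^+ 2 + 4 * M * V.

Lemma beta_ge0 q : 0 <= beta q.
Proof.
by apply: le_trans (betaD q); apply: Ex_ge0 => w; case/andP: (D01 q w).
Qed.

Lemma beta_or1_ge0 q : 0 <= beta_or1 q.
Proof. by rewrite /beta_or1; case: ifP => // _; exact: beta_ge0. Qed.

Definition centred_prod j (a b : nat) (w : T) : R :=
  cX j a%:Z w * cX j b%:Z w - \int[P]_w' (cX j a%:Z w' * cX j b%:Z w').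

Lemma bmf_centred_prod j a b : bmf (centred_prod j a b).
Proof.
by have ba := bmf_cX j a; have bb := bmf_cX j b; apply: bmfB; [exact: bmfM|exact: bmf_cst].
Qed.

Lemma centred_prodC j a b : centred_prod j a b = centred_prod j b a.
Proof.
apply/funext => w; rewrite /centred_prod mulrC; congr (_ - _).
by apply: eq_Rintegral => w' _; rewrite mulrC.
Qed.

Lemma low_total_bound kp nu (u q : nat) : 0 <= kp -> 0 < nu ->
  \sum_j `|\int[P]_w (low kp j (past_path w) * centred_prod j (u + q) u w)| <=
  low_cst * kp * (nu * Apast + nu `^ (- ((p - 2) / 2)) * beta_or1 q).
Proof.
move=> kp0 nu0; rewrite /beta_or1 /low_cst.
have A0 := Apast_ge0.
have b0 := beta_ge0 q; have n0 := powR_ge0 nu (- ((p - 2) / 2)).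
have [->|q0] := eqVneq q 0%N.
  rewrite addn0; apply: le_trans (low_square_bound u kp0 nu0) _.
  rewrite ler_wpM2r//; first by rewrite addr_ge0// mulr_ge0// ltW.
  by rewrite ler_wpM2r// lerDl !mulr_ge0.
apply: (@le_trans _ _ (2 * (V * (2 * M) * kp * (nu * Apast + nu `^ (- ((p - 2) / 2)) * beta q)))).
  rewrite mulrDl mul1r; apply: le_trans (lerD (low_bound u q kp0 nu0) (low_mean_bound u q kp0 nu0)).
  rewrite -big_split/=; apply: ler_sum => j _.
  have bl : bmf (fun w : T => low kp j (past_path w)).
    exact: (bmf_plow p2 bmf_cen mppT).
  have ba := bmf_cX j (u + q)%N; have bb := bmf_cX j u.
  have b1 : bmf (fun w => cX j (u + q)%:Z w * cX j u%:Z w) by apply: bmfM.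
  apply: le_trans (ler_normB _ _); rewrite -ExB; [|exact: bmfM|by apply: bmfM => //; exact: bmf_cst].
  rewrite le_eqVlt; apply/orP; left; apply/eqP; congr (`|_|).
  by apply: eq_Rintegral => w _; rewrite mulrBr.
have -> : 2 * (V * (2 * M) * kp * (nu * Apast + nu `^ (- ((p - 2) / 2)) * beta q)) =
  4 * M * V * kp * (nu * Apast + nu `^ (- ((p - 2) / 2)) * beta q) by ring.
rewrite ler_wpM2r//; first by rewrite addr_ge0// mulr_ge0// ltW.
by rewrite ler_wpM2r// lerDr mulr_ge0// sqr_ge0.
Qed.

Variable x : R.
Hypothesis xlo : (p - 2) / p < x.

(** For q >= u the cutoff is 1, the truncation is void and only the first term is
    present. *)
Definition pair_bound eta l (u q : nat) : R :=
  low_cst * (cutoff x u q * (nu1 p x eta l q * Apast +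
     nu1 p x eta l q `^ (- ((p - 2) / 2)) * beta_or1 q)) +
  (if (q < u)%N then V * (cutoff x u q `^ (- (2 / (p - 2))) *
     (nu2 p eta l u * Apast + nu2 p eta l u `^ (- ((p - 2) / 2)) * beta u.+1))
   else 0).

Lemma weight_bound eta l (u q : nat) : 0 < eta ->
  \sum_j `|\int[P]_w (wt j (past_path w) * centred_prod j (u.+1 + q) u.+1 w)| <=
  pair_bound eta l.+1 u q.
Proof.
move=> eta0; rewrite /pair_bound.
have n1 : 0 < nu1 p x eta l.+1 q by exact: nu1_gt0.
have n2 : 0 < nu2 p eta l.+1 u by exact: nu2_gt0.
have kp0 : 0 < cutoff x u q by exact: cutoff_gt0.
set kp := cutoff x u q in kp0 *.
have bhi j : bmf (fun w : T => high kp j (past_path w)) by exact: (bmf_phigh p2 bmf_cen mppT).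
have blo j : bmf (fun w : T => low kp j (past_path w)) by exact: (bmf_plow p2 bmf_cen mppT).
have E j : \int[P]_w (wt j (past_path w) * centred_prod j (u.+1 + q) u.+1 w) =
   \int[P]_w (low kp j (past_path w) * centred_prod j (u.+1 + q) u.+1 w) +
   \int[P]_w (high kp j (past_path w) * centred_prod j (u.+1 + q) u.+1 w).
  have bc := bmf_centred_prod j (u.+1 + q) u.+1.
  rewrite -ExD; [|exact: bmfM|exact: bmfM].
  by apply: eq_Rintegral => w _; rewrite -mulrDl addrC -pweightE.
apply: (@le_trans _ _ ((\sum_j `|\int[P]_w (low kp j (past_path w) * centred_prod j (u.+1 + q) u.+1 w)|) +
  \sum_j `|\int[P]_w (high kp j (past_path w) * centred_prod j (u.+1 + q) u.+1 w)|)).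
  by rewrite -big_split/=; apply: ler_sum => j _; rewrite E ler_normD.
apply: lerD.
  by rewrite mulrA; exact: low_total_bound (ltW kp0) n1.
case: ifP => [qu|/negbT qu].
  by rewrite mulrA; exact: high_bound kp0 n2.
rewrite big1// => j _.
have kp1 : kp = 1 by apply: (cutoff_eq1 p2 xlo); rewrite leqNgt.
have -> : \int[P]_w (high kp j (past_path w) * centred_prod j (u.+1 + q) u.+1 w) = \int[P]_w (0 : R).
  by apply: eq_Rintegral => w _; rewrite kp1 phigh1// mul0r.
by rewrite Ex_cst normr0.
Qed.

Lemma pair_bound_ge0 eta l (u q : nat) : 0 < eta -> 0 <= pair_bound eta l.+1 u q.
Proof. by move=> e0; apply: le_trans (weight_bound l u q e0); apply: sumr_ge0. Qed.

Lemma bmf_fwd l j : bmf (fwd l j).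
Proof. by apply: bmf_sum => i; exact: bmf_cX. Qed.

(** The square of the future sum is expanded in products of two variables; each is
    compared with its expectation, and what remains is a product of expectations. *)
Lemma cross_split eta l : 0 < eta ->
  \sum_j \int[P]_w (wt j (past_path w) * fwd l.+1 j w ^+ 2) <=
  (\sum_j (\int[P]_w wt j (past_path w)) * \int[P]_w (fwd l.+1 j w ^+ 2)) +
  2 * \sum_(u < l.+1) \sum_(q < l.+1) pair_bound eta l.+1 u q.
Proof.
move=> e0; set n := l.+1.
have bw j : bmf (fun w : T => wt j (past_path w)) by exact: (bmf_pweight p2 bmf_cen mppT).
have bX j i := bmf_cX j i.
have bc j a b := bmf_centred_prod j a b.
have bwc j a b : bmf (fun w : T => wt j (past_path w) * centred_prod j a b w) by apply: bmfM.
have key j : \int[P]_w (wt j (past_path w) * fwd n j w ^+ 2) =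
   (\int[P]_w wt j (past_path w)) * (\int[P]_w (fwd n j w ^+ 2)) +
   \sum_(i < n) \sum_(i' < n) \int[P]_w (wt j (past_path w) * centred_prod j i.+1 i'.+1 w).
  have sq w : fwd n j w ^+ 2 = \sum_(i < n) \sum_(i' < n) cX j i.+1%:Z w * cX j i'.+1%:Z w.
    by rewrite expr2 /fwd mulr_suml; apply: eq_bigr => i _; rewrite mulr_sumr.
  have e1 : \int[P]_w (fwd n j w ^+ 2) =
     \sum_(i < n) \sum_(i' < n) \int[P]_w (cX j i.+1%:Z w * cX j i'.+1%:Z w).
    rewrite (eq_Rintegral _ (f := fun w => fwd n j w ^+ 2)
      (g := fun w => \sum_(i < n) \sum_(i' < n) cX j i.+1%:Z w * cX j i'.+1%:Z w)); last first.
      by move=> w _; exact: sq.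
    rewrite Ex_sum; last by move=> i; apply: bmf_sum => i'; apply: bmfM.
    by apply: eq_bigr => i _; rewrite Ex_sum// => i'; apply: bmfM.
  have -> : \sum_(i < n) \sum_(i' < n) \int[P]_w (wt j (past_path w) * centred_prod j i.+1 i'.+1 w) =
    \int[P]_w (wt j (past_path w) * (fwd n j w ^+ 2 - \int[P]_w' (fwd n j w' ^+ 2))).
    rewrite (eq_Rintegral _ (f := fun w => wt j (past_path w) * (fwd n j w ^+ 2 - \int[P]_w' (fwd n j w' ^+ 2)))
      (g := fun w => \sum_(i < n) \sum_(i' < n) wt j (past_path w) * centred_prod j i.+1 i'.+1 w)); last first.
      move=> w _; rewrite e1 sq -sumrB mulr_sumr; apply: eq_bigr => i _.
      by rewrite -sumrB mulr_sumr.
    rewrite Ex_sum; last by move=> i; apply: bmf_sum => i'; exact: bwc.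
    by apply: eq_bigr => i _; rewrite Ex_sum.
  have bf := bmfX 2 (bmf_fwd n j).
  set c := \int[P]_w (fwd n j w ^+ 2).
  have -> : (\int[P]_w wt j (past_path w)) * c = \int[P]_w (wt j (past_path w) * c).
    by rewrite mulrC -ExZ//; apply: eq_Rintegral => w _; rewrite mulrC.
  rewrite -ExD; [|by apply: bmfM => //; exact: bmf_cst|
    by apply: bmfM => //; apply: bmfB => //; exact: bmf_cst].
  by apply: eq_Rintegral => w _; rewrite -mulrDr addrC subrK.
under eq_bigr do rewrite key; rewrite big_split/= lerD2l.
pose r (i i' : nat) := \sum_j `|\int[P]_w (wt j (past_path w) * centred_prod j i.+1 i'.+1 w)|.
have rC i i' : r i i' = r i' i.
  by apply: eq_bigr => j _; rewrite centred_prodC.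
have rle i i' : (i <= i')%N -> r i i' <= pair_bound eta n i (i' - i).
  move=> ii; rewrite rC; apply: le_trans (weight_bound l i (i' - i) e0).
  by rewrite /r addSn subnKC.
have pb0 u q : 0 <= pair_bound eta n u q by exact: pair_bound_ge0.
apply: (@le_trans _ _ (\sum_(i < n) \sum_(i' < n) r i i')).
  rewrite exchange_big/=; apply: ler_sum => i _.
  rewrite exchange_big/=; apply: ler_sum => i' _.
  by apply: ler_sum => j _; exact: ler_norm.
pose e (i i' : nat) := if (i <= i')%N then pair_bound eta n i (i' - i) else 0.
apply: (@le_trans _ _ (\sum_(i < n) \sum_(i' < n) (e i i' + e i' i))).
  apply: ler_sum => i _; apply: ler_sum => i' _; rewrite /e.
  have [ii|ii] := leqP i i'.
    by apply: le_trans (rle _ _ ii) _; rewrite lerDl; case: ifP.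
  by rewrite rC add0r (ltnW ii) rle// ltnW.
have e1 : \sum_(i < n) \sum_(i' < n) e i i' <= \sum_(u < n) \sum_(q < n) pair_bound eta n u q.
  by apply: ler_sum => i _; apply: sum_lag_le => q; exact: pb0.
have -> : \sum_(i < n) \sum_(i' < n) (e i i' + e i' i) =
    \sum_(i < n) \sum_(i' < n) e i i' + \sum_(i < n) \sum_(i' < n) e i' i.
  by rewrite -big_split; apply: eq_bigr => i _; rewrite big_split.
have e2 : \sum_(i < n) \sum_(i' < n) e i' i <= \sum_(u < n) \sum_(q < n) pair_bound eta n u q.
  by rewrite exchange_big.
by rewrite mulrDl mul1r lerD.
Qed.

Variables C1 C2 : R.
Hypothesis HW1 : low_weights_bound p x C1.
Hypothesis HW2 : high_weights_bound p x C2.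
Hypothesis C10 : 0 <= C1.
Hypothesis C20 : 0 <= C2.

Lemma low_cst_ge0 : 0 <= low_cst.
Proof. by rewrite /low_cst addr_ge0 ?mulr_ge0// sqr_ge0. Qed.

Lemma sum_pair_bound eta l : 0 < eta ->
  \sum_(u < l.+1) \sum_(q < l.+1) pair_bound eta l.+1 u q <=
  (low_cst * C1 + V * C2) * (eta * Apast + eta `^ (- ((p - 2) / 2)) *
     (l.+1%:R * (1 + \sum_(q < l.+2) q.+1%:R `^ (p - 2) * beta q))).
Proof.
move=> e0; set n := l.+1; set E := eta `^ _; set W := \sum_(q < l.+2) _.
have A0 := Apast_ge0.
have E0 : 0 <= E by exact: powR_ge0.
have -> : \sum_(u < n) \sum_(q < n) pair_bound eta n u q =
  low_cst * (\sum_(u < n) \sum_(q < n) cutoff x u q *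
     (nu1 p x eta n q * Apast + nu1 p x eta n q `^ (- ((p - 2) / 2)) * beta_or1 q)) +
  V * (\sum_(u < n) \sum_(q < n | (q < u)%N) cutoff x u q `^ (- (2 / (p - 2))) *
     (nu2 p eta n u * Apast + nu2 p eta n u `^ (- ((p - 2) / 2)) * beta u.+1)).
  rewrite !mulr_sumr -big_split; apply: eq_bigr => u _.
  rewrite big_split /= !mulr_sumr; congr (_ + _).
  by rewrite [RHS]big_mkcond.
have B1 := HW1 n e0 A0 beta_or1_ge0.
have B2 := HW2 n e0 A0 (fun u => beta_ge0 u.+1).
have W0 : 0 <= W by apply: sumr_ge0 => q _; rewrite mulr_ge0 ?powR_ge0// beta_ge0.
have le1 : \sum_(q < n) q.+1%:R `^ (p - 2) * beta_or1 q <= 1 + W.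
  rewrite /n big_ord_recl /= {1}/beta_or1 eqxx mulr1 one_powR lerD2l.
  rewrite /W big_ord_recl /= ler_wpDl ?mulr_ge0 ?powR_ge0 ?beta_ge0//.
  rewrite big_ord_recr/= ler_wpDr ?mulr_ge0 ?powR_ge0 ?beta_ge0//.
have le2 : \sum_(u < n) u.+1%:R `^ (p - 2) * beta u.+1 <= 1 + W.
  have -> : W = 1%:R `^ (p - 2) * beta 0 + \sum_(u < n) u.+2%:R `^ (p - 2) * beta u.+1.
    by rewrite /W big_ord_recl.
  rewrite addrA ler_wpDl ?addr_ge0 ?mulr_ge0 ?powR_ge0 ?beta_ge0//.
  apply: ler_sum => u _; rewrite ler_wpM2r ?beta_ge0// le_powR_base ?(ltW p20)//.
  by rewrite ler_nat.
rewrite [leRHS]mulrDl lerD//.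
  rewrite -mulrA ler_wpM2l ?low_cst_ge0//; apply: le_trans B1 _.
  by rewrite ler_wpM2l// lerD2l ler_wpM2l// ler_wpM2l.
rewrite -mulrA ler_wpM2l//; apply: le_trans B2 _.
by rewrite ler_wpM2l// lerD2l ler_wpM2l// ler_wpM2l.
Qed.

Lemma cross_final eta l : 0 < eta ->
  \sum_j \int[P]_w (wt j (past_path w) * fwd l.+1 j w ^+ 2) <=
  eta * (1 + 2 * (low_cst * C1 + V * C2)) * Apast + eta `^ (- ((p - 2) / 2)) *
   (\sum_j (\int[P]_w (fwd l.+1 j w ^+ 2)) `^ (p / 2) +
    2 * (low_cst * C1 + V * C2) *
     (l.+1%:R * (1 + \sum_(q < l.+2) q.+1%:R `^ (p - 2) * beta q))).
Proof.
move=> e0; set E := eta `^ _.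
apply: le_trans (cross_split l e0) _.
have bw j : bmf (fun w : T => wt j (past_path w)) by exact: (bmf_pweight p2 bmf_cen mppT).
have bs j : bmf (fun w : T => sm j (past_path w)) by exact: (bmf_psum bmf_cen mppT).
have bsp j : bmf (fun w : T => `|sm j (past_path w)| `^ p).
  by apply: bmf_powR; rewrite ?(ltW p0)//; exact: bmf_norm.
have first : \sum_j (\int[P]_w wt j (past_path w)) * \int[P]_w (fwd l.+1 j w ^+ 2) <=
   eta * Apast + E * \sum_j (\int[P]_w (fwd l.+1 j w ^+ 2)) `^ (p / 2).
  rewrite /Apast /ptotal Ex_sum// !mulr_sumr -big_split; apply: ler_sum => j _.
  rewrite /=; set v := \int[P]_w (fwd l.+1 j w ^+ 2).
  have v0 : 0 <= v by apply: Ex_ge0 => w; exact: sqr_ge0.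
  have -> : (\int[P]_w wt j (past_path w)) * v = \int[P]_w (wt j (past_path w) * v).
    by rewrite mulrC -ExZ//; apply: eq_Rintegral => w _; rewrite mulrC.
  rewrite -(ExZ P eta (bsp j)) -[X in _ + X](Ex_cst P) -ExD; [|by bmf_tac|by bmf_tac].
  apply: Ex_le; [by bmf_tac|by bmf_tac|] => w.
  exact: powR_youngM.
apply: le_trans (lerD first (ler_wpM2l _ (sum_pair_bound l e0))) _ => //.
rewrite le_eqVlt; apply/orP; left; apply/eqP; rewrite -/E; ring.
Qed.

End fixed_k.

(** The quantity of the recursion. Summing over j before any estimate is what keeps
    the constants independent of the number of functions. *)
Definition Afwd (n : nat) : R := \sum_j \int[P]_w (`|fwd n j w| `^ p).

Lemma bmf_fwdp n j : bmf (fun w => `|fwd n j w| `^ p).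
Proof. by apply: bmf_powR; rewrite ?(ltW p0)//; apply: bmf_norm; exact: bmf_fwd. Qed.

Lemma Afwd_ge0 n : 0 <= Afwd n.
Proof. by apply: sumr_ge0 => j _; apply: Ex_ge0 => w; exact: powR_ge0. Qed.

Lemma Ex_fwd_shift j n (t : int) :
  \int[P]_w (`|\sum_(i < n) cX j (i.+1%:Z + t) w| `^ p) =
  \int[P]_w (`|fwd n j w| `^ p).
Proof.
pose F (y : nat -> R) := `|\sum_(i < n) cen j (y i)| `^ p.
apply: (@stationary_path _ _ _ P Y hY n (fun i => i.+1%:Z) t F).
  apply: bmf_powR; rewrite ?(ltW p0)//; apply: bmf_norm; apply: bmf_sum => i.
  by apply: bmf_comp (bmf_cen j) _; exact: measurable_nth.
move=> y y' yy; rewrite /F; congr (`|_| `^ _).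
by apply: eq_bigr => i _; rewrite yy.
Qed.

Lemma psum_past k j w : psum cen k j (past_path w) = \sum_(i < k) cX j (i.+1%:Z - k%:Z) w.
Proof.
rewrite /psum (reindex_inj rev_ord_inj)/=; apply: eq_bigr => i _.
rewrite /cX /past_path; congr (cen j (Y _ w)).
by rewrite -subzn// opprB.
Qed.

Lemma Apast_fwd k : Apast k = Afwd k.
Proof.
rewrite /Apast /ptotal Ex_sum; last first.
  move=> j; apply: bmf_powR; rewrite ?(ltW p0)//; apply: bmf_norm.
  by apply: (bmf_psum bmf_cen) => i; exact: measurable_funPT.
apply: eq_bigr => j _; rewrite -(Ex_fwd_shift j k (- k%:Z)).
by apply: eq_Rintegral => w _; rewrite psum_past.
Qed.

Lemma Afwd_add k l :
  Afwd (k + l) = \sum_j \int[P]_w (`|psum cen k j (past_path w) + fwd l j w| `^ p).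
Proof.
apply: eq_bigr => j _; rewrite -(Ex_fwd_shift j (k + l) (- k%:Z)).
apply: eq_Rintegral => w _; rewrite psum_past big_split_ord/=.
congr (`|_ + _| `^ _); apply: eq_bigr => i _; congr (cX j _ w).
by rewrite -addnS PoszD addrAC subrr add0r.
Qed.

Lemma Afwd_succ (e C : R) n : 0 <= C ->
  (forall a b : R, `|a + b| `^ p <= (1 + e) * `|a| `^ p + C * `|b| `^ p) ->
  Afwd n.+1 <= (1 + e) * Afwd n + C * (2 * M) `^ p.
Proof.
move=> C0 H.
have bXp j i : bmf (fun w => `|cX j i w| `^ p).
  by apply: bmf_powR; rewrite ?(ltW p0)//; apply: bmf_norm; exact: bmf_cX.
have bfp := bmf_fwdp n.
apply: (@le_trans _ _ (\sum_j \int[P]_w ((1 + e) * `|fwd n j w| `^ p + C * `|cX j n.+1 w| `^ p))).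
  apply: ler_sum => j _; apply: Ex_le; [exact: bmf_fwdp|by bmf_tac|] => w.
  by rewrite {1}/fwd big_ord_recr; exact: H.
have -> : \sum_j \int[P]_w ((1 + e) * `|fwd n j w| `^ p + C * `|cX j n.+1 w| `^ p) =
   (1 + e) * Afwd n + C * \int[P]_w (\sum_j `|cX j n.+1 w| `^ p).
  rewrite Ex_sum// !mulr_sumr -big_split; apply: eq_bigr => j _.
  by rewrite ExD ?ExZ//; bmf_tac.
rewrite lerD2l ler_wpM2l// -[leRHS](Ex_cst P); apply: Ex_le; [exact: bmf_sum|exact: bmf_cst|].
move=> w; have M20 : 0 <= 2 * M by rewrite mulr_ge0.
apply: (@le_trans _ _ (\sum_j `|cX j n.+1 w| * (2 * M) `^ (p - 1))).
  apply: ler_sum => j _; rewrite -mulr_powRB1// ler_wpM2l// le_powR_base ?cen_le//.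
  by rewrite subr_ge0; apply: ltW; apply: lt_trans p2; rewrite ltr1n.
by rewrite -mulr_suml -(mulr_powRB1 M20 p0) ler_wpM2r ?powR_ge0// sum_cen.
Qed.

(** A sum of length 2l is a past sum plus a future sum of length l; the term with
    |past|^(p-2) future^2 is the cross term bounded by cross_final, and by
    stationarity the past sum has the same moments as the future one. *)
Lemma Afwd_double (e C eta x C1 C2 : R) l : 0 <= C -> 0 < eta -> 0 <= C1 -> 0 <= C2 ->
  (p - 2) / p < x ->
  (forall a b : R, `|a + b| `^ p <= (1 + e) * (`|a| `^ p + `|b| `^ p) +
     C * (`|a| `^ (p - 2) * b ^+ 2)) ->
  low_weights_bound p x C1 ->
  high_weights_bound p x C2 ->
  Afwd (l.+1 + l.+1) <= (2 * (1 + e) + C * (eta * (1 + 2 * (low_cst * C1 + V * C2)))) * Afwd l.+1 +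
   C * (eta `^ (- ((p - 2) / 2)) * (\sum_j (\int[P]_w (fwd l.+1 j w ^+ 2)) `^ (p / 2) +
    2 * (low_cst * C1 + V * C2) *
     (l.+1%:R * (1 + \sum_(q < l.+2) q.+1%:R `^ (p - 2) * beta q)))).
Proof.
move=> C0 e0 C10 C20 xlo H HW1 HW2.
have cf := cross_final l.+1 xlo HW1 HW2 C10 C20 l e0.
rewrite Apast_fwd in cf.
have bs j : bmf (fun w : T => psum cen l.+1 j (past_path w)).
  by apply: (bmf_psum bmf_cen) => i; exact: measurable_funPT.
have bsp j : bmf (fun w : T => `|psum cen l.+1 j (past_path w)| `^ p).
  by apply: bmf_powR; rewrite ?(ltW p0)//; exact: bmf_norm.
have bw j : bmf (fun w : T => pweight p cen l.+1 j (past_path w)).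
  by apply: (bmf_pweight p2 bmf_cen) => i; exact: measurable_funPT.
have bf2 j := bmfX 2 (bmf_fwd l.+1 j).
have bfp := bmf_fwdp l.+1.
rewrite Afwd_add.
apply: (@le_trans _ _ (\sum_j \int[P]_w ((1 + e) * (`|psum cen l.+1 j (past_path w)| `^ p +
    `|fwd l.+1 j w| `^ p) + C * (pweight p cen l.+1 j (past_path w) * fwd l.+1 j w ^+ 2)))).
  apply: ler_sum => j _; apply: Ex_le; [|by bmf_tac|by move=> w; exact: H].
  apply: bmf_powR; rewrite ?(ltW p0)//; apply: bmf_norm; apply: bmfD => //.
  exact: bmf_fwd.
have -> : \sum_j \int[P]_w ((1 + e) * (`|psum cen l.+1 j (past_path w)| `^ p +
    `|fwd l.+1 j w| `^ p) + C * (pweight p cen l.+1 j (past_path w) * fwd l.+1 j w ^+ 2)) =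
   (1 + e) * (Apast l.+1 + Afwd l.+1) +
   C * \sum_j \int[P]_w (pweight p cen l.+1 j (past_path w) * fwd l.+1 j w ^+ 2).
  rewrite /Apast /ptotal Ex_sum// -big_split/= !mulr_sumr -big_split; apply: eq_bigr => j _.
  rewrite ExD ?ExZ ?ExD//; bmf_tac.
rewrite Apast_fwd; apply: le_trans (lerD (lexx _) (ler_wpM2l C0 cf)) _.
by rewrite le_eqVlt; apply/orP; left; apply/eqP; ring.
Qed.

End core.

(** * The moment inequality for a controlled family *)

Section recursion.
Context {R : realType}.

(** Doubling multiplies a by a factor close to 2, while n^al and n^b with exponents
    above 1 grow by a factor t > 2; the error terms are therefore absorbed, with
    one more step for odd lengths. *)
Lemma doubling_recursion (al b : R) : 1 < al -> 1 < b -> exists2 e : R, 0 < e &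
  forall C : R, 0 <= C -> exists2 K : R, 0 <= K &
  forall (a : nat -> R) (L : R), 0 <= L -> a 0%N <= 0 ->
  (forall l, a (l.+1 + l.+1)%N <= (2 + e) * a l.+1 +
     C * (L * l.+1%:R `^ al + l.+1%:R `^ b)) ->
  (forall n, a n.+1 <= (1 + e) * a n + C) ->
  forall n, a n.+1 <= K * (L * n.+1%:R `^ al + n.+1%:R `^ b).
Proof.
move=> al1 b1.
pose ka := Num.min al b.
have ka1 : 1 < ka by rewrite lt_min al1 b1.
have ka_al : ka <= al by rewrite ge_min lexx.
have ka_b : ka <= b by rewrite ge_min lexx orbT.
pose t : R := 2 `^ ka.
have t2 : 2 < t.
  have -> : t = 2 * 2 `^ (ka - 1) by rewrite mulr_powRB1//; exact: lt_trans ka1.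
  have h : 1 `^ (ka - 1) < 2 `^ (ka - 1) :> R.
    by apply: gt0_ltr_powR; rewrite ?nnegrE ?subr_gt0// ltr1n.
  by rewrite one_powR in h; rewrite ltr_pMr.
(* e is so small that (1 + e) (2 + e) < t *)
pose e := Num.min 1 ((t - 2) / 8).
have e0 : 0 < e by rewrite lt_min ltr01 divr_gt0// subr_gt0.
have e1 : e <= 1 by rewrite ge_min lexx.
have e2 : e <= (t - 2) / 8 by rewrite ge_min lexx orbT.
exists e => // C C0.
have e3 : 0 <= 2 + e by rewrite addr_ge0// ltW.
have e4 : 0 <= 1 + e by rewrite addr_ge0// ltW.
pose th := (1 + e) * (2 + e) / t.
have t0 : 0 < t by exact: lt_trans t2.
have th1 : th < 1.
  rewrite ltr_pdivrMr// mul1r; nra.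
have th0 : 0 <= th by rewrite divr_ge0// ?mulr_ge0// ltW//; lra.
pose K := (2 + e) * C / (1 - th).
have K0 : 0 <= K by rewrite divr_ge0 ?mulr_ge0//; lra.
have KE : th * K + (2 + e) * C = K.
  by rewrite /K; field; rewrite gt_eqF// subr_gt0.
clearbody K.
exists K => // a L L0 a0 adbl asucc.
pose Psi (n : nat) : R := L * n%:R `^ al + n%:R `^ b.
have Psi0 n : 0 <= Psi n by rewrite addr_ge0 ?mulr_ge0 ?powR_ge0.
have Psi1 n : 1 <= Psi n.+1.
  rewrite ler_wpDl ?mulr_ge0 ?powR_ge0// -[leLHS](one_powR b) le_powR_base ?ler1n//.
  by apply: ltW; apply: lt_trans b1.
have Psim n n' : (n <= n')%N -> Psi n <= Psi n'.
  move=> nn; rewrite lerD ?ler_wpM2l ?le_powR_base ?ler_nat//; apply: ltW.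
    by apply: lt_trans al1.
  by apply: lt_trans b1.
have Psi2 l : t * Psi l.+1 <= Psi (l.+1 + l.+1)%N.
  have tal g : ka <= g -> t * l.+1%:R `^ g <= (l.+1 + l.+1)%:R `^ g.
    move=> kg; have -> : (l.+1 + l.+1)%:R = 2 * l.+1%:R :> R by rewrite addnn -mul2n natrM.
    by rewrite powRM// ler_wpM2r ?powR_ge0// ler_powR// ler1n.
  rewrite /Psi mulrDr mulrCA lerD ?tal// ler_wpM2l ?tal//.
suff H n : a n.+1 <= K * Psi n.+1 by move=> n; exact: H.
elim/ltn_ind: n => n IH.
case: n IH => [|n] IH.
  have h1 := asucc 0%N.
  have h2 : a 1%N <= C by apply: le_trans h1 _; nra.
  apply: le_trans h2 _; have h3 := Psi1 0%N.
  have CK : C <= K.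
    rewrite -KE; have := mulr_ge0 th0 K0; nra.
  nra.
have even l : (l < n.+1)%N -> a (l.+1 + l.+1)%N <=
    ((2 + e) * K + C) / t * Psi (l.+1 + l.+1)%N.
  move=> ln; have h := IH l ln; have h2 := adbl l.
  have h3 := Psi2 l; have h4 := Psi0 l.+1.
  apply: (@le_trans _ _ (((2 + e) * K + C) * Psi l.+1)).
    apply: le_trans h2 _; rewrite [leRHS]mulrDl -/(Psi l.+1) lerD2r -[leRHS]mulrA ler_wpM2l//.
  rewrite -[leRHS]mulrA ler_wpM2l ?addr_ge0 ?mulr_ge0//.
  by rewrite ler_pdivlMl.
have q1 : ((2 + e) * K + C) / t <= K.
  have i1 : 1 < t by lra.
  have : ((2 + e) * K + C) / t <= th * K + C.
    rewrite mulrDl lerD//; last by rewrite ler_pdivrMr// ler_peMr// ltW.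
    have -> : th * K = (1 + e) * ((2 + e) * K / t) by rewrite /th; ring.
    by rewrite ler_peMl ?divr_ge0 ?mulr_ge0 ?(ltW t0)// lerDl ltW.
  move=> h; apply: le_trans h _; rewrite -[leRHS]KE lerD2l; nra.
have [on|on] := boolP (odd n).
  have [l nl] : exists l, n = l.*2.+1.
    by exists n./2; rewrite -[LHS]odd_double_half on.
  have -> : n.+2 = (l.+1 + l.+1).+1 by rewrite nl -addnn addSn addnS.
  have ln : (l < n.+1)%N by rewrite nl -addnn ltnS leqW// leq_addr.
  have h := asucc (l.+1 + l.+1)%N; have h2 := even l ln.
  have h3 := Psim _ _ (leqnSn (l.+1 + l.+1)%N).
  have h4 := Psi1 (l.+1 + l.+1)%N.
  apply: le_trans h _.
  have c0 : 0 <= ((2 + e) * K + C) / t by rewrite divr_ge0 ?addr_ge0 ?mulr_ge0// ?(ltW t0)//.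
  have h5 : a (l.+1 + l.+1)%N <= ((2 + e) * K + C) / t * Psi (l.+1 + l.+1).+1.
    by apply: le_trans h2 _; rewrite ler_wpM2l.
  have h6 : (1 + e) * (((2 + e) * K + C) / t) + C <= K.
    have -> : (1 + e) * (((2 + e) * K + C) / t) = th * K + (1 + e) * C / t.
      by rewrite /th; field; rewrite gt_eqF.
    have : (1 + e) * C / t <= (1 + e) * C.
      rewrite ler_pdivrMr// ler_peMr ?mulr_ge0//; lra.
    move=> ?; rewrite -[leRHS]KE; lra.
  apply: (@le_trans _ _ (((1 + e) * (((2 + e) * K + C) / t) + C) * Psi (l.+1 + l.+1).+1)).
    rewrite [leRHS]mulrDl lerD//; last by rewrite ler_peMr.
    rewrite -[leRHS]mulrA ler_wpM2l//; lra.
  by rewrite ler_wpM2r.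
have [l nl] : exists l, n = l.*2.
  by exists n./2; have := odd_double_half n; rewrite (negbTE on) add0n.
have -> : n.+2 = (l.+1 + l.+1)%N by rewrite nl -addnn addSn addnS.
have ln : (l < n.+1)%N by rewrite nl -addnn ltnS leq_addr.
by apply: le_trans (even l ln) _; rewrite ler_wpM2r.
Qed.

End recursion.

Section moment_bound.
Context {d : measure_display} {T : measurableType d} {R : realType}.
Context {P : probability T R} (Y : int -> {RV P >-> R}).
Local Notation F0 := (g_sigma_algebraType (past Y 0)).

(** D q and D2 a b are variables of the past that measure how far the conditional
    laws of Y_q and of (Y_a, Y_b) are from the unconditional ones. *)
Record dependence_bounds (D : nat -> F0 -> R) (D2 : nat -> nat -> F0 -> R)
    (beta : nat -> R) : Prop := {
  dep_meas1 : forall q, bmf (D q);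
  dep_itv1 : forall q w, 0 <= D q w <= 1;
  dep_meas2 : forall a b, bmf (D2 a b);
  dep_itv2 : forall a b w, 0 <= D2 a b w <= 1;
  dep_mean1 : forall q, \int[P]_w D q w <= beta q;
  dep_mean2 : forall a b, (b < a)%N -> \int[P]_w D2 a b w <= beta b }.

(** Families whose conditional expectations given the past deviate by at most a
    constant times D and D2. The sum over j of |h_j| is bounded, which is the case
    when few functions are nonzero at any point. *)
Record controlled_family (D : nat -> F0 -> R) (D2 : nat -> nat -> F0 -> R)
    (M V : R) (J : finType) (h : J -> R -> R) : Prop := {
  ctl_meas : forall j, bmf (h j);
  ctl_sum : forall y, \sum_j `|h j y| <= M;
  ctl_one : forall j q (z : F0 -> R), bmf z -> (forall w, 0 <= z w) ->
    `|\int[P]_w (z w * cX Y h j q%:Z w)| <= V * \int[P]_w (z w * D q w);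
  ctl_two : forall j a b (z : F0 -> R), (b < a)%N ->
    bmf z -> (forall w, 0 <= z w) ->
    `|\int[P]_w (z w * (cX Y h j a%:Z w * cX Y h j b%:Z w -
         \int[P]_w' (cX Y h j a%:Z w' * cX Y h j b%:Z w')))| <=
    V * \int[P]_w (z w * D2 a b w);
  ctl_square : forall j a (z : F0 -> R), bmf z -> (forall w, 0 <= z w) ->
    `|\int[P]_w (z w * (cX Y h j a%:Z w * cX Y h j a%:Z w -
         \int[P]_w' (cX Y h j a%:Z w' * cX Y h j a%:Z w')))| <=
    V * \int[P]_w (z w * D a w) }.

Hypothesis hY : strictly_stationary Y.
Variables (D : nat -> F0 -> R) (D2 : nat -> nat -> F0 -> R) (beta : nat -> R).
Hypothesis dep : dependence_bounds D D2 beta.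

(** The doubling recursion for the sums of p-th powers: al is the growth of the
    variances and ga + 1 that of the dependence sums. The constant is chosen before
    the family, since the number of functions will grow with the length. *)
Theorem moment_bound (p al b ga N M V : R) : 2 < p -> 0 <= V -> 0 <= M ->
  1 < al -> 1 < b -> 0 <= ga -> ga + 1 <= b -> 0 <= N ->
  (forall n : nat, \sum_(q < n.+2) q.+1%:R `^ (p - 2) * beta q <= N * n.+1%:R `^ ga) ->
  exists2 K : R, 0 <= K & forall (J : finType) (h : J -> R -> R) (L : R),
    controlled_family D D2 M V h -> 0 <= L ->
    (forall l : nat, \sum_j (\int[P]_w (fwd Y h l.+1 j w ^+ 2)) `^ (p / 2) <=
       L * l.+1%:R `^ al) ->
    forall n, Afwd Y h p n.+1 <= K * (L * n.+1%:R `^ al + n.+1%:R `^ b).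
Proof.
move=> p2 V0 M0 al1 b1 ga0 gab N0 hN.
have p20 : 0 < p - 2 by rewrite subr_gt0.
have p0 : 0 < p by exact: lt_trans p2.
have [e e0 recH] := doubling_recursion al1 b1.
have e40 : 0 < e / 4 by rewrite divr_gt0.
have [C C0 HC] := normr_powRD_le p2 e40.
have [C' C'0 HC'] := normr_powRD_le2 p2 e0.
have [x [xlo x1 xhi]] := weights_exponent p2.
have [C1 C10 HW1] := low_weights_sum p2 xlo x1.
have [C2 C20 HW2] := high_weights_sum p2 xlo xhi.
pose Q := low_cst M V * C1 + V * C2.
have Q0 : 0 <= Q.
  by rewrite addr_ge0// mulr_ge0 ?(ltW C10) ?(ltW C20)// /low_cst addr_ge0 ?mulr_ge0// sqr_ge0.
pose eta := e / 2 / (C * (1 + 2 * Q) + 1).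
have den0 : 0 < C * (1 + 2 * Q) + 1.
  by rewrite ltr_wpDl// mulr_ge0// addr_ge0// mulr_ge0.
have eta0 : 0 < eta by rewrite divr_gt0// divr_gt0.
pose E := eta `^ (- ((p - 2) / 2)).
have E0 : 0 <= E by exact: powR_ge0.
pose CC := C * E * (1 + 2 * Q * (1 + N)) + C' * (2 * M) `^ p.
have CC0 : 0 <= CC.
  rewrite addr_ge0// mulr_ge0 ?powR_ge0//; first by rewrite mulr_ge0.
  by rewrite addr_ge0// !mulr_ge0// addr_ge0.
have [K K0 HK] := recH CC CC0.
exists K => // J h L [bh hM H1 H2 H3] L0 hL.
case: dep => bD D01 bD2 D201 mD mD2.
apply: HK => //.
- rewrite /Afwd big1// => j _.
  rewrite (eq_Rintegral _ (f := fun w => `|fwd Y h 0 j w| `^ p) (g := fun _ => 0)).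
    by rewrite Ex_cst.
  by move=> w _; rewrite /fwd big_ord0 normr0 powR0// gt_eqF.
- move=> l; have := @Afwd_double _ _ _ _ Y hY J h M V p D D2 beta p2 bh hM V0 bD
    D01 bD2 D201 mD mD2 H1 H2 H3 (e / 4) C eta x C1 C2 l C0 eta0 (ltW C10) (ltW C20)
    xlo HC HW1 HW2.
  move=> h1; apply: le_trans h1 _; rewrite -/E -/Q.
  have A0 := Afwd_ge0 Y h p l.+1.
  apply: lerD.
    rewrite ler_wpM2r//.
    have : C * (eta * (1 + 2 * Q)) <= e / 2.
      rewrite /eta; set W := C * (1 + 2 * Q) + 1 in den0 *.
      have -> : C * (e / 2 / W * (1 + 2 * Q)) = e / 2 * ((C * (1 + 2 * Q)) / W) by ring.
      rewrite ler_piMr ?divr_ge0 ?(ltW e0)// ler_pdivrMr// mul1r /W lerDl//.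
    move=> h2; apply: le_trans (lerD (lexx _) h2) _.
    by rewrite le_eqVlt; apply/orP; left; apply/eqP; field.
  have lp : 1 <= l.+1%:R :> R by rewrite ler1n.
  have lb : l.+1%:R * (1 + \sum_(q < l.+2) q.+1%:R `^ (p - 2) * beta q) <=
     (1 + N) * l.+1%:R `^ b.
    have s1 : 1 + \sum_(q < l.+2) q.+1%:R `^ (p - 2) * beta q <=
       (1 + N) * l.+1%:R `^ ga.
      rewrite mulrDl mul1r lerD// -[leLHS](one_powR ga) le_powR_base//.
    apply: (@le_trans _ _ (l.+1%:R * ((1 + N) * l.+1%:R `^ ga))).
      by rewrite ler_wpM2l.
    rewrite mulrCA ler_wpM2l ?addr_ge0//.
    rewrite -[X in X * _](powRr1 (ler0n _ _)) -powRD ?pnatr_eq0 ?implybT//.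
    by rewrite ler_powR// addrC.
  have lb0 : 0 <= l.+1%:R `^ b :> R by exact: powR_ge0.
  have la0 : 0 <= L * l.+1%:R `^ al by rewrite mulr_ge0 ?powR_ge0.
  apply: (@le_trans _ _ (C * (E * (L * l.+1%:R `^ al + 2 * Q * ((1 + N) * l.+1%:R `^ b))))).
    by rewrite ler_wpM2l// ler_wpM2l// lerD// ler_wpM2l// mulr_ge0.
  apply: (@le_trans _ _ (C * E * (1 + 2 * Q * (1 + N)) * (L * l.+1%:R `^ al + l.+1%:R `^ b))).
    rewrite -!mulrA ler_wpM2l// ler_wpM2l//.
    have qn : 0 <= 2 * Q * (1 + N) by rewrite !mulr_ge0// addr_ge0.
    have -> : 2 * (Q * ((1 + N) * l.+1%:R `^ b)) = 2 * Q * (1 + N) * l.+1%:R `^ b.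
      by rewrite !mulrA.
    rewrite [2 * (Q * _)]mulrA [leRHS]mulrDr lerD//; first by rewrite ler_peMl// lerDl.
    by rewrite ler_wpM2r// lerDr.
  by rewrite ler_wpM2r ?addr_ge0// lerDl mulr_ge0 ?powR_ge0.
- move=> n; have := @Afwd_succ _ _ _ _ Y J h M p p2 bh hM e C' n C'0 HC'.
  move=> h1; apply: le_trans h1 _; rewrite lerD2l /CC lerDr.
  have N10 : 0 <= 1 + N by exact: addr_ge0.
  by apply: mulr_ge0; [exact: mulr_ge0|apply: addr_ge0 => //; apply: mulr_ge0 => //; exact: mulr_ge0].
Qed.

End moment_bound.

(** * Measurable dependence coefficients *)

Section integral_tools.
Context {d : measure_display} {T : measurableType d} {R : realType}.

(** Integrals of nonnegative functions are monotone without measurability, being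
    suprema over simple functions below. It lets the conditional suprema, which are
    taken over uncountably many half-lines, be compared with countable ones. *)
Lemma ge0_le_integral_nonmeas (mu : {measure set T -> \bar R}) (f g : T -> \bar R) :
  (forall w, (0 <= f w)%E) -> (forall w, (f w <= g w)%E) ->
  (\int[mu]_w f w <= \int[mu]_w g w)%E.
Proof.
move=> f0 fg; have g0 w : (0 <= g w)%E by exact: le_trans (f0 w) (fg w).
rewrite !ge0_integralTE//; apply: le_ereal_sup => _ [h /= hf <-].
by exists h => // w; exact: le_trans (hf w) (fg w).
Qed.

Definition rsup (g : nat -> T -> R) (w : T) : R :=
  fine (esups (fun n => (g n w)%:E) 0).

Section rsup_theory.
Variable g : nat -> T -> R.
Hypothesis bg : forall n, bmf (g n).
Hypothesis g01 : forall n w, 0 <= g n w <= 1.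

Lemma rsupE w : esups (fun n => (g n w)%:E) 0 = ereal_sup (range (fun n => (g n w)%:E)).
Proof.
by rewrite /esups/= /sdrop; congr (ereal_sup (_ @` _)); apply/seteqP; split.
Qed.

Lemma rsup_fin w : (rsup g w)%:E = ereal_sup (range (fun n => (g n w)%:E)).
Proof.
rewrite /rsup rsupE fineK// fin_real//; apply/andP; split.
  apply: (@lt_le_trans _ _ (g 0%N w)%:E); first exact: ltNyr.
  by apply: ereal_sup_ubound; exists 0%N.
apply: (@le_lt_trans _ _ 1%:E); last exact: ltry.
by apply: ge_ereal_sup => _ [n _ <-]; rewrite lee_fin; case/andP: (g01 n w).
Qed.

Lemma rsup_ge n w : g n w <= rsup g w.
Proof. by rewrite -lee_fin rsup_fin; apply: ereal_sup_ubound; exists n. Qed.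

Lemma rsup_le w (b : \bar R) : (forall n, ((g n w)%:E <= b)%E) -> ((rsup g w)%:E <= b)%E.
Proof. by move=> gb; rewrite rsup_fin; apply: ge_ereal_sup => _ [n _ <-]. Qed.

Lemma rsup_itv w : 0 <= rsup g w <= 1.
Proof.
rewrite (le_trans _ (rsup_ge 0 w))/=; last by case/andP: (g01 0 w).
by rewrite -lee_fin; apply: rsup_le => n; rewrite lee_fin; case/andP: (g01 n w).
Qed.

Lemma bmf_rsup : bmf (rsup g).
Proof.
split; last first.
  by exists 1 => w; case/andP: (rsup_itv w) => h0 h1; rewrite ger0_norm.
apply: (measurableT_comp (f := fine)) => //.
apply: (@measurable_fun_esups _ _ _ setT (fun n w => (g n w)%:E)) => n.
by apply/measurable_EFinP; have [] := bg n.
Qed.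

End rsup_theory.
End integral_tools.

Section kernel_probability.
Context {R : realType}.
Context {d1 : measure_display} {X1 : measurableType d1}.
Context {d2 : measure_display} {X2 : measurableType d2}.
Variables (k : R.-pker X1 ~> X2) (w : X1).
(** A value of the kernel, as a probability to which expectation lemmas apply. *)
Definition kernel_prob : set X2 -> \bar R := k w.

Let kernel_prob0 : kernel_prob set0 = 0%E. Proof. exact: measure0. Qed.

Let kernel_prob_ge0 A : (0 <= kernel_prob A)%E. Proof. exact: measure_ge0. Qed.

Let kernel_prob_sigma_additive : semi_sigma_additive kernel_prob.
Proof. exact: measure_semi_sigma_additive. Qed.

HB.instance Definition _ := isMeasure.Build _ _ _ kernel_prob
  kernel_prob0 kernel_prob_ge0 kernel_prob_sigma_additive.

Let kernel_probT : kernel_prob [set: X2] = 1%E.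
Proof. exact: prob_kernel. Qed.

HB.instance Definition _ := Measure_isProbability.Build _ _ _ kernel_prob kernel_probT.
End kernel_probability.

Section dependence_coefficients.
Context {d : measure_display} {T : measurableType d} {R : realType}.
Context {P : probability T R} (Y : int -> {RV P >-> R}).
Hypothesis hY : strictly_stationary Y.
Local Notation F0 := (g_sigma_algebraType (past Y 0)).
Variables (k1 : nat -> R.-pker F0 ~> R)
  (k2 : nat -> nat -> R.-pker F0 ~> (R * R)%type).
Hypothesis hk1 : forall k : nat, is_cond_dist P (Y k%:Z) (k1 k).
Hypothesis hk2 : forall i j : nat,
   is_cond_dist P (pairRV (Y i%:Z) (Y j%:Z)) (k2 i j).

Let pastT := @past_measurable _ _ _ P Y 0.
Let toT (g : F0 -> R) : bmf g -> bmf (g : T -> R) := @sub_bmf _ T R _ pastT g.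

Definition below (t : R) : set R := [set` `]-oo, t]].
Definition cdf0 (t : R) : R := \int[distribution P (Y 0)]_y half_line t y.

Lemma measurable_below (t : R) : measurable (below t).
Proof. exact: measurable_itv. Qed.

Lemma bmf_half_line (t : R) : bmf (half_line t).
Proof. exact: bmf_indic (measurable_below t). Qed.

Lemma half_line_itv (t x : R) : 0 <= half_line t x <= 1.
Proof. by rewrite /half_line indicE; case: (_ \in _); rewrite ?lexx ler01. Qed.

Lemma Ex_distribution {d' : measure_display} {U : measurableType d'} (X : {RV P >-> U})
  (g : U -> R) : bmf g -> \int[distribution P X]_y g y = \int[P]_w g (X w).
Proof.
move=> bg; rewrite /Rintegral integral_distribution//.
  by apply/measurable_EFinP; case: bg.
by apply: (bmf_integrable P); apply: bmf_comp.
Qed.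

Lemma cdf0E (t : R) : cdf0 t = \int[P]_w half_line t (Y 0 w).
Proof. by rewrite /cdf0 Ex_distribution//; exact: bmf_half_line. Qed.

Lemma cdf0_itv (t : R) : 0 <= cdf0 t <= 1.
Proof.
rewrite cdf0E Ex_ge0/=; last by move=> w; case/andP: (half_line_itv t (Y 0 w)).
rewrite -[leRHS](Ex_cst P); apply: Ex_le => //; last 2 first.
- exact: bmf_cst.
- by move=> w; case/andP: (half_line_itv t (Y 0 w)).
- by apply: bmf_comp (bmf_half_line t) _.
Qed.

Lemma half_line0_norm (t x : R) : `|half_line0 Y t x| <= 1.
Proof.
rewrite /half_line0 -/(cdf0 t); have /andP[a b] := cdf0_itv t.
have /andP[e f] := half_line_itv t x.
by rewrite ler_norml; apply/andP; split; lra.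
Qed.

Lemma bmf_half_line0 (t : R) : bmf (half_line0 Y t).
Proof. by apply: bmfB; [exact: bmf_half_line|exact: bmf_cst]. Qed.

Lemma kernel1_half_line q (w : F0) (t : R) :
  \int[k1 q w]_y half_line t y = fine (k1 q w (below t)).
Proof. by rewrite /Rintegral integral_indic// setIT. Qed.

(** Rational thresholds suffice to approximate steps, and make the suprema dep1 and
    dep2 measurable. *)
Definition thr1 (n : nat) : R := ratr (odflt 0 (unpickle n)).
Definition thr2 (n : nat) : R * R :=
  let: ts := odflt (0, 0) (unpickle n : option (rat * rat)) in (ratr ts.1, ratr ts.2).

Definition gap1 (q n : nat) (w : F0) : R :=
  `|\int[k1 q w]_y half_line (thr1 n) y - cdf0 (thr1 n)|.
Definition gap2 (a b n : nat) (w : F0) : R :=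
  `|\int[k2 a b w]_z half_line0_tensor Y (thr2 n).1 (thr2 n).2 z -
    \int[distribution P (pairRV (Y a%:Z) (Y b%:Z))]_z
       half_line0_tensor Y (thr2 n).1 (thr2 n).2 z| / 2.

Definition dep1 (q : nat) : F0 -> R := rsup (gap1 q).
Definition dep2 (a b : nat) : F0 -> R := rsup (gap2 a b).

Lemma bmf_gap1 q n : bmf (gap1 q n).
Proof.
apply: bmf_norm; apply: bmfB; last exact: bmf_cst.
under [X in bmf X]funext do rewrite kernel1_half_line.
by apply: (bmf_kernel (k1 q)); exact: measurable_below.
Qed.

Lemma gap1_itv q n w : 0 <= gap1 q n w <= 1.
Proof.
rewrite /gap1 normr_ge0 kernel1_half_line/=.
have [h1 h2] := kernel_le1 (k1 q) w (measurable_below (thr1 n)).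
have /andP[a b] := cdf0_itv (thr1 n).
have h3 : 0 <= fine (k1 q w (below (thr1 n))) by rewrite fine_ge0.
have h4 : fine (k1 q w (below (thr1 n))) <= 1 by rewrite -lee_fin fineK.
by rewrite ler_norml; apply/andP; split; lra.
Qed.

Lemma bmf_tensor (t s : R) : bmf (half_line0_tensor Y t s).
Proof.
apply: bmfM.
  by apply: (bmf_comp (g := half_line0 Y t) (f := fst)) => //; exact: bmf_half_line0.
by apply: (bmf_comp (g := half_line0 Y s) (f := snd)) => //; exact: bmf_half_line0.
Qed.

Lemma tensor_norm (t s : R) (z : R * R) : `|half_line0_tensor Y t s z| <= 1.
Proof.
by rewrite normrM -[leRHS]mulr1 ler_pM// half_line0_norm.
Qed.

(** Expanding the product of the two centred indicators gives finitely many values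
    of the kernel on rectangles, hence a measurable function of the condition. *)
Lemma kernel2_tensor a b (w : F0) (t s : R) :
  \int[k2 a b w]_z half_line0_tensor Y t s z =
  fine (k2 a b w (below t `*` below s)) - cdf0 s * fine (k2 a b w (below t `*` setT))
  - cdf0 t * fine (k2 a b w (setT `*` below s)) + cdf0 t * cdf0 s.
Proof.
have m1 : measurable (below t `*` below s) by apply: measurableX; exact: measurable_below.
have m2 : measurable (below t `*` [set: R]).
  by apply: measurableX => //; exact: measurable_below.
have m3 : measurable ([set: R] `*` below s).
  by apply: measurableX => //; exact: measurable_below.
rewrite -[LHS]/(\int[kernel_prob (k2 a b) w]_z half_line0_tensor Y t s z).
set Q := kernel_prob (k2 a b) w.
have b1 : bmf (\1_(below t `*` below s) : R * R -> R) by exact: bmf_indic.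
have b2 : bmf (\1_(below t `*` [set: R]) : R * R -> R) by exact: bmf_indic.
have b3 : bmf (\1_([set: R] `*` below s) : R * R -> R) by exact: bmf_indic.
transitivity (\int[Q]_z (\1_(below t `*` below s) z - cdf0 s * \1_(below t `*` [set: R]) z
   - cdf0 t * \1_([set: R] `*` below s) z + cdf0 t * cdf0 s)).
  apply: eq_Rintegral => -[z1 z2] _; rewrite /half_line0_tensor /half_line0 /=.
  rewrite -/(cdf0 t) -/(cdf0 s) /half_line !indicE !in_setX !in_setT !andbT !andTb.
  rewrite -/(below t) -/(below s).
  by case: (z1 \in below t); case: (z2 \in below s); rewrite /=; ring.
rewrite ExD ?ExB ?ExZ ?Ex_cst; last by bmf_tac.
all: try by bmf_tac.
by rewrite !Ex_indic.
Qed.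

Lemma bmf_gap2 a b n : bmf (gap2 a b n).
Proof.
apply: bmfM; last exact: bmf_cst.
apply: bmf_norm; apply: bmfB; last exact: bmf_cst.
under [X in bmf X]funext do rewrite kernel2_tensor.
have bk (B : set (R * R)) : measurable B -> bmf (fun w => fine (k2 a b w B)).
  exact: (bmf_kernel (k2 a b)).
have m1 : measurable (below (thr2 n).1 `*` below (thr2 n).2).
  by apply: measurableX; exact: measurable_below.
have m2 : measurable (below (thr2 n).1 `*` [set: R]).
  by apply: measurableX => //; exact: measurable_below.
have m3 : measurable ([set: R] `*` below (thr2 n).2).
  by apply: measurableX => //; exact: measurable_below.
have := bk _ m1; have := bk _ m2; have := bk _ m3 => ? ? ?.
by bmf_tac.
Qed.

Lemma Ex_norm_le1 {d' : measure_display} {U : measurableType d'} (Q : probability U R)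
  (g : U -> R) : bmf g -> (forall z, `|g z| <= 1) -> `|\int[Q]_z g z| <= 1.
Proof.
move=> bg g1; apply: le_trans (Ex_norm Q bg) _; rewrite -[leRHS](Ex_cst Q).
by apply: Ex_le => //; [exact: bmf_norm|exact: bmf_cst].
Qed.

Lemma gap2_itv a b n w : 0 <= gap2 a b n w <= 1.
Proof.
rewrite divr_ge0//= ler_pdivrMr// mul1r; apply: le_trans (ler_normB _ _) _.
rewrite -[2]/(1 + 1) lerD//.
  exact: (Ex_norm_le1 (kernel_prob (k2 a b) w) (bmf_tensor _ _) (tensor_norm _ _)).
exact: (Ex_norm_le1 (distribution P (pairRV (Y a%:Z) (Y b%:Z)))
  (bmf_tensor _ _) (tensor_norm _ _)).
Qed.

Lemma dep1_itv q w : 0 <= dep1 q w <= 1.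
Proof. by apply: rsup_itv => n ?; exact: gap1_itv. Qed.

Lemma dep2_itv a b w : 0 <= dep2 a b w <= 1.
Proof. by apply: rsup_itv => n ?; exact: gap2_itv. Qed.

Lemma bmf_dep1 q : bmf (dep1 q).
Proof. by apply: bmf_rsup => n; [exact: bmf_gap1|exact: gap1_itv]. Qed.

Lemma bmf_dep2 a b : bmf (dep2 a b).
Proof. by apply: bmf_rsup => n; [exact: bmf_gap2|exact: gap2_itv]. Qed.

Lemma dep1_beta q : ((\int[P]_w dep1 q w)%:E <= beta2 Y k1 k2 q)%E.
Proof.
rewrite -EFin_Ex; last exact: toT (bmf_dep1 q).
apply: (@le_trans _ _ (beta1 Y k1 q)); last by rewrite /beta2 le_max lexx.
apply: ge0_le_integral_nonmeas => w.
  by rewrite lee_fin; case/andP: (dep1_itv q w).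
apply: rsup_le => [n w'|n]; first exact: gap1_itv.
by apply: ereal_sup_ubound; exists (thr1 n).
Qed.

Lemma dep2_beta a b : (b < a)%N -> ((\int[P]_w dep2 a b w)%:E <= beta2 Y k1 k2 b)%E.
Proof.
move=> ba; rewrite -EFin_Ex; last exact: toT (bmf_dep2 a b).
apply: (@le_trans _ _ (\int[P]_w b2 Y a%:Z b%:Z (k2 a b w))%E); last first.
  rewrite /beta2 le_max; apply/orP; right.
  by apply: ereal_sup_ubound; exists (a, b) => //=; rewrite leqnn.
apply: ge0_le_integral_nonmeas => w.
  by rewrite lee_fin; case/andP: (dep2_itv a b w).
apply: rsup_le => [n w'|n]; first exact: gap2_itv.
apply: le_trans (ereal_sup_ubound _); last by exists (thr2 n).
by rewrite lee_fin ler_pdivrMr// ler_peMr// ler1n.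
Qed.

(** Uniform approximation by steps with total jump at most V: what is needed of a
    function of bounded variation. *)
Definition step_approx (V : R) (g : R -> R) : Prop := forall e : R, 0 < e ->
  exists (n : nat) (c : 'I_n -> R) (t : 'I_n -> rat),
    \sum_i `|c i| <= V /\
    forall y, `|g y - \sum_i c i * half_line (ratr (t i)) y| <= e.

Lemma gap1_le_dep1 q w (t : rat) :
  `|\int[k1 q w]_y half_line (ratr t) y - cdf0 (ratr t)| <= dep1 q w.
Proof.
have := rsup_ge (gap1_itv q) (pickle t) w.
by rewrite /gap1 /thr1 pickleK.
Qed.

Lemma gap2_le_dep2 a b w (t s : rat) :
  `|\int[k2 a b w]_z half_line0_tensor Y (ratr t) (ratr s) z -
    \int[distribution P (pairRV (Y a%:Z) (Y b%:Z))]_z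
       half_line0_tensor Y (ratr t) (ratr s) z| <= 2 * dep2 a b w.
Proof.
have := rsup_ge (gap2_itv a b) (pickle (t, s)) w.
by rewrite /gap2 /thr2 pickleK/= ler_pdivrMr// mulrC.
Qed.

Lemma Ex_mul_norm_le (z g D : T -> R) : bmf z -> bmf g -> bmf D ->
  (forall w, 0 <= z w) -> (forall w, `|g w| <= D w) ->
  `|\int[P]_w (z w * g w)| <= \int[P]_w (z w * D w).
Proof.
move=> bz bg bD z0 gD; apply: le_trans (Ex_norm P (bmfM bz bg)) _.
apply: Ex_le; [by bmf_tac|by bmf_tac|] => w.
by rewrite normrM ger0_norm// ler_wpM2l.
Qed.

Lemma bmf_dep1T q : bmf (dep1 q : T -> R). Proof. exact: toT (bmf_dep1 q). Qed.
Lemma bmf_dep2T a b : bmf (dep2 a b : T -> R). Proof. exact: toT (bmf_dep2 a b). Qed.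

Lemma half_line_dep q (z : F0 -> R) (t : rat) : bmf z -> (forall w, 0 <= z w) ->
  `|\int[P]_w (z w * (half_line (ratr t) (Y q%:Z w) - cdf0 (ratr t)))| <=
  \int[P]_w (z w * dep1 q w).
Proof.
move=> bz z0; have bzT := toT bz.
have mB := measurable_below (ratr t).
have bk := toT (bmf_kernel (k1 q) mB).
have bX : bmf (fun w => half_line (ratr t) (Y q%:Z w)).
  by apply: bmf_comp (bmf_half_line _) _; exact: measurable_funPT.
have -> : \int[P]_w (z w * (half_line (ratr t) (Y q%:Z w) - cdf0 (ratr t))) =
   \int[P]_w (z w * (fine (k1 q w (below (ratr t))) - cdf0 (ratr t))).
  have H := cond_dist_Ex pastT (hk1 q) mB bz.
  transitivity (\int[P]_w (z w * half_line (ratr t) (Y q%:Z w)) - \int[P]_w (z w * cdf0 (ratr t))).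
    rewrite -ExB; [|exact: bmfM|by apply: bmfM => //; exact: bmf_cst].
    by apply: eq_Rintegral => w _; rewrite mulrBr.
  rewrite [X in X - _]H -ExB; [|exact: bmfM|by apply: bmfM => //; exact: bmf_cst].
  by apply: eq_Rintegral => w _; rewrite mulrBr.
apply: Ex_mul_norm_le => //.
- by apply: bmfB => //; exact: bmf_cst.
- exact: bmf_dep1T.
- by move=> w; rewrite -kernel1_half_line; exact: gap1_le_dep1.
Qed.

(** By linearity the bound for half-lines extends to steps, and the error of the
    uniform approximation is arbitrarily small. *)
Lemma step_dep (V : R) (g : R -> R) q (z : F0 -> R) : 0 <= V -> bmf g ->
  step_approx V g -> bmf z -> (forall w, 0 <= z w) ->
  `|\int[P]_w (z w * (g (Y q%:Z w) - \int[P]_w' g (Y 0 w')))| <=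
  V * \int[P]_w (z w * dep1 q w).
Proof.
move=> V0 bg apx bz z0; have bzT := toT bz.
have bgY i : bmf (fun w => g (Y i w)).
  by apply: bmf_comp bg _; exact: measurable_funPT.
pose Z := \int[P]_w z w.
have Z0 : 0 <= Z by apply: Ex_ge0.
apply/ler_addgt0Pl => /= e e0.
pose e' := e / (2 * Z + 1).
have den0 : 0 < 2 * Z + 1 by rewrite ltr_wpDl// mulr_ge0.
have e'0 : 0 < e' by rewrite divr_gt0.
have [n [c [t [cV gs]]]] := apx e' e'0.
pose s y := \sum_i c i * half_line (ratr (t i)) y.
have bs i : bmf (fun w => s (Y i w)).
  apply: bmf_sum => k; apply: bmfM; first exact: bmf_cst.
  by apply: bmf_comp (bmf_half_line _) _; exact: measurable_funPT.
have bhl i k : bmf (fun w => half_line (ratr (t k)) (Y i w)).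
  by apply: bmf_comp (bmf_half_line _) _; exact: measurable_funPT.
pose m := \int[P]_w g (Y 0 w).
pose ms := \int[P]_w s (Y 0 w).
have msE : ms = \sum_i c i * cdf0 (ratr (t i)).
  rewrite /ms /s Ex_sum; last by move=> k; apply: bmfM; [exact: bmf_cst|exact: bhl].
  by apply: eq_bigr => k _; rewrite ExZ ?cdf0E.
have mms : `|m - ms| <= e'.
  rewrite /m /ms -ExB//; apply: le_trans (Ex_norm P _) _; first exact: bmfB.
  rewrite -[leRHS](Ex_cst P); apply: Ex_le; [by bmf_tac|exact: bmf_cst|].
  by move=> w; exact: gs.
have split1 : \int[P]_w (z w * (g (Y q%:Z w) - m)) =
   \int[P]_w (z w * ((g (Y q%:Z w) - s (Y q%:Z w)) - (m - ms))) +
   \sum_i c i * \int[P]_w (z w * (half_line (ratr (t i)) (Y q%:Z w) - cdf0 (ratr (t i)))).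
  have -> : \sum_i c i * \int[P]_w (z w * (half_line (ratr (t i)) (Y q%:Z w) - cdf0 (ratr (t i)))) =
     \int[P]_w (z w * (s (Y q%:Z w) - ms)).
    have bi i : bmf (fun w : T => z w * (half_line (ratr (t i)) (Y q%:Z w) - cdf0 (ratr (t i)))).
      by apply: bmfM => //; apply: bmfB => //; exact: bmf_cst.
    transitivity (\int[P]_w \sum_i c i * (z w * (half_line (ratr (t i)) (Y q%:Z w) - cdf0 (ratr (t i))))).
      rewrite Ex_sum; last by move=> i; apply: bmfM => //; exact: bmf_cst.
      by apply: eq_bigr => i _; rewrite ExZ.
    apply: eq_Rintegral => w _; rewrite msE /s -sumrB mulr_sumr.
    by apply: eq_bigr => i _; rewrite mulrCA mulrBr.
  have := bs q; have := bgY q => bgq bsq.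
  rewrite -ExD; [|by bmf_tac|by bmf_tac].
  by apply: eq_Rintegral => w _; rewrite -mulrDr; congr (_ * _); ring.
rewrite split1; apply: le_trans (ler_normD _ _) _; apply: lerD.
  have := bs q; have := bgY q => bgq bsq.
  apply: (@le_trans _ _ (\int[P]_w (z w * (2 * e')))).
    apply: Ex_mul_norm_le => //; [by bmf_tac|exact: bmf_cst|] => w.
    apply: le_trans (ler_normB _ _) _; rewrite mulrDl mul1r lerD//; exact: gs.
  have -> : \int[P]_w (z w * (2 * e')) = 2 * e' * Z.
    by rewrite -ExZ//; apply: eq_Rintegral => w _; rewrite mulrC.
  have -> : 2 * e' * Z = e * ((2 * Z) / (2 * Z + 1)) by rewrite /e'; ring.
  by rewrite ler_piMr ?(ltW e0)// ler_pdivrMr// mul1r lerDl.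
apply: le_trans (ler_norm_sum _ _ _) _.
have D0 : 0 <= \int[P]_w (z w * dep1 q w).
  by apply: Ex_ge0 => w; rewrite mulr_ge0//; case/andP: (dep1_itv q w).
apply: (@le_trans _ _ (\sum_i `|c i| * \int[P]_w (z w * dep1 q w))).
  by apply: ler_sum => i _; rewrite normrM ler_wpM2l// half_line_dep.
by rewrite -mulr_suml ler_wpM2r.
Qed.

Lemma tensor_dep a b (z : F0 -> R) (t s : rat) : bmf z -> (forall w, 0 <= z w) ->
  `|\int[P]_w (z w * (half_line0 Y (ratr t) (Y a%:Z w) * half_line0 Y (ratr s) (Y b%:Z w) -
     \int[P]_w' (half_line0 Y (ratr t) (Y a%:Z w') * half_line0 Y (ratr s) (Y b%:Z w'))))| <=
  2 * \int[P]_w (z w * dep2 a b w).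
Proof.
move=> bz z0; have bzT := toT bz.
pose X := pairRV (Y a%:Z) (Y b%:Z).
pose tt := ratr t : R; pose ss := ratr s : R.
pose ten := half_line0_tensor Y tt ss.
have bX : bmf (fun w => ten (X w)).
  by apply: bmf_comp (bmf_tensor _ _) _; exact: measurable_pairRV.
pose c := \int[P]_w ten (X w).
have cE : c = \int[distribution P (pairRV (Y a%:Z) (Y b%:Z))]_z ten z.
  by rewrite Ex_distribution//; exact: bmf_tensor.
pose kt (w : F0) := \int[k2 a b w]_z ten z.
have m1 : measurable (below tt `*` below ss) by apply: measurableX; exact: measurable_below.
have m2 : measurable (below tt `*` [set: R]).
  by apply: measurableX => //; exact: measurable_below.
have m3 : measurable ([set: R] `*` below ss).
  by apply: measurableX => //; exact: measurable_below.
have bk1 := toT (bmf_kernel (k2 a b) m1).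
have bk2 := toT (bmf_kernel (k2 a b) m2).
have bk3 := toT (bmf_kernel (k2 a b) m3).
have bi (B : set (R * R)) : measurable B -> bmf (fun w => \1_B (X w) : R).
  by move=> mB; apply: bmf_comp (bmf_indic mB) _; exact: measurable_pairRV.
have bi1 := bi _ m1; have bi2 := bi _ m2; have bi3 := bi _ m3.
have bkt : bmf (kt : T -> R).
  rewrite (_ : kt = (fun w => fine (k2 a b w (below tt `*` below ss)) - cdf0 ss * fine (k2 a b w (below tt `*` setT))
  - cdf0 tt * fine (k2 a b w (setT `*` below ss)) + cdf0 tt * cdf0 ss)); last first.
    by apply/funext => w; rewrite /kt kernel2_tensor.
  by bmf_tac.
have zero (B : set (R * R)) : measurable B ->
    \int[P]_w (z w * (\1_B (X w) - fine (k2 a b w B))) = 0.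
  move=> mB; have H := cond_dist_Ex pastT (hk2 a b) mB bz.
  have bkB := toT (bmf_kernel (k2 a b) mB).
  have biB := bi _ mB.
  transitivity (\int[P]_w (z w * \1_B (X w)) - \int[P]_w (z w * fine (k2 a b w B))).
    rewrite -ExB; [|by bmf_tac|by bmf_tac].
    by apply: eq_Rintegral => w _; rewrite mulrBr.
  by rewrite [X in X - _]H subrr.
have E : \int[P]_w (z w * (ten (X w) - c)) = \int[P]_w (z w * (kt w - c)).
  apply/eqP; rewrite -subr_eq0 -ExB; [|by bmf_tac|by bmf_tac].
  pose e1 (w : T) := z w * (\1_(below tt `*` below ss) (X w) - fine (k2 a b w (below tt `*` below ss))).
  pose e2 (w : T) := z w * (\1_(below tt `*` [set: R]) (X w) - fine (k2 a b w (below tt `*` [set: R]))).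
  pose e3 (w : T) := z w * (\1_([set: R] `*` below ss) (X w) - fine (k2 a b w ([set: R] `*` below ss))).
  have be1 : bmf e1 by rewrite /e1; bmf_tac.
  have be2 : bmf e2 by rewrite /e2; bmf_tac.
  have be3 : bmf e3 by rewrite /e3; bmf_tac.
  transitivity (\int[P]_w (e1 w - cdf0 ss * e2 w - cdf0 tt * e3 w) == 0).
    congr (_ == 0); apply: eq_Rintegral => w _.
    rewrite /kt /e1 /e2 /e3 -mulrBr kernel2_tensor /ten /half_line0_tensor /half_line0.
    rewrite -/(cdf0 tt) -/(cdf0 ss) /half_line !indicE !in_setX !in_setT !andbT !andTb.
    rewrite -/(below tt) -/(below ss) /X /pairRV /=.
    by case: (Y a w \in below tt); case: (Y b w \in below ss); rewrite /=; ring.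
  apply/eqP.
  rewrite ExB; [|by bmf_tac|by bmf_tac].
  rewrite ExB; [|by bmf_tac|by bmf_tac].
  by rewrite !ExZ// /e1 /e2 /e3 !zero// !mulr0 !subr0.
rewrite -[X in `|X|]/(\int[P]_w (z w * (ten (X w) - c))) E.
have bD := bmf_dep2T a b.
rewrite -ExZ; last by bmf_tac.
have -> : \int[P]_w (2 * (z w * dep2 a b w)) = \int[P]_w (z w * (2 * dep2 a b w)).
  by apply: eq_Rintegral => w _; rewrite mulrCA.
apply: Ex_mul_norm_le => //; [by bmf_tac|by bmf_tac|] => w.
by rewrite cE; exact: gap2_le_dep2.
Qed.

Section family.
Variables (J : finType) (h : J -> R -> R) (M V V2 : R).
Hypothesis V0 : 0 <= V.
Hypothesis V20 : 0 <= V2.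
Hypothesis bh : forall j, bmf (h j).
Hypothesis hM : forall y, \sum_j `|h j y| <= M.
Hypothesis hV : forall j, step_approx V (h j).
Hypothesis hV2 : forall j, step_approx V2 (fun y => h j y ^+ 2).

Let M0 : 0 <= M. Proof. by apply: le_trans (hM 0); apply: sumr_ge0. Qed.

(** The centred variables are approximated by combinations of centred indicators,
    the centring constants being approximated at the same time. *)
Lemma pair_dep j a b (z : F0 -> R) : bmf z -> (forall w, 0 <= z w) ->
  `|\int[P]_w (z w * (cX Y h j a%:Z w * cX Y h j b%:Z w -
       \int[P]_w' (cX Y h j a%:Z w' * cX Y h j b%:Z w')))| <=
  2 * V ^+ 2 * \int[P]_w (z w * dep2 a b w).
Proof.
move=> bz z0; have bzT := toT bz.
pose K := 2 * M.
have bX i : bmf (cX Y h j i) := bmf_cX Y bh j i.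
have XK i w : `|cX Y h j i w| <= K := cen_le Y bh hM j (Y i w).
have K0 : 0 <= K by rewrite mulr_ge0.
pose Z := \int[P]_w z w.
have Z0 : 0 <= Z by apply: Ex_ge0.
apply/ler_addgt0Pl => /= e e0.
pose den := 4 * (K + V) * Z + 1.
have den0 : 0 < den by rewrite ltr_wpDl// !mulr_ge0// addr_ge0.
pose e' := e / den.
have e'0 : 0 < e' by rewrite divr_gt0.
have [n [c [t [cV gs]]]] := hV j e'0.
pose s (i : int) w := \sum_k c k * half_line0 Y (ratr (t k)) (Y i w).
have bhl i k : bmf (fun w => half_line0 Y (ratr (t k)) (Y i w)).
  by apply: bmf_comp (bmf_half_line0 _) _; exact: measurable_funPT.
have bs i : bmf (s i).
  by apply: bmf_sum => k; apply: bmfM => //; exact: bmf_cst.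
have mean_apx : `|mean_of Y h j - \sum_k c k * cdf0 (ratr (t k))| <= e'.
  have b1 k : bmf (fun w => c k * half_line (ratr (t k)) (Y 0 w)).
    apply: bmfM; [exact: bmf_cst|apply: bmf_comp (bmf_half_line _) _; exact: measurable_funPT].
  have -> : \sum_k c k * cdf0 (ratr (t k)) = \int[P]_w (\sum_k c k * half_line (ratr (t k)) (Y 0 w)).
    rewrite Ex_sum//; apply: eq_bigr => k _; rewrite ExZ ?cdf0E//.
    by apply: bmf_comp (bmf_half_line _) _; exact: measurable_funPT.
  have bhY := bmf_hY Y bh j 0.
  have bsum : bmf (fun w => \sum_k c k * half_line (ratr (t k)) (Y 0 w)) by apply: bmf_sum.
  rewrite /mean_of -ExB//; apply: le_trans (Ex_norm P _) _; first exact: bmfB.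
  rewrite -[leRHS](Ex_cst P); apply: Ex_le; [by apply: bmf_norm; exact: bmfB|exact: bmf_cst|].
  by move=> w; exact: gs.
have Xs i w : `|cX Y h j i w - s i w| <= 2 * e'.
  have -> : cX Y h j i w - s i w =
    (h j (Y i w) - \sum_k c k * half_line (ratr (t k)) (Y i w)) -
    (mean_of Y h j - \sum_k c k * cdf0 (ratr (t k))).
    have -> : s i w = \sum_k c k * half_line (ratr (t k)) (Y i w) -
        \sum_k c k * cdf0 (ratr (t k)).
      by rewrite /s -sumrB; apply: eq_bigr => k _; rewrite -mulrBr.
    rewrite /cX /cen; ring.
  apply: le_trans (ler_normB _ _) _; rewrite mulrDl mul1r lerD//; exact: gs.
have sV i w : `|s i w| <= V.
  apply: le_trans (ler_norm_sum _ _ _) _; apply: le_trans cV.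
  by apply: ler_sum => k _; rewrite normrM ler_piMr// half_line0_norm.
pose G w := s a w * s b w.
pose F w := cX Y h j a w * cX Y h j b w.
have bF : bmf F by exact: bmfM.
have bG : bmf G by exact: bmfM.
have FG w : `|F w - G w| <= 2 * e' * (K + V).
  have -> : F w - G w = cX Y h j a w * (cX Y h j b w - s b w) +
     (cX Y h j a w - s a w) * s b w by rewrite /F /G; ring.
  apply: le_trans (ler_normD _ _) _; rewrite !normrM mulrDr.
  by apply: lerD; [rewrite mulrC|]; apply: ler_pM.
have mFG : `|(\int[P]_w F w) - \int[P]_w G w| <= 2 * e' * (K + V).
  rewrite -ExB//; apply: le_trans (Ex_norm P _) _; first exact: bmfB.
  rewrite -[leRHS](Ex_cst P); apply: Ex_le; [by apply: bmf_norm; exact: bmfB|exact: bmf_cst|].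
  exact: FG.
set mF := \int[P]_w F w in mFG *; set mG := \int[P]_w G w in mFG *.
pose H k l (w : T) := half_line0 Y (ratr (t k)) (Y a w) * half_line0 Y (ratr (t l)) (Y b w).
have bH k l : bmf (H k l) by exact: bmfM.
have GE w : G w = \sum_k \sum_l (c k * c l) * H k l w.
  rewrite /G /s mulr_suml; apply: eq_bigr => k _; rewrite mulr_sumr.
  by apply: eq_bigr => l _; rewrite /H; ring.
have bcH k l : bmf (fun w => (c k * c l) * H k l w).
  by apply: bmfM => //; exact: bmf_cst.
have mGE : mG = \sum_k \sum_l (c k * c l) * \int[P]_w H k l w.
  rewrite /mG (eq_Rintegral _ (f := G) (g := fun w => \sum_k \sum_l (c k * c l) * H k l w)); last first.
    by move=> w _; exact: GE.
  rewrite Ex_sum; last by move=> k; apply: bmf_sum.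
  by apply: eq_bigr => k _; rewrite Ex_sum//; apply: eq_bigr => l _; rewrite ExZ.
have split1 : \int[P]_w (z w * (F w - mF)) =
   \int[P]_w (z w * ((F w - G w) - (mF - mG))) +
   \sum_k \sum_l (c k * c l) * \int[P]_w (z w * (H k l w - \int[P]_w' H k l w')).
  have bi k l : bmf (fun w : T => z w * (H k l w - \int[P]_w' H k l w')).
    by apply: bmfM => //; apply: bmfB => //; exact: bmf_cst.
  have bci k l : bmf (fun w : T => (c k * c l) * (z w * (H k l w - \int[P]_w' H k l w'))).
    by apply: bmfM => //; exact: bmf_cst.
  have -> : \sum_k \sum_l (c k * c l) * \int[P]_w (z w * (H k l w - \int[P]_w' H k l w')) =
     \int[P]_w (z w * (G w - mG)).
    transitivity (\int[P]_w \sum_k \sum_l (c k * c l) * (z w * (H k l w - \int[P]_w' H k l w'))).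
      rewrite Ex_sum; last by move=> k; apply: bmf_sum.
      apply: eq_bigr => k _; rewrite Ex_sum//; apply: eq_bigr => l _; by rewrite ExZ.
    apply: eq_Rintegral => w _; rewrite mGE GE -sumrB mulr_sumr.
    apply: eq_bigr => k _; rewrite -sumrB mulr_sumr.
    by apply: eq_bigr => l _; rewrite mulrCA mulrBr.
  rewrite -ExD; [|by bmf_tac|by bmf_tac].
  by apply: eq_Rintegral => w _; rewrite -mulrDr; congr (_ * _); ring.
rewrite -[X in `|X|]/(\int[P]_w (z w * (F w - mF))) split1.
apply: le_trans (ler_normD _ _) _; apply: lerD.
  apply: (@le_trans _ _ (\int[P]_w (z w * (4 * e' * (K + V))))).
    apply: Ex_mul_norm_le => //; [by bmf_tac|exact: bmf_cst|] => w.
    apply: le_trans (ler_normB _ _) _.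
    have -> : 4 * e' * (K + V) = 2 * e' * (K + V) + 2 * e' * (K + V) by ring.
    by rewrite lerD.
  have -> : \int[P]_w (z w * (4 * e' * (K + V))) = 4 * e' * (K + V) * Z.
    by rewrite -ExZ//; apply: eq_Rintegral => w _; rewrite mulrC.
  have -> : 4 * e' * (K + V) * Z = e * ((4 * (K + V) * Z) / den) by rewrite /e'; ring.
  by rewrite ler_piMr ?(ltW e0)// ler_pdivrMr// mul1r lerDl.
have D0 : 0 <= \int[P]_w (z w * dep2 a b w).
  by apply: Ex_ge0 => w; rewrite mulr_ge0//; case/andP: (dep2_itv a b w).
set DD := \int[P]_w (z w * dep2 a b w) in D0 *.
apply: (@le_trans _ _ (\sum_k \sum_l (`|c k| * `|c l|) * (2 * DD))).
  apply: le_trans (ler_norm_sum _ _ _) _; apply: ler_sum => k _.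
  apply: le_trans (ler_norm_sum _ _ _) _; apply: ler_sum => l _.
  rewrite normrM normrM ler_wpM2l ?mulr_ge0//; exact: tensor_dep.
have -> : \sum_k \sum_l (`|c k| * `|c l|) * (2 * DD) = (\sum_k `|c k|) ^+ 2 * (2 * DD).
  rewrite expr2 mulr_suml mulr_suml; apply: eq_bigr => k _.
  by rewrite mulr_sumr mulr_suml.
have -> : 2 * V ^+ 2 * DD = V ^+ 2 * (2 * DD) by ring.
rewrite ler_wpM2r ?mulr_ge0//.
by rewrite lerXn2r ?nnegrE// sumr_ge0.
Qed.

(** On the diagonal the product is itself a function of one variable, of bounded
    variation as h_j^2 is. *)
Lemma square_dep j a (z : F0 -> R) : bmf z -> (forall w, 0 <= z w) ->
  `|\int[P]_w (z w * (cX Y h j a%:Z w * cX Y h j a%:Z w -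
       \int[P]_w' (cX Y h j a%:Z w' * cX Y h j a%:Z w')))| <=
  (V2 + 2 * M * V) * \int[P]_w (z w * dep1 a w).
Proof.
move=> bz z0; have bzT := toT bz.
pose mu := mean_of Y h j.
have muM : `|mu| <= M.
  by apply: le_trans (sum_mean Y bh hM); rewrite (bigD1 j)//= lerDl sumr_ge0.
have b1 i := bmf_hY Y bh j i.
have b2 i : bmf (fun w => h j (Y i w) ^+ 2) := bmfX 2 (b1 i).
have bX i : bmf (cX Y h j i) := bmf_cX Y bh j i.
have st2 : \int[P]_w (h j (Y a w) ^+ 2) = \int[P]_w (h j (Y 0 w) ^+ 2).
  have := stationary1 hY 0 a (bmfX 2 (bh j)); by rewrite add0r.
have st1 : \int[P]_w (h j (Y a w)) = mu.
  have := stationary1 hY 0 a (bh j); by rewrite add0r.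
have c2 : \int[P]_w (cX Y h j a%:Z w * cX Y h j a%:Z w) =
   \int[P]_w (h j (Y 0 w) ^+ 2) - mu ^+ 2.
  transitivity (\int[P]_w (h j (Y a w) ^+ 2 - 2 * mu * h j (Y a w) + mu ^+ 2)).
    by apply: eq_Rintegral => w _; rewrite /cX /cen -/mu; ring.
  have ba1 := b1 a; have ba2 := b2 a.
  rewrite ExD; [|by bmf_tac|exact: bmf_cst].
  rewrite ExB; [|by bmf_tac|by bmf_tac].
  by rewrite ExZ// Ex_cst st2 st1; ring.
have ba1 := b1 a; have ba2 := b2 a.
have E : \int[P]_w (z w * (cX Y h j a%:Z w * cX Y h j a%:Z w -
       \int[P]_w' (cX Y h j a%:Z w' * cX Y h j a%:Z w'))) =
   \int[P]_w (z w * (h j (Y a w) ^+ 2 - \int[P]_w' (h j (Y 0 w') ^+ 2))) -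
   2 * mu * \int[P]_w (z w * (h j (Y a w) - \int[P]_w' h j (Y 0 w'))).
  rewrite -ExZ; last by bmf_tac.
  rewrite -ExB; [|by bmf_tac|by bmf_tac].
  apply: eq_Rintegral => w _; rewrite c2 /cX /cen -/mu -[\int[P]_w' h j _]/mu; ring.
rewrite E; apply: le_trans (ler_normB _ _) _; rewrite [leRHS]mulrDl; apply: lerD.
  exact: (step_dep a V20 (bmfX 2 (bh j)) (hV2 j) bz z0).
have D0 : 0 <= \int[P]_w (z w * dep1 a w).
  by apply: Ex_ge0 => w; rewrite mulr_ge0//; case/andP: (dep1_itv a w).
rewrite normrM -[leRHS]mulrA ler_pM ?mulr_ge0//.
  by rewrite normrM ger0_norm// ler_wpM2l.
exact: (step_dep a V0 (bh j) (hV j) bz z0).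
Qed.

Lemma controlled_step_family :
  controlled_family (Y := Y) dep1 dep2 M (V + 2 * V ^+ 2 + (V2 + 2 * M * V)) h.
Proof.
have W1 : 0 <= 2 * V ^+ 2 by rewrite mulr_ge0// sqr_ge0.
have W2 : 0 <= V2 + 2 * M * V by rewrite addr_ge0// !mulr_ge0.
split => //.
- move=> j q z bz z0; apply: le_trans (step_dep q V0 (bh j) (hV j) bz z0) _.
  rewrite ler_wpM2r//; last by rewrite -addrA lerDl addr_ge0.
  by apply: Ex_ge0 => w; rewrite mulr_ge0//; case/andP: (dep1_itv q w).
- move=> j a b z _ bz z0; apply: le_trans (pair_dep j a b bz z0) _.
  rewrite ler_wpM2r//; last by rewrite -addrA ler_wpDl// lerDl.
  by apply: Ex_ge0 => w; rewrite mulr_ge0//; case/andP: (dep2_itv a b w).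
- move=> j a z bz z0; apply: le_trans (square_dep j a bz z0) _.
  rewrite ler_wpM2r//; last by rewrite lerDr addr_ge0.
  by apply: Ex_ge0 => w; rewrite mulr_ge0//; case/andP: (dep1_itv a w).
Qed.

End family.
End dependence_coefficients.

(** * Polynomial pieces *)

Section polynomial_pieces.
Context {R : realType}.
Implicit Types (q : {poly R}) (x y : R).

Definition poly_sup q : R := \sum_(k < size q) `|q`_k|.
Definition poly_lip q : R := \sum_(k < size q) `|q`_k| * k%:R.

Lemma poly_sup_ge0 q : 0 <= poly_sup q. Proof. exact: sumr_ge0. Qed.
Lemma poly_lip_ge0 q : 0 <= poly_lip q.
Proof. by apply: sumr_ge0 => k _; rewrite mulr_ge0. Qed.

Lemma horner_le_sup q x : 0 <= x <= 1 -> `|q.[x]| <= poly_sup q.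
Proof.
move=> /andP[x0 x1]; rewrite horner_coef; apply: le_trans (ler_norm_sum _ _ _) _.
apply: ler_sum => k _; rewrite normrM ler_piMr// normrX exprn_ile1// ger0_norm//.
Qed.

Lemma horner_lipschitz q x y : 0 <= x <= 1 -> 0 <= y <= 1 ->
  `|q.[x] - q.[y]| <= poly_lip q * `|x - y|.
Proof.
move=> /andP[x0 x1] /andP[y0 y1]; rewrite !horner_coef -sumrB.
apply: le_trans (ler_norm_sum _ _ _) _; rewrite mulr_suml.
apply: ler_sum => k _; rewrite -mulrBr normrM -mulrA ler_wpM2l//.
rewrite subrXX normrM mulrC ler_wpM2r//.
apply: le_trans (ler_norm_sum _ _ _) _.
apply: (@le_trans _ _ (\sum_(i < k) 1)); last by rewrite sumr_const card_ord.
apply: ler_sum => i _.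
rewrite ger0_norm ?mulr_ge0 ?exprn_ge0//.
by rewrite -[leRHS]mulr1 ler_pM ?exprn_ge0// exprn_ile1.
Qed.

Lemma poly01_le q x : `|poly01 q x| <= poly_sup q * (x \in `]0, 1])%:R.
Proof.
rewrite /poly01; case: ifPn => [|_]; last by rewrite normr0 mulr0.
rewrite in_itv/= mulr1 => /andP[x0 x1]; apply: horner_le_sup.
by rewrite (ltW x0) x1.
Qed.

Lemma bmf_poly01 q : bmf (poly01 q).
Proof.
split; last first.
  exists (poly_sup q) => x; apply: le_trans (poly01_le q x) _.
  by case: (_ \in _); rewrite ?mulr1 ?mulr0// poly_sup_ge0.
have mq : measurable_fun [set: R] (fun x => q.[x]).
  under [X in measurable_fun _ X]funext do rewrite horner_coef.
  by apply: measurable_sum => k; apply: measurable_funM => //; exact: measurable_funX.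
have mI : measurable_fun [set: R] (\1_([set` `]0%R, 1%R]]) : R -> R).
  by apply: measurable_indic; exact: measurable_itv.
rewrite (_ : poly01 q = (fun x => \1_([set` `]0%R, 1%R]]) x * q.[x])).
  exact: measurable_funM.
apply/funext => x; rewrite /poly01 indicE mem_setE.
by case: (_ \in _); rewrite ?mul1r ?mul0r.
Qed.

Lemma poly01X q x : poly01 q x ^+ 2 = poly01 (q ^+ 2) x.
Proof. by rewrite /poly01; case: ifP => _; rewrite ?horner_exp// expr0n. Qed.

(** piece q j is q carried by the j-th of m bins, without the normalization of
    phi. *)
Definition piece q (m : nat) (j : 'I_m) (y : R) : R :=
  poly01 q (m%:R * y - j%:R).
Definition in_bin (m : nat) (j : 'I_m) (y : R) : bool :=
  m%:R * y - j%:R \in `]0, 1].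

Lemma measurable_affine (a b : R) : measurable_fun [set: R] (fun y => a * y - b).
Proof. by apply: measurable_funB => //; exact: measurable_funM. Qed.

Lemma bmf_piece q m (j : 'I_m) : bmf (piece q j).
Proof. by apply: bmf_comp (bmf_poly01 q) _; exact: measurable_affine. Qed.

Lemma piece_le q m (j : 'I_m) y : `|piece q j y| <= poly_sup q * (in_bin j y)%:R.
Proof. exact: poly01_le. Qed.

Lemma in_bin_inj m (j k : 'I_m) y : in_bin j y -> in_bin k y -> j = k.
Proof.
rewrite /in_bin !in_itv/= => /andP[a b] /andP[c e].
have jk (i i' : 'I_m) : m%:R * y - i%:R <= 1 -> 0 < m%:R * y - i'%:R -> (i' <= i)%N.
  move=> h1 h2; rewrite -ltnS -(ltr_nat R) -natr1; lra.
by apply/val_inj/eqP; rewrite eqn_leq !jk.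
Qed.

Lemma sum_in_bin m y : \sum_(j < m) (in_bin j y)%:R <= 1 :> R.
Proof.
have [[j0 h]|h] := pselect (exists j0 : 'I_m, in_bin j0 y).
  rewrite (bigD1 j0)//= h big1 ?addr0// => k kj.
  case: (boolP (in_bin k y)) => // hk.
  by rewrite (in_bin_inj hk h) eqxx in kj.
rewrite big1// => k _; case: (boolP (in_bin k y)) => // hk.
by exfalso; apply: h; exists k.
Qed.

Lemma step_approx_differences (V : R) (g : R -> R) :
  (forall e : R, 0 < e -> exists (N : nat) (c : 'I_N -> R) (a b : 'I_N -> rat),
    2 * (\sum_i `|c i|) <= V /\
    forall y, `|g y - \sum_i c i * (half_line (ratr (b i)) y - half_line (ratr (a i)) y)| <= e) ->
  step_approx V g.
Proof.
move=> H e e0; have [N [c [a [b [cV gs]]]]] := H e e0.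
exists (N + N)%N.
exists (fun i => match fintype.split i with inl k => c k | inr k => - c k end).
exists (fun i => match fintype.split i with inl k => b k | inr k => a k end).
split.
  rewrite big_split_ord/=.
  under eq_bigr do rewrite (unsplitK (inl _)).
  under [X in _ + X]eq_bigr do rewrite (unsplitK (inr _)) normrN.
  by rewrite -mulr2n -mulr_natl.
move=> y; rewrite big_split_ord/=.
under eq_bigr do rewrite (unsplitK (inl _)).
under [X in _ - (_ + X)]eq_bigr do rewrite (unsplitK (inr _)) mulNr.
rewrite sumrN -sumrB; have := gs y.
by under eq_bigr do rewrite mulrBr.
Qed.

Lemma exists_unit_cell (N : nat) (u : R) : 0 < u -> u <= N%:R ->
  exists2 l, (l < N)%N & l%:R < u <= l.+1%:R.
Proof.
elim: N => [|N IH] u0 uN; first by have := lt_le_trans u0 uN; rewrite ltxx.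
have [h|h] := leP u N%:R; last by exists N => //; rewrite h uN.
by have [l lN hl] := IH u0 h; exists l => //; exact: ltnW.
Qed.

(** Summation by parts of an increment sequence cut at l. *)
Lemma telescope_cut (g : nat -> R) (N l : nat) : (l < N)%N ->
  \sum_(k < N.+1) (if k == 0%N :> nat then g 0%N else g k - g k.-1) *
     ((k.-1 <= l)%N)%:R = g l.+1.
Proof.
move=> lN; have tel n : \sum_(k < n.+1) (if k == 0%N :> nat then g 0%N else g k - g k.-1) = g n.
  elim: n => [|n IH]; first by rewrite big_ord_recl big_ord0 addr0.
  by rewrite big_ord_recr/= IH addrC subrK.
rewrite -(tel l.+1) (big_ord_widen N.+1 (fun k => if k == 0%N then g 0%N else g k - g k.-1)); last by [].
rewrite [RHS]big_mkcond; apply: eq_bigr => k _.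
have -> : (k < l.+2)%N = (k.-1 <= l)%N by case: (nat_of_ord k).
by case: (_ <= l)%N; rewrite ?mulr1 ?mulr0.
Qed.

(** The polynomial is sampled on a grid of N points of [0, 1]; the jumps sum to at
    most its Lipschitz constant, plus its value at 0. The scale m does not enter,
    since total variation is invariant under affine changes of variable. The factor 2
    comes from the ends of the steps, all at the right end of the bin. *)
Lemma step_approx_piece q m (j : 'I_m) :
  step_approx (2 * (poly_sup q + poly_lip q)) (piece q j).
Proof.
have m0 : (0 < m)%N by case: m j => // -[].
have mR : 0 < m%:R :> R by rewrite ltr0n.
apply: step_approx_differences => e e0.
pose N := (Num.truncn (poly_lip q / e)).+1.
have N0 : 0 < N%:R :> R by rewrite ltr0n.
have Ne : poly_lip q / N%:R <= e.
  rewrite ler_pdivrMr// mulrC -ler_pdivrMr// ltW// truncnS_gt//.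
pose G (k : nat) : R := q.[k%:R / N%:R].
pose c (k : 'I_N.+1) : R := if k == 0%N :> nat then G 0%N else G k - G k.-1.
(* th k is the point of the bin at which the rescaled variable equals k / N *)
pose th (k : nat) : rat := ((j : nat)%:Q + k%:Q / N%:Q) / m%:Q.
exists N.+1, c, (fun k => th k.-1), (fun _ => th N).
have itvN (k : nat) : (k <= N)%N -> 0 <= (k%:R / N%:R : R) <= 1.
  by move=> kN; rewrite divr_ge0//= ler_pdivrMr// mul1r ler_nat.
split.
  rewrite ler_wpM2l// big_ord_recl/= /c/= lerD//.
    by apply: horner_le_sup; exact: itvN.
  apply: (@le_trans _ _ (\sum_(k < N) poly_lip q / N%:R)).
    apply: ler_sum => k _; rewrite /= /bump/= add1n.
    apply: le_trans (horner_lipschitz q (itvN _ _) (itvN _ _)) _.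
    - by rewrite ltn_ord.
    - by rewrite add0n ltnW.
    rewrite add0n ler_wpM2l ?poly_lip_ge0//= -mulrBl -natr1 addrAC subrr add0r mul1r.
    by rewrite ger0_norm// invr_ge0.
  by rewrite sumr_const card_ord -[leLHS]mulr_natr divfK// gt_eqF.
move=> y; set v := m%:R * y - j%:R.
have thE k : half_line (ratr (th k)) y = (v <= k%:R / N%:R)%R%:R :> R.
  rewrite /half_line indicE mem_setE in_itv/=; congr ((nat_of_bool _)%:R).
  rewrite /th rmorphM/= fmorphV/= rmorphD/= rmorphM/= fmorphV/= !ratr_nat.
  by rewrite ler_pdivlMr// /v lerBlDl [y * _]mulrC.
under eq_bigr do rewrite !thE.
have NN : N%:R / N%:R = 1 :> R by rewrite divff// gt_eqF.
rewrite NN /piece /poly01 -/v in_itv/=.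
have [v1|v1] := leP v 1; last first.
  rewrite andbF big1 ?subrr ?normr0 ?(ltW e0)// => k _.
  have -> : (v <= k.-1%:R / N%:R) = false.
    apply/negbTE; rewrite -ltNge; apply: le_lt_trans v1.
    rewrite ler_pdivrMr// mul1r ler_nat.
    by apply: leq_trans (leq_pred _) _; rewrite -ltnS.
  by rewrite subrr mulr0.
rewrite andbT; have [v0|v0] := leP v 0.
  rewrite big1 ?subrr ?normr0 ?(ltW e0)// => k _.
  have -> : (v <= k.-1%:R / N%:R) by apply: le_trans v0 _; rewrite divr_ge0.
  by rewrite subrr mulr0.
have u0 : 0 < N%:R * v by rewrite mulr_gt0.
have uN : N%:R * v <= N%:R by rewrite ler_piMr// ltW.
have [l lN /andP[l1 l2]] := exists_unit_cell u0 uN.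
have -> : \sum_(k < N.+1) c k * (1 - (v <= k.-1%:R / N%:R)%R%:R) = G l.+1.
  rewrite -(telescope_cut G lN); apply: eq_bigr => k _; congr (_ * _).
  have -> : (v <= k.-1%:R / N%:R) = ~~ (k.-1 <= l)%N.
    rewrite ler_pdivlMr// mulrC; apply/idP/idP.
      move=> h; rewrite -ltnNge -(ltr_nat R); exact: lt_le_trans l1 h.
    by rewrite -ltnNge -(ler_nat R) => h; exact: le_trans l2 h.
  by case: (_ <= l)%N; rewrite ?subr0 ?subrr.
apply: le_trans (horner_lipschitz q _ (itvN _ lN)) _; first by rewrite (ltW v0) v1.
apply: le_trans Ne; rewrite ler_wpM2l ?poly_lip_ge0//.
have -> : v - l.+1%:R / N%:R = (N%:R * v - l.+1%:R) / N%:R by rewrite mulrBl mulrAC divff ?mul1r// gt_eqF.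
rewrite normrM [`|_^-1|]ger0_norm ?invr_ge0// ler_piMl ?invr_ge0//.
rewrite distrC ger0_norm ?subr_ge0//; rewrite -natr1 in l2 *; lra.
Qed.

End polynomial_pieces.

(** * Variances of the partial sums *)

Section variance.
Context {d : measure_display} {T : measurableType d} {R : realType}.
Context {P : probability T R} (Y : int -> {RV P >-> R}).
Hypothesis hY : strictly_stationary Y.
Local Notation F0 := (g_sigma_algebraType (past Y 0)).

Lemma fwd_square_le (J : finType) (h : J -> R -> R) j (l : nat) :
  (forall j, bmf (h j)) ->
  \int[P]_w (fwd Y h l.+1 j w ^+ 2) <=
  2 * l.+1%:R * \sum_(q < l.+1) `|\int[P]_w (cX Y h j 0 w * cX Y h j q%:Z w)|.
Proof.
move=> bh; set n := l.+1.
have bX i : bmf (cX Y h j i) by exact: bmf_cX.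
pose e (q : nat) : R := `|\int[P]_w (cX Y h j 0 w * cX Y h j q%:Z w)|.
have -> : \int[P]_w (fwd Y h n j w ^+ 2) =
    \sum_(i < n) \sum_(i' < n) \int[P]_w (cX Y h j i.+1%:Z w * cX Y h j i'.+1%:Z w).
  rewrite (eq_Rintegral _ (f := fun w => fwd Y h n j w ^+ 2)
    (g := fun w => \sum_(i < n) \sum_(i' < n) cX Y h j i.+1%:Z w * cX Y h j i'.+1%:Z w)); last first.
    by move=> w _; rewrite expr2 /fwd mulr_suml; apply: eq_bigr => i _; rewrite mulr_sumr.
  rewrite Ex_sum; last by move=> i; apply: bmf_sum => i'; apply: bmfM.
  by apply: eq_bigr => i _; rewrite Ex_sum// => i'; apply: bmfM.
have le1 (i i' : nat) : (i <= i')%N ->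
   `|\int[P]_w (cX Y h j i'.+1%:Z w * cX Y h j i.+1%:Z w)| = e (i' - i)%N.
  by move=> ii; rewrite /e -(cov_stat hY bh j i.+1 (i' - i)) addSn subnKC.
pose f (i i' : nat) : R := if (i <= i')%N then e (i' - i)%N else 0.
have f0 i i' : 0 <= f i i' by rewrite /f; case: ifP => // _; rewrite /e normr_ge0.
apply: (@le_trans _ _ (\sum_(i < n) \sum_(i' < n) (f i i' + f i' i))).
  apply: ler_sum => i _; apply: ler_sum => i' _; apply: le_trans (ler_norm _) _.
  have [ii|ii] := leqP i i'.
    apply: (@le_trans _ _ (f i i')); last by rewrite lerDl.
    rewrite /f ii -(le1 _ _ ii) le_eqVlt; apply/orP; left; apply/eqP; congr (`|_|).
    by apply: eq_Rintegral => w _; rewrite mulrC.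
  apply: (@le_trans _ _ (f i' i)); last by rewrite lerDr.
  by rewrite /f (ltnW ii) (le1 _ _ (ltnW ii)).
have -> : \sum_(i < n) \sum_(i' < n) (f i i' + f i' i) =
    \sum_(i < n) \sum_(i' < n) f i i' + \sum_(i < n) \sum_(i' < n) f i' i.
  by rewrite -big_split; apply: eq_bigr => i _; rewrite big_split.
have h1 : \sum_(i < n) \sum_(i' < n) f i i' <= n%:R * \sum_(q < n) e q.
  apply: (@le_trans _ _ (\sum_(i < n) \sum_(q < n) e q)).
    by apply: ler_sum => i _; apply: sum_lag_le => q; exact: normr_ge0.
  by rewrite sumr_const card_ord -[leLHS]mulr_natl.
rewrite -mulrA mulrDl mul1r lerD//; by rewrite exchange_big.
Qed.

(** With I the indicator of a bin, this bounds E (I B) by cutting B at the level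
    nu * mu: below it E I is bounded through the density, above it B is at most a
    multiple of B^(p-1). The level mu balances the three contributions F, the moment
    of order p - 1, and 1 / m, all of which are summable over the bins. *)
Lemma truncated_moment (p m F N' : R) (I B : T -> R) : 2 < p -> 0 < m -> 0 <= F ->
  0 < N' -> bmf I -> (forall w, 0 <= I w) -> bmf B -> (forall w, 0 <= B w) ->
  (forall mu, 0 < mu -> \int[P]_w I w <= mu / m + mu `^ (1 - p) * F) ->
  (\int[P]_w (I w * B w)) `^ (p / 2) <=
  (2 * N' `^ (p - 1)^-1) `^ (p / 2) *
   (m `^ (1 - p / 2) *
     (N'^-1 * (\int[P]_w (I w * B w `^ (p - 1))) + F + m^-1)).
Proof.
move=> p2 m0 F0 N'0 bI I0 bB B0 HF.
have p0 : 0 < p by exact: lt_trans p2.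
have p1 : 0 < p - 1 by rewrite subr_gt0 (lt_trans _ p2)// ltr1n.
have p20 : 0 < p - 2 by rewrite subr_gt0.
have bBp : bmf (fun w => B w `^ (p - 1)) by apply: bmf_powR => //; exact: ltW.
set A := N'^-1 * _; set g := A + F + m^-1.
have A0 : 0 <= A.
  by rewrite mulr_ge0 ?invr_ge0 ?(ltW N'0)// Ex_ge0// => w; rewrite mulr_ge0 ?powR_ge0.
have g0 : 0 < g by rewrite ltr_wpDl ?invr_gt0// addr_ge0.
(* this level makes mu^2 / m equal to mu^(2 - p) g *)
pose mu := (m * g) `^ p^-1.
have mu0 : 0 < mu by rewrite powR_gt0// mulr_gt0.
have muE : mu `^ p = m * g by rewrite powR_root ?gt_eqF// mulr_ge0 ?ltW.
pose nu := N' `^ (p - 1)^-1.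
have nu0 : 0 < nu by rewrite powR_gt0.
have nuE : nu `^ (p - 1) = N' by rewrite powR_root ?gt_eqF ?ltW.
have mu2 : mu `^ (2 - p) = mu ^+ 2 * (m * g)^-1.
  by rewrite powRB ?(gt_eqF mu0) ?implybT// muE -powR_mulrn// ltW.
clearbody mu.
have key : \int[P]_w (I w * B w) <= 2 * nu * (mu ^+ 2 / m).
  apply: (@le_trans _ _ (\int[P]_w (nu * mu * I w + nu * mu `^ (2 - p) * N'^-1 * (I w * B w `^ (p - 1))))).
    apply: Ex_le; [by bmf_tac|by bmf_tac|] => w.
    have bw : B w <= nu * mu + nu * mu `^ (2 - p) * N'^-1 * B w `^ (p - 1).
      have r0 : 0 <= nu * mu `^ (2 - p) * N'^-1 * B w `^ (p - 1).
        by rewrite !mulr_ge0 ?powR_ge0 ?invr_ge0 ?(ltW nu0) ?(ltW N'0).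
      have [h|h] := leP (B w) (nu * mu); first by rewrite (le_trans h)// lerDl.
      have Bw : 0 < B w by apply: lt_trans h; rewrite mulr_gt0.
      apply: (@le_trans _ _ (nu * mu `^ (2 - p) * N'^-1 * B w `^ (p - 1))); last first.
        by rewrite lerDr mulr_ge0 ?ltW.
      have -> : nu * mu `^ (2 - p) * N'^-1 = (nu * mu) `^ (2 - p).
        rewrite powRM ?(ltW nu0) ?(ltW mu0)// -nuE -powRN -{1}(powRr1 (ltW nu0)).
        rewrite mulrAC -powRD ?(gt_eqF nu0) ?implybT//; congr (_ `^ _ * _); ring.
      have -> : 2 - p = - (p - 2) by ring.
      rewrite powRN -ler_pdivrMl ?invr_gt0 ?powR_gt0 ?mulr_gt0// invrK.
      have -> : p - 1 = (p - 2) + 1 by ring.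
      rewrite [leRHS]powRD ?(gt_eqF Bw) ?implybT// powRr1 ?(ltW Bw)// ler_wpM2r ?(ltW Bw)//.
      by rewrite le_powR_base ?(ltW p20) ?mulr_ge0 ?(ltW nu0) ?(ltW mu0) ?(ltW h).
    have := ler_wpM2l (I0 w) bw; rewrite mulrDr => h; apply: le_trans h _.
    by rewrite le_eqVlt; apply/orP; left; apply/eqP; ring.
  rewrite ExD; [|by bmf_tac|by bmf_tac].
  rewrite !ExZ; [|by bmf_tac|by bmf_tac].
  set II := \int[P]_w (I w * _).
  have -> : nu * mu `^ (2 - p) * N'^-1 * II = nu * (mu `^ (2 - p) * A) by rewrite /A -!mulrA.
  have h1 := HF mu mu0.
  have h2 : nu * mu * (\int[P]_w I w) <= nu * (mu ^+ 2 / m + mu `^ (2 - p) * F).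
    rewrite -mulrA ler_wpM2l ?(ltW nu0)//; apply: le_trans (ler_wpM2l (ltW mu0) h1) _.
    rewrite mulrDr mulrA -expr2 lerD2l mulrA ler_wpM2r//.
    rewrite -{1}(powRr1 (ltW mu0)) -powRD ?(gt_eqF mu0) ?implybT//.
    by rewrite le_eqVlt; apply/orP; left; apply/eqP; congr (_ `^ _); ring.
  apply: le_trans (lerD h2 (lexx _)) _.
  have h3 : mu `^ (2 - p) * (A + F) <= mu ^+ 2 / m.
    rewrite mu2 -mulrA ler_wpM2l ?sqr_ge0// invfM mulrC mulrA.
    rewrite mulrAC ler_piMl ?invr_ge0 ?(ltW m0)// ler_pdivrMr// mul1r /g lerDl invr_ge0 ltW//.
  have -> : nu * (mu ^+ 2 / m + mu `^ (2 - p) * F) + nu * (mu `^ (2 - p) * A) =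
     nu * (mu ^+ 2 / m + mu `^ (2 - p) * (A + F)) by ring.
  have -> : 2 * nu * (mu ^+ 2 / m) = nu * (mu ^+ 2 / m + mu ^+ 2 / m) by ring.
  by rewrite ler_wpM2l ?(ltW nu0)// lerD2l.
apply: (@le_trans _ _ ((2 * nu * (mu ^+ 2 / m)) `^ (p / 2))).
  apply: le_powR_base => //; first by rewrite divr_ge0 ?ltW.
  by apply: Ex_ge0 => w; rewrite mulr_ge0.
have m2 : 0 <= mu ^+ 2 / m by rewrite divr_ge0 ?sqr_ge0 ?ltW.
have nu20 : 0 <= 2 * nu by rewrite mulr_ge0 ?ltW.
rewrite (powRM _ nu20 m2) ler_wpM2l ?powR_ge0//.
rewrite powRM ?sqr_ge0 ?invr_ge0 ?(ltW m0)//.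
have -> : (mu ^+ 2) `^ (p / 2) = m * g.
  rewrite -powR_mulrn ?(ltW mu0)// -powRrM.
  have -> : 2%:R * (p / 2) = p by field.
  exact: muE.
have -> : m^-1 `^ (p / 2) = m `^ (- (p / 2)).
  by rewrite -(powR_inv1 (ltW m0)) -powRrM mulN1r.
rewrite mulrAC -{1}(powRr1 (ltW m0)) -powRD ?(gt_eqF m0) ?implybT//.
Qed.

Variables (D : nat -> F0 -> R) (beta : nat -> R).
Hypothesis bD : forall q, bmf (D q).
Hypothesis D01 : forall q w, 0 <= D q w <= 1.
Hypothesis mD : forall q, \int[P]_w D q w <= beta q.
Variables (p N ga V B : R) (r : nat) (Q : 'I_r.+1 -> {poly R}).
Hypothesis p2 : 2 < p.
Hypothesis V0 : 0 <= V.
Hypothesis N0 : 0 <= N.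
Hypothesis ga0 : 0 <= ga.
Hypothesis hN : forall n : nat,
  \sum_(q < n.+2) q.+1%:R `^ (p - 2) * beta q <= N * n.+1%:R `^ ga.
Hypothesis hB : forall i, poly_sup (Q i) <= B.

Definition pieces (m : nat) (ij : 'I_r.+1 * 'I_m) : R -> R := piece (Q ij.1) ij.2.
Definition dep_or1 (q : nat) (w : T) : R := if q == 0%N then 1 else D q w.
Definition dep_sum (l : nat) (w : T) : R := \sum_(q < l.+1) dep_or1 q w.

Let pastT := @past_measurable _ _ _ P Y 0.
Let toT (g : F0 -> R) : bmf g -> bmf (g : T -> R) := @sub_bmf _ T R _ pastT g.

Lemma bmf_dep_or1 q : bmf (dep_or1 q).
Proof. by rewrite /dep_or1; case: (q == 0%N); [exact: bmf_cst|exact: toT]. Qed.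

Lemma dep_or1_itv q w : 0 <= dep_or1 q w <= 1.
Proof. by rewrite /dep_or1; case: (q == 0%N); rewrite ?lexx ?ler01// D01. Qed.

Lemma bmf_dep_sum l : bmf (dep_sum l).
Proof. by apply: bmf_sum => q; exact: bmf_dep_or1. Qed.

Lemma dep_sum_ge0 l w : 0 <= dep_sum l w.
Proof. by apply: sumr_ge0 => q _; case/andP: (dep_or1_itv q w). Qed.

Lemma beta_nonneg q : 0 <= beta q.
Proof. by apply: le_trans (mD q); apply: Ex_ge0 => w; case/andP: (D01 q w). Qed.

(** The moment of order p - 1 is bounded pointwise by the sum of the D q with
    weights (q + 1)^(p - 2), which the hypothesis controls. *)
Lemma dep_sum_moment : exists2 C, 0 < C & forall l,
  \int[P]_w (dep_sum l w `^ (p - 1)) <= C * l.+1%:R `^ ga.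
Proof.
have p1 : 1 <= p - 1 by rewrite lerBrDr (le_trans _ (ltW p2)).
have [C C0 HC] := powR_sum_weighted p1.
exists (C * (1 + N)); first by rewrite mulr_gt0// ltr_wpDr.
move=> l.
have e1 : p - 1 - 1 = p - 2 by ring.
have bdp : bmf (fun w => dep_sum l w `^ (p - 1)).
  apply: bmf_powR; [exact: le_trans p1|exact: dep_sum_ge0|exact: bmf_dep_sum].
have bt q : bmf (fun w => dep_or1 q w * q.+1%:R `^ (p - 2)).
  by apply: bmfM; [exact: bmf_dep_or1|exact: bmf_cst].
apply: (@le_trans _ _ (\int[P]_w (C * \sum_(q < l.+1) dep_or1 q w * q.+1%:R `^ (p - 2)))).
  apply: Ex_le => //.
    by apply: bmfM; [exact: bmf_cst|apply: bmf_sum => q; exact: bt].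
  by move=> w; have := HC l.+1 (fun q => dep_or1 q w) (fun q => dep_or1_itv q w); rewrite e1.
rewrite ExZ; last by apply: bmf_sum => q; exact: bt.
rewrite -mulrA ler_wpM2l ?(ltW C0)// Ex_sum//.
have lg1 : 1 <= l.+1%:R `^ ga :> R by rewrite -[leLHS](one_powR ga) le_powR_base// ler1n.
apply: (@le_trans _ _ (1 + \sum_(q < l.+2) q.+1%:R `^ (p - 2) * beta q)); last first.
  by rewrite mulrDl mul1r lerD.
rewrite big_ord_recl/= {1}/dep_or1/=.
rewrite (eq_Rintegral _ (f := fun w => 1 * 1 `^ (p - 2)) (g := fun _ => 1)); last first.
  by move=> w _; rewrite one_powR mul1r.
rewrite Ex_cst lerD2l big_ord_recl/= ler_wpDl ?mulr_ge0 ?powR_ge0 ?beta_nonneg//.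
rewrite big_ord_recr/= ler_wpDr ?mulr_ge0 ?powR_ge0 ?beta_nonneg//.
apply: ler_sum => q _.
rewrite /bump/= add1n.
rewrite (eq_Rintegral _ (f := fun w : T => dep_or1 q.+1 w * q.+2%:R `^ (p - 2)) (g := fun w : T => q.+2%:R `^ (p - 2) * D q.+1 w)); last first.
  by move=> w _; rewrite /dep_or1/= mulrC.
by rewrite ExZ ?ler_wpM2l ?powR_ge0//; exact: toT.
Qed.

Lemma in_bin_bmf m (j : 'I_m) : bmf (fun y : R => (in_bin j y)%:R : R).
Proof.
have := @bmf_indic R _ _ _ (measurable_itv `]0%R, 1%R]) : bmf (\1_([set` `]0%R, 1%R]]) : R -> R).
move=> b1; have := bmf_comp b1 (@measurable_affine R m%:R j%:R).
congr bmf; apply/funext => y; rewrite indicE mem_setE /in_bin//.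
Qed.

Definition bin_of m (j : 'I_m) (w : T) : R := (in_bin j (Y 0 w))%:R.

Lemma bmf_bin_of m (j : 'I_m) : bmf (bin_of j).
Proof. by apply: bmf_comp (in_bin_bmf j) _; exact: measurable_funPT. Qed.

(** In the covariance at lag q the past variable h_ij(Y_0) is kept as a factor. It
    vanishes outside the bin, so that D q is only integrated over the event that Y_0
    lies in the bin. *)
Lemma fwd_square_pieces m (ij : 'I_r.+1 * 'I_m) l :
  (forall ij q (z : F0 -> R), bmf z -> (forall w, 0 <= z w) ->
    `|\int[P]_w (z w * cX Y (@pieces m) ij q%:Z w)| <= V * \int[P]_w (z w * D q w)) ->
  \int[P]_w (fwd Y (@pieces m) l.+1 ij w ^+ 2) <=
  2 * (V * B + B ^+ 2) * l.+1%:R * \int[P]_w (bin_of ij.2 w * dep_sum l w).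
Proof.
move=> H1.
have B0 : 0 <= B by apply: le_trans (hB ord0); exact: poly_sup_ge0.
have bh k : bmf (@pieces m k) by exact: bmf_piece.
have hle y : `|pieces ij y| <= B * (in_bin ij.2 y)%:R.
  by apply: le_trans (piece_le _ _ _) _; rewrite ler_wpM2r.
have bX i := bmf_cX Y bh ij i.
have bh0 : bmf (fun w : F0 => pieces ij (Y 0 w)).
  by apply: bmf_comp (bh ij) _; exact: measurable_past.
have bh0T := toT bh0.
have bI := bmf_bin_of ij.2.
apply: le_trans (fwd_square_le ij l bh) _.
have -> : 2 * (V * B + B ^+ 2) * l.+1%:R * (\int[P]_w (bin_of ij.2 w * dep_sum l w)) =
  2 * l.+1%:R * \sum_(q < l.+1) ((V * B + B ^+ 2) * \int[P]_w (bin_of ij.2 w * dep_or1 q w)).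
  rewrite -mulr_sumr -Ex_sum; last by move=> q; apply: bmfM => //; exact: bmf_dep_or1.
  have -> : \int[P]_w (bin_of ij.2 w * dep_sum l w) = \int[P]_w (\sum_(q < l.+1) bin_of ij.2 w * dep_or1 q w).
    by apply: eq_Rintegral => w _; rewrite mulr_sumr.
  ring.
rewrite ler_wpM2l ?mulr_ge0//; apply: ler_sum => q _.
pose mu := mean_of Y (@pieces m) ij.
have E0 : \int[P]_w (cX Y (@pieces m) ij 0 w * cX Y (@pieces m) ij q%:Z w) =
    \int[P]_w (pieces ij (Y 0 w) * cX Y (@pieces m) ij q%:Z w).
  transitivity (\int[P]_w (pieces ij (Y 0 w) * cX Y (@pieces m) ij q%:Z w) - mu * \int[P]_w cX Y (@pieces m) ij q%:Z w).
    rewrite -ExZ// -ExB; [|exact: bmfM|by apply: bmfM => //; exact: bmf_cst].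
    by apply: eq_Rintegral => w _; rewrite {1}/cX /cen mulrBl.
  by rewrite (Ex_cX hY bh) mulr0 subr0.
have BI0 : 0 <= \int[P]_w (bin_of ij.2 w * dep_or1 q w).
  by apply: Ex_ge0 => w; rewrite mulr_ge0//; case/andP: (dep_or1_itv q w).
rewrite E0; have [q0|q0] := eqVneq (q : nat) 0%N.
  rewrite q0.
  have E1 : \int[P]_w (pieces ij (Y 0 w) * cX Y (@pieces m) ij 0 w) =
     \int[P]_w (pieces ij (Y 0 w) ^+ 2) - mu ^+ 2.
    have bsq := bmfX 2 bh0T.
    transitivity (\int[P]_w (pieces ij (Y 0 w) ^+ 2 - mu * pieces ij (Y 0 w))).
      by apply: eq_Rintegral => w _; rewrite /cX /cen -/mu; ring.
    by rewrite ExB ?ExZ//; bmf_tac.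
  have E2 : 0 <= \int[P]_w (pieces ij (Y 0 w) * cX Y (@pieces m) ij 0 w).
    have <- : \int[P]_w (cX Y (@pieces m) ij 0 w * cX Y (@pieces m) ij 0 w) =
       \int[P]_w (pieces ij (Y 0 w) * cX Y (@pieces m) ij 0 w) by move: E0; rewrite q0.
    by apply: Ex_ge0 => w; rewrite -expr2 sqr_ge0.
  rewrite ger0_norm// E1; apply: (@le_trans _ _ (\int[P]_w (pieces ij (Y 0 w) ^+ 2))).
    by rewrite gerBl sqr_ge0.
  apply: (@le_trans _ _ (B ^+ 2 * \int[P]_w (bin_of ij.2 w * dep_or1 0 w))); last first.
    by move: BI0; rewrite q0 => BI00; rewrite ler_wpM2r// lerDr mulr_ge0.
  have bd0 := bmf_dep_or1 0.
  rewrite -ExZ; last by bmf_tac.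
  apply: Ex_le; [exact: bmfX|by bmf_tac|] => w.
  rewrite /dep_or1/= mulr1 -real_normK ?num_real//.
  have := hle (Y 0 w); rewrite /bin_of; case: (in_bin _ _).
    by rewrite !mulr1 => h; rewrite lerXn2r ?nnegrE.
  by rewrite !mulr0 => h; rewrite (le_anti (introT andP (conj h (normr_ge0 _)))) expr0n.
have bDq := toT (bD q).
have bDq0 := bmf_dep_or1 q.
have bh0n := bmf_norm bh0T.
have hs := one_dep_signed bh V0 bD H1 ij q bh0.
apply: (le_trans hs).
apply: (@le_trans _ _ (V * B * \int[P]_w (bin_of ij.2 w * dep_or1 q w))).
  rewrite -mulrA ler_wpM2l// -ExZ; last by bmf_tac.
  apply: Ex_le; [exact: bmfM|by bmf_tac|] => w.
  rewrite /dep_or1 (negbTE q0) mulrA ler_wpM2r//; by case/andP: (D01 q w).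
by rewrite ler_wpM2r// lerDl sqr_ge0.
Qed.

(** Each variance is of order l / m up to the dependence factor, as for bins of
    probability 1 / m and independent variables, and there are m bins. *)
Lemma variance_sum : exists2 K : R, 0 <= K & forall m (F : 'I_m -> R) (Fp : R),
  (forall ij q (z : F0 -> R), bmf z -> (forall w, 0 <= z w) ->
    `|\int[P]_w (z w * cX Y (@pieces m) ij q%:Z w)| <= V * \int[P]_w (z w * D q w)) ->
  (0 < m)%N -> (forall j, 0 <= F j) -> \sum_j F j <= Fp ->
  (forall j mu, 0 < mu ->
    \int[P]_w bin_of j w <= mu / m%:R + mu `^ (1 - p) * F j) ->
  forall l : nat, \sum_ij (\int[P]_w (fwd Y (@pieces m) l.+1 ij w ^+ 2)) `^ (p / 2) <=
    K * ((2 + Fp) * m%:R `^ (1 - p / 2)) * l.+1%:R `^ (p / 2 + ga * (p / (2 * (p - 1)))).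
Proof.
have [C C0 HC] := dep_sum_moment.
have B0 : 0 <= B by apply: le_trans (hB ord0); exact: poly_sup_ge0.
pose c0 : R := 2 * (V * B + B ^+ 2).
have c00 : 0 <= c0 by rewrite mulr_ge0// addr_ge0 ?sqr_ge0// mulr_ge0.
pose c1 : R := 2 * C `^ (p - 1)^-1.
have c10 : 0 <= c1 by rewrite mulr_ge0 ?powR_ge0.
exists (r.+1%:R * (c0 `^ (p / 2) * c1 `^ (p / 2))).
  by rewrite mulr_ge0// mulr_ge0// powR_ge0.
move=> m F Fp H1 m0 F0' hF hI l.
have mR : 0 < m%:R :> R by rewrite ltr0n.
have p0 : 0 < p by exact: lt_trans p2.
have p1 : 0 < p - 1 by rewrite subr_gt0 (lt_trans _ p2)// ltr1n.
have p20 : 0 <= p / 2 by rewrite divr_ge0 ?ltW.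
pose L : R := l.+1%:R.
have L0 : 0 < L by rewrite ltr0n.
pose N' : R := C * L `^ ga.
have N'0 : 0 < N' by rewrite mulr_gt0// powR_gt0.
have bds := bmf_dep_sum l; have ds0 := dep_sum_ge0 l.
have bdp : bmf (fun w => dep_sum l w `^ (p - 1)) by apply: bmf_powR => //; exact: ltW.
pose A (j : 'I_m) : R := \int[P]_w (bin_of j w * dep_sum l w `^ (p - 1)).
pose c2 : R := c0 `^ (p / 2) * L `^ (p / 2) * ((2 * N' `^ (p - 1)^-1) `^ (p / 2) * m%:R `^ (1 - p / 2)).
have c20 : 0 <= c2 by rewrite !mulr_ge0 ?powR_ge0.
have step (ij : 'I_r.+1 * 'I_m) :
   (\int[P]_w (fwd Y (@pieces m) l.+1 ij w ^+ 2)) `^ (p / 2) <=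
   c2 * (N'^-1 * A ij.2 + F ij.2 + m%:R^-1).
  have bI := bmf_bin_of ij.2.
  have I0 w : 0 <= bin_of ij.2 w by rewrite /bin_of.
  have E0 : 0 <= \int[P]_w (bin_of ij.2 w * dep_sum l w).
    by apply: Ex_ge0 => w; rewrite mulr_ge0.
  have h1 := fwd_square_pieces ij l H1.
  have h2 := truncated_moment p2 mR (F0' ij.2) N'0 bI I0 bds ds0 (hI ij.2).
  apply: (@le_trans _ _ ((c0 * L * \int[P]_w (bin_of ij.2 w * dep_sum l w)) `^ (p / 2))).
    apply: le_powR_base => //; apply: Ex_ge0 => w; exact: sqr_ge0.
  have cL : 0 <= c0 * L by rewrite mulr_ge0// ltW.
  rewrite (powRM _ cL E0) (powRM _ c00 (ltW L0)) /c2 -[leRHS]mulrA.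
  by rewrite ler_wpM2l ?mulr_ge0 ?powR_ge0// -mulrA.
apply: le_trans (ler_sum _ (fun ij _ => step ij)) _.
rewrite -(pair_big xpredT xpredT (fun _ j => c2 * (N'^-1 * A j + F j + m%:R^-1)))/=.
rewrite sumr_const card_ord -[leLHS]mulr_natl -mulr_sumr.
have sA : \sum_j A j <= N'.
  apply: le_trans (HC l); rewrite -Ex_sum; last first.
    by move=> j; apply: bmfM => //; exact: bmf_bin_of.
  apply: Ex_le => //; first by apply: bmf_sum => j; apply: bmfM => //; exact: bmf_bin_of.
  move=> w; rewrite -mulr_suml ler_piMl ?powR_ge0//; exact: sum_in_bin.
have s1 : \sum_j (N'^-1 * A j + F j + m%:R^-1) <= 2 + Fp.
  rewrite !big_split/= -mulr_sumr sumr_const card_ord -[m%:R^-1 *+ m]mulr_natl.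
  rewrite mulfV ?gt_eqF//.
  have : N'^-1 * \sum_j A j <= 1 by rewrite mulrC ler_pdivrMr// mul1r.
  by move=> h; have := lerD (lerD h hF) (lexx 1); move=> h'; apply: le_trans h' _; lra.
apply: (@le_trans _ _ (r.+1%:R * (c2 * (2 + Fp)))).
  by rewrite ler_wpM2l// ler_wpM2l.
rewrite le_eqVlt; apply/orP; left; apply/eqP.
have -> : c2 = c0 `^ (p / 2) * c1 `^ (p / 2) * m%:R `^ (1 - p / 2) *
    L `^ (p / 2 + ga * (p / (2 * (p - 1)))).
  rewrite /c2 [L `^ (_ + _)]powRD ?(gt_eqF L0) ?implybT//.
  have -> : 2 * N' `^ (p - 1)^-1 = c1 * L `^ (ga * (p - 1)^-1).
    by rewrite /N' powRM ?powR_ge0 ?(ltW C0)// -powRrM /c1 mulrA.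
  rewrite powRM ?powR_ge0// -powRrM.
  have -> : ga * (p - 1)^-1 * (p / 2) = ga * (p / (2 * (p - 1))).
    by field; rewrite gt_eqF.
  ring.
ring.
Qed.

End variance.

(** * Densities and bins *)

Section real_integrable.
Context {d} {T : measurableType d} {R : realType} (mu : {measure set T -> \bar R}).
Variables (D : set T) (mD : measurable D).
Implicit Types g h : T -> R.

Definition rint g := mu.-integrable D (EFin \o g).

Lemma rint_measurable g : rint g -> measurable_fun D g.
Proof. by move=> /measurable_int/measurable_EFinP. Qed.

Lemma rintD g h : rint g -> rint h -> rint (fun x => g x + h x).
Proof. by move=> ig ih; have := integrableD mD ig ih; apply: eq_integrable. Qed.

Lemma rintZ c g : rint g -> rint (fun x => c * g x).
Proof. by move=> ig; have := integrableZl mD c ig; apply: eq_integrable. Qed.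

Lemma rintN g : rint g -> rint (fun x => - g x).
Proof.
by move=> ig; have := rintZ (-1) ig; apply: eq_integrable => // x _ /=; rewrite mulN1r.
Qed.

Lemma rintB g h : rint g -> rint h -> rint (fun x => g x - h x).
Proof. by move=> ig ih; apply: rintD => //; exact: rintN. Qed.

Lemma rint0 : rint (fun _ => 0).
Proof. exact: integrable0. Qed.

Lemma rint_sum (I : Type) (s : seq I) (g : I -> T -> R) : (forall i, rint (g i)) ->
  rint (fun x => \sum_(i <- s) g i x).
Proof.
move=> ig; elim: s => [|i s IH].
  by under [X in rint X]funext do rewrite big_nil; exact: rint0.
by under [X in rint X]funext do rewrite big_cons; exact: rintD.
Qed.

Lemma rint_norm g : rint g -> rint (fun x => `|g x|).
Proof. by move=> ig; have := integrable_abse ig; apply: eq_integrable. Qed.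

Lemma rint_le g h : measurable_fun D g -> (forall x, D x -> `|g x| <= h x) ->
  rint h -> rint g.
Proof.
move=> mg gh ih; apply: le_integrable ih => //; first exact/measurable_EFinP.
by move=> x Dx /=; rewrite lee_fin (le_trans (gh x Dx))// ler_norm.
Qed.

Lemma rint_bmf h g : bmf h -> rint g -> rint (fun x => h x * g x).
Proof.
move=> [mh [M hM]] ig; apply: (@rint_le _ (fun x => M * `|g x|)).
- apply: measurable_funM; first exact: measurable_funTS.
  exact: rint_measurable.
- by move=> x _; rewrite normrM ler_wpM2r.
- by apply: rintZ; exact: rint_norm.
Qed.

Lemma rint_Rintegral_sum (I : Type) (s : seq I) (g : I -> T -> R) :
  (forall i, rint (g i)) ->
  \int[mu]_(x in D) (\sum_(i <- s) g i x) = \sum_(i <- s) \int[mu]_(x in D) g i x.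
Proof.
move=> ig; elim: s => [|i s IH].
  by under eq_Rintegral do rewrite big_nil; rewrite big_nil Rintegral_cst// mul0r.
under eq_Rintegral do rewrite big_cons.
by rewrite big_cons (RintegralD mD (ig i) (rint_sum s ig)) IH.
Qed.

End real_integrable.

Section finite_set_integrable.
Context {d} {T : measurableType d} {R : realType} (mu : {measure set T -> \bar R}).
Variables (D : set T) (mD : measurable D).
Hypothesis muD : (mu D < +oo)%E.

Lemma rint_of_bmf (g : T -> R) : bmf g -> rint mu D g.
Proof.
move=> [mg [M gM]]; apply: (@rint_le _ _ _ mu D mD g (cst M)).
- exact: measurable_funTS.
- by move=> x _; exact: gM.
- apply/integrableP; split; first by apply/measurable_EFinP; exact: measurable_cst.
  by rewrite (eq_integral (cst `|M|%:E))// integral_cst// lte_mul_pinfty.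
Qed.

End finite_set_integrable.

(** The Lebesgue measure lives on a copy of the real line whose display differs
    from the default one; the two sigma-algebras coincide. *)
Lemma bmf_lam {R : realType} (h : R -> R) : bmf h -> @bmf R _ (measurableTypeR R) h.
Proof. by move=> [? ?]; split. Qed.

Lemma lebesgue01 {R : realType} : (@lebesgue_measure R `[0%R, 1%R] < +oo)%E.
Proof. by rewrite lebesgue_measure_itv/= lte_fin ltr01 ltry. Qed.

Lemma rint01 {R : realType} (g : R -> R) : bmf g -> rint (@lebesgue_measure R) `[0, 1] g.
Proof.
by move=> bg; apply: rint_of_bmf (bmf_lam bg); [exact: measurable_itv|exact: lebesgue01].
Qed.

Section density.
Context {d : measure_display} {T : measurableType d} {R : realType}.
Context {P : probability T R} (X : {RV P >-> R}) (f : R -> R).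
Hypothesis hf : is_density X f.
Local Notation lam := (@lebesgue_measure R).

Lemma density_rint : rint lam setT f.
Proof.
case: hf => f0 mf Hf; apply/integrableP; split; first exact/measurable_EFinP.
have := Hf setT measurableT; rewrite probability_setT => h.
under eq_integral do rewrite /= ger0_norm//.
by rewrite -h ltry.
Qed.

Lemma distribution_dominated : distribution P X `<< lam.
Proof.
case: hf => f0 mf Hf; apply/null_content_dominatesP => A mA A0.
rewrite Hf//; apply: null_set_integral => //.
by apply/measurable_EFinP; exact: measurable_funTS.
Qed.

(** The density is the Radon-Nikodym derivative of the law, almost everywhere. *)
Lemma Ex_density (h : R -> R) : bmf h ->
  \int[P]_w h (X w) = \int[lam]_x (h x * f x).
Proof.
move=> bh; have [mh hM] := bh; case: (hf) => f0 mf Hf.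
have mX : measurable_fun setT (X : T -> measurableTypeR R) := measurable_funPT X.
pose X' : {RV P >-> measurableTypeR R} := HB.pack (X : T -> measurableTypeR R)
  (isMeasurableFun.Build _ _ T (measurableTypeR R) (X : T -> measurableTypeR R) mX).
have bh' := bmf_lam bh.
transitivity (\int[distribution P X']_y h y); first by rewrite (Ex_distribution X' bh').
rewrite /Rintegral; congr fine.
have ih : (distribution P X').-integrable setT (EFin \o h) by exact: bmf_integrable.
have dom : distribution P X' `<< lam by exact: distribution_dominated.
have RN := @Radon_Nikodym_change_of_variables _ (measurableTypeR R) R
  (distribution P X') (@lebesgue_measure R) dom _ _ measurableT ih.
rewrite -RN.
under [RHS]eq_integral do rewrite EFinM.
apply: ae_eq_integral => //.
- apply: emeasurable_funM => //; exact/measurable_EFinP.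
- by apply: emeasurable_funM => //; apply/measurable_EFinP.
apply: ae_eqe_mul2l => /=.
rewrite Radon_NikodymE//=.
case: cid => /= g [h1 h2 h3].
apply: integral_ae_eq => //=; first exact/measurable_EFinP.
by move=> E _ mE; rewrite -h3//= -Hf.
Qed.

End density.

Section bins.
Context {R : realType}.
Local Notation lam := (@lebesgue_measure R).
Variables (m : nat) (m0 : (0 < m)%N).

Let mR : 0 < m%:R :> R. Proof. by rewrite ltr0n. Qed.

Lemma in_binE (j : 'I_m) (y : R) :
  in_bin j y = (y \in `]j%:R / m%:R, j.+1%:R / m%:R]).
Proof.
rewrite /in_bin !in_itv/= ltr_pdivrMr// ler_pdivlMr// subr_gt0 lerBlDr nat1r.
by rewrite ![m%:R * y]mulrC.
Qed.

Lemma in_bin01 (j : 'I_m) (y : R) : in_bin j y -> 0 < y <= 1.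
Proof.
rewrite in_binE in_itv/= => /andP[a b]; apply/andP; split.
  by apply: le_lt_trans a; rewrite divr_ge0.
by apply: le_trans b _; rewrite ler_pdivrMr// mul1r ler_nat.
Qed.

Lemma bin_subset (j : 'I_m) : [set x : R | in_bin j x] `<=` `[0, 1].
Proof. by move=> y /= /in_bin01/andP[/ltW a b]; rewrite in_itv/= a. Qed.

Lemma bin_setE (j : 'I_m) :
  [set y : R | in_bin j y] = `]j%:R / m%:R, j.+1%:R / m%:R]%classic.
Proof. by apply/seteqP; split => y /=; rewrite in_binE. Qed.

Lemma measurable_bin (j : 'I_m) : measurable [set y : R | in_bin j y].
Proof. by rewrite bin_setE. Qed.

Lemma lebesgue_bin (j : 'I_m) : lam [set y : R | in_bin j y] = (m%:R^-1)%:E.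
Proof.
rewrite bin_setE lebesgue_measure_itv/= lte_fin ltr_pM2r ?invr_gt0// ltr_nat ltnSn.
by rewrite -EFinB -mulrBl -natr1 addrAC subrr add0r mul1r.
Qed.

Lemma exists_bin (y : R) : 0 < y <= 1 -> exists j : 'I_m, in_bin j y.
Proof.
move=> /andP[y0 y1].
have my : 0 < m%:R * y <= m%:R.
  by rewrite mulr_gt0//= -[leRHS]mulr1 ler_wpM2l// ltW.
have [j jm Hj] : exists2 j, (j < m)%N & j%:R < m%:R * y <= j.+1%:R.
  move: (m%:R * y) my => z; elim: (m) => [/andP[a b]|k IH /andP[a b]]; first by have := lt_le_trans a b; rewrite ltxx.
  have [h|h] := leP z k%:R; last by exists k => //; rewrite h.
  by have [j jk Hj] := IH (introT andP (conj a h)); exists j => //; exact: leq_trans jk _.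
exists (Ordinal jm); rewrite /in_bin in_itv/= subr_gt0 lerBlDr.
by case/andP: Hj => -> /=; rewrite nat1r.
Qed.

End bins.

Section density_bins.
Context {d : measure_display} {T : measurableType d} {R : realType}.
Context {P : probability T R} (Y : int -> {RV P >-> R}) (f : R -> R) (p : R).
Hypothesis hf : is_density (Y 0) f.
Local Notation lam := (@lebesgue_measure R).
Hypothesis p1 : 1 <= p.
Hypothesis fp : rint lam `[0, 1] (fun x => f x `^ p).
Variables (m : nat) (m0 : (0 < m)%N).

Definition bin_energy (j : 'I_m) : R := \int[lam]_(x in `[0, 1]) ((in_bin j x)%:R * f x `^ p).

Let mI : measurable (`[0%R, 1%R]%classic : set R). Proof. exact: measurable_itv. Qed.
Let bb (j : 'I_m) : @bmf R _ (measurableTypeR R) (fun y => (in_bin j y)%:R) := bmf_lam (in_bin_bmf j).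

Lemma bin_energy_ge0 j : 0 <= bin_energy j.
Proof. by apply: Rintegral_ge0 => x _; rewrite mulr_ge0 ?powR_ge0. Qed.

Lemma sum_bin_energy : \sum_j bin_energy j <= \int[lam]_(x in `[0, 1]) (f x `^ p).
Proof.
rewrite -rint_Rintegral_sum//; last by move=> j; exact: rint_bmf.
apply: le_Rintegral => //; first by apply: rint_sum => // j; exact: rint_bmf.
by move=> x _; rewrite -mulr_suml ler_piMl ?powR_ge0// sum_in_bin.
Qed.

(** f <= mu where f is below mu, and f <= mu^(1 - p) f^p elsewhere. *)
Lemma bin_energy_le (j : 'I_m) (mu : R) : 0 < mu ->
  \int[P]_w bin_of Y j w <= mu / m%:R + mu `^ (1 - p) * bin_energy j.
Proof.
move=> mu0; case: (hf) => f0 mf Hf.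
rewrite /bin_of (Ex_density hf (in_bin_bmf j)).
have -> : \int[lam]_x ((in_bin j x)%:R * f x) = \int[lam]_(x in `[0, 1]) ((in_bin j x)%:R * f x).
  rewrite [RHS]Rintegral_mkcond; apply: eq_Rintegral => x _.
  rewrite patchE; case: ifPn => // /negP; rewrite mem_setE => h.
  case: (boolP (in_bin j x)) => [hx|]; last by rewrite mul0r.
  by exfalso; apply: h; have := bin_subset m0 hx.
have e1 : mu / m%:R = mu * \int[lam]_(x in `[0, 1]) (in_bin j x)%:R.
  congr (_ * _).
  have -> : \int[lam]_(x in `[0, 1]) (in_bin j x)%:R = \int[lam]_(x in [set y | in_bin j y]) 1.
    rewrite Rintegral_mkcond [RHS]Rintegral_mkcond; apply: eq_Rintegral => x _.
    rewrite !patchE; case: (boolP (in_bin j x)) => hx.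
      by rewrite !mem_set//; exact: (bin_subset m0 hx).
    by rewrite if_same; case: ifPn => //; rewrite inE /= => h; rewrite h in hx.
  have mb : measurable [set y : R | in_bin j y] by exact: measurable_bin.
  transitivity (1 * fine (lam [set y : R | in_bin j y])); last by apply/esym; exact: Rintegral_cst.
  by rewrite mul1r lebesgue_bin.
have ib := rint01 (in_bin_bmf (R := R) j).
have ifp : rint lam `[0, 1] (fun x => (in_bin j x)%:R * f x `^ p) by exact: rint_bmf.
have iF : rint lam `[0, 1] f.
  have := density_rint hf; apply: integrableS => //.
rewrite e1 /bin_energy -!RintegralZl// -RintegralD//; [|exact: rintZ|exact: rintZ].
apply: le_Rintegral => //; first exact: rint_bmf.
  by apply: rintD => //; exact: rintZ.
move=> x _; rewrite mulrCA -[mu * _]mulrC -mulrDr ler_wpM2l//.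
have [h|h] := leP (f x) mu; first by rewrite (le_trans h)// lerDl mulr_ge0 ?powR_ge0.
apply: (@le_trans _ _ (mu `^ (1 - p) * f x `^ p)); last by rewrite lerDr ltW.
have fx : 0 < f x by exact: lt_trans h.
have -> : 1 - p = - (p - 1) by ring.
rewrite powRN -ler_pdivrMl ?invr_gt0 ?powR_gt0// invrK.
have {2}-> : p = (p - 1) + 1 by ring.
rewrite [leRHS]powRD ?(gt_eqF fx) ?implybT// powRr1 ?(ltW fx)// ler_wpM2r ?(ltW fx)//.
by rewrite le_powR_base ?subr_ge0 ?(ltW mu0) ?(ltW h).
Qed.

End density_bins.

(** * Weighted sums of the dependence coefficients *)

Section dependence_sums.
Context {d : measure_display} {T : measurableType d} {R : realType}.
Context {P : probability T R} (Y : int -> {RV P >-> R}).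
Hypothesis hY : strictly_stationary Y.
Variable k1 : nat -> R.-pker (g_sigma_algebraType (past Y 0)) ~> R.
Hypothesis hk1 : forall k : nat, is_cond_dist P (Y k%:Z) (k1 k).
Variable k2 : nat -> nat -> R.-pker (g_sigma_algebraType (past Y 0)) ~> (R * R)%type.
Hypothesis hk2 : forall i j : nat,
  is_cond_dist P (pairRV (Y i%:Z) (Y j%:Z)) (k2 i j).
Variables (p ga : R).
Hypothesis ga0 : 0 <= ga.
Hypothesis hbeta : ebigO
  (fun n => (\sum_(k < n.+1) (k.+1%:R `^ (p - 2))%R%:E * beta2 Y k1 k2 k)%E)
  (fun n => n%:R `^ ga).

Lemma beta2_ge0 k : (0 <= beta2 Y k1 k2 k)%E.
Proof.
apply: le_trans (dep1_beta _ _ k); rewrite lee_fin; apply: Ex_ge0 => w.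
by case/andP: (dep1_itv k1 k w).
Qed.

(** An infinite coefficient would make all later weighted sums infinite, against
    the asymptotic bound. *)
Lemma beta2_fin k : beta2 Y k1 k2 k \is a fin_num.
Proof.
rewrite ge0_fin_numE ?beta2_ge0//.
have [K [n0 _ HK]] := hbeta.
have := HK (maxn n0 k) (leq_maxl _ _).
set S := (\sum_(i < _) _)%E => h.
have t0 (i : nat) : (0 <= (i.+1%:R `^ (p - 2))%R%:E * beta2 Y k1 k2 i)%E.
  by rewrite mule_ge0 ?beta2_ge0// lee_fin powR_ge0.
have S0 : (0 <= S)%E by apply: sume_ge0 => i _; exact: t0.
have kS : (k < (maxn n0 k).+1)%N by rewrite ltnS leq_maxr.
have le1 : ((k.+1%:R `^ (p - 2))%R%:E * beta2 Y k1 k2 k <= S)%E.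
  rewrite /S (bigD1 (Ordinal kS))//= leeDl//.
  by apply: sume_ge0 => i _; exact: t0.
have c0 : 0 < k.+1%:R `^ (p - 2) :> R by rewrite powR_gt0.
have : ((k.+1%:R `^ (p - 2))%R%:E * beta2 Y k1 k2 k < +oo)%E.
  apply: le_lt_trans le1 _; rewrite -(gee0_abs S0).
  by apply: le_lt_trans h _; exact: ltry.
case: (beta2 Y k1 k2 k) (beta2_ge0 k) => [x _ _|_|//]; first exact: ltry.
by rewrite gt0_muley ?lte_fin.
Qed.

Definition betar (k : nat) : R := fine (beta2 Y k1 k2 k).

Lemma betarE k : (betar k)%:E = beta2 Y k1 k2 k.
Proof. by rewrite fineK// beta2_fin. Qed.

Lemma betar_ge0 k : 0 <= betar k.
Proof. by rewrite fine_ge0// beta2_ge0. Qed.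

Lemma dependence_bounds_beta2 : dependence_bounds (Y := Y) (dep1 k1) (dep2 k2) betar.
Proof.
split.
- exact: bmf_dep1.
- exact: dep1_itv.
- exact: bmf_dep2.
- exact: dep2_itv.
- by move=> q; rewrite -lee_fin betarE dep1_beta.
- by move=> a b ba; rewrite -lee_fin betarE dep2_beta.
Qed.

(** The asymptotic bound is extended to all n by enlarging the constant; the sum up
    to n + 1 is compared with (n + 1)^ga, so that no index 0 occurs. *)
Lemma weighted_sums_beta2 : exists2 N : R, 0 <= N & forall n : nat,
  \sum_(q < n.+2) q.+1%:R `^ (p - 2) * betar q <= N * n.+1%:R `^ ga.
Proof.
have [K [n0 _ HK]] := hbeta.
pose S n : R := \sum_(q < n.+1) q.+1%:R `^ (p - 2) * betar q.
have t0 (q : nat) : 0 <= q.+1%:R `^ (p - 2) * betar q :> R.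
  by rewrite mulr_ge0 ?powR_ge0 ?betar_ge0.
have S0 n : 0 <= S n by apply: sumr_ge0 => q _; exact: t0.
exists (`|K| + S n0) => [|n]; first by rewrite addr_ge0.
have l1 : 1 <= n.+1%:R `^ ga :> R.
  by rewrite -[leLHS](one_powR ga) le_powR_base// ler1n.
rewrite mulrDl; have [nn|nn] := leqP n0 n.+1.
  have := HK n.+1 nn.
  have -> : (\sum_(k < n.+2) (k.+1%:R `^ (p - 2))%R%:E * beta2 Y k1 k2 k)%E = (S n.+1)%:E.
    by rewrite /S -sumEFin; apply: eq_bigr => q _; rewrite EFinM betarE.
  rewrite lee_fin => h; apply: le_trans (ler_norm _) _; apply: le_trans h _.
  rewrite [`|_ `^ _|]ger0_norm ?powR_ge0//.
  apply: (@le_trans _ _ (`|K| * n.+1%:R `^ ga)).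
    by rewrite ler_wpM2r ?powR_ge0// ler_norm.
  by rewrite lerDl mulr_ge0 ?powR_ge0.
apply: (@le_trans _ _ (S n0)); last first.
  by rewrite -[leLHS]add0r lerD ?mulr_ge0 ?powR_ge0// ler_peMr.
rewrite /S -!(big_mkord xpredT (fun q => q.+1%:R `^ (p - 2) * betar q)).
rewrite (big_cat_nat _ (n := n.+2) (p := n0.+1))//=; last exact: leqW.
by rewrite lerDl sumr_ge0// => i _; exact: t0.
Qed.

End dependence_sums.

(** * The stochastic error *)

Lemma step_approx_weaken {R : realType} (V V' : R) (g : R -> R) :
  V <= V' -> step_approx V g -> step_approx V' g.
Proof.
move=> VV H e e0; have [n [c [t [cV ge]]]] := H e e0.
by exists n, c, t; split => //; exact: le_trans cV VV.
Qed.

Lemma powR_add_le {R : realType} (p x y : R) : 1 < p -> 0 <= x -> 0 <= y ->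
  (x + y) `^ p <= 2 `^ (p - 1) * (x `^ p + y `^ p).
Proof.
move=> p1 x0 y0.
have := @powR_sum_le R _ p (fun _ : bool => 1) (fun b : bool => if b then x else y) p1.
rewrite !big_bool/= !mul1r; apply => // b; by case: b.
Qed.

Section piecewise_family.
Context {R : realType}.
Variables (r : nat) (Q : 'I_r.+1 -> {poly R}).
Local Notation lam := (@lebesgue_measure R).

Definition basis_sup : R := \sum_i poly_sup (Q i).

Lemma basis_sup_ge0 : 0 <= basis_sup.
Proof. by apply: sumr_ge0 => i _; exact: poly_sup_ge0. Qed.

Lemma poly_sup_le_basis i : poly_sup (Q i) <= basis_sup.
Proof.
by rewrite /basis_sup (bigD1 i)//= lerDl sumr_ge0// => k _; exact: poly_sup_ge0.
Qed.

Lemma pieces_le m (ij : 'I_r.+1 * 'I_m) y :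
  `|pieces Q ij y| <= basis_sup * (in_bin ij.2 y)%:R.
Proof.
apply: le_trans (piece_le _ _ _) _; rewrite ler_wpM2r//; exact: poly_sup_le_basis.
Qed.

Lemma sum_pieces_le m y : \sum_(ij : 'I_r.+1 * 'I_m) `|pieces Q ij y| <= r.+1%:R * basis_sup.
Proof.
apply: (@le_trans _ _ (\sum_(ij : 'I_r.+1 * 'I_m) basis_sup * (in_bin ij.2 y)%:R)).
  by apply: ler_sum => ij _; exact: pieces_le.
rewrite -(pair_big xpredT xpredT (fun _ j => basis_sup * (in_bin j y)%:R))/=.
rewrite sumr_const card_ord -[leLHS]mulr_natl ler_wpM2l// -mulr_sumr.
by rewrite ler_piMr ?basis_sup_ge0// sum_in_bin.
Qed.

Lemma bmf_pieces m (ij : 'I_r.+1 * 'I_m) : bmf (pieces Q ij).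
Proof. exact: bmf_piece. Qed.

Lemma Rintegral01_bin m (j : 'I_m) : (0 < m)%N ->
  \int[lam]_(x in `[0, 1]) (in_bin j x)%:R = m%:R^-1.
Proof.
move=> m0.
have -> : \int[lam]_(x in `[0, 1]) (in_bin j x)%:R = \int[lam]_(x in [set y | in_bin j y]) 1.
  rewrite Rintegral_mkcond [RHS]Rintegral_mkcond; apply: eq_Rintegral => x _.
  rewrite !patchE; case: (boolP (in_bin j x)) => hx.
    by rewrite !mem_set//; exact: (bin_subset m0 hx).
  by rewrite if_same; case: ifPn => //; rewrite inE /= => h; rewrite h in hx.
have mb : measurable [set y : R | in_bin j y] by exact: measurable_bin.
transitivity (1 * fine (lam [set y : R | in_bin j y])); first exact: Rintegral_cst.
by rewrite mul1r lebesgue_bin.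
Qed.

(** Jensen's inequality with the weights |h_ij(x)|, whose integral over [0,1] is O(1/m). *)
Lemma pieces_combination_Lp m (p : R) (S : 'I_r.+1 * 'I_m -> R) : (0 < m)%N -> 1 < p ->
  \int[lam]_(x in `[0, 1]) (`|\sum_ij S ij * pieces Q ij x| `^ p) <=
  (r.+1%:R * basis_sup) `^ (p - 1) * (basis_sup / m%:R) * \sum_ij `|S ij| `^ p.
Proof.
move=> m0 p1.
have p0 : 0 < p by exact: lt_trans p1.
have B0 := basis_sup_ge0.
have bw (ij : 'I_r.+1 * 'I_m) : bmf (fun x : R => `|pieces Q ij x|).
  by apply: bmf_norm; exact: bmf_pieces.
pose M : R := (r.+1%:R * basis_sup) `^ (p - 1).
have bl : bmf (fun x : R => `|\sum_ij S ij * pieces Q ij x| `^ p).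
  apply: bmf_powR => //; first exact: ltW.
  apply: bmf_norm; apply: bmf_sum => ij; apply: bmfM; first exact: bmf_cst.
  exact: bmf_pieces.
have iw (ij : 'I_r.+1 * 'I_m) := rint01 (bw ij).
have I01 : measurable (`[0%R, 1%R]%classic : set R) by exact: measurable_itv.
apply: (@le_trans _ _ (\int[lam]_(x in `[0, 1]) (\sum_ij (M * `|S ij| `^ p) * `|pieces Q ij x|))).
  apply: le_Rintegral => //; first exact: rint01.
    by apply: rint_sum => // ij; apply: rintZ.
  move=> x _.
  apply: (@le_trans _ _ ((\sum_ij `|pieces Q ij x| * `|S ij|) `^ p)).
    apply: le_powR_base => //; first exact: ltW.
    apply: le_trans (ler_norm_sum _ _ _) _; apply: ler_sum => ij _.
    by rewrite normrM mulrC.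
  apply: le_trans (@powR_sum_le R _ p (fun ij => `|pieces Q ij x|) (fun ij => `|S ij|) p1 _ _) _ => //.
  apply: (@le_trans _ _ (M * \sum_ij `|pieces Q ij x| * `|S ij| `^ p)).
    rewrite ler_wpM2r//; first by apply: sumr_ge0 => ij _; rewrite mulr_ge0 ?powR_ge0.
    apply: le_powR_base; [by rewrite subr_ge0 ltW|exact: sumr_ge0|exact: sum_pieces_le].
  rewrite mulr_sumr; apply: ler_sum => ij _.
  by rewrite le_eqVlt; apply/orP; left; apply/eqP; ring.
rewrite rint_Rintegral_sum//; last by move=> ij; apply: rintZ.
rewrite mulr_sumr; apply: ler_sum => ij _.
rewrite RintegralZl//; last exact: iw.
have h : \int[lam]_(x in `[0, 1]) `|pieces Q ij x| <= basis_sup / m%:R.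
  rewrite -(Rintegral01_bin ij.2 m0) -RintegralZl//; last first.
    exact: (rint01 (in_bin_bmf ij.2)).
  apply: le_Rintegral => //; first exact: iw.
    by apply: rintZ => //; exact: (rint01 (in_bin_bmf ij.2)).
  by move=> x _; exact: pieces_le.
apply: le_trans (ler_wpM2l _ h) _; first by rewrite mulr_ge0 ?powR_ge0.
by rewrite le_eqVlt; apply/orP; left; apply/eqP; rewrite /M; ring.
Qed.

End piecewise_family.

Section stochastic_error.
Context {d : measure_display} {T : measurableType d} {R : realType}.
Context {P : probability T R} (Y : int -> {RV P >-> R}).
Hypothesis hY : strictly_stationary Y.
Variable f : R -> R.
Hypothesis hf : is_density (Y 0) f.
Variable k1 : nat -> R.-pker (g_sigma_algebraType (past Y 0)) ~> R.
Hypothesis hk1 : forall k : nat, is_cond_dist P (Y k%:Z) (k1 k).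
Variable k2 : nat -> nat -> R.-pker (g_sigma_algebraType (past Y 0)) ~> (R * R)%type.
Hypothesis hk2 : forall i j : nat,
  is_cond_dist P (pairRV (Y i%:Z) (Y j%:Z)) (k2 i j).
Variables (p delta : R).
Hypothesis p2 : 2 < p.
Hypothesis delta01 : 0 <= delta < 1.
Hypothesis hbeta : ebigO
  (fun n => (\sum_(k < n.+1) (k.+1%:R `^ (p - 2))%R%:E * beta2 Y k1 k2 k)%E)
  (fun n => n%:R `^ (delta * (p - 1))).
Variables (r : nat) (Q : 'I_r.+1 -> {poly R}).
Local Notation lam := (@lebesgue_measure R).
Hypothesis fp : rint lam `[0, 1] (fun x => f x `^ p).
Variables (s C : R).
Hypothesis s0 : 0 < s.
Hypothesis C0 : 0 < C.

Let p0 : 0 < p. Proof. exact: lt_trans p2. Qed.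
Let p1 : 1 < p. Proof. by apply: lt_trans p2; rewrite ltr1n. Qed.

Definition bin_rate : R := (1 - delta) / (2 * s + 1).
Definition error_rate : R := - (p * s * (1 - delta)) / (2 * s + 1).

(** The expectation of the estimator at x. *)
Definition mean_estimator (m : nat) (x : R) : R :=
  \sum_(ij : 'I_r.+1 * 'I_m) (m%:R * mean_of Y (pieces Q (m := m)) ij) * pieces Q ij x.

Lemma estimator_deviation m n w x :
  estimator Y Q m n.+1 w x - mean_estimator m x =
  \sum_(ij : 'I_r.+1 * 'I_m) (m%:R / n.+1%:R * fwd Y (pieces Q (m := m)) n.+1 ij w) * pieces Q ij x.
Proof.
have -> : estimator Y Q m n.+1 w x = \sum_(ij : 'I_r.+1 * 'I_m)
   (n.+1%:R^-1 * \sum_(k < n.+1) phi Q ij.1 ij.2 (Y k.+1%:Z w)) * phi Q ij.1 ij.2 x.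
  rewrite /estimator pair_big/=; apply: eq_bigr => ij _; congr (_ * _ * _).
  by rewrite big_add1 big_mkord.
rewrite -sumrB; apply: eq_bigr => ij _.
have e y : phi Q ij.1 ij.2 y = Num.sqrt m%:R * pieces Q ij y by [].
under eq_bigr do rewrite e.
rewrite -mulr_sumr e /fwd /cX /cen sumrB sumr_const card_ord -[mean_of _ _ _ *+ _]mulr_natl.
set S := \sum_(i < n.+1) _; set mu := mean_of _ _ _; set q := Num.sqrt _.
have <- : q * q = m%:R by rewrite -expr2 sqr_sqrtr.
have : n.+1%:R != 0 :> R by rewrite pnatr_eq0.
by move: (n.+1%:R : R) => t t0; field.
Qed.

(** The moment inequality for the pieces. Besides the variance term of exponent
    (1 + delta) p / 2 it has a term n^b with b > delta (p - 1) + 1; for m at most of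
    order n^bin_rate the variance term dominates as soon as
    b <= (1 + delta) p / 2 - bin_rate (p / 2 - 1), and this leaves room for eta. *)
Lemma energy_bound : exists2 K : R, 0 <= K & forall n m : nat, (0 < m)%N ->
  m%:R <= C * n.+1%:R `^ bin_rate ->
  Afwd Y (pieces Q (m := m)) p n.+1 <=
  K * (n.+1%:R `^ ((1 + delta) * p / 2) * m%:R `^ (1 - p / 2)).
Proof.
case/andP: delta01 => d0 d1.
pose ga := delta * (p - 1).
have pm1 : 0 < p - 1 by rewrite subr_gt0.
have ga0 : 0 <= ga by rewrite mulr_ge0// ltW.
have [N N0 hN] := weighted_sums_beta2 ga0 hbeta.
have dep := dependence_bounds_beta2 hbeta.
pose B := basis_sup Q; have B0 : 0 <= B := basis_sup_ge0 Q.
pose M : R := r.+1%:R * B.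
have M0 : 0 <= M by rewrite mulr_ge0.
pose v (q : {poly R}) : R := 2 * (poly_sup q + poly_lip q).
have v0 q : 0 <= v q by rewrite mulr_ge0// addr_ge0 ?poly_sup_ge0 ?poly_lip_ge0.
pose V1 : R := \sum_i v (Q i).
pose V2 : R := \sum_i v (Q i ^+ 2).
have V10 : 0 <= V1 by exact: sumr_ge0.
have V20 : 0 <= V2 by exact: sumr_ge0.
pose V : R := V1 + 2 * V1 ^+ 2 + (V2 + 2 * M * V1).
have V0 : 0 <= V by rewrite !addr_ge0// ?mulr_ge0// sqr_ge0.
have ctl m : controlled_family (Y := Y) (dep1 k1) (dep2 k2) M V (pieces Q (m := m)).
  apply: controlled_step_family => //.
  - by move=> ij; exact: bmf_pieces.
  - by move=> y; exact: sum_pieces_le.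
  - move=> ij; apply: (step_approx_weaken _ (step_approx_piece (Q ij.1) ij.2)).
    by rewrite /V1 (bigD1 ij.1)//= lerDl sumr_ge0.
  - move=> ij; apply: (@step_approx_weaken _ (v (Q ij.1 ^+ 2))).
      by rewrite /V2 (bigD1 ij.1)//= lerDl sumr_ge0.
    have -> : (fun y => pieces Q ij y ^+ 2) = piece (Q ij.1 ^+ 2) ij.2.
      by apply/funext => y; rewrite /pieces /piece poly01X.
    exact: step_approx_piece.
case: (dep) => bD D01 bD2 D201 mD mD2.
have [Kv Kv0 HKv] := @variance_sum _ _ _ _ Y hY (dep1 k1) (betar k1 k2) bD D01 mD p N ga V B r Q p2 V0 N0 ga0 hN (poly_sup_le_basis Q).
pose al := (1 + delta) * p / 2.
have pn0 : p - 1 != 0 by rewrite gt_eqF.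
have e1 : p / 2 + ga * (p / (2 * (p - 1))) = al by rewrite /ga /al; field.
have s10 : 0 < 2 * s + 1 by rewrite ltr_wpDl// mulr_ge0// ltW.
have sn0 : 2 * s + 1 != 0 by rewrite gt_eqF.
(* eta is the slack for which the two terms have the same order at m = n^bin_rate *)
pose eta := (p / 2 - 1) * (1 - delta) * (2 * s / (2 * s + 1)).
have h20 : 0 < p / 2 - 1 by rewrite subr_gt0 ltr_pdivlMr// mul1r.
have eta0 : 0 < eta by rewrite !mulr_gt0 ?invr_gt0// subr_gt0.
pose b := ga + 1 + eta.
have bE : b = al - bin_rate * (p / 2 - 1) by rewrite /b /al /eta /ga /bin_rate; field.
have al1 : 1 < al.
  rewrite /al -mulrA -[X in X < _]mulr1; apply: (@lt_le_trans _ _ (p / 2)).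
    by rewrite mulr1 ltr_pdivlMr// mul1r.
  by rewrite ler_peMl ?divr_ge0 ?(ltW p0)// lerDl.
have b1 : 1 < b by rewrite /b -addrA addrCA ltrDl ltr_wpDl.
have gab : ga + 1 <= b by rewrite /b lerDl ltW.
have [Km Km0 HKm] := moment_bound hY dep p2 V0 M0 al1 b1 ga0 gab N0 hN.
pose Fp : R := \int[lam]_(x in `[0, 1]) (f x `^ p).
have Fp0 : 0 <= Fp by apply: Rintegral_ge0 => x _; exact: powR_ge0.
exists (Km * (Kv * (2 + Fp) + C `^ (p / 2 - 1))).
  by rewrite mulr_ge0// addr_ge0 ?powR_ge0// mulr_ge0// addr_ge0.
move=> n m m0 hm.
have mR : 0 < m%:R :> R by rewrite ltr0n.
pose L : R := Kv * ((2 + Fp) * m%:R `^ (1 - p / 2)).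
have L0 : 0 <= L by rewrite !mulr_ge0 ?powR_ge0// addr_ge0.
apply: le_trans (HKm _ _ L (ctl m) L0 _ n) _.
  move=> l; rewrite -e1; apply: (HKv m (bin_energy f p (m := m))) => //.
  - exact: (ctl_one (ctl m)).
  - exact: bin_energy_ge0.
  - by apply: sum_bin_energy.
  - by move=> j mu mu0; apply: bin_energy_le => //; exact: ltW.
rewrite -mulrA ler_wpM2l// mulrDl; apply: lerD.
  by rewrite le_eqVlt; apply/orP; left; apply/eqP; rewrite /L; ring.
have nR : 0 < n.+1%:R :> R by rewrite ltr0n.
rewrite bE powRD ?(gt_eqF nR) ?implybT// mulrCA ler_wpM2l ?powR_ge0//.
have -> : 1 - p / 2 = - (p / 2 - 1) by ring.
rewrite !powRN -[X in X <= _]mul1r ler_pdivrMr ?powR_gt0// mulrAC ler_pdivlMr ?powR_gt0// mul1r.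
by rewrite powRrM -powRM ?(ltW C0) ?powR_ge0// le_powR_base// ltW.
Qed.

(** Bias and stochastic error are separated by convexity of the p-th power; the
    latter is then, per sample, at most a multiple of the sum of p-th powers
    bounded by energy_bound. *)
Theorem estimator_error : exists2 K : R, 0 <= K & forall (n m : nat) (b : R), (0 < m)%N ->
  m%:R <= C * n.+1%:R `^ bin_rate ->
  (\int[lam]_(x in `[0%R, 1%R]) (`|mean_estimator m x - f x| `^ p)%R%:E <= b%:E)%E ->
  (\int[P]_w \int[lam]_(x in `[0%R, 1%R])
     (`|estimator Y Q m n.+1 w x - f x| `^ p)%R%:E <=
   (2 `^ (p - 1) * (K * n.+1%:R `^ error_rate + b))%:E)%E.
Proof.
have [K K0 HK] := energy_bound.
pose B := basis_sup Q; have B0 : 0 <= B := basis_sup_ge0 Q.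
pose M : R := (r.+1%:R * B) `^ (p - 1) * B.
have M0 : 0 <= M by rewrite mulr_ge0 ?powR_ge0.
exists (M * K * C `^ (p / 2)) => [|n m b m0 hm hb]; first by rewrite !mulr_ge0 ?powR_ge0.
have mR : 0 < m%:R :> R by rewrite ltr0n.
have nR : 0 < n.+1%:R :> R by rewrite ltr0n.
pose u : R := m%:R / n.+1%:R.
have u0 : 0 < u by rewrite divr_gt0.
pose S w := \sum_ij `|fwd Y (pieces Q (m := m)) n.+1 ij w| `^ p.
have bF ij : bmf (fwd Y (pieces Q (m := m)) n.+1 ij).
  by apply: bmf_fwd => k; exact: bmf_pieces.
have bFp ij : bmf (fun w => `|fwd Y (pieces Q (m := m)) n.+1 ij w| `^ p).
  by apply: bmf_powR => //; [exact: ltW|exact: bmf_norm].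
have bS : bmf S by exact: bmf_sum.
pose c : R := u `^ p * (M / m%:R).
have bd w : bmf (fun x : R => estimator Y Q m n.+1 w x - mean_estimator m x).
  under [X in bmf X]funext do rewrite estimator_deviation.
  by apply: bmf_sum => ij; apply: bmfM; [exact: bmf_cst|exact: bmf_pieces].
have bm : bmf (mean_estimator m).
  by apply: bmf_sum => ij; apply: bmfM; [exact: bmf_cst|exact: bmf_pieces].
have bdp w : bmf (fun x : R => `|estimator Y Q m n.+1 w x - mean_estimator m x| `^ p).
  by apply: bmf_powR => //; [exact: ltW|exact: bmf_norm].
have I01 : measurable (`[0%R, 1%R]%classic : set R) by exact: measurable_itv.
have mb : measurable_fun (`[0%R, 1%R]%classic : set R) (fun x => `|mean_estimator m x - f x| `^ p).
  apply: (measurableT_comp (measurable_powR p)); apply: measurableT_comp => //.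
  case: hf => _ mf _; case: bm => bm _.
  by apply: measurable_funB; apply: measurable_funTS.
have inner w : (\int[lam]_(x in `[0%R, 1%R])
     (`|estimator Y Q m n.+1 w x - f x| `^ p)%R%:E <= (2 `^ (p - 1) * (c * S w + b))%:E)%E.
  apply: (@le_trans _ _ (\int[lam]_(x in `[0%R, 1%R]) ((2 `^ (p - 1))%:E *
     ((`|estimator Y Q m n.+1 w x - mean_estimator m x| `^ p)%:E +
      (`|mean_estimator m x - f x| `^ p)%:E)))%E).
    apply: ge0_le_integral => //.
    - apply/measurable_EFinP.
      apply: (measurableT_comp (measurable_powR p)); apply: measurableT_comp => //.
      case: hf => _ mf _; case: bm => bm _; case: (bd w) => bdw _.
      have -> : (fun x => estimator Y Q m n.+1 w x - f x) = (fun x =>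
         (estimator Y Q m n.+1 w x - mean_estimator m x) + (mean_estimator m x - f x)).
        by apply/funext => x; rewrite addrA subrK.
      apply: measurable_funD; first exact: measurable_funTS.
      by apply: measurable_funB; apply: measurable_funTS.
    - apply: measurable_funeM; apply: emeasurable_funD; apply/measurable_EFinP => //.
      by case: (bdp w) => h _; exact: measurable_funTS.
    - move=> x _; rewrite -EFinD -EFinM lee_fin.
      apply: le_trans (powR_add_le p1 (normr_ge0 _) (normr_ge0 _)).
      apply: le_powR_base => //; first exact: ltW.
      by apply: le_trans (ler_normD _ _); rewrite addrA subrK.
  rewrite ge0_integralZl//; last 2 first.
  - apply: emeasurable_funD; apply/measurable_EFinP => //.
    by case: (bdp w) => h _; exact: measurable_funTS.
  - by move=> x _; rewrite -EFinD lee_fin addr_ge0 ?powR_ge0.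
  rewrite EFinM lee_wpmul2l// ?lee_fin ?powR_ge0//.
  rewrite ge0_integralD//; last 2 first.
  - by apply/measurable_EFinP; case: (bdp w) => h _; exact: measurable_funTS.
  - exact/measurable_EFinP.
  rewrite EFinD leeD//.
  have idp := rint01 (bdp w).
  rewrite -(fineK (integrable_fin_num _ idp))// lee_fin -/(Rintegral _ _ _).
  have -> : \int[lam]_(x in `[0, 1]) (`|estimator Y Q m n.+1 w x - mean_estimator m x| `^ p) =
     \int[lam]_(x in `[0, 1]) (`|\sum_ij (u * fwd Y (pieces Q (m := m)) n.+1 ij w) * pieces Q ij x| `^ p).
    by apply: eq_Rintegral => x _; rewrite estimator_deviation.
  apply: le_trans (pieces_combination_Lp _ _ m0 p1) _.
  have -> : \sum_ij `|u * fwd Y (pieces Q (m := m)) n.+1 ij w| `^ p = u `^ p * S w.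
    rewrite mulr_sumr; apply: eq_bigr => ij _.
    by rewrite normrM (gtr0_norm u0) powRM ?(ltW u0).
  by rewrite le_eqVlt; apply/orP; left; apply/eqP; rewrite /c /M -/B; ring.
have bound : c * \int[P]_w S w <= M * K * C `^ (p / 2) * n.+1%:R `^ error_rate.
  have -> : \int[P]_w S w = Afwd Y (pieces Q (m := m)) p n.+1 by rewrite /S Ex_sum.
  have c0 : 0 <= c by rewrite mulr_ge0 ?powR_ge0// divr_ge0// ltW.
  apply: le_trans (ler_wpM2l c0 (HK n m m0 hm)) _.
  have -> : c * (K * (n.+1%:R `^ ((1 + delta) * p / 2) * m%:R `^ (1 - p / 2))) =
    M * K * (m%:R `^ (p / 2) * n.+1%:R `^ ((1 + delta) * p / 2 - p)).
    have e1 : m%:R `^ (p / 2) = m%:R `^ p * m%:R^-1 * m%:R `^ (1 - p / 2) :> R.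
      rewrite -[m%:R^-1](powR_inv1 (ltW mR)) -!powRD ?(gt_eqF mR) ?implybT//.
      by congr (_ `^ _); field.
    have e2 : n.+1%:R `^ ((1 + delta) * p / 2 - p) = n.+1%:R `^ ((1 + delta) * p / 2) * (n.+1%:R `^ p)^-1 :> R.
      by rewrite powRD ?(gt_eqF nR) ?implybT// powRN.
    have e3 : u `^ p = m%:R `^ p * (n.+1%:R `^ p)^-1.
      rewrite /u powRM ?(ltW mR) ?invr_ge0 ?(ltW nR)//; congr (_ * _).
      by rewrite -powR_inv1 ?(ltW nR)// -powRrM mulN1r powRN.
    rewrite e1 e2 /c e3; ring.
  have MK0 : 0 <= M * K by exact: mulr_ge0.
  rewrite -[leRHS]mulrA ler_wpM2l//.
  have -> : error_rate = bin_rate * (p / 2) + ((1 + delta) * p / 2 - p).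
    have sn0 : 2 * s + 1 != 0 by rewrite gt_eqF// ltr_wpDl// mulr_ge0// ltW.
    by rewrite /error_rate /bin_rate; field.
  rewrite [X in _ <= _ * X]powRD ?(gt_eqF nR) ?implybT// [leRHS]mulrA ler_wpM2r ?powR_ge0//.
  rewrite (powRrM _ bin_rate) -powRM ?powR_ge0 ?(ltW C0)//.
  by rewrite le_powR_base// ?divr_ge0// ltW.
apply: (@le_trans _ _ (\int[P]_w (2 `^ (p - 1) * (c * S w + b))%:E)%E).
  apply: ge0_le_integral_nonmeas => // w.
  by apply: integral_ge0 => x _; rewrite lee_fin powR_ge0.
have bcS : bmf (fun w => c * S w) by bmf_tac.
rewrite EFin_Ex; last by bmf_tac.
rewrite lee_fin ExZ; last by bmf_tac.
rewrite ler_wpM2l ?powR_ge0// ExD//; last exact: bmf_cst.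
by rewrite Ex_cst ExZ// lerD.
Qed.

End stochastic_error.

(** * Polynomial approximation along a chain of derivatives *)

Section derivative_chains.
Context {R : realType}.
Local Notation lam := (@lebesgue_measure R).

Definition poly_primitive (q : {poly R}) : {poly R} :=
  \poly_(i < (size q).+1) (q`_i.-1 / i%:R).

Lemma deriv_primitive (q : {poly R}) : (poly_primitive q)^`() = q.
Proof.
apply/polyP => i; rewrite coef_deriv coef_poly ltnS/=.
have [iq|iq] := ltnP i (size q).
  by rewrite -[LHS]mulr_natr divfK// pnatr_eq0.
by rewrite mul0rn nth_default.
Qed.

Lemma is_derive_horner (q : {poly R}) (x : R) : is_derive x 1 (horner q) q^`().[x].
Proof.
apply: DeriveDef; first exact: derivable_horner.
by have := congr1 (fun g => g x) (derivE q); rewrite derive1E => <-.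
Qed.

(** The successive derivatives of a Sobolev-type function: G (i+1) is the
    derivative of G i up to order k - 2, and the last step is only an absolutely
    continuous one, recorded through the inequality that is used. *)
Definition derivative_chain (k : nat) (G : nat -> R -> R) (al be : R) : Prop :=
  [/\ forall i, (i < k.-1)%N ->
        {within `[al, be], continuous (G i)} /\
        (forall x, al < x < be -> is_derive x 1 (G i) (G i.+1 x)),
      rint lam `[al, be] (G k) &
      forall x y, al <= x -> x <= y -> y <= be ->
        `|G k.-1 y - G k.-1 x| <= \int[lam]_(t in `[x, y]) `|G k t|].

Lemma rint_sub_itv (g : R -> R) (al be a b : R) : al <= a -> b <= be ->
  rint lam `[al, be] g -> rint lam `[a, b] g.
Proof.
move=> ala bbe; apply: integrableS => //; apply: subset_itv; by rewrite bnd_simp.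
Qed.

Lemma Rintegral_norm_sub (g : R -> R) (al be a b : R) : al <= a -> b <= be ->
  rint lam `[al, be] g ->
  \int[lam]_(t in `[a, b]) `|g t| <= \int[lam]_(t in `[al, be]) `|g t|.
Proof.
move=> ala bbe ig.
have sub : (`[a, b] : set R) `<=` `[al, be] by apply: subset_itv; rewrite bnd_simp.
have ign : rint lam `[al, be] (fun t => `|g t|) by exact: rint_norm.
have ign' : rint lam `[a, b] (fun t => `|g t|) by exact: rint_sub_itv ign.
rewrite /Rintegral fine_le ?integrable_fin_num//.
by apply: ge0_subset_integral => //; apply: (measurable_int lam).
Qed.

(** Taylor's formula without Taylor coefficients: the approximating polynomial is
    a primitive of the one that approximates the first derivative. *)
Lemma chain_poly k (G : nat -> R -> R) (al be a b : R) : (0 < k)%N ->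
  derivative_chain k G al be -> al <= a -> a <= b -> b <= be ->
  exists2 q : {poly R}, (size q <= k)%N & forall x, a <= x <= b ->
    `|G 0%N x - q.[x]| <= (b - a) ^+ k.-1 * \int[lam]_(t in `[a, b]) `|G k t|.
Proof.
move=> + + ala ab bbe; elim: k G => // k IH G _ [H1 H2 H3].
have iab : rint lam `[a, b] (G k.+1) by exact: rint_sub_itv H2.
case: k => [|k] in IH H1 H2 H3 iab *.
  exists (G 0%N a)%:P; first by rewrite size_polyC; case: (_ != _).
  move=> x /andP[ax xb]; rewrite hornerC expr0 mul1r.
  apply: le_trans (H3 _ _ ala ax (le_trans xb bbe)) _.
  exact: Rintegral_norm_sub.
have chS : derivative_chain k.+1 (fun i => G i.+1) al be.
  by split => // i ik; apply: (H1 i.+1); rewrite /= ltnS in ik *.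
have [q1 sq1 Hq1] := IH _ erefl chS.
pose q0 := poly_primitive q1.
pose c : R := G 0%N a - q0.[a].
exists (q0 + c%:P).
  apply: leq_trans (size_polyD _ _) _; rewrite geq_max; apply/andP; split.
    by apply: leq_trans (size_poly _ _) _; rewrite ltnS.
  by rewrite size_polyC; case: (_ != _).
move=> x /andP[ax xb].
have [cG dG] := H1 0%N erefl.
pose H : R -> R := G 0%N - horner q0.
have -> : G 0%N x - (q0 + c%:P).[x] = H x - H a.
  by rewrite hornerD hornerC /c /H !fctE; ring.
have dH y : y \in `]a, x[%R -> is_derive y 1 H (G 1%N y - q1.[y]).
  rewrite in_itv/= => /andP[ay yx].
  apply: is_deriveB; first by apply: dG; rewrite (le_lt_trans ala ay) (lt_le_trans yx)// (le_trans xb).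
  by have := is_derive_horner q0 y; rewrite deriv_primitive.
have cH : {within `[a, x], continuous H}.
  move=> y; apply: cvgB.
    have sub : (`[a, x] : set R) `<=` `[al, be].
      by apply: subset_itv; rewrite bnd_simp// (le_trans xb).
    exact: (continuous_subspaceW sub cG).
  apply: (@continuous_subspaceT _ _ _ (horner q0)) => z.
  by apply: differentiable_continuous; apply/derivable1_diffP; exact: derivable_horner.
have [y yax ->] := MVT_segment ax dH cH.
move: yax; rewrite in_itv/= => /andP[ay yx].
rewrite normrM mulrC (@ger0_norm _ (x - a)) ?subr_ge0// exprS -mulrA.
rewrite ler_pM ?subr_ge0//; first by rewrite lerD2r.
by apply: Hq1; rewrite ay (le_trans yx).
Qed.

End derivative_chains.

(** * Affine changes of variable and Jensen's inequality *)

Lemma powR_pred {R : realType} (p a : R) : 0 < a -> a `^ p = a `^ (p - 1) * a.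
Proof.
move=> a0; rewrite -[X in _ * X](powRr1 (ltW a0)) -powRD ?(gt_eqF a0) ?implybT//.
by congr (_ `^ _); ring.
Qed.

Section affine_maps.
Context {R : realType}.
Local Notation lam := (@lebesgue_measure R).

Definition affine (a b : R) (x : measurableTypeR R) : measurableTypeR R := a * x + b.

Lemma measurable_fun_affine (a b : R) :
  measurable_fun [set: measurableTypeR R] (affine a b).
Proof. by apply: measurable_funD => //; exact: measurable_funM. Qed.

Definition affine_image (a b : R) : {measure set (measurableTypeR R) -> \bar R} :=
  measure_function_pushforward__canonical__measure_function_Measure
    (@lebesgue_measure R) (measurable_fun_affine a b).

Definition scaled_image (a b : R) : {measure set (measurableTypeR R) -> \bar R} :=
  mscale (`|a|%:nng) (affine_image a b).

(** By uniqueness of the Lebesgue measure among measures with the right values on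
    half-open intervals. *)
Lemma lebesgue_affine (a b : R) (A : set R) : a != 0 -> measurable A ->
  lam A = scaled_image a b A.
Proof.
move=> a0 mA; apply: lebesgue_measure_unique => //= _ [[u v]] _ <-.
rewrite /scaled_image/= /mscale/= /affine_image/= /pushforward.
have [ap|an] : 0 < a \/ a < 0 by move: a0; rewrite neq_lt => /orP[]; [right|left].
  have -> : affine a b @^-1` `]u, v] = `](u - b) / a, (v - b) / a]%classic.
    apply/seteqP; split => x; rewrite /= !in_itv/= /affine.
      by rewrite ltr_pdivrMr// ler_pdivlMr// ltrBlDr lerBrDr ![x * a]mulrC.
    by rewrite ltr_pdivrMr// ler_pdivlMr// ltrBlDr lerBrDr ![x * a]mulrC.
  rewrite !lebesgue_measure_itv/= !lte_fin ltr_pM2r ?invr_gt0// ltrD2r.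
  case: ifP => _; last by rewrite mule0.
  rewrite -!EFinD -EFinM gtr0_norm//; congr (_%:E); field; exact: a0.
have -> : affine a b @^-1` `]u, v] = `[(v - b) / a, (u - b) / a[%classic.
  apply/seteqP; split => x; rewrite /= !in_itv/= /affine.
    by rewrite ltr_ndivlMr// ler_ndivrMr// ltrBlDr lerBrDr ![x * a]mulrC => /andP[-> ->].
  by rewrite ltr_ndivlMr// ler_ndivrMr// ltrBlDr lerBrDr ![x * a]mulrC => /andP[-> ->].
rewrite !lebesgue_measure_itv/= !lte_fin ltr_nM2r ?invr_lt0// ltrD2r.
case: ifP => _; last by rewrite mule0.
rewrite -!EFinD -EFinM ltr0_norm//; congr (_%:E); field; exact: a0.
Qed.

Lemma ge0_integral_affine (a b : R) (g : R -> \bar R) : a != 0 ->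
  measurable_fun [set: measurableTypeR R] g -> (forall x, 0 <= g x)%E ->
  (\int[lam]_x g (a * x + b)%R = (`|a|^-1)%:E * \int[lam]_x g x)%E.
Proof.
move=> a0 mg g0.
have -> : (\int[lam]_x g x = \int[scaled_image a b]_x g x)%E.
  by apply: eq_measure_integral => A mA _; exact: lebesgue_affine.
rewrite /scaled_image ge0_integral_mscale// ge0_integral_pushforward//; last first.
  exact: measurable_fun_affine.
rewrite muleA -EFinM/= mulVf ?normr_eq0// mul1e.
by rewrite preimage_setT.
Qed.

Lemma rint_affine (a b : R) (g : R -> R) : a != 0 ->
  rint lam setT g -> rint lam setT (fun x => g (a * x + b)).
Proof.
move=> a0 ig; have mg := rint_measurable ig; case/integrableP: ig => _ ioo.
apply/integrableP; split.
  apply/measurable_EFinP; apply: (measurableT_comp mg).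
  exact: measurable_fun_affine.
rewrite (@ge0_integral_affine a b (fun x => `|(g x)%:E|%E))//.
  by rewrite lte_mul_pinfty.
by apply: measurableT_comp => //; apply/measurable_EFinP.
Qed.

Lemma Rintegral_affine (a b : R) (g : R -> R) : a != 0 -> rint lam setT g ->
  \int[lam]_x g (a * x + b) = `|a|^-1 * \int[lam]_x g x.
Proof.
move=> a0 ig; have mg := rint_measurable ig.
have meg : measurable_fun [set: measurableTypeR R] (EFin \o g) by exact/measurable_EFinP.
rewrite /Rintegral; have -> : (\int[lam]_x (g (a * x + b)%R)%:E = (`|a|^-1)%:E * \int[lam]_x (g x)%:E)%E.
  rewrite integralE [in RHS]integralE.
  transitivity ((\int[lam]_x ((EFin \o g)^\+%E (a * x + b)%R)) -
                (\int[lam]_x ((EFin \o g)^\-%E (a * x + b)%R)))%E.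
    by congr (_ - _)%E; apply: eq_integral => x _; rewrite ?funeposE ?funenegE.
  rewrite (@ge0_integral_affine a b (EFin \o g)^\+%E)//; last exact: measurable_funepos.
  rewrite (@ge0_integral_affine a b (EFin \o g)^\-%E)//; last exact: measurable_funeneg.
  rewrite [RHS]muleBr//.
  apply: fin_num_adde_defl; rewrite fin_numN; apply: integrable_fin_num => //.
  exact: integrable_funeneg.
by rewrite fineM//; exact: integrable_fin_num.
Qed.

End affine_maps.

Section jensen.
Context {R : realType}.
Local Notation lam := (@lebesgue_measure R).
Variables (D : set (measurableTypeR R)) (mD : measurable D) (L : R).
Hypothesis L0 : 0 < L.
Hypothesis lamD : lam D = L%:E.

(** Jensen's inequality for |x|^p, by integrating the tangent inequality at the mean. *)
Lemma jensen_powR (p : R) (g : R -> R) : 1 < p -> rint lam D g ->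
  (((`|\int[lam]_(x in D) g x|) `^ p)%:E <=
   (L `^ (p - 1))%:E * \int[lam]_(x in D) (`|g x| `^ p)%:E)%E.
Proof.
move=> p1 ig.
have p0 : 0 < p by exact: lt_trans p1.
have mg := rint_measurable ig.
have mgp : measurable_fun D (fun x => `|g x| `^ p).
  by apply: (measurableT_comp (measurable_powR p)); exact: measurableT_comp.
have Lp : 0 < L `^ (p - 1) by rewrite powR_gt0.
have ign : rint lam D (fun x => `|g x|) by exact: rint_norm.
pose a : R := \int[lam]_(x in D) `|g x|.
have a0 : 0 <= a by exact: Rintegral_ge0.
apply: (@le_trans _ _ ((a `^ p)%:E)).
  by rewrite lee_fin le_powR_base ?(ltW p0)//; exact: le_normr_Rintegral.
have Ige0 : (0 <= \int[lam]_(x in D) (`|g x| `^ p)%:E)%E.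
  by apply: integral_ge0 => x _; rewrite lee_fin powR_ge0.
have [Ioo|Ifin] := eqVneq (\int[lam]_(x in D) (`|g x| `^ p)%:E)%E +oo%E.
  by rewrite Ioo gt0_muley ?leey// lte_fin.
have igp : rint lam D (fun x => `|g x| `^ p).
  apply/integrableP; split; first exact/measurable_EFinP.
  under eq_integral do rewrite /= ger0_norm ?powR_ge0//.
  by rewrite ltey.
pose b : R := a / L.
have b0 : 0 <= b by rewrite divr_ge0// ltW.
have bL : b * L = a by rewrite /b divfK// gt_eqF.
have key : p * b `^ (p - 1) * a <= \int[lam]_(x in D) (`|g x| `^ p) + (p - 1) * b `^ p * L.
  have icst : rint lam D (fun=> (p - 1) * b `^ p).
    have lamDoo : (lam D < +oo)%E by rewrite lamD ltry.
    exact: (rint_of_bmf mD lamDoo (bmf_cst _)).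
  have -> : (p - 1) * b `^ p * L = \int[lam]_(x in D) ((p - 1) * b `^ p).
    transitivity ((p - 1) * b `^ p * fine (lam D)); first by rewrite lamD.
    by apply/esym; exact: Rintegral_cst.
  rewrite -RintegralD// -RintegralZl//.
  apply: le_Rintegral => //; [exact: rintZ|exact: rintD|] => x _.
  have := powR_tangent p1 (normr_ge0 (g x)) b0; apply: le_trans.
  by rewrite le_eqVlt; apply/orP; left; apply/eqP; ring.
have : b `^ p * L <= \int[lam]_(x in D) (`|g x| `^ p).
  have [b00|bn0] := eqVneq b 0.
    by rewrite b00 powR0 ?gt_eqF// mul0r; apply: Rintegral_ge0 => x _; exact: powR_ge0.
  have e1 : b `^ (p - 1) * a = b `^ p * L.
    by rewrite [b `^ p]powR_pred ?lt_def ?bn0// -mulrA bL.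
  by move: key; rewrite -mulrA e1; lra.
move=> h.
have -> : (\int[lam]_(x in D) (`|g x| `^ p)%:E = (\int[lam]_(x in D) (`|g x| `^ p))%:E)%E.
  by rewrite /Rintegral fineK//; exact: integrable_fin_num.
rewrite -EFinM lee_fin; apply: le_trans (ler_wpM2l (ltW Lp) h).
rewrite -{1}bL powRM ?(ltW L0)// mulrCA ler_wpM2l ?powR_ge0//.
by rewrite [L `^ p]powR_pred.
Qed.

End jensen.

(** * Primitives and Steklov averages *)

Section primitives.
Context {R : realType}.
Local Notation lam := (@lebesgue_measure R).
Implicit Types (g : R -> R) (x y c h : R).

Lemma lebesgue_ocitv (a b : R) : a <= b -> lam `]a, b] = (b - a)%:E.
Proof.
rewrite lebesgue_measure_itv/= lte_fin le_eqVlt => /predU1P[->|->].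
  by rewrite ltxx subrr.
by rewrite -EFinD.
Qed.

Definition primitive g x : R := \int[lam]_(t in `]-oo, x]) g t.

Lemma rint_itv g (i : interval R) : rint lam setT g -> rint lam [set` i] g.
Proof. by apply: integrableS => //; exact: measurable_itv. Qed.

Lemma primitive_sub g x y : rint lam setT g -> x <= y ->
  primitive g y - primitive g x = \int[lam]_(t in `]x, y]) g t.
Proof.
move=> ig xy; rewrite /primitive -(@Rintegral_itvB R g -oo%O (BRight y) x)//.
exact: rint_itv.
Qed.

Lemma primitive_sub_norm g x y : rint lam setT g -> x <= y ->
  `|primitive g y - primitive g x| <= \int[lam]_(t in `]x, y]) `|g t|.
Proof.
by move=> ig xy; rewrite primitive_sub//; apply: le_normr_Rintegral => //; exact: rint_itv.
Qed.

Lemma continuous_primitive g : rint lam setT g -> continuous (primitive g).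
Proof.
move=> ig x; apply/cvgrPdist_lt => e e0.
have [del [del0 Hdel]] := integral_normr_continuous ig e0.
near=> y.
have key a b : a <= b -> b - a < del -> `|primitive g b - primitive g a| < e.
  move=> ab bad; apply: le_lt_trans (primitive_sub_norm ig ab) _.
  apply: Hdel; first exact: measurable_itv.
  have h : ((b - a)%:E < del%:E)%E by rewrite lte_fin.
  by rewrite -(lebesgue_ocitv ab) in h.
have xyd : `|x - y| < del by near: y; exact: (@cvgr_dist_lt _ _ _ (nbhs x)).
have [xy|yx] := leP x y.
  by rewrite distrC; apply: key => //; rewrite distrC ger0_norm ?subr_ge0 in xyd.
by apply: key => //; [exact: ltW|rewrite gtr0_norm ?subr_gt0 in xyd].
Unshelve. all: by end_near. Qed.

Lemma is_derive_primitive g x : rint lam setT g -> {for x, continuous g} ->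
  is_derive x 1 (primitive g) (g x).
Proof.
move=> ig cg.
have x1 : x < x + 1 by rewrite ltrDl.
have ii : rint lam [set` Interval -oo%O (BRight (x + 1))] g by exact: rint_itv.
have [|d1 d2] := continuous_FTC1 x1 ii _ cg; first by rewrite ltNyr.
by apply: DeriveDef; [exact: d1|rewrite -derive1E; exact: d2].
Qed.

End primitives.

Section steklov_averages.
Context {R : realType}.
Local Notation lam := (@lebesgue_measure R).
Implicit Types (g phi : R -> R) (x y c h : R).

(** The average of phi over the segment from x to x + c. Writing it as an integral
    over [0, 1] covers both signs of c and gives phi itself for c = 0. *)
Definition steklov c phi x : R := \int[lam]_(u in `[0, 1]) phi (x + c * u).
Definition quotient c phi x : R := (phi (x + c) - phi x) / c.

Lemma steklov0 phi : steklov 0 phi = phi.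
Proof.
apply/funext => x; rewrite /steklov.
transitivity (\int[lam]_(u in `[0, 1]) phi x).
  by apply: eq_Rintegral => u _; rewrite mul0r addr0.
transitivity (phi x * fine (lam `[0, 1])); first exact: Rintegral_cst.
by rewrite lebesgue_measure_itv/= lte_fin ltr01 oppr0 adde0 mulr1.
Qed.

Lemma rint_shift c x phi : c != 0 -> rint lam setT phi ->
  rint lam setT (fun u => phi (x + c * u)).
Proof.
move=> c0 ip; have := @rint_affine R c x phi c0 ip.
by under [X in rint _ _ X -> _]funext do rewrite addrC.
Qed.

Lemma rint_translate c phi : rint lam setT phi -> rint lam setT (fun x => phi (x + c)).
Proof.
move=> ip; have := @rint_affine R 1 c phi (oner_neq0 _) ip.
by under [X in rint _ _ X -> _]funext do rewrite mul1r.
Qed.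

Lemma rint_patch (S : set R) phi : measurable S -> rint lam setT phi ->
  rint lam setT (phi \_ S).
Proof.
move=> mS ip; apply: (@rint_le _ _ _ lam setT measurableT _ (fun x => `|phi x|)).
- apply/(measurable_restrictT _ mS); apply: measurable_funTS; exact: rint_measurable ip.
- by move=> x _; rewrite patchE; case: ifP => // _; rewrite normr0.
- exact: rint_norm.
Qed.

Lemma Rintegral_translate c phi (a b : R) : rint lam setT phi ->
  \int[lam]_(t in `]a, b]) phi (t + c) = \int[lam]_(t in `]a + c, b + c]) phi t.
Proof.
move=> ip; rewrite Rintegral_mkcond [RHS]Rintegral_mkcond.
pose g := phi \_ `]a + c, b + c].
have ig : rint lam setT g.
  by apply: rint_patch => //; exact: measurable_itv.
have := @Rintegral_affine R 1 c g (oner_neq0 _) ig.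
rewrite normr1 invr1 mul1r => <-; apply: eq_Rintegral => x _.
rewrite /g mul1r !patchE; congr (if _ then _ else _).
by apply/idP/idP; rewrite !inE/= !in_itv/= ltrD2r lerD2r.
Qed.

Lemma steklov_primitive c phi x : c != 0 -> rint lam setT phi ->
  steklov c phi x = (primitive phi (x + c) - primitive phi x) / c.
Proof.
move=> c0 ip; rewrite /steklov Rintegral_mkcond.
pose S : set R := [set y | 0 <= (y - x) / c <= 1].
pose g := phi \_ S.
have change : measurable S -> \int[lam]_u ((fun u => phi (x + c * u)) \_ `[0, 1]) u =
    `|c|^-1 * \int[lam]_(t in S) phi t.
  move=> mS.
  have ig : rint lam setT g.
    exact: rint_patch.
  rewrite [in RHS]Rintegral_mkcond -(@Rintegral_affine R c x g c0 ig).
  apply: eq_Rintegral => u _; rewrite /g !patchE addrC; congr (if _ then _ else _).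
  have e : (c * u + x - x) / c = u by rewrite addrK mulrC mulKf.
  by apply/idP/idP; rewrite !inE /S /= in_itv/= e.
have [cp|cn] : 0 < c \/ c < 0 by move: c0; rewrite neq_lt => /orP[]; [right|left].
  have SE : S = `[x, x + c]%classic.
    apply/seteqP; split => y; rewrite /S/= in_itv/=.
      by rewrite ler_pdivlMr// mul0r ler_pdivrMr// mul1r subr_ge0 lerBlDl.
    by rewrite ler_pdivlMr// mul0r ler_pdivrMr// mul1r subr_ge0 lerBlDl.
  rewrite change; last by rewrite SE; exact: measurable_itv.
  have le : x <= x + c by rewrite lerDl ltW.
  rewrite (primitive_sub ip le) gtr0_norm// mulrC SE; congr (_ * _).
  by rewrite Rintegral_itv_obnd_cbnd//; exact: rint_itv.
have SE : S = `[x + c, x]%classic.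
  apply/seteqP; split => y; rewrite /S/= in_itv/=.
    rewrite ler_ndivlMr// mul0r ler_ndivrMr// mul1r subr_le0 lerBrDl.
    by rewrite andbC.
  by rewrite ler_ndivlMr// mul0r ler_ndivrMr// mul1r subr_le0 lerBrDl andbC.
rewrite change; last by rewrite SE; exact: measurable_itv.
have le : x + c <= x by rewrite gerDl ltW.
have := primitive_sub ip le; rewrite -opprB => /eqP; rewrite eqr_oppLR => /eqP ->.
rewrite ltr0_norm// invrN mulNr mulrC SE mulNr; congr (- (_ * _)).
by rewrite Rintegral_itv_obnd_cbnd//; exact: rint_itv.
Qed.

Lemma continuous_steklov c phi : c != 0 -> rint lam setT phi -> continuous (steklov c phi).
Proof.
move=> c0 ip.
have -> : steklov c phi = (fun x => (primitive phi (x + c) - primitive phi x) / c).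
  by apply/funext => x; rewrite steklov_primitive.
have cp := continuous_primitive ip.
move=> x; apply: cvgMl; apply: cvgB; last exact: cp.
apply: (@cvg_comp _ _ _ (fun x => x + c) (primitive phi)); last exact: cp.
by apply: cvgD; [exact: cvg_id|exact: cvg_cst].
Qed.

Lemma is_derive_steklov c phi x : c != 0 -> rint lam setT phi -> continuous phi ->
  is_derive x 1 (steklov c phi) (quotient c phi x).
Proof.
move=> c0 ip cphi.
have -> : steklov c phi = c^-1 \*: ((primitive phi \o shift c) - primitive phi).
  apply/funext => y; rewrite steklov_primitive// /= !fctE /=.
  by rewrite mulrC.
have -> : quotient c phi x = c^-1 *: (phi (x + c) - phi x) by rewrite /quotient mulrC.
apply: is_deriveZ; apply: is_deriveB; last exact: (is_derive_primitive ip (cphi x)).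
have d1 : is_derive (x + c) 1 (primitive phi) (phi (x + c)).
  exact: (is_derive_primitive ip (cphi (x + c))).
have d2 : is_derive x 1 (shift c : R -> R) 1 by exact: is_derive_shift.
by have := @is_derive1_comp R (primitive phi) (shift c) x _ _ d1 d2; rewrite mulr1.
Qed.

Lemma rint_quotient c phi : rint lam setT phi -> rint lam setT (quotient c phi).
Proof.
move=> ip; have := rintZ measurableT c^-1 (rintB measurableT (rint_translate c ip) ip).
by under [X in rint _ _ X -> _]funext do rewrite mulrC.
Qed.

(** The average is absolutely continuous with the difference quotient as
    derivative, even where phi is not continuous. *)
Lemma steklov_sub c phi x y : c != 0 -> rint lam setT phi -> x <= y ->
  steklov c phi y - steklov c phi x = \int[lam]_(t in `]x, y]) quotient c phi t.
Proof.
move=> c0 ip xy; have ip' := rint_translate c ip.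
rewrite !steklov_primitive// -mulrBl.
have -> : primitive phi (y + c) - primitive phi y - (primitive phi (x + c) - primitive phi x) =
  (primitive phi (y + c) - primitive phi (x + c)) - (primitive phi y - primitive phi x) by ring.
rewrite primitive_sub ?lerD2r// primitive_sub// -Rintegral_translate//.
rewrite -RintegralB//; [|exact: rint_itv|exact: rint_itv].
rewrite mulrC -RintegralZl//; last by apply: rint_itv; exact: rintB.
by apply: eq_Rintegral => t _; rewrite /quotient mulrC.
Qed.

End steklov_averages.

(** * Averages in L^p *)

Section averaging.
Context {R : realType}.
Local Notation lam := (@lebesgue_measure R).
Local Notation RT := (measurableTypeR R).

Lemma lebesgue_unit : lam `[0%R, 1%R] = 1%:E.
Proof. by rewrite lebesgue_measure_itv/= lte_fin ltr01 oppr0 adde0. Qed.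

Lemma ge0_le_integral_nonmeas_on (D : set RT) (f g : R -> \bar R) :
  (forall x, D x -> 0 <= f x)%E -> (forall x, D x -> f x <= g x)%E ->
  (\int[lam]_(x in D) f x <= \int[lam]_(x in D) g x)%E.
Proof.
move=> f0 fg; rewrite integral_mkcond [leRHS]integral_mkcond.
apply: ge0_le_integral_nonmeas => x; rewrite !patchE; case: ifPn => //; rewrite inE => Dx.
  exact: f0.
exact: fg.
Qed.

(** Exchanging the two integrations reduces the bound to one value of u at a time. *)
Lemma tonelli_bound (J : set RT) (Psi : RT * RT -> \bar R) (K : \bar R) :
  measurable J -> measurable_fun setT Psi -> (forall z, 0 <= Psi z)%E -> (0 <= K)%E ->
  (forall u : R, (0 <= u <= 1)%R -> \int[lam]_(x in J) Psi (x, u) <= K)%E ->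
  (\int[lam]_(x in J) \int[lam]_(u in `[0%R, 1%R]) Psi (x, u) <= K)%E.
Proof.
move=> mJ mPsi Psi0 K0 HK.
pose I : set RT := `[0%R, 1%R]%classic.
have mI : measurable I by exact: measurable_itv.
pose F := Psi \_ (J `*` I).
have mF : measurable_fun setT F.
  by apply/(measurable_restrictT _ (measurableX mJ mI)); exact: measurable_funTS.
have F0 z : (0 <= F z)%E by rewrite /F patchE; case: ifP.
have -> : (\int[lam]_(x in J) \int[lam]_(u in I) Psi (x, u) = \int[lam]_x \int[lam]_u F (x, u))%E.
  rewrite integral_mkcond; apply: eq_integral => x _; rewrite patchE.
  case: ifPn => xJ.
    rewrite integral_mkcond; apply: eq_integral => u _; rewrite /F !patchE.
    by rewrite in_setX xJ.
  rewrite integral0_eq// => u _; rewrite /F patchE in_setX (negbTE xJ)//.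
rewrite (fubini_tonelli _ mF F0).
apply: (@le_trans _ _ (\int[lam]_u ((cst K \_ I) u))%E); last first.
  rewrite -integral_mkcond integral_cst// -[leRHS]mule1 lee_wpmul2l//.
  by rewrite le_eqVlt; apply/orP; left; apply/eqP; exact: lebesgue_unit.
apply: ge0_le_integral_nonmeas => u; first exact: integral_ge0.
rewrite patchE; case: ifPn => uI.
  apply: le_trans (HK u _); last by move: uI; rewrite inE /I /= in_itv.
  rewrite [leRHS]integral_mkcond le_eqVlt; apply/orP; left; apply/eqP.
  by apply: eq_integral => x _; rewrite /F !patchE in_setX uI andbT.
rewrite integral0_eq// => x _; rewrite /F patchE in_setX (negbTE uI) andbF//.
Qed.

(** Jensen's inequality in u, then tonelli_bound. *)
Lemma average_Lp (J : set RT) (Phi : R -> R -> R) (p : R) (K : \bar R) :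
  measurable J -> 1 < p -> (0 <= K)%E ->
  measurable_fun [set: RT * RT] (fun z => Phi z.1 z.2) ->
  (forall x, rint lam `[0, 1] (Phi x)) ->
  (forall u : R, (0 <= u <= 1)%R -> \int[lam]_(x in J) (`|Phi x u| `^ p)%:E <= K)%E ->
  (\int[lam]_(x in J) (`|(\int[lam]_(u in `[0, 1]) Phi x u)%R| `^ p)%:E <= K)%E.
Proof.
move=> mJ p1 K0 mPhi iPhi HK.
apply: le_trans (tonelli_bound (Psi := fun z => (`|Phi z.1 z.2| `^ p)%:E) mJ _ _ K0 HK).
- apply: ge0_le_integral_nonmeas_on => x _; first by rewrite lee_fin powR_ge0.
  have mI : measurable (`[0%R, 1%R]%classic : set RT) by exact: measurable_itv.
  have := jensen_powR mI (@ltr01 R) lebesgue_unit p1 (iPhi x).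
  by rewrite one_powR mul1e.
- apply/measurable_EFinP; apply: (measurableT_comp (measurable_powR p)).
  exact: measurableT_comp.
- by move=> z; rewrite lee_fin powR_ge0.
Qed.

Lemma measurable_pair_affine (phi : RT -> R) (c : R) : measurable_fun [set: RT] phi ->
  measurable_fun [set: RT * RT] (fun z => phi (z.1 + c * z.2)).
Proof.
move=> mphi; apply: (measurableT_comp mphi).
by apply: measurable_funD => //; apply: measurable_funM.
Qed.

Lemma rint_steklov (c : R) (phi : R -> R) : rint lam setT phi ->
  rint lam setT (steklov c phi).
Proof.
move=> ip; have [->|c0] := eqVneq c 0; first by rewrite steklov0.
have mphi := rint_measurable ip.
apply/integrableP; split.
  apply/measurable_EFinP; apply: continuous_measurable_fun.
  exact: continuous_steklov.
pose K : \bar R := (\int[lam]_x (`|phi x|)%:E)%E.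
have Koo : (K < +oo)%E.
  by case/integrableP: ip.
apply: le_lt_trans Koo.
apply: le_trans (tonelli_bound (J := setT) (Psi := fun z => (`|phi (z.1 + c * z.2)|)%:E) measurableT _ _ _ _).
- apply: ge0_le_integral_nonmeas_on => x _; first exact: abse_ge0.
  have iu : rint lam `[0, 1] (fun u => phi (x + c * u)).
    by apply: rint_itv; exact: rint_shift.
  rewrite /= /steklov; apply: (@le_trans _ _ (\int[lam]_(u in `[0%R, 1%R]) `|phi (x + c * u)|)%R%:E).
    by rewrite lee_fin; apply: le_normr_Rintegral => //; exact: measurable_itv.
  rewrite /Rintegral fineK//; apply: integrable_fin_num => //; exact: rint_norm.
- apply/measurable_EFinP; apply: measurableT_comp => //.
  exact: measurable_pair_affine.
- by move=> z; rewrite lee_fin.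
- by apply: integral_ge0.
- move=> u _; have := @ge0_integral_affine R 1 (c * u) (fun x => (`|phi x|)%:E) (oner_neq0 _).
  rewrite normr1 invr1 mul1e => h; rewrite /K -h//.
    rewrite le_eqVlt; apply/orP; left; apply/eqP.
    by apply: eq_integral => x _; rewrite mul1r.
  by apply/measurable_EFinP; exact: measurableT_comp.
Qed.

Lemma rint_iter (F : (R -> R) -> R -> R) n (phi : R -> R) :
  (forall psi, rint lam setT psi -> rint lam setT (F psi)) ->
  rint lam setT phi -> rint lam setT (iter n F phi).
Proof. by move=> HF ip; elim: n => //= n IH; exact: HF. Qed.

Lemma quotient_steklov (h : R) (phi : R -> R) : h != 0 -> rint lam setT phi ->
  quotient h (steklov h phi) = steklov h (quotient h phi).
Proof.
move=> h0 ip; apply/funext => x; rewrite /quotient /steklov.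
have i1 y : rint lam `[0, 1] (fun u => phi (y + h * u)).
  by apply: rint_itv; exact: rint_shift.
have mI : measurable (`[0%R, 1%R]%classic : set RT) by exact: measurable_itv.
rewrite -RintegralB//; [|exact: i1|exact: i1].
rewrite mulrC -RintegralZl//; last by apply: rintB => //; exact: i1.
by apply: eq_Rintegral => u _; rewrite mulrC addrAC.
Qed.

Lemma quotient_iter_steklov (h : R) n (phi : R -> R) : h != 0 -> rint lam setT phi ->
  quotient h (iter n (steklov h) phi) = iter n (steklov h) (quotient h phi).
Proof.
move=> h0 ip; elim: n => //= n <-; rewrite quotient_steklov//.
by apply: rint_iter => // psi; exact: rint_steklov.
Qed.

(** The l-th derivative of the k-fold average of g: each derivative turns one average
    into a difference quotient. *)
Definition smoothed (k : nat) (h : R) (g : R -> R) (l : nat) : R -> R :=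
  iter (k - l) (steklov h) (iter l (quotient h) g).

Lemma rint_smoothed k h g l : rint lam setT g -> rint lam setT (smoothed k h g l).
Proof.
move=> ig; apply: rint_iter; first by move=> psi; exact: rint_steklov.
by apply: rint_iter => // psi; exact: rint_quotient.
Qed.

(** One step of the chain: the average of a function has its difference quotient
    for derivative, and averages commute with difference quotients. *)
Lemma smoothed_step k h g l : h != 0 -> rint lam setT g -> (l < k)%N ->
  exists2 psi, rint lam setT psi & [/\ smoothed k h g l = steklov h psi,
    smoothed k h g l.+1 = quotient h psi & ((l.+1 < k)%N -> continuous psi)].
Proof.
move=> h0 ig lk; have iq : rint lam setT (iter l (quotient h) g).
  by apply: rint_iter => // psi; exact: rint_quotient.
exists (iter (k - l.+1) (steklov h) (iter l (quotient h) g)).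
  by apply: rint_iter => // psi; exact: rint_steklov.
split.
- by rewrite /smoothed -(subnSK lk).
- by rewrite quotient_iter_steklov.
- move=> lk1; rewrite -(subnSK lk1)/=; apply: continuous_steklov => //.
  by apply: rint_iter => // psi; exact: rint_steklov.
Qed.

End averaging.

(** * Smooth approximants built from finite differences *)

Section smooth_approximation.
Context {R : realType}.
Local Notation lam := (@lebesgue_measure R).
Local Notation RT := (measurableTypeR R).

Lemma fdiff_succ (l : nat) (u : R) (g : R -> R) (x : R) :
  fdiff l.+1 u g x = fdiff l u g (x + u) - fdiff l u g x.
Proof.
rewrite {1}/fdiff big_ord_recl/= bin0 mulr1 mul0r addr0 subn0.
have -> : \sum_(i < l.+1) (-1) ^+ (l.+1 - bump 0 i) * 'C(l.+1, bump 0 i)%:R * g (x + (bump 0 i)%:R * u) =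
   \sum_(i < l.+1) (-1) ^+ (l - i) * 'C(l, i.+1)%:R * g (x + i.+1%:R * u) + fdiff l u g (x + u).
  rewrite /fdiff -big_split; apply: eq_bigr => i _ /=.
  rewrite /bump/= add1n subSS binS natrD -natr1; set e := (-1) ^+ _.
  have -> : x + u + i%:R * u = x + (i%:R + 1) * u by ring.
  by ring.
rewrite addrA [RHS]addrC; congr (_ + _).
rewrite big_ord_recr/= bin_small// mulr0 mul0r addr0.
rewrite /fdiff big_ord_recl/= bin0 mulr1 mul0r addr0 subn0 opprD exprS !mulN1r mulNr.
congr (_ + _); rewrite -sumrN; apply: eq_bigr => i _.
rewrite /bump/= add1n -(subnSK (ltn_ord i)) exprS; ring.
Qed.

Lemma iter_quotient (l : nat) (h : R) (g : R -> R) (x : R) :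
  iter l (quotient h) g x = h^-1 ^+ l * fdiff l h g x.
Proof.
elim: l x => [|l IH] x.
  by rewrite /fdiff big_ord1/= subn0 bin0 mul0r addr0 !expr0 !mul1r.
rewrite iterS {1}/quotient !IH fdiff_succ exprS; ring.
Qed.

Variables (g : R -> R) (ig : rint lam setT g) (k : nat) (c : R) (c0 : c != 0).

(** The alternating combination of j-fold averages of g with steps 0, c, ..., k c.
    For j = 0 it is, up to sign, a k-th difference of g of step c v, and averaged_succ shows that
    averaging it over v raises j by one. For j = k and v = 0 the term with i = 0
    is g, so that the others approximate g. *)
Definition averaged (j : nat) (v x : R) : R :=
  \sum_(i < k.+1) (-1) ^+ i * 'C(k, i)%:R *
     iter j (steklov (i%:R * c)) g (x + (i%:R * c) * v).

Let rint_avg j i : rint lam setT (iter j (steklov (i%:R * c)) g).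
Proof. by apply: rint_iter => // psi; exact: rint_steklov. Qed.

Lemma averaged_succ j v x :
  averaged j.+1 v x = \int[lam]_(u in `[0, 1]) averaged j (v + u) x.
Proof.
have iI (i : nat) : rint lam `[0, 1] (fun u => iter j (steklov (i%:R * c)) g (x + (i%:R * c) * (v + u))).
  have [->|i0] := eqVneq i 0%N.
    under [X in rint _ _ X]funext do rewrite !mul0r.
    by apply: rint01; exact: bmf_cst.
  have ic : i%:R * c != 0 by rewrite mulf_neq0// pnatr_eq0.
  have := rint_shift (x + (i%:R * c) * v) ic (rint_avg j i) => /(rint_itv `[0, 1]).
  by under [X in rint _ _ X -> _]funext do rewrite -addrA -mulrDr.
rewrite /averaged rint_Rintegral_sum//; last first.
  by move=> i; apply: rintZ.
apply: eq_bigr => i _; rewrite RintegralZl//; last exact: iI.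
congr (_ * _); rewrite iterS {1}/steklov; apply: eq_Rintegral => u _.
by congr (iter _ _ _ _); ring.
Qed.

Lemma measurable_averaged j v : measurable_fun [set: RT * RT]
  (fun z => averaged j (v + z.2) z.1).
Proof.
apply: measurable_sum => i; apply: measurable_funM => //.
apply: (measurableT_comp (rint_measurable (rint_avg j i))).
apply: measurable_funD => //; apply: measurable_funM => //.
by apply: measurable_funD.
Qed.

Lemma rint_averaged j v x : rint lam `[0, 1] (fun u => averaged j (v + u) x).
Proof.
apply: rint_sum => // i; apply: rintZ => //.
have [->|i0] := eqVneq (i : nat) 0%N.
  under [X in rint _ _ X]funext do rewrite !mul0r.
  by apply: rint01; exact: bmf_cst.
have ic : i%:R * c != 0 by rewrite mulf_neq0// pnatr_eq0.
have := rint_shift (x + (i%:R * c) * v) ic (rint_avg j i) => /(rint_itv `[0, 1]).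
by under [X in rint _ _ X -> _]funext do rewrite -addrA -mulrDr.
Qed.

Variables (p : R) (p1 : 1 < p) (al be : R) (K : R).
Hypothesis K0 : 0 <= K.
Hypothesis HK : forall v : R, 0 <= v <= k%:R ->
  (\int[lam]_(x in `[al, be]) (`|averaged 0 v x| `^ p)%:E <= K%:E)%E.

(** By induction on j, each average over v being bounded by average_Lp; v + j <= k
    keeps the steps in the range of the hypothesis. *)
Lemma averaged_bound j v : (j <= k)%N -> 0 <= v -> v + j%:R <= k%:R ->
  (\int[lam]_(x in `[al, be]) (`|averaged j v x| `^ p)%:E <= K%:E)%E.
Proof.
elim: j v => [|j IH] v jk v0 vk.
  by apply: HK; rewrite v0; rewrite addr0 in vk.
under eq_integral do rewrite averaged_succ.
apply: average_Lp => //.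
- exact: measurable_averaged.
- by move=> x; exact: rint_averaged.
- move=> u /andP[u0 u1]; apply: IH; first exact: ltnW.
    exact: addr_ge0.
  by apply: le_trans vk; rewrite -natr1 -addrA lerD2l addrC lerD2l.
Qed.

Hypothesis k0 : (0 < k)%N.

(** The l-th derivative of the smooth approximation of g. *)
Definition approximant (l : nat) (x : R) : R :=
  \sum_(i < k) ((-1) ^+ i * 'C(k, i.+1)%:R) * smoothed k (i.+1%:R * c) g l x.

Lemma approximant_error x : g x - approximant 0 x = averaged k 0 x.
Proof.
rewrite /averaged big_ord_recl/= bin0 mulr1 mul1r !mulr0 addr0 !mul0r.
have -> : iter k (steklov 0) g x = g x.
  by elim: k => //= n IH; rewrite steklov0.
congr (_ + _); rewrite /approximant -sumrN; apply: eq_bigr => i _.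
rewrite /smoothed subn0/= /bump/= add1n mulr0 addr0 exprS; ring.
Qed.

Let ic0 (i : nat) : i.+1%:R * c != 0.
Proof. by rewrite mulf_neq0// pnatr_eq0. Qed.

Lemma chain_approximant : derivative_chain k approximant al be.
Proof.
have iap l : rint lam setT (approximant l).
  by apply: rint_sum => // i; apply: rintZ => //; exact: rint_smoothed.
split.
- move=> l lk1; have lk : (l.+1 < k)%N by rewrite -ltn_predRL.
  have dx (x : R) : is_derive x 1 (approximant l) (approximant l.+1 x).
    have -> : approximant l = \sum_(i < k) ((-1) ^+ i * 'C(k, i.+1)%:R) \*: smoothed k (i.+1%:R * c) g l.
      by apply/funext => y; rewrite /approximant fct_sumE.
    rewrite /approximant; apply: is_derive_sum => i.
    have [psi ipsi [-> -> cpsi]] := smoothed_step (ic0 i) ig (ltnW lk).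
    apply: is_deriveZ; apply: is_derive_steklov => //; exact: cpsi.
  split=> [|x _]; last exact: dx.
  apply: continuous_subspaceT => x; have [ex _] := dx x.
  by apply: differentiable_continuous; apply/derivable1_diffP.
- exact: rint_itv.
- move=> x y _ xy _.
  have -> : approximant k.-1 y - approximant k.-1 x = \int[lam]_(t in `]x, y]) approximant k t.
    rewrite /approximant rint_Rintegral_sum//; last first.
      by move=> i; apply: rintZ => //; apply: rint_itv; exact: rint_smoothed.
    rewrite -sumrB; apply: eq_bigr => i _.
    rewrite RintegralZl//; last by apply: rint_itv; exact: rint_smoothed.
    have lk : (k.-1 < k)%N by rewrite prednK.
    have [psi ipsi [-> + _]] := smoothed_step (ic0 i) ig lk.
    by rewrite (prednK k0) => ->; rewrite -mulrBr steklov_sub.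
  apply: le_trans (le_normr_Rintegral _ _) _ => //; first exact: rint_itv.
  rewrite Rintegral_itv_obnd_cbnd//.
  by apply: rint_itv; exact: rint_norm.
Qed.

(** The k-th derivative of a k-fold average of step i c is a k-th difference of step
    i c divided by (i c)^k. *)
Lemma approximant_top x : approximant k x =
  \sum_(i < k) ((-1) ^+ i * 'C(k, i.+1)%:R) *
     ((i.+1%:R * c)^-1 ^+ k * ((-1) ^+ k * averaged 0 i.+1%:R x)).
Proof.
apply: eq_bigr => i _; congr (_ * _).
rewrite /smoothed subnn/= iter_quotient; congr (_ * _).
rewrite /averaged mulr_sumr /fdiff; apply: eq_bigr => l _ /=.
have lk : (l <= k)%N by rewrite -ltnS.
have -> : (-1) ^+ (k - l) = (-1) ^+ k * (-1) ^+ l :> R.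
  by rewrite -signr_odd oddB// signr_addb !signr_odd.
have -> : x + l%:R * c * i.+1%:R = x + l%:R * (i.+1%:R * c) by ring.
ring.
Qed.

Lemma approximant_top_bound :
  (\int[lam]_(x in `[al, be]) (`|approximant k x| `^ p)%:E <=
   ((\sum_(i < k) 'C(k, i.+1)%:R) `^ p * (`|c|^-1 ^+ k) `^ p * K)%:E)%E.
Proof.
have p0 : 0 < p by exact: lt_trans p1.
pose W : R := \sum_(i < k) 'C(k, i.+1)%:R.
have W0 : 0 <= W by exact: sumr_ge0.
pose q : R := (`|c|^-1 ^+ k) `^ p.
have q0 : 0 <= q by exact: powR_ge0.
have pw x : `|approximant k x| `^ p <=
    q * (W `^ (p - 1) * \sum_(i < k) 'C(k, i.+1)%:R * `|averaged 0 i.+1%:R x| `^ p).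
  have h1 : `|approximant k x| <= `|c|^-1 ^+ k * \sum_(i < k) 'C(k, i.+1)%:R * `|averaged 0 i.+1%:R x|.
    rewrite approximant_top; apply: le_trans (ler_norm_sum _ _ _) _.
    rewrite mulr_sumr; apply: ler_sum => i _.
    rewrite !normrM !normrX !normrN1 !expr1n !mul1r normr_nat normfV normrM.
    rewrite [leRHS]mulrCA ler_wpM2l// ler_wpM2r// lerXn2r ?nnegrE ?invr_ge0//.
    rewrite lef_pV2 ?posrE ?mulr_gt0 ?normr_gt0// ?pnatr_eq0// ler_peMl//.
    by rewrite normr_nat ler1n.
  apply: le_trans (le_powR_base (ltW p0) (normr_ge0 _) h1) _.
  have s0 : 0 <= \sum_(i < k) 'C(k, i.+1)%:R * `|averaged 0 i.+1%:R x|.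
    by apply: sumr_ge0 => i _; rewrite mulr_ge0.
  have e0 : 0 <= `|c|^-1 ^+ k by rewrite exprn_ge0// invr_ge0.
  by rewrite (powRM _ e0 s0) ler_wpM2l//; apply: powR_sum_le.
have mav (v : R) : measurable_fun (`[al, be]%classic : set RT) (averaged 0 v).
  apply: measurable_funTS; apply: measurable_sum => i; apply: measurable_funM => //.
  apply: (measurableT_comp (rint_measurable (rint_avg 0 i))).
  exact: measurable_funD.
have mavp (v : R) : measurable_fun (`[al, be]%classic : set RT) (fun x => `|averaged 0 v x| `^ p).
  by apply: (measurableT_comp (measurable_powR p)); exact: measurableT_comp.
apply: (@le_trans _ _ (\int[lam]_(x in `[al, be]) ((q * W `^ (p - 1))%:E *
   \sum_(i < k) ('C(k, i.+1)%:R%:E * (`|averaged 0 i.+1%:R x| `^ p)%:E)))%E).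
  apply: ge0_le_integral_nonmeas_on => x _; first by rewrite lee_fin powR_ge0.
  by rewrite sumEFin -EFinM lee_fin -mulrA.
rewrite ge0_integralZl//; last 3 first.
- apply: emeasurable_sum => i; apply: measurable_funeM; exact/measurable_EFinP.
- by move=> x _; apply: sume_ge0 => i _; rewrite mule_ge0// lee_fin powR_ge0.
- by rewrite lee_fin mulr_ge0 ?powR_ge0.
rewrite ge0_integral_sum//; last by move=> i; apply: measurable_funeM; exact/measurable_EFinP.
apply: (@le_trans _ _ ((q * W `^ (p - 1))%:E * \sum_(i < k) ('C(k, i.+1)%:R * K)%:E)%E).
  rewrite lee_wpmul2l ?lee_fin ?mulr_ge0 ?powR_ge0//; apply: lee_sum => i _.
  rewrite ge0_integralZl//; last exact/measurable_EFinP.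
  by rewrite EFinM lee_wpmul2l// HK// ler0n/= ler_nat.
rewrite sumEFin -EFinM lee_fin -mulr_suml -/W -/q.
have [W00|Wn0] := eqVneq W 0; first by rewrite W00 mul0r mulr0 mulr_ge0// mulr_ge0 ?powR_ge0.
have Wp : 0 < W by rewrite lt_def Wn0.
rewrite [W `^ p]powR_pred// le_eqVlt; apply/orP; left; apply/eqP; ring.
Qed.

End smooth_approximation.

(** * The projection on piecewise polynomials *)

Section projection.
Context {R : realType}.
Local Notation lam := (@lebesgue_measure R).
Local Notation RT := (measurableTypeR R).
Variables (r : nat) (Q : 'I_r.+1 -> {poly R}).
Hypothesis hQ : is_orthonormal_poly_basis Q.
Variables (m : nat) (m0 : (0 < m)%N).
Local Notation h := (pieces Q (m := m)).
Local Notation bin j := ([set y : RT | in_bin j y]).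

Let mR : 0 < m%:R :> R. Proof. by rewrite ltr0n. Qed.
Let I01 : measurable (`[0%R, 1%R]%classic : set RT). Proof. exact: measurable_itv. Qed.
Let mbin (j : 'I_m) : measurable (bin j).
Proof. exact: measurable_bin. Qed.

(** The orthogonal projection on piecewise polynomials; the factor m normalizes the
    pieces. *)
Definition projection (g : R -> R) (x : R) : R :=
  \sum_(ij : 'I_r.+1 * 'I_m) (m%:R * \int[lam]_(y in `[0, 1]) (h ij y * g y)) * h ij x.

Lemma rint_mkcond (S : set RT) (g : R -> R) : measurable S -> rint lam S g ->
  rint lam setT (g \_ S).
Proof.
move=> mS iS; have := (@integrable_mkcond _ _ _ lam S (EFin \o g) mS).1 iS.
by apply: eq_integrable => // x _; rewrite /= !patchE; case: ifP.
Qed.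

Lemma poly01M (p q : {poly R}) x : poly01 p x * poly01 q x = poly01 (p * q) x.
Proof. by rewrite /poly01; case: ifP => _; rewrite ?hornerM// mulr0. Qed.

Lemma rint_poly01 (q : {poly R}) : rint lam setT (poly01 q).
Proof.
have -> : poly01 q = (poly01 q) \_ `[0, 1].
  apply/funext => x; rewrite patchE; case: ifPn => //; rewrite notin_setE/= in_itv/= => hx.
  rewrite /poly01 in_itv/=; case: ifPn => // /andP[a b]; exfalso; apply: hx.
  by rewrite (ltW a).
exact: (rint_mkcond I01 (rint01 (bmf_poly01 q))).
Qed.

Lemma Rintegral01_piece (q : {poly R}) (j : 'I_m) :
  \int[lam]_(y in `[0, 1]) piece q j y = m%:R^-1 * \int[lam]_(x in `[0, 1]) q.[x].
Proof.
have -> : \int[lam]_(y in `[0, 1]) piece q j y = \int[lam]_y poly01 q (m%:R * y + - j%:R).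
  rewrite Rintegral_mkcond; apply: eq_Rintegral => y _; rewrite patchE.
  case: ifPn => //; rewrite notin_setE => hy; rewrite /poly01; case: ifPn => // hj.
  by exfalso; apply: hy; apply: (bin_subset m0 (j := j)).
rewrite Rintegral_affine ?gt_eqF//; last exact: rint_poly01.
rewrite gtr0_norm//; congr (_ * _).
have -> : \int[lam]_(x in `[0, 1]) q.[x] = \int[lam]_(x in `]0, 1]) q.[x].
  rewrite -Rintegral_itv_obnd_cbnd//.
  have := rint_itv `]0, 1] (rint_poly01 q).
  apply: eq_integrable => // x; rewrite inE/= => hx.
  by rewrite /= /poly01 hx.
rewrite [RHS]Rintegral_mkcond; apply: eq_Rintegral => x _.
by rewrite patchE mem_setE /poly01.
Qed.

Lemma gram i i' (j : 'I_m) :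
  \int[lam]_(y in `[0, 1]) (h (i, j) y * h (i', j) y) = m%:R^-1 * (i == i')%:R.
Proof.
case: hQ => _ orth _; rewrite -(orth i i').
transitivity (\int[lam]_(y in `[0, 1]) piece (Q i * Q i') j y).
  by apply: eq_Rintegral => y _; rewrite /pieces /piece poly01M.
rewrite Rintegral01_piece; congr (_ * _); apply: eq_Rintegral => x _.
by rewrite hornerM.
Qed.

(** A polynomial in y is a polynomial of the same degree in m y - j, to which the
    spanning property of the basis applies. *)
Lemma poly_on_bin (q : {poly R}) (j : 'I_m) : (size q <= r.+1)%N ->
  exists c : 'I_r.+1 -> R, forall y, in_bin j y -> q.[y] = \sum_i c i * h (i, j) y.
Proof.
move=> sq; pose a : {poly R} := m%:R^-1 *: 'X + (j%:R / m%:R)%:P.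
have sa : ((size a).-1 <= 1)%N.
  have : (size a <= 2)%N.
    apply: leq_trans (size_polyD _ _) _; rewrite geq_max; apply/andP; split.
      by apply: leq_trans (size_scale_leq _ _) _; rewrite size_polyX.
    by apply: leq_trans (size_polyC_leq1 _) _.
  by case: (size a) => [//|n]; rewrite ltnS.
have sqt : (size (q \Po a) <= r.+1)%N.
  apply: leq_trans (size_comp_poly_leq _ _) _; rewrite ltnS.
  apply: leq_trans (leq_mul (leqnn _) sa) _; rewrite muln1.
  by case: (size q) sq => [//|n]; rewrite ltnS.
case: hQ => _ _ /(_ _ sqt)[c Hc]; exists c => y yj.
have -> : q.[y] = (q \Po a).[m%:R * y - j%:R].
  rewrite horner_comp /a hornerD hornerZ hornerX hornerC; congr (_.[_]).
  by field; rewrite gt_eqF.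
rewrite Hc horner_sum; apply: eq_bigr => i _.
by rewrite hornerZ /pieces /piece /poly01 [_ \in _]yj.
Qed.

Lemma projection_bin (g : R -> R) (j : 'I_m) x : in_bin j x ->
  projection g x = \sum_i (m%:R * \int[lam]_(y in `[0, 1]) (h (i, j) y * g y)) * h (i, j) x.
Proof.
move=> xj; rewrite /projection.
rewrite -(pair_big xpredT xpredT (fun i k =>
  (m%:R * \int[lam]_(y in `[0, 1]) (h (i, k) y * g y)) * h (i, k) x))/=.
apply: eq_bigr => i _; rewrite (bigD1 j)//= big1 ?addr0// => k kj.
have -> : h (i, k) x = 0.
  rewrite /pieces /piece /poly01; case: ifPn => // xk.
  have kj' : k = j := in_bin_inj (xk : in_bin k x) xj.
  by rewrite kj' eqxx in kj.
by rewrite mulr0.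
Qed.

Lemma projection_poly (q : {poly R}) (j : 'I_m) x : (size q <= r.+1)%N -> in_bin j x ->
  projection (horner q) x = q.[x].
Proof.
move=> sq xj; have [c Hc] := poly_on_bin j sq.
rewrite (projection_bin _ xj) (Hc x xj); apply: eq_bigr => i _; congr (_ * _).
have -> : \int[lam]_(y in `[0, 1]) (h (i, j) y * q.[y]) =
    \int[lam]_(y in `[0, 1]) \sum_i' c i' * (h (i, j) y * h (i', j) y).
  apply: eq_Rintegral => y _; case: (boolP (in_bin j y)) => yj.
    by rewrite Hc// mulr_sumr; apply: eq_bigr => i' _; rewrite mulrCA.
  have -> : h (i, j) y = 0.
    by rewrite /pieces /piece /poly01; case: ifPn => // yj'; rewrite /in_bin yj' in yj.
  by rewrite mul0r big1// => i' _; rewrite mul0r mulr0.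
have ih i' : rint lam `[0, 1] (fun y => h (i, j) y * h (i', j) y).
  by apply: rint01; apply: bmfM; exact: bmf_pieces.
rewrite rint_Rintegral_sum//; last by move=> i'; exact: rintZ.
have ci i' : \int[lam]_(y in `[0, 1]) (c i' * (h (i, j) y * h (i', j) y)) =
    c i' * (m%:R^-1 * (i == i')%:R).
  by rewrite -(gram i i' j); apply: RintegralZl => //; exact: ih.
under eq_bigr do rewrite ci.
rewrite (bigD1 i)//= eqxx mulr1 big1 ?addr0.
  by rewrite mulrCA mulfV ?gt_eqF// mulr1.
by move=> i' i'i; rewrite eq_sym (negbTE i'i) !mulr0.
Qed.

Variables (g : R -> R) (ig : rint lam setT g).
Let B := basis_sup Q.
Let B0 : 0 <= B. Proof. exact: basis_sup_ge0. Qed.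
Definition projection_cst : R := r.+1%:R * B ^+ 2.

Let ig01 : rint lam `[0, 1] g. Proof. exact: rint_itv. Qed.

Lemma rint_pieces_mul (u : R -> R) ij : rint lam `[0, 1] u -> rint lam `[0, 1] (fun y => h ij y * u y).
Proof. by apply: rint_bmf => //; exact: bmf_lam (bmf_pieces Q ij). Qed.

Lemma horner_rint01 (q : {poly R}) : rint lam `[0, 1] (horner q).
Proof.
apply: (@rint_le _ _ _ lam _ I01 _ (fun=> poly_sup q)).
- apply: measurable_funTS; apply: continuous_measurable_fun => x.
  by apply: differentiable_continuous; apply/derivable1_diffP; exact: derivable_horner.
- by move=> x; rewrite /= in_itv/= => x01; exact: horner_le_sup.
- by apply: rint01; exact: bmf_cst.
Qed.

(** Subtracting a polynomial changes neither side of the difference on the bin, and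
    what remains is bounded by its mean over the bin. *)
Lemma projection_local (q : {poly R}) (j : 'I_m) x : (size q <= r.+1)%N -> in_bin j x ->
  `|projection g x - g x| <= `|g x - q.[x]| +
     projection_cst * m%:R * \int[lam]_(y in bin j) `|g y - q.[y]|.
Proof.
move=> sq xj.
have iq := horner_rint01 q.
have igq : rint lam `[0, 1] (fun y => g y - q.[y]) by exact: rintB.
have ibin : rint lam (bin j) (fun y => `|g y - q.[y]|).
  apply: (@integrableS _ _ _ lam `[0, 1]%classic) => //; first exact: (@bin_subset R m m0 j).
  exact: rint_norm.
have -> : projection g x - g x = (q.[x] - g x) +
    \sum_i (m%:R * \int[lam]_(y in `[0, 1]) (h (i, j) y * (g y - q.[y]))) * h (i, j) x.
  rewrite -{1}(projection_poly sq xj) !(projection_bin _ xj).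
  rewrite [RHS]addrAC -big_split/=; congr (_ - _); apply: eq_bigr => i _.
  rewrite -mulrDl -mulrDr -RintegralD//; [|exact: rint_pieces_mul|exact: rint_pieces_mul].
  by congr (_ * _ * _); apply: eq_Rintegral => y _; rewrite -mulrDr addrC subrK.
apply: le_trans (ler_normD _ _) _; rewrite distrC lerD2l.
apply: le_trans (ler_norm_sum _ _ _) _.
have -> : projection_cst * m%:R * \int[lam]_(y in bin j) `|g y - q.[y]| =
    \sum_(i < r.+1) (m%:R * (B * \int[lam]_(y in bin j) `|g y - q.[y]|)) * B.
  by rewrite sumr_const card_ord -mulr_natl /projection_cst; ring.
apply: ler_sum => i _; rewrite !normrM (gtr0_norm mR).
apply: ler_pM => //.
  rewrite ler_wpM2l ?(ltW mR)//.
  apply: le_trans (le_normr_Rintegral _ _) _ => //; first exact: rint_pieces_mul.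
  have -> : \int[lam]_(y in bin j) `|g y - q.[y]| =
      \int[lam]_(y in `[0, 1]) ((in_bin j y)%:R * `|g y - q.[y]|).
    rewrite Rintegral_mkcond [RHS]Rintegral_mkcond; apply: eq_Rintegral => y _.
    rewrite !patchE; case: (boolP (in_bin j y)) => hy.
      by rewrite !mem_set//; [rewrite mul1r|exact: (bin_subset m0 hy)].
    by rewrite mul0r if_same; case: ifPn => //; rewrite inE /= => hy'; rewrite hy' in hy.
  have ibn : rint lam `[0, 1] (fun y => (in_bin j y)%:R * `|g y - q.[y]|).
    by apply: rint_bmf => //; [exact: bmf_lam (in_bin_bmf j)|exact: rint_norm].
  rewrite -RintegralZl//; apply: le_Rintegral => //.
  - by apply: rint_norm => //; exact: rint_pieces_mul.
  - exact: rintZ.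
  - move=> y _; rewrite normrM mulrA ler_wpM2r//; exact: (pieces_le Q (i, j) y).
apply: le_trans (pieces_le Q (i, j) x) _; rewrite ler_piMr//.
by case: (in_bin _ _).
Qed.

End projection.

(** * The error of the projection *)

Section projection_error.
Context {R : realType}.
Local Notation lam := (@lebesgue_measure R).
Local Notation RT := (measurableTypeR R).
Variables (p : R) (p1 : 1 < p).

Let p0 : 0 < p. Proof. exact: lt_trans p1. Qed.

Lemma measurable_powR_norm (D : set RT) (u : R -> R) : measurable_fun D u ->
  measurable_fun D (fun x => (`|u x| `^ p)%:E).
Proof.
move=> mu; apply/measurable_EFinP; apply: (measurableT_comp (measurable_powR p)).
exact: measurableT_comp.
Qed.

Lemma split_Lp (D : set RT) (a b e : R -> R) : measurable D ->
  measurable_fun D b -> measurable_fun D e ->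
  (forall x, D x -> `|a x| <= `|b x| + `|e x|) ->
  (\int[lam]_(x in D) (`|a x| `^ p)%:E <= (2 `^ (p - 1))%:E *
    (\int[lam]_(x in D) (`|b x| `^ p)%:E + \int[lam]_(x in D) (`|e x| `^ p)%:E))%E.
Proof.
move=> mD mb me abe; have mb' := measurable_powR_norm mb; have me' := measurable_powR_norm me.
rewrite -ge0_integralD//; [|by move=> x _; rewrite lee_fin powR_ge0..].
rewrite -ge0_integralZl//; last 2 first.
- exact: emeasurable_funD.
- by move=> x _; rewrite -EFinD lee_fin addr_ge0 ?powR_ge0.
apply: ge0_le_integral_nonmeas_on => x Dx; first by rewrite lee_fin powR_ge0.
rewrite -EFinD -EFinM lee_fin.
apply: le_trans (powR_add_le p1 (normr_ge0 _) (normr_ge0 _)).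
by apply: le_powR_base; [exact: ltW|exact: normr_ge0|exact: abe].
Qed.

Variables (r : nat) (Q : 'I_r.+1 -> {poly R}).
Hypothesis hQ : is_orthonormal_poly_basis Q.
Variables (m : nat) (m0 : (0 < m)%N).
Variables (g : R -> R) (ig : rint lam setT g).
Local Notation bin j := ([set y : RT | in_bin j y]).
Local Notation Pg := (projection Q m g).

Let mR : 0 < m%:R :> R. Proof. by rewrite ltr0n. Qed.
Let mbin (j : 'I_m) : measurable (bin j). Proof. exact: measurable_bin. Qed.
Let mg : measurable_fun [set: RT] g. Proof. exact: rint_measurable ig. Qed.

Lemma measurable_projection : measurable_fun [set: RT] Pg.
Proof.
apply: measurable_sum => ij; apply: measurable_funM => //.
by case: (bmf_lam (bmf_pieces Q ij)).
Qed.

Lemma bin_jensen (j : 'I_m) (u : R -> R) (c : R) : 0 <= c -> rint lam (bin j) u ->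
  (\int[lam]_(x in bin j) (`|c * \int[lam]_(y in bin j) `|u y| |%R `^ p)%:E <=
   ((c / m%:R) `^ p)%:E * \int[lam]_(y in bin j) (`|u y| `^ p)%:E)%E.
Proof.
move=> c0 iu; pose A : R := \int[lam]_(y in bin j) `|u y|.
have A0 : 0 <= A by exact: Rintegral_ge0.
have mi : 0 < m%:R^-1 :> R by rewrite invr_gt0.
have iun : rint lam (bin j) (fun y => `|u y|) by exact: rint_norm.
have := jensen_powR (mbin j) mi (@lebesgue_bin R m m0 j) p1 iun.
rewrite -/A; under [X in (_ <= _ * X)%E -> _]eq_integral do rewrite normr_id.
set I := (\int[lam]_(y in bin j) (`|u y| `^ p)%:E)%E => hA.
apply: (@le_trans _ _ ((c `^ p * m%:R^-1)%:E * (`|A| `^ p)%:E)%E).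
  apply: (@le_trans _ _ ((`|c * A| `^ p)%:E * lam (bin j))%E).
    by rewrite integral_cst.
  have -> : lam (bin j) = (m%:R^-1)%:E by exact: lebesgue_bin.
  rewrite -!EFinM lee_fin normrM (ger0_norm c0) powRM//.
  by rewrite le_eqVlt; apply/orP; left; apply/eqP; ring.
apply: le_trans (lee_wpmul2l _ hA) _; first by rewrite lee_fin mulr_ge0 ?powR_ge0 ?(ltW mi).
rewrite muleA -EFinM powRM ?(ltW mi)// (powR_pred p mi).
by rewrite le_eqVlt; apply/orP; left; apply/eqP; congr (_%:E * _)%E; ring.
Qed.

Definition projection_Lp_cst : R := 2 `^ (p - 1) * (1 + (projection_cst Q) `^ p).

Lemma projection_Lp_cst_ge0 : 0 <= projection_Lp_cst.
Proof. by rewrite mulr_ge0 ?addr_ge0 ?powR_ge0. Qed.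

Lemma measurable_horner (D : set RT) (q : {poly R}) : measurable_fun D (horner q).
Proof.
apply: measurable_funTS; apply: continuous_measurable_fun => x.
by apply: differentiable_continuous; apply/derivable1_diffP; exact: derivable_horner.
Qed.

(** The mean over the bin in projection_local is bounded in L^p by Jensen's inequality. *)
Lemma bin_error (j : 'I_m) (q : {poly R}) : (size q <= r.+1)%N ->
  (\int[lam]_(x in bin j) (`|Pg x - g x| `^ p)%:E <=
   projection_Lp_cst%:E * \int[lam]_(x in bin j) (`|g x - q.[x]| `^ p)%:E)%E.
Proof.
move=> sq; pose u x := g x - q.[x].
have mu : measurable_fun (bin j) u.
  apply: measurable_funB; first exact: measurable_funTS.
  exact: measurable_horner.
have iu : rint lam (bin j) u.
  apply: (@integrableS _ _ _ lam `[0, 1]%classic) => //; first exact: (@bin_subset R m m0 j).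
  by apply: rintB => //; [exact: rint_itv|exact: horner_rint01].
pose c : R := projection_cst Q * m%:R.
have pc0 : 0 <= projection_cst Q by rewrite mulr_ge0// sqr_ge0.
have c0 : 0 <= c by rewrite mulr_ge0// ltW.
pose A : R := c * \int[lam]_(y in bin j) `|u y|.
have A0 : 0 <= A by rewrite mulr_ge0//; exact: Rintegral_ge0.
apply: le_trans (@split_Lp (bin j) _ u (fun=> A) (mbin j) mu _ _) _ => //.
  move=> x xj; rewrite (ger0_norm A0); exact: projection_local.
rewrite /projection_Lp_cst EFinM -muleA lee_wpmul2l ?lee_fin ?powR_ge0//.
rewrite EFinD ge0_muleDl ?lee_fin ?powR_ge0// mul1e leeD2l//.
apply: le_trans (bin_jensen c0 iu) _.
by rewrite /c mulfK ?gt_eqF.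
Qed.

Lemma bin_error_chain (j : 'I_m) (k : nat) (G : nat -> R -> R) (al be : R) :
  (0 < k <= r.+1)%N -> derivative_chain k G al be ->
  measurable_fun (`[al, be]%classic : set RT) (G 0%N) ->
  al <= j%:R / m%:R -> j.+1%:R / m%:R <= be ->
  (\int[lam]_(x in bin j) (`|Pg x - g x| `^ p)%:E <=
   (projection_Lp_cst * 2 `^ (p - 1))%:E *
     (\int[lam]_(x in bin j) (`|g x - G 0%N x| `^ p)%:E +
      (((m%:R^-1) ^+ k) `^ p)%:E * \int[lam]_(x in bin j) (`|G k x| `^ p)%:E))%E.
Proof.
move=> /andP[k0 kr] ch mG ala bbe.
have ab : j%:R / m%:R <= j.+1%:R / m%:R :> R.
  by rewrite ler_pM2r ?invr_gt0// ler_nat.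
have [q sq Hq] := chain_poly k0 ch ala ab bbe.
apply: (le_trans (bin_error j (leq_trans sq kr))).
rewrite (EFinM projection_Lp_cst (2 `^ (p - 1))) -[leRHS]muleA lee_wpmul2l ?lee_fin ?projection_Lp_cst_ge0//.
have bsub : bin j `<=` `[al, be]%classic.
  move=> x; rewrite /= in_binE// !in_itv/= => /andP[h1 h2].
  by rewrite (le_trans ala (ltW h1)) (le_trans h2).
have [_ iGk _] := ch.
have iG : rint lam (bin j) (G k) by apply: integrableS iGk.
pose c : R := m%:R^-1 ^+ k.-1.
have c0 : 0 <= c by rewrite exprn_ge0// invr_ge0 ltW.
pose A : R := c * \int[lam]_(y in bin j) `|G k y|.
have A0 : 0 <= A by rewrite mulr_ge0//; exact: Rintegral_ge0.
have mu : measurable_fun (bin j) (fun x => g x - G 0%N x).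
  apply: measurable_funB; first exact: measurable_funTS.
  exact: measurable_funS mG.
apply: le_trans (@split_Lp (bin j) _ _ (fun=> A) (mbin j) mu _ _) _ => //.
  move=> x xj; rewrite (ger0_norm A0).
  have -> : g x - q.[x] = (g x - G 0%N x) + (G 0%N x - q.[x]) by rewrite addrA subrK.
  apply: le_trans (ler_normD _ _) _; rewrite lerD2l.
  have xab : j%:R / m%:R <= x <= j.+1%:R / m%:R.
    by move: xj; rewrite /= in_binE// in_itv/= => /andP[/ltW -> ->].
  apply: le_trans (Hq x xab) _.
  have -> : j.+1%:R / m%:R - j%:R / m%:R = m%:R^-1 :> R.
    by rewrite -mulrBl -natr1 addrAC subrr add0r mul1r.
  rewrite /A ler_wpM2l// le_eqVlt; apply/orP; left; apply/eqP.
  rewrite -Rintegral_itv_obnd_cbnd; last first.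
    apply: rint_norm; first exact: measurable_itv.
    apply: integrableS iGk => //; move=> y /=; rewrite !in_itv/= => /andP[h1 h2].
    by rewrite (le_trans ala (ltW h1)) (le_trans h2).
  by rewrite (@bin_setE R m m0 j).
rewrite lee_wpmul2l ?lee_fin ?powR_ge0// leeD2l//.
apply: le_trans (bin_jensen c0 iG) _.
by rewrite /c -exprSr prednK.
Qed.

Lemma sum_bins_le (A : pred 'I_m) (al be : R) (u : R -> \bar R) :
  (forall x, 0 <= u x)%E -> measurable_fun (`[al, be]%classic : set RT) u ->
  (forall j, A j -> al <= j%:R / m%:R /\ j.+1%:R / m%:R <= be) ->
  (\sum_(j | A j) \int[lam]_(x in bin j) u x <= \int[lam]_(x in `[al, be]) u x)%E.
Proof.
move=> u0 mu HA.
have bsub j : A j -> bin j `<=` `[al, be]%classic.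
  move=> /HA[ala bbe] x; rewrite /= in_binE// !in_itv/= => /andP[h1 h2].
  by rewrite (le_trans ala (ltW h1)) (le_trans h2).
pose s := [seq j <- enum 'I_m | A j].
pose D : set RT := \big[setU/set0]_(j <- s) bin j.
have Dsub : D `<=` `[al, be]%classic.
  rewrite /D -bigcup_seq => x [j /=]; rewrite mem_filter => /andP[Aj _]; exact: bsub.
have mD : measurable D by apply: bigsetU_measurable.
have -> : (\sum_(j | A j) \int[lam]_(x in bin j) u x = \int[lam]_(x in D) u x)%E.
  rewrite /D ge0_integral_bigsetU//.
  - by rewrite big_filter big_enum_cond.
  - by rewrite filter_uniq// enum_uniq.
  - by move=> i j _ _ [x [/= xi xj]]; exact: in_bin_inj xi xj.
  - exact: measurable_funS mu.
by apply: ge0_subset_integral.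
Qed.

Lemma integral01_bins (u : R -> \bar R) : (forall x, 0 <= u x)%E ->
  measurable_fun [set: RT] u ->
  (\int[lam]_(x in `[0%R, 1%R]) u x = \sum_(j < m) \int[lam]_(x in bin j) u x)%E.
Proof.
move=> u0 mu.
rewrite -integral_itv_obnd_cbnd//; last exact: measurable_funTS.
have -> : (`]0, 1]%classic : set RT) = \big[setU/set0]_(j <- enum 'I_m) bin j.
  rewrite -bigcup_seq; apply/seteqP; split => x /=.
    by rewrite in_itv/= => /(exists_bin m0)[j xj]; exists j => //=; rewrite mem_enum.
  by move=> [j _ /=]; rewrite in_itv/=; exact: in_bin01.
rewrite ge0_integral_bigsetU//.
- by rewrite big_enum.
- exact: enum_uniq.
- by move=> i j _ _ [x [/= xi xj]]; exact: in_bin_inj xi xj.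
- exact: measurable_funTS.
Qed.

(** The bounds of bin_error_chain add up, since the bins are disjoint. *)
Lemma projection_error_on (A : pred 'I_m) (k : nat) (G : nat -> R -> R) (al be E0 E1 : R) :
  (0 < k <= r.+1)%N -> derivative_chain k G al be ->
  measurable_fun (`[al, be]%classic : set RT) (G 0%N) ->
  (forall j, A j -> al <= j%:R / m%:R /\ j.+1%:R / m%:R <= be) ->
  (\int[lam]_(x in `[al, be]) (`|g x - G 0%N x| `^ p)%:E <= E0%:E)%E ->
  (\int[lam]_(x in `[al, be]) (`|G k x| `^ p)%:E <= E1%:E)%E ->
  (\sum_(j | A j) \int[lam]_(x in bin j) (`|Pg x - g x| `^ p)%:E <=
   (projection_Lp_cst * 2 `^ (p - 1) * (E0 + (m%:R^-1 ^+ k) `^ p * E1))%:E)%E.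
Proof.
move=> kr ch mG HA H0 H1.
have mg0 : measurable_fun (`[al, be]%classic : set RT) (fun x => g x - G 0%N x).
  by apply: measurable_funB => //; exact: measurable_funTS.
have mG1 : measurable_fun (`[al, be]%classic : set RT) (G k).
  by case: ch => _ iG _; exact: rint_measurable iG.
pose c : \bar R := (projection_Lp_cst * 2 `^ (p - 1))%:E.
have c0 : (0 <= c)%E by rewrite lee_fin mulr_ge0 ?projection_Lp_cst_ge0 ?powR_ge0.
pose e : \bar R := ((m%:R^-1 ^+ k) `^ p)%:E.
have e0 : (0 <= e)%E by rewrite lee_fin powR_ge0.
pose u0 x : \bar R := (`|g x - G 0%N x| `^ p)%:E.
pose u1 x : \bar R := (`|G k x| `^ p)%:E.
have u00 x : (0 <= u0 x)%E by rewrite lee_fin powR_ge0.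
have u10 x : (0 <= u1 x)%E by rewrite lee_fin powR_ge0.
apply: (@le_trans _ _ (\sum_(j | A j) (c * (\int[lam]_(x in bin j) u0 x + e * \int[lam]_(x in bin j) u1 x)))%E).
  apply: lee_sum => j Aj; have [ala bbe] := HA j Aj.
  exact: bin_error_chain ch mG ala bbe.
have I0 j : (0 <= \int[lam]_(x in bin j) u0 x)%E by exact: integral_ge0.
have I1 j : (0 <= \int[lam]_(x in bin j) u1 x)%E by exact: integral_ge0.
rewrite -ge0_sume_distrr; last by move=> j _; rewrite adde_ge0// mule_ge0.
rewrite big_split/= -ge0_sume_distrr//.
rewrite (EFinM (projection_Lp_cst * 2 `^ (p - 1))) lee_wpmul2l//.
rewrite (EFinD E0) (EFinM ((m%:R^-1 ^+ k) `^ p)) leeD//.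
  apply: le_trans H0; apply: sum_bins_le => //; exact: measurable_powR_norm.
rewrite lee_wpmul2l//; apply: le_trans H1.
by apply: sum_bins_le => //; exact: measurable_powR_norm.
Qed.

End projection_error.

(** * Increments of absolutely continuous functions *)

Section absolute_continuity.
Context {R : realType}.
Local Notation lam := (@lebesgue_measure R).
Local Notation RT := (measurableTypeR R).

Lemma derive_near (f : R -> R) (x a e : R) : derivable f x 1 -> 'D_1 f x = a -> 0 < e ->
  exists2 eta : R, 0 < eta & forall y, `|y - x| < eta ->
    `|f y - f x - a * (y - x)| <= e * `|y - x|.
Proof.
move=> df Df e0.
have hc : (fun h : R => h^-1 *: ((f \o shift x) (h *: (1 : R)) - f x)) @ 0^' --> a.
  by rewrite -Df; exact: df.
have := hc => /cvgrPdist_le/(_ e e0).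
rewrite near_withinE => -[eta /= eta0 H]; exists eta => // y yx.
have [->|xy] := eqVneq y x; first by rewrite !subrr mulr0 subrr normr0 mulr0.
have yx0 : y - x != 0 by rewrite subr_eq0.
have := H (y - x); rewrite /ball/= sub0r normrN => /(_ yx yx0).
rewrite -[(y - x) *: 1]/((y - x) * 1) mulr1 subrK => h.
rewrite -[f y - f x](mulVKf yx0) [a * _]mulrC -mulrBr normrM mulrC ler_wpM2r//.
by rewrite distrC.
Qed.

Variables (F phi : R -> R).
Hypothesis acF : abs_continuous 0 1 F.
Hypothesis dF : {ae lam, forall x : R, 0 < x < 1 -> is_derive x 1 F (phi x)}.
Hypothesis iphi : rint lam `[0, 1] phi.

Let I01 : measurable (`[0%R, 1%R]%classic : set RT). Proof. exact: measurable_itv. Qed.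
Let psi : R -> R := (fun x => `|phi x|) \_ `[0, 1].
Let ipsi : rint lam setT psi.
Proof. by apply: rint_mkcond => //; exact: rint_norm. Qed.
Let psi0 x : 0 <= psi x. Proof. by rewrite /psi patchE; case: ifP. Qed.

Lemma primitive_nondecreasing x y : x <= y -> primitive psi x <= primitive psi y.
Proof.
by move=> xy; rewrite -subr_ge0 primitive_sub//; apply: Rintegral_ge0 => t _; exact: psi0.
Qed.

(** Almost every point is a point of differentiability of F and of the primitive of
    |phi|; the exceptional null set is covered by a small open set. *)
Lemma ac_exceptional_set (e : R) : 0 < e -> exists2 U : set RT,
  open U /\ (lam U < e%:E)%E & forall x : R, 0 <= x <= 1 -> ~ U x ->
    [/\ derivable F x 1, 'D_1 F x = phi x, derivable (primitive psi) x 1 &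
        'D_1 (primitive psi) x = `|phi x|].
Proof.
move=> e0.
have iN y : rint lam `]-oo, y] psi by exact: rint_itv.
have loc := integrable_locally I01 (rint_norm I01 iphi).
have [N1 [mN1 N10 HN1]] := FTC1Ny iN loc.
have [N2 [mN2 N20 HN2]] := dF.
pose N : set RT := N1 `|` (N2 `|` ([set 0] `|` [set 1])).
have m1 (z : R) : measurable ([set z] : set RT) by exact: measurable_set1.
have mN : measurable N by do 2 (apply: measurableU => //); exact: measurableU.
have l1 (z : R) : lam [set z] = 0%E by exact: lebesgue_measure_set1.
have N0 : lam N = 0%E.
  have m2 : measurable ([set 0] `|` [set 1] : set RT) by exact: measurableU.
  have s1 := null_set_setU (m1 0) (m1 1) (l1 0) (l1 1).
  have s2 := null_set_setU mN2 m2 N20 s1.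
  exact: (null_set_setU mN1 (measurableU _ _ mN2 m2) N10 s2).
have Noo : (lam N < +oo)%E by rewrite N0 ltry.
have [U [oU NU HU]] := lebesgue_regularity_outer mN Noo e0.
exists U.
  split => //.
  have mU : measurable U by exact: open_measurable.
  have mUN : measurable (U `\` N) by exact: measurableD.
  have h : (lam (N `|` (U `\` N)) <= lam N + lam (U `\` N))%E by exact: measureU2.
  rewrite setDUK// in h; apply: (le_lt_trans h).
  by rewrite N0 add0e.
move=> x /andP[x0 x1] Ux.
have nN : ~ N x by move=> Nx; apply: Ux; exact: NU.
have x01 : 0 < x < 1.
  rewrite !lt_def x0 x1 !andbT; apply/andP; split; apply/eqP => xe; apply: nN; right; right.
    by left.
  by right.
have [d1 d2] : derivable (primitive psi) x 1 /\ 'D_1 (primitive psi) x = psi x.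
  apply: contrapT => h; apply: nN; left; apply: HN1 => -[q1 q2]; apply: h.
  by split; [exact: q1|rewrite -derive1E; exact: q2].
have dFx : is_derive x 1 F (phi x).
  by apply: contrapT => h; apply: nN; right; left; apply: HN2 => h'; apply: h; exact: h'.
have [e1 e2] := dFx; split => //; rewrite d2 /psi patchE mem_set//=.
by rewrite in_itv/= x0 x1.
Qed.

(** A real induction along [a, b]. At a point outside the small open set U, both F
    and the primitive of |phi| are differentiable, so that F increases at most as
    fast, up to e; inside U the increments are collected in a list of consecutive
    intervals of total length at most that of U, which absolute continuity controls. *)
Lemma ac_increment (a b : R) : 0 <= a -> a <= b -> b <= 1 ->
  `|F b - F a| <= \int[lam]_(t in `[a, b]) `|phi t|.
Proof.
move=> a0 ab b1.
pose P := primitive psi.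
have PI : P b - P a = \int[lam]_(t in `[a, b]) `|phi t|.
  rewrite /P primitive_sub// Rintegral_itv_obnd_cbnd; last exact: rint_itv.
  apply: eq_Rintegral => t; rewrite inE/= in_itv/= => /andP[h1 h2].
  by rewrite /psi patchE mem_set//= in_itv/= (le_trans a0 h1) (le_trans h2).
rewrite -PI; apply/ler_addgt0Pr => e e0.
pose e1 : R := e / 2.
have e10 : 0 < e1 by rewrite divr_gt0.
have [del del0 Hdel] := acF e10.
have [U [oU lU] HU] := ac_exceptional_set del0.
have mU : measurable U by exact: open_measurable.
have mUI (t : R) : measurable (U `&` `[a, t]%classic).
  by apply: measurableI => //; exact: measurable_itv.
(* S t: the claim holds on [a, t] up to the increments over the intervals of s *)
pose S (t : R) := exists s : seq (R * R),
  [/\ all (fun q => [&& a <= q.1, q.1 <= q.2 & q.2 <= t]) s,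
     pairwise (fun q q' => q'.2 <= q.1) s,
     ((\sum_(q <- s) (q.2 - q.1))%R%:E <= lam (U `&` `[a, t]%classic))%E &
     `|F t - F a| <= P t - P a + e1 * (t - a) + \sum_(q <- s) `|F q.2 - F q.1|].
have ext1 t t' : S t -> t <= t' -> `|F t' - F t| <= P t' - P t + e1 * (t' - t) -> S t'.
  move=> [s [s1 s2 s3 s4]] tt' h; exists s; split => //.
  - by apply: sub_all s1 => q /and3P[-> -> /le_trans]; apply.
  - apply: le_trans s3 _; apply: le_measure; rewrite ?inE//.
    apply: setIS => x /=; rewrite !in_itv/= => /andP[-> xt]; exact: le_trans xt tt'.
  - have -> : F t' - F a = (F t' - F t) + (F t - F a) by ring.
    apply: le_trans (ler_normD _ _) _; apply: le_trans (lerD h s4) _.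
    by rewrite le_eqVlt; apply/orP; left; apply/eqP; ring.
have ext2 t t' : S t -> a <= t -> t <= t' -> (forall x, t <= x <= t' -> U x) -> S t'.
  move=> [s [s1 s2 s3 s4]] at_ tt' tU; exists ((t, t') :: s); split.
  - rewrite /= at_ tt' lexx/=.
    by apply: sub_all s1 => q /and3P[-> -> /le_trans]; apply.
  - rewrite /= s2 andbT; apply: sub_all s1 => q /and3P[_ _ h]; exact: h.
  - rewrite big_cons/= EFinD.
    have mi : measurable (`]t, t']%classic : set RT) by exact: measurable_itv.
    apply: (@le_trans _ _ (lam `]t, t']%classic + lam (U `&` `[a, t]%classic))%E).
      by apply: leeD => //; rewrite le_eqVlt; apply/orP; left; apply/eqP/esym; exact: lebesgue_ocitv.
    rewrite -measureU//; last first.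
      rewrite -subset0 => x /=; rewrite !in_itv/= => -[/andP[h1 _] [_ /andP[_ h2]]].
      by have := lt_le_trans h1 h2; rewrite ltxx.
    apply: le_measure; rewrite ?inE//; first exact: measurableU.
    move=> x /=; rewrite !in_itv/= => -[/andP[h1 h2]|[Ux /andP[h1 h2]]].
      by split; [apply: tU; rewrite (ltW h1)|rewrite (le_trans at_ (ltW h1))].
    by split => //; rewrite h1 (le_trans h2).
  - rewrite big_cons/=.
    have -> : F t' - F a = (F t' - F t) + (F t - F a) by ring.
    apply: le_trans (ler_normD _ _) _.
    have Ptt : P t <= P t' by exact: primitive_nondecreasing.
    have ett : e1 * (t - a) <= e1 * (t' - a) by rewrite ler_wpM2l ?(ltW e10)// lerB.
    by move: s4; set Z := \sum_(q <- s) _; set N := `|F t - F a|; set N' := `|F t' - F t|; move=> s4; lra.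
have loc x : a <= x -> x <= b -> exists2 eta : R, 0 < eta &
    (forall y, a <= y -> y <= x -> x - y < eta -> S y -> S x) /\
    (forall z, x <= z -> z <= b -> z - x < eta -> S x -> S z).
  move=> ax xb; have [Ux|Ux] := pselect (U x).
    have /nbhs_ballP[eta /= eta0 Heta] : nbhs x U by exact: open_nbhs_nbhs.
    have HB y : `|x - y| < eta -> U y by move=> h; apply: Heta; exact: h.
    exists eta => //; split=> y.
      move=> ay yx xy Sy; apply: (ext2 y) => // z /andP[yz zx]; apply: HB.
      by rewrite ger0_norm ?subr_ge0//; apply: le_lt_trans xy; rewrite lerB.
    move=> xy yb yx Sx; apply: (ext2 x) => // z /andP[xz zy]; apply: HB.
    by rewrite ler0_norm ?subr_le0// opprB; apply: le_lt_trans yx; rewrite lerB.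
  have x01 : 0 <= x <= 1 by rewrite (le_trans a0 ax) (le_trans xb b1).
  have [d1 d2 d3 d4] := HU x x01 Ux.
  have e20 : 0 < e1 / 2 by rewrite divr_gt0.
  have [eta1 eta10 H1] := derive_near d1 d2 e20.
  have [eta2 eta20 H2] := derive_near d3 d4 e20.
  have key y : `|y - x| < Num.min eta1 eta2 ->
      `|F y - F x| <= `|P y - P x| + e1 * `|y - x|.
    rewrite lt_min => /andP[y1 y2].
    have h1 := H1 y y1; have h2 := H2 y y2; rewrite -/P in h2.
    have h3 : `|F y - F x| <= `|phi x| * `|y - x| + e1 / 2 * `|y - x|.
      have -> : F y - F x = phi x * (y - x) + (F y - F x - phi x * (y - x)) by ring.
      by apply: le_trans (ler_normD _ _) _; rewrite normrM lerD2l.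
    have h4 : `|phi x| * `|y - x| <= `|P y - P x| + e1 / 2 * `|y - x|.
      have -> : `|phi x| * `|y - x| = `| (P y - P x) - (P y - P x - `|phi x| * (y - x))|.
        transitivity (`| `|phi x| * (y - x)|); first by rewrite normrM normr_id.
        by congr (`|_|); ring.
      by apply: le_trans (ler_normB _ _) _; rewrite lerD2l.
    have -> : e1 * `|y - x| = e1 / 2 * `|y - x| + e1 / 2 * `|y - x| by field.
    by apply: le_trans h3 _; rewrite addrA lerD2r.
  exists (Num.min eta1 eta2); first by rewrite lt_min eta10.
  split=> y.
    move=> ay yx xy Sy; apply: (ext1 y) => //.
    have := key y; rewrite distrC (ger0_norm (_ : 0 <= x - y)) ?subr_ge0// => /(_ xy).
    rewrite distrC (distrC (P y)) (ger0_norm (_ : 0 <= P x - P y))//.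
    by rewrite subr_ge0; exact: primitive_nondecreasing.
  move=> xy yb yx Sx; apply: (ext1 x) => //.
  have := key y; rewrite (ger0_norm (_ : 0 <= y - x)) ?subr_ge0// => /(_ yx).
  rewrite (ger0_norm (_ : 0 <= P y - P x))//.
  by rewrite subr_ge0; exact: primitive_nondecreasing.
have Sa : S a.
  by exists [::]; split => //; rewrite !big_nil// !subrr mulr0 normr0 !addr0.
have Sb : S b.
  pose A : set R := [set t | [/\ a <= t, t <= b & S t]].
  have Aa : A a by split.
  have supA : has_sup A.
    by split; [exists a|exists b => t [_ tb _]].
  pose c := sup A.
  have ac : a <= c by apply: ub_le_sup => //; exact: supA.2.
  have cb : c <= b by apply: ge_sup; [exists a|move=> t [_ tb _]].
  have [eta eta0 [left_ right_]] := loc c ac cb.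
  have [y [ay yb Sy] cy] := sup_adherent eta0 supA.
  have yc : y <= c by apply: ub_le_sup; [exact: supA.2|split].
  have Sc : S c by apply: (left_ y) => //; rewrite ltrBlDr addrC -ltrBlDr.
  have [cltb|bc] := ltP c b; last by have -> : b = c by apply/le_anti; rewrite cb bc.
  pose z := Num.min b (c + eta / 2).
  have cz : c < z by rewrite lt_min cltb ltrDl divr_gt0.
  have zb : z <= b by rewrite ge_min lexx.
  have Sz : S z.
    apply: (right_ z) => //; first exact: ltW.
    apply: (@le_lt_trans _ _ (eta / 2)); first by rewrite lerBlDl ge_min lexx orbT.
    by rewrite ltr_pdivrMr// mulr_natr mulr2n ltrDl.
  have : z <= c by apply: ub_le_sup; [exact: supA.2|split => //; exact: le_trans ac (ltW cz)].
  by rewrite leNgt cz.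
have [s [s1 s2 s3 s4]] := Sb.
have len : \sum_(q <- s) (q.2 - q.1) < del.
  rewrite -lte_fin; apply: le_lt_trans s3 _; apply: le_lt_trans lU.
  by apply: le_measure; rewrite ?inE.
have small : \sum_(q <- s) `|F q.2 - F q.1| < e1.
  pose I (k : 'I_(size s)) := nth (0, 0) s k.
  have sI : \sum_(k < size s) ((I k).2 - (I k).1) < del.
    by move: len; rewrite (big_nth (0, 0)) big_mkord.
  have := Hdel (size s) I; rewrite (big_nth (0, 0)) big_mkord; apply => //.
  - move=> k; have := all_nthP (0, 0) s1 k (ltn_ord k) => /and3P[h1 h2 h3].
    by split; [exact: le_trans a0 h1|split => //; exact: le_trans h3 b1].
  - move=> k l kl; have /pairwiseP := s2 => /(_ (0, 0)) pw.
    have := kl; rewrite neq_ltn => /orP[h|h]; [right|left].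
      exact: (pw k l (ltn_ord k) (ltn_ord l) h).
    exact: (pw l k (ltn_ord l) (ltn_ord k) h).
apply: le_trans s4 _; rewrite -addrA lerD2l.
have : e1 * (b - a) <= e1 by rewrite ler_piMr ?(ltW e10)//; lra.
move=> h; apply: le_trans (lerD h (ltW small)) _.
by rewrite /e1 le_eqVlt; apply/orP; left; apply/eqP; field.
Qed.

End absolute_continuity.

(** * Membership in the function spaces *)

Section function_space_facts.
Context {R : realType}.
Local Notation lam := (@lebesgue_measure R).
Local Notation RT := (measurableTypeR R).
Variables (p : R) (p1 : 1 < p).

Let p0 : 0 < p. Proof. exact: lt_trans p1. Qed.
Let I01 : measurable (`[0%R, 1%R]%classic : set RT). Proof. exact: measurable_itv. Qed.

Lemma Lp_norm_integral (D : set RT) (u : R -> R) (c : R) : measurable D -> 0 <= c ->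
  (Lp_norm p D u <= c%:E)%E ->
  (\int[lam]_(x in D) (`|u x| `^ p)%:E <= (c `^ p)%:E)%E.
Proof.
move=> mD c0 h.
have -> : (\int[lam]_(x in D) (`|u x| `^ p)%:E = (Lp_norm p D u) `^ p)%E.
  rewrite /Lp_norm poweR_Lnorm; last by rewrite gt_eqF.
  rewrite [LHS]integral_mkcond; apply: eq_integral => x _ /=.
  rewrite !patchE; case: ifP => // _.
  by rewrite normr0 powR0 ?gt_eqF.
rewrite -poweR_EFin; apply: gt0_ler_poweR => //; first exact: ltW.
- by rewrite in_itv/= Lnorm_ge0 leey.
- by rewrite in_itv/= lee_fin c0 leey.
Qed.

Lemma Lfun_patch_rint (u : R -> R) : u \_ `[0, 1] \in Lfun lam p%:E ->
  measurable_fun (`[0%R, 1%R]%classic : set RT) u /\ rint lam `[0, 1] (fun x => `|u x| `^ p).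
Proof.
move=> hu; split.
  have := hu; rewrite inE => /andP[/[!inE]/= mu _].
  by apply/(measurable_restrictT _ I01).
have := Lfun_integrable (ltW p1) hu => /(integrableS measurableT I01 (@subsetT _ _)).
by apply: eq_integrable => // x xI; rewrite /= patchE xI.
Qed.

Lemma rint_of_Lp (u : R -> R) : measurable_fun (`[0%R, 1%R]%classic : set RT) u ->
  rint lam `[0, 1] (fun x => `|u x| `^ p) -> rint lam `[0, 1] u.
Proof.
move=> mu iu; apply: (@rint_le _ _ _ lam _ I01 _ (fun x => 1 + `|u x| `^ p)) => //.
  move=> x _; have [h|h] := leP (`|u x|) 1; first by rewrite (le_trans h)// lerDl powR_ge0.
  apply: (@le_trans _ _ (`|u x| `^ p)); last by rewrite lerDr.
  by rewrite -[leLHS]powRr1// ler_powR// ltW.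
by apply: rintD => //; apply: rint01; exact: bmf_cst.
Qed.

Lemma EFin_rint (D : set RT) (u : R -> R) : measurable D -> rint lam D u ->
  (\int[lam]_(x in D) (u x)%:E = (\int[lam]_(x in D) u x)%R%:E)%E.
Proof. by move=> mD iu; rewrite /Rintegral fineK//; exact: integrable_fin_num. Qed.

(** At t = u the supremum over t bounds the difference of step u itself. *)
Lemma Lip_star_differences (s : R) (g : R -> R) : Lip_star s p g ->
  exists2 S : R, 0 <= S & forall u : R, 0 < u ->
    (\int[lam]_(x in `[0%R, (1 - (Num.truncn s).+1%:R * u)%R])
       (`|fdiff (Num.truncn s).+1 u g x| `^ p)%:E <= ((S * u `^ s) `^ p)%:E)%E.
Proof.
move=> [_]; set k := (Num.truncn s).+1; set W := ereal_sup _ => Woo.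
have mod0 t : 0 < t -> (0 <= modulus_smooth p k g t)%E.
  move=> t0; apply: (@le_trans _ _ (Lp_norm p `[0, 1 - k%:R * t] (fdiff k t g))).
    exact: Lnorm_ge0.
  by apply: ereal_sup_ubound; exists t => //=; rewrite t0 lexx.
have WW (t : R) : 0 < t -> ((t `^ (- s))%:E * modulus_smooth p k g t <= W)%E.
  by move=> t0; apply: ereal_sup_ubound; exists t.
have W0 : (0 <= W)%E.
  by apply: le_trans (WW 1 ltr01); rewrite mule_ge0 ?mod0// lee_fin powR_ge0.
have Wfin : W \is a fin_num by rewrite ge0_fin_numE.
exists (fine W); first exact: fine_ge0.
move=> u u0; apply: Lp_norm_integral; first exact: measurable_itv.
  by rewrite mulr_ge0 ?powR_ge0// fine_ge0.
apply: (@le_trans _ _ (modulus_smooth p k g u)).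
  by apply: ereal_sup_ubound; exists u => //=; rewrite u0 lexx.
have us : 0 < u `^ s by rewrite powR_gt0.
have -> : modulus_smooth p k g u = ((u `^ s)%:E * ((u `^ (- s))%:E * modulus_smooth p k g u))%E.
  by rewrite muleA -EFinM powRN mulfV ?gt_eqF// mul1e.
rewrite mulrC EFinM fineK// lee_wpmul2l ?lee_fin ?(ltW us)//.
exact: WW.
Qed.

(** F is extended by constants beyond [0, 1]. *)
Lemma abs_continuous_within (F : R -> R) : abs_continuous 0 1 F ->
  {within `[0, 1], continuous F}.
Proof.
move=> ac; pose cl (x : R) : R := Num.max 0 (Num.min 1 x).
have cl01 x : 0 <= cl x <= 1 by rewrite /cl le_max lexx ge_max ge_min lexx ler01.
have clE x : 0 <= x <= 1 -> cl x = x.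
  by move=> /andP[x0 x1]; rewrite /cl (min_idPr x1) (max_idPr x0).
have clm x y : x <= y -> 0 <= cl y - cl x <= y - x.
  by move=> xy; rewrite /cl; case: (leP 1 x); case: (leP 1 y); case: (leP 0 x);
    case: (leP 0 y) => *; rewrite ?(max_idPr ler01); try (case: (leP 0 1) => ?); try lra.
have cE : continuous (F \o cl).
  move=> x; apply/cvgrPdist_lt => e e0; have [del del0 H] := ac e e0.
  have key y z : 0 <= y -> y <= z -> z <= 1 -> z - y < del -> `|F z - F y| < e.
    move=> y0 yz z1 zy; have := H 1%N (fun=> (y, z)); rewrite !big_ord1/=; apply => //.
    by move=> i j; rewrite !ord1 eqxx.
  near=> y.
  have xyd : `|x - y| < del by near: y; exact: (@cvgr_dist_lt _ _ _ (nbhs x)).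
  have [/andP[x0 x1] /andP[y0 y1]] := (cl01 x, cl01 y).
  have [xy|yx] := leP x y.
    have /andP[h1 h2] := clm _ _ xy; rewrite distrC; apply: key => //.
      by rewrite -subr_ge0.
    by apply: le_lt_trans h2 _; rewrite distrC ger0_norm ?subr_ge0 in xyd.
  have /andP[h1 h2] := clm _ _ (ltW yx); apply: key => //.
    by rewrite -subr_ge0.
  by apply: le_lt_trans h2 _; rewrite gtr0_norm ?subr_gt0 in xyd.
apply: (@subspace_eq_continuous _ _ _ (F \o cl)); last exact: continuous_subspaceT.
by move=> x; rewrite inE/= in_itv/= => x01; rewrite clE.
Unshelve. all: by end_near. Qed.

Lemma within_continuous_bounded (F : R -> R) : {within `[0, 1], continuous F} ->
  exists M : R, forall x, 0 <= x <= 1 -> `|F x| <= M.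
Proof.
move=> cF; have [c1 _ H1] := EVT_max ler01 cF; have [c2 _ H2] := EVT_min ler01 cF.
exists (`|F c1| + `|F c2|) => x x01.
have xI : x \in `[0, 1] by rewrite in_itv.
have h1 := H1 x xI; have h2 := H2 x xI.
rewrite ler_norml; apply/andP; split.
  by apply: le_trans h2; rewrite lerNl; have := ler_norm (- F c2); rewrite normrN; have := normr_ge0 (F c1); lra.
by apply: le_trans h1 _; have := ler_norm (F c1); have := normr_ge0 (F c2); lra.
Qed.

Lemma within_continuous_measurable (F : R -> R) : {within `[0, 1], continuous F} ->
  measurable_fun (`[0%R, 1%R]%classic : set RT) F.
Proof. by move=> cF; apply: subspace_continuous_measurable_fun => //; exact: measurable_itv. Qed.

End function_space_facts.

(** * The bias *)

Section bias.
Context {R : realType}.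
Local Notation lam := (@lebesgue_measure R).
Local Notation RT := (measurableTypeR R).
Variables (p : R) (p1 : 1 < p).
Variables (r : nat) (Q : 'I_r.+1 -> {poly R}).
Hypothesis hQ : is_orthonormal_poly_basis Q.
Variables (g : R -> R) (ig : rint lam setT g).

Let p0 : 0 < p. Proof. exact: lt_trans p1. Qed.
Let I01 : measurable (`[0%R, 1%R]%classic : set RT). Proof. exact: measurable_itv. Qed.
Let mg : measurable_fun [set: RT] g. Proof. exact: rint_measurable ig. Qed.
Let cst1 : R := projection_Lp_cst p Q * 2 `^ (p - 1).
Let cst10 : 0 <= cst1. Proof. by rewrite mulr_ge0 ?projection_Lp_cst_ge0 ?powR_ge0. Qed.

Lemma measurable_error (m : nat) (D : set RT) :
  measurable_fun D (fun x => (`|projection Q m g x - g x| `^ p)%:E).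
Proof.
apply: measurable_powR_norm; apply: measurable_funTS; apply: measurable_funB => //.
exact: measurable_projection.
Qed.

Lemma sobolev_Lp : sobolev r.+1 p g -> rint lam `[0, 1] (fun x => `|g x| `^ p).
Proof.
move=> [D [D0g Dch Dac _ _]].
have cD0 : {within `[0, 1], continuous (D 0%N)}.
  case: (posnP r) => [r0|r0]; last by have [] := Dch 0%N r0.
  by move: Dac; rewrite r0; exact: abs_continuous_within.
have [M HM] := within_continuous_bounded cD0.
have mD0 := within_continuous_measurable cD0.
have mgp : measurable_fun (`[0%R, 1%R]%classic : set RT) (fun x => (`|g x| `^ p)%:E).
  by apply: measurable_powR_norm; exact: measurable_funTS.
have mDp := measurable_powR_norm p mD0.
have iDp : rint lam `[0, 1] (fun x => `|D 0%N x| `^ p).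
  apply: (@rint_le _ _ _ lam _ I01 _ (fun=> `|M| `^ p)); first exact/measurable_EFinP.
    move=> x; rewrite /= in_itv/= => x01; rewrite ger0_norm ?powR_ge0//.
    apply: le_powR_base; [exact: ltW|exact: normr_ge0|].
    exact: le_trans (HM x x01) (ler_norm _).
  by apply: rint01; exact: bmf_cst.
apply/integrableP; split => //.
have e1 : (\int[lam]_(x in `[0%R, 1%R]) `|(`|g x| `^ p)%:E| =
    \int[lam]_(x in `[0%R, 1%R]) (`|D 0%N x| `^ p)%:E)%E.
  apply: ge0_ae_eq_integral => //.
  - by apply: measurableT_comp.
  - move: D0g; apply: filterS; first exact: (ae_filter_ringOfSetsType lam).
    move=> x /= Hx; rewrite in_itv/= => /Hx <-.
    by rewrite ger0_norm ?powR_ge0.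
by rewrite e1 EFin_rint// ltry.
Qed.

(** The smooth version D 0 of g is the bottom of a chain of derivatives on the whole
    of [0, 1], whose top D (r + 1) is in L^p. *)
Lemma bias_sobolev : sobolev r.+1 p g -> exists2 K : R, 0 <= K & forall m : nat, (0 < m)%N ->
  (\int[lam]_(x in `[0%R, 1%R]) (`|projection Q m g x - g x| `^ p)%:E <=
   (K * m%:R `^ (- (p * r.+1%:R)))%:E)%E.
Proof.
move=> [D [D0g Dch Dac Dder DLp]].
have [mD iDp] := Lfun_patch_rint p1 DLp.
have iD := rint_of_Lp p1 mD iDp.
have cD0 : {within `[0, 1], continuous (D 0%N)}.
  case: (posnP r) => [r0|r0]; last by have [] := Dch 0%N r0.
  by move: Dac; rewrite r0; exact: abs_continuous_within.
have mD0 := within_continuous_measurable cD0.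
have ch : derivative_chain r.+1 D 0 1.
  split => // x y x0 xy y1; exact: (ac_increment Dac Dder iD).
pose E1 : R := \int[lam]_(x in `[0, 1]) (`|D r.+1 x| `^ p).
have E10 : 0 <= E1 by apply: Rintegral_ge0 => x _; exact: powR_ge0.
exists (cst1 * E1) => [|m m0]; first exact: mulr_ge0.
have mR : 0 < m%:R :> R by rewrite ltr0n.
rewrite (integral01_bins m0)//; last exact: measurable_error.
have H0 : (\int[lam]_(x in `[0%R, 1%R]) (`|g x - D 0%N x| `^ p)%:E <= 0%:E)%E.
  rewrite le_eqVlt; apply/orP; left; apply/eqP.
  transitivity (\int[lam]_(x in `[0%R, 1%R]) (cst 0%E) x)%E; last by rewrite integral0.
  apply: ge0_ae_eq_integral => //.
    apply: measurable_powR_norm; apply: measurable_funB => //; exact: measurable_funTS.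
  move: D0g; apply: filterS; first exact: (ae_filter_ringOfSetsType lam).
  move=> x /= Hx; rewrite in_itv/= => /Hx ->.
  by rewrite subrr normr0 powR0 ?gt_eqF.
have H1 : (\int[lam]_(x in `[0%R, 1%R]) (`|D r.+1 x| `^ p)%:E <= E1%:E)%E.
  by rewrite EFin_rint.
have HA (j : 'I_m) : xpredT j -> (0 : R) <= j%:R / m%:R /\ j.+1%:R / m%:R <= (1 : R).
  by move=> _; rewrite divr_ge0// ler_pdivrMr// mul1r ler_nat.
have kr : (0 < r.+1 <= r.+1)%N by rewrite leqnn.
apply: le_trans (projection_error_on p1 hQ m0 ig kr ch mD0 HA H0 H1) _.
rewrite lee_fin add0r -/cst1 le_eqVlt; apply/orP; left; apply/eqP.
have -> : (m%:R^-1 ^+ r.+1) `^ p = m%:R `^ (- (p * r.+1%:R)) :> R.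
  rewrite -powR_mulrn ?invr_ge0 ?(ltW mR)// -powRrM -(powR_inv1 (ltW mR)) -powRrM.
  by congr (_ `^ _); ring.
ring.
Qed.

Lemma averaged0 (k : nat) (c v x : R) :
  averaged g k c 0 v x = (-1) ^+ k * fdiff k (c * v) g x.
Proof.
rewrite /averaged /fdiff mulr_sumr; apply: eq_bigr => l _ /=.
have lk : (l <= k)%N by rewrite -ltnS.
have -> : (-1) ^+ (k - l) = (-1) ^+ k * (-1) ^+ l :> R.
  by rewrite -signr_odd oddB// signr_addb !signr_odd.
have -> : x + l%:R * c * v = x + l%:R * (c * v) by ring.
rewrite !mulrA -exprD addnn -mul2n exprM sqrrN !expr1n mul1r; ring.
Qed.

Lemma fdiff_opp (k : nat) (u x : R) :
  (-1) ^+ k * fdiff k (- u) g x = fdiff k u g (x - k%:R * u).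
Proof.
rewrite [RHS]/fdiff (reindex_inj rev_ord_inj)/= /fdiff mulr_sumr.
apply: eq_bigr => l _ /=; have lk : (l <= k)%N by rewrite -ltnS.
rewrite subSS subKn// bin_sub//.
have -> : (-1) ^+ (k - l) = (-1) ^+ k * (-1) ^+ l :> R.
  by rewrite -signr_odd oddB// signr_addb !signr_odd.
have -> : x - k%:R * u + (k - l)%:R * u = x + l%:R * - u by rewrite natrB//; ring.
rewrite !mulrA -exprD addnn -mul2n exprM sqrrN !expr1n mul1r; ring.
Qed.

Lemma fdiff0 (k : nat) (x : R) : (0 < k)%N -> fdiff k 0 g x = 0.
Proof. by case: k => // k _; rewrite fdiff_succ addr0 subrr. Qed.

Lemma measurable_fdiff (k : nat) (u : R) : measurable_fun [set: RT] (fdiff k u g).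
Proof.
apply: measurable_sum => i; apply: measurable_funM => //.
by apply: (measurableT_comp mg); apply: measurable_funD.
Qed.

(** A difference with k steps of size u from x stays in [0, 1] for x <= 2 / 3 if it
    goes to the right and for x >= 1 / 3 if it goes to the left, provided that
    k u <= 1 / 3. *)
Section one_resolution.
Variables (s S : R) (k : nat).
Hypothesis s0 : 0 < s.
Hypothesis S0 : 0 <= S.
Hypothesis k0 : (0 < k)%N.
Hypothesis HS : forall u : R, 0 < u ->
  (\int[lam]_(x in `[0%R, (1 - k%:R * u)%R]) (`|fdiff k u g x| `^ p)%:E <=
   ((S * u `^ s) `^ p)%:E)%E.
Variables (c : R) (c0 : 0 < c).
Hypothesis kc : k%:R * (k%:R * c) <= 1 / 3.
Let K : R := (S * (k%:R * c) `^ s) `^ p.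

Let bound (u : R) : 0 < u -> u <= k%:R * c ->
  (\int[lam]_(x in `[0%R, (1 - k%:R * u)%R]) (`|fdiff k u g x| `^ p)%:E <= K%:E)%E.
Proof.
move=> u0 uc; apply: le_trans (HS u0) _; rewrite lee_fin.
apply: le_powR_base; [exact: ltW|by rewrite mulr_ge0 ?powR_ge0|].
by rewrite ler_wpM2l// le_powR_base ?(ltW s0) ?(ltW u0).
Qed.

Let mHu (u : R) (D : set RT) : measurable_fun D (fun x => (`|fdiff k u g x| `^ p)%:E).
Proof. by apply: measurable_powR_norm; apply: measurable_funTS; exact: measurable_fdiff. Qed.

Let ku (u : R) : u <= k%:R * c -> k%:R * u <= 1 / 3.
Proof. by move=> uc; apply: le_trans kc; rewrite ler_wpM2l. Qed.

Lemma left_differences (v : R) : 0 <= v <= k%:R ->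
  (\int[lam]_(x in `[0%R, (2 / 3)%R]) (`|averaged g k c 0 v x| `^ p)%:E <= K%:E)%E.
Proof.
move=> /andP[v0 vk].
have -> : (\int[lam]_(x in `[0%R, (2 / 3)%R]) (`|averaged g k c 0 v x| `^ p)%:E =
    \int[lam]_(x in `[0%R, (2 / 3)%R]) (`|fdiff k (c * v) g x| `^ p)%:E)%E.
  by apply: eq_integral => x _; rewrite averaged0 normrM normrX normrN1 expr1n mul1r.
have [->|vn] := eqVneq v 0.
  rewrite mulr0 integral0_eq ?lee_fin ?powR_ge0// => x _.
  by rewrite fdiff0// normr0 powR0 ?gt_eqF.
have vp : 0 < v by rewrite lt_def vn.
have uc : c * v <= k%:R * c by rewrite mulrC ler_wpM2r// ltW.
apply: le_trans (bound _ uc); last by rewrite mulr_gt0.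
apply: ge0_subset_integral => //.
move=> x; rewrite /= !in_itv/= => /andP[-> h]/=; apply: le_trans h _.
by have := ku uc; lra.
Qed.

Lemma right_differences (v : R) : 0 <= v <= k%:R ->
  (\int[lam]_(x in `[(1 / 3)%R, 1%R]) (`|averaged g k (- c) 0 v x| `^ p)%:E <= K%:E)%E.
Proof.
move=> /andP[v0 vk]; pose u := c * v.
have -> : (\int[lam]_(x in `[(1 / 3)%R, 1%R]) (`|averaged g k (- c) 0 v x| `^ p)%:E =
    \int[lam]_(x in `[(1 / 3)%R, 1%R]) (`|fdiff k u g (x - k%:R * u)| `^ p)%:E)%E.
  by apply: eq_integral => x _; rewrite averaged0 mulNr fdiff_opp.
have [v00|vn] := eqVneq v 0.
  rewrite /u v00 mulr0 integral0_eq ?lee_fin ?powR_ge0// => x _.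
  by rewrite fdiff0// normr0 powR0 ?gt_eqF.
have vp : 0 < v by rewrite lt_def vn.
have uc : u <= k%:R * c by rewrite /u mulrC ler_wpM2r// ltW.
have u0 : 0 < u by rewrite mulr_gt0.
apply: le_trans (bound u0 uc).
pose H (x : R) : \bar R := (`|fdiff k u g x| `^ p)%:E.
pose J : set RT := `[0%R, (1 - k%:R * u)%R]%classic.
have mJ : measurable J by exact: measurable_itv.
have mHJ : measurable_fun [set: RT] (H \_ J).
  by apply/(measurable_restrictT _ mJ); exact: mHu.
have HJ0 x : (0 <= (H \_ J) x)%E by rewrite patchE; case: ifP => // _; rewrite lee_fin powR_ge0.
have := @ge0_integral_affine R 1 (- (k%:R * u)) (H \_ J) (oner_neq0 _) mHJ HJ0.
rewrite normr1 invr1 mul1e => hE.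
rewrite [leRHS]integral_mkcond -hE [leLHS]integral_mkcond; apply: ge0_le_integral_nonmeas => x; rewrite patchE.
  by case: ifP => // _; rewrite lee_fin powR_ge0.
case: ifPn => [xI|_]; last exact: HJ0.
rewrite mul1r patchE.
have hx : x - k%:R * u \in J.
  move: xI; rewrite !inE /J/= !in_itv/= => /andP[h1 h2].
  by rewrite lerD2r h2 andbT subr_ge0; apply: le_trans h1; exact: ku.
by rewrite hx.
Qed.

End one_resolution.

Lemma measurable_approximant (k : nat) (c : R) l (D : set RT) :
  measurable_fun D (approximant g k c l).
Proof.
apply: measurable_funTS; apply: (@rint_measurable _ _ _ lam); apply: rint_sum => // i.
by apply: rintZ => //; exact: rint_smoothed.
Qed.

(** g is replaced by smooth approximants of step c of order 1 / m, averaged to the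
    right for the bins in [0, 2 / 3] and to the left for the others; at this scale
    both their distance to g and their k-th derivative times m^(-k) are of order
    m^(-s) in L^p. *)
Lemma bias_lip (s : R) : 0 < s -> s < r.+1%:R -> Lip_star s p g ->
  exists2 K : R, 0 <= K & forall m : nat, (2 < m)%N ->
  (\int[lam]_(x in `[0%R, 1%R]) (`|projection Q m g x - g x| `^ p)%:E <=
   (K * m%:R `^ (- (p * s)))%:E)%E.
Proof.
move=> s0 sr Ls; set k := (Num.truncn s).+1.
have kr : (0 < k <= r.+1)%N.
  by rewrite /= ltnS Num.Theory.truncn_le_nat.
have k0 : (0 < k)%N by [].
have kR : 0 < k%:R :> R by rewrite ltr0n.
have [S S0 HS] := Lip_star_differences p1 Ls; rewrite -/k in HS.
pose W : R := \sum_(i < k) 'C(k, i.+1)%:R.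
pose K1 : R := (S * (3 * k%:R)^-1 `^ s) `^ p.
pose K2 : R := W `^ p * ((3 * k%:R ^+ 2) ^+ k) `^ p.
exists (2 * cst1 * (K1 + K2 * K1)) => [|m m2].
  by rewrite mulr_ge0 ?mulr_ge0// addr_ge0 ?mulr_ge0 ?powR_ge0.
have m0 : (0 < m)%N by exact: ltn_trans m2.
have mR : 0 < m%:R :> R by rewrite ltr0n.
have mR3 : 3 <= m%:R :> R by rewrite (ler_nat R 3).
(* the largest difference step is k c and it is repeated k times: k (k c) <= 1 / 3 *)
pose c : R := (3 * k%:R ^+ 2 * m%:R)^-1.
have cp : 0 < c by rewrite invr_gt0 !mulr_gt0// exprn_gt0.
have cn0 : c != 0 by rewrite gt_eqF.
have kn0 : k%:R != 0 :> R by rewrite gt_eqF.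
have mn0 : m%:R != 0 :> R by rewrite gt_eqF.
have kcE : k%:R * c = (3 * k%:R)^-1 * m%:R^-1.
  by rewrite /c; field; rewrite kn0 mn0.
have kc : k%:R * (k%:R * c) <= 1 / 3.
  have -> : k%:R * (k%:R * c) = 1 / 3 * m%:R^-1 by rewrite kcE; field; rewrite kn0 mn0.
  by rewrite ler_piMr// invf_le1// (le_trans _ mR3)// ler1n.
pose K : R := (S * (k%:R * c) `^ s) `^ p.
have K0 : 0 <= K by exact: powR_ge0.
have KE : K = K1 * m%:R `^ (- (p * s)).
  have i3 : 0 <= (3 * k%:R)^-1 :> R by rewrite invr_ge0 mulr_ge0// ltW.
  have im : 0 <= m%:R^-1 :> R by rewrite invr_ge0 ltW.
  rewrite /K kcE (powRM _ i3 im) mulrA powRM ?mulr_ge0 ?powR_ge0//; congr (_ * _).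
  rewrite -powRrM -(powR_inv1 (ltW mR)) -powRrM.
  by congr (_ `^ _); ring.
have Hl := left_differences s0 S0 k0 HS cp kc.
have Hr := right_differences s0 S0 k0 HS cp kc.
have cnn : - c != 0 by rewrite oppr_eq0.
have top (al be c' : R) : c' != 0 -> `|c'| = c ->
    (forall v : R, 0 <= v <= k%:R ->
      (\int[lam]_(x in `[al, be]) (`|averaged g k c' 0 v x| `^ p)%:E <= K%:E)%E) ->
    forall A : pred 'I_m, (forall j, A j -> al <= j%:R / m%:R /\ j.+1%:R / m%:R <= be) ->
  (\sum_(j | A j) \int[lam]_(x in [set y : RT | in_bin j y])
      (`|projection Q m g x - g x| `^ p)%:E <= (cst1 * (K + K2 * K))%:E)%E.
  move=> c'0 c'c HK A HA.
  have ch := chain_approximant ig c'0 al be k0.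
  have H1 := approximant_top_bound ig c'0 p1 K0 HK.
  have H0 : (\int[lam]_(x in `[al, be]) (`|g x - approximant g k c' 0%N x| `^ p)%:E <= K%:E)%E.
    under eq_integral do rewrite approximant_error.
    by apply: (averaged_bound ig c'0 p1 K0 HK); rewrite ?add0r.
  have mG : measurable_fun (`[al, be]%classic : set RT) (approximant g k c' 0%N).
    exact: measurable_approximant.
  have := projection_error_on p1 hQ m0 ig kr ch mG HA H0 H1.
  move=> h; apply: le_trans h _; rewrite lee_fin -/cst1 c'c -/W.
  rewrite le_eqVlt; apply/orP; left; apply/eqP; congr (_ * (_ + _)).
  have -> : c^-1 = 3 * k%:R ^+ 2 * m%:R by rewrite invrK.
  have e1 : 0 <= m%:R^-1 ^+ k :> R by rewrite exprn_ge0// invr_ge0 ltW.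
  have e2 : 0 <= (3 * k%:R ^+ 2) ^+ k :> R by rewrite exprn_ge0// mulr_ge0// exprn_ge0// ltW.
  have e3 : 0 <= m%:R ^+ k :> R by rewrite exprn_ge0// ltW.
  rewrite exprMn (powRM _ e2 e3) /K2.
  have e4 : (m%:R^-1 ^+ k) `^ p * (m%:R ^+ k) `^ p = 1 :> R.
    by rewrite -(powRM _ e1 e3) -exprMn mulVf// expr1n one_powR.
  transitivity (W `^ p * ((3 * k%:R ^+ 2) ^+ k) `^ p * K * ((m%:R^-1 ^+ k) `^ p * (m%:R ^+ k) `^ p)); first ring.
  by rewrite e4 mulr1.
pose A (j : 'I_m) : bool := j.+1%:R / m%:R <= 2 / 3 :> R.
have HA (j : 'I_m) : A j -> (0 : R) <= j%:R / m%:R /\ j.+1%:R / m%:R <= (2 / 3 : R).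
  by move=> Aj; rewrite divr_ge0.
have HA' (j : 'I_m) : ~~ A j -> (1 / 3 : R) <= j%:R / m%:R /\ j.+1%:R / m%:R <= (1 : R).
  rewrite /A -ltNge => h; split; last by rewrite ler_pdivrMr// mul1r ler_nat.
  rewrite ler_pdivlMr//; rewrite ltr_pdivlMr// -natr1 in h; lra.
have b1 := top 0 (2 / 3) c cn0 (gtr0_norm cp) Hl A HA.
have b2 := top (1 / 3) 1 (- c) cnn (etrans (normrN c) (gtr0_norm cp)) Hr (fun j => ~~ A j) HA'.
rewrite (integral01_bins m0)//; last exact: measurable_error.
rewrite (bigID A)/=; apply: le_trans (leeD b1 b2) _.
rewrite -EFinD lee_fin KE le_eqVlt; apply/orP; left; apply/eqP; ring.
Qed.

End bias.

(** * The rate of convergence *)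

(** The integer part of x is at least x / 2 once x >= 2. *)
Lemma resolution_bounds {R : realType} (a C : R) : 0 < a -> 0 < C ->
  \forall n \near \oo, let x : R := C * n%:R `^ a in
    (2 < Num.truncn x)%N /\ C / 2 * n%:R `^ a <= (Num.truncn x)%:R <= x.
Proof.
move=> a0 C0; near=> n; pose x : R := C * n%:R `^ a; rewrite -/x.
have x3 : 3 <= x.
  rewrite /x mulrC -ler_pdivrMr//.
  have -> : 3 / C = ((3 / C) `^ a^-1) `^ a.
    by rewrite -powRrM mulVf ?gt_eqF// powRr1// divr_ge0// ltW.
  apply: le_powR_base; [exact: ltW|exact: powR_ge0|].
  near: n; exact: nbhs_infty_ger.
have x0 : 0 <= x by apply: le_trans x3.
have /andP[mx xm] := Num.Theory.truncn_itv x0.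
have m3 : (2 < Num.truncn x)%N by rewrite -ltnS -(ltr_nat R) (le_lt_trans x3).
split; first exact: m3.
rewrite mx andbT; have -> : C / 2 * n%:R `^ a = x / 2 by rewrite /x; ring.
have : 3 <= (Num.truncn x)%:R :> R by rewrite (ler_nat R 3).
by rewrite -natr1 in xm; lra.
Unshelve. all: by end_near.
Qed.

Lemma resolution_bias {R : realType} (a C e M N : R) : 0 < C -> 0 <= e -> 0 < N ->
  C / 2 * N `^ a <= M -> M `^ (- e) <= (C / 2) `^ (- e) * N `^ (- (e * a)).
Proof.
move=> C0 e0 N0 CM.
have C2 : 0 < C / 2 by rewrite divr_gt0.
have Na : 0 < N `^ a by exact: powR_gt0.
have L0 : 0 < C / 2 * N `^ a by exact: mulr_gt0.
have -> : - (e * a) = a * - e by ring.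
rewrite powRrM -powRM ?(ltW C2) ?(ltW Na)// !powRN.
rewrite lef_pV2 ?posrE ?powR_gt0 ?(lt_le_trans L0)//.
by apply: le_powR_base => //; exact: ltW.
Qed.

Section estimator_bias.
Context {d : measure_display} {T : measurableType d} {R : realType} {P : probability T R}.
Local Notation lam := (@lebesgue_measure R).
Variables (Y : int -> {RV P >-> R}) (f : R -> R) (hf : is_density (Y 0) f).
Variables (r : nat) (Q : 'I_r.+1 -> {poly R}).
Local Notation g := (f \_ `[0, 1]).

Lemma rint_density01 : rint lam setT g.
Proof. by apply: rint_patch (density_rint hf); exact: measurable_itv. Qed.

(** The expectation of a piece is its integral against the density, and pieces vanish
    outside [0, 1]. *)
Lemma mean_estimatorE (m : nat) x : (0 < m)%N ->
  mean_estimator Y Q m x = projection Q m g x.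
Proof.
move=> m0; apply: eq_bigr => ij _; congr (_ * _ * _).
rewrite /mean_of (Ex_density hf (bmf_pieces Q ij)) [RHS]Rintegral_mkcond.
apply: eq_Rintegral => y _; rewrite patchE; case: ifPn => [yI|]; first by rewrite patchE yI.
rewrite notin_setE => yI.
have : in_bin ij.2 y = false by apply/negP => h; apply: yI; exact: bin_subset h.
have := piece_le (Q ij.1) ij.2 y => + h; rewrite h mulr0 normr_le0 => /eqP.
by rewrite /pieces => ->; rewrite mul0r.
Qed.

Lemma mean_estimator_bias (p b : R) (m : nat) : (0 < m)%N ->
  (\int[lam]_(x in `[0%R, 1%R]) (`|projection Q m g x - g x| `^ p)%:E <= b%:E)%E ->
  (\int[lam]_(x in `[0%R, 1%R]) (`|mean_estimator Y Q m x - f x| `^ p)%:E <= b%:E)%E.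
Proof.
move=> m0; apply: le_trans; rewrite le_eqVlt; apply/orP; left; apply/eqP.
by apply: eq_integral => x xI; rewrite mean_estimatorE// !patchE xI.
Qed.

Lemma bias_bound (p s : R) : 1 < p -> is_orthonormal_poly_basis Q ->
  (0 < s < r.+1%:R /\ Lip_star s p g) \/ (s = r.+1%:R /\ sobolev r.+1 p g) ->
  exists2 K : R, 0 <= K & forall m : nat, (2 < m)%N ->
  (\int[lam]_(x in `[0%R, 1%R]) (`|mean_estimator Y Q m x - f x| `^ p)%:E <=
    (K * m%:R `^ (- (p * s)))%:E)%E.
Proof.
move=> p1 hQ [[/andP[s0 sr] Lf]|[-> Wf]].
  have [K K0 HK] := bias_lip p1 hQ rint_density01 s0 sr Lf.
  exists K => [//|m m2]; have m0 := leq_trans (isT : 0 < 3)%N m2.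
  exact: mean_estimator_bias m0 (HK m m2).
have [K K0 HK] := bias_sobolev p1 hQ rint_density01 Wf.
exists K => [//|m m2]; have m0 := leq_trans (isT : 0 < 3)%N m2.
exact: mean_estimator_bias m0 (HK m m0).
Qed.

Lemma density_Lp (p s : R) : 1 < p ->
  (0 < s < r.+1%:R /\ Lip_star s p g) \/ (s = r.+1%:R /\ sobolev r.+1 p g) ->
  rint lam `[0, 1] (fun x => f x `^ p).
Proof.
move=> p1 hfs; have [f0 _ _] := hf.
suff : rint lam `[0, 1] (fun x => `|g x| `^ p).
  apply: eq_integrable => [|x xI]; first exact: measurable_itv.
  by rewrite /= patchE xI ger0_norm.
case: hfs => [[_ [Lf _]]|[_ Wf]]; last exact: (sobolev_Lp p1 rint_density01 Wf).
have [_] := Lfun_patch_rint p1 Lf.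
apply: eq_integrable => [|x xI]; first exact: measurable_itv.
by rewrite /= patchE xI.
Qed.

End estimator_bias.

Theorem mainTheorem8 (R : realType) (d : measure_display)
    (T : measurableType d) (P : probability T R)
    (p : R) (hp : 2 < p)
    (Y : int -> {RV P >-> R}) (hY : strictly_stationary Y)
    (f : R -> R) (hf : is_density (Y 0) f)
    (k1 : nat -> R.-pker (g_sigma_algebraType (past Y 0)) ~> R)
    (hk1 : forall k : nat, is_cond_dist P (Y k%:Z) (k1 k))
    (k2 : nat -> nat ->
          R.-pker (g_sigma_algebraType (past Y 0)) ~> (R * R)%type)
    (hk2 : forall i j : nat,
       is_cond_dist P (pairRV (Y i%:Z) (Y j%:Z)) (k2 i j))
    (delta : R) (hdelta : 0 <= delta < 1)
    (hbeta : ebigO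
       (fun n => (\sum_(k < n.+1)
                    (k.+1%:R `^ (p - 2))%R%:E * beta2 Y k1 k2 k)%E)
       (fun n => n%:R `^ (delta * (p - 1))))
    (r : nat) (s : R)
    (hfs : (0 < s < r.+1%:R /\ Lip_star s p (f \_ `[0, 1])) \/
           (s = r.+1%:R /\ sobolev r.+1 p (f \_ `[0, 1])))
    (Q : 'I_r.+1 -> {poly R}) (hQ : is_orthonormal_poly_basis Q)
    (C : R) (hC : 0 < C)
    (m : nat -> nat)
    (hm : forall n : nat,
       m n = Num.truncn (C * n%:R `^ ((1 - delta) / (2 * s + 1)))) :
  ebigO
    (fun n => (\int[P]_w \int[lebesgue_measure]_(x in `[0%R, 1%R])
                 (`|estimator Y Q (m n) n w x - f x| `^ p)%R%:E)%E)
    (fun n => n%:R `^ (- (p * s * (1 - delta)) / (2 * s + 1))).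
Proof.
have p1 : 1 < p by lra.
have s0 : 0 < s by case: hfs => [[/andP[]]//|[-> _]]; rewrite ltr0n.
have [delta0 delta1] := andP hdelta.
have a0 : 0 < bin_rate delta s by rewrite divr_gt0 ?subr_gt0// addr_gt0// mulr_gt0.
have [Kv Kv0 HKv] := estimator_error hY hf hk1 hk2 hp hdelta hbeta Q
  (density_Lp hf p1 hfs) s0 hC.
have [Kb Kb0 HKb] := bias_bound hf p1 hQ hfs.
exists (2 `^ (p - 1) * (Kv + Kb * (C / 2) `^ (- (p * s)))).
near=> n.
have n0 : (0 < n)%N by near: n; exact: nbhs_infty_gt.
have : let x : R := C * n%:R `^ bin_rate delta s in
    (2 < Num.truncn x)%N /\ C / 2 * n%:R `^ bin_rate delta s <= (Num.truncn x)%:R <= x.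
  by near: n; exact: resolution_bounds.
rewrite /= -[bin_rate delta s]/((1 - delta) / (2 * s + 1)) -hm => -[m2 /andP[mlo mup]].
have m0 : (0 < m n)%N by exact: leq_trans m2.
have nR : 0 < n%:R :> R by rewrite ltr0n.
have e0 : 0 <= p * s by rewrite mulr_ge0//; [lra|exact: ltW].
rewrite gee0_abs; last by apply: integral_ge0 => w _; apply: integral_ge0 => x _;
  rewrite lee_fin powR_ge0.
have bm := HKb _ m2.
have := HKv n.-1 (m n) _ m0; rewrite prednK// => /(_ _ mup bm) h.
apply: le_trans h _; rewrite lee_fin ger0_norm ?powR_ge0// -mulrA ler_wpM2l ?powR_ge0//.
rewrite [leRHS]mulrDl lerD2l -[leRHS]mulrA ler_wpM2l//.
have := resolution_bias hC e0 nR mlo.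
by have -> : - (p * s * ((1 - delta) / (2 * s + 1))) =
    - (p * s * (1 - delta)) / (2 * s + 1) by ring.
Unshelve. all: by end_near.
Qed.
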